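(* Let $g_0=g_{S^4}$ be the standard round metric on $S^4$ and let $D=\sum_{i=1}^q\beta_ip_i$ be a conformal divisor on $S^4$. (i) If $(S^4,D)$ is supercritical for the $\sigma_2$ Yamabe equation, then there does not exist a conformal metric $g\in[g_D]$ with $g\in\mathcal{C}_2^+$ and constant $\sigma_2$ curvature (i.e. $\sigma_2(g^{-1}A_g)$ constant on $S^4\setminus\{p_1,\dots,p_q\}$). (ii) If $(S^4,D)$ is critical for the $\sigma_2$ Yamabe equation and $g\in[g_D]$ satisfies $g\in\mathcal{C}_2^+$ and has constant $\sigma_2$ curvature, then $(S^4,g)$ is a football.
   Context: A conformal divisor is a formal sum $D=\sum_{i=1}^q\beta_ip_i$ with $p_1,\dots,p_q\in S^4$ distinct points and $\beta_i\in(-1,0)$. A metric $g$ conformal to $g_0$ has a conic singularity of order $\beta$ at $p$ if near $p$ one has $g=e^{2v}d(x,p)^{2\beta}g_0$ with $v$ locally bounded and $d$ the distance of $g_0$. $[g_D]$ is the set of metrics conformal to $g_0$ that have a conic singularity of order $\beta_i$ at $p_i$ for each $i$ and are smooth elsewhere. In dimension $4$ the Schouten tensor is $A_g=\frac12\left(\mathrm{Ric}_g-\frac{R_g}{6}g\right)$, and $\sigma_k(g^{-1}A_g)$ is the $k$-th elementary symmetric function of the eigenvalues of $A_g$ with respect to $g$. $g\in\mathcal{C}_2^+$ means $\sigma_1(g^{-1}A_g)>0$ and $\sigma_2(g^{-1}A_g)>0$ on $S^4\setminus\{p_1,\dots,p_q\}$. For $j=1,\dots,q$ put $\widetilde{\beta_j}=\Big(\sum_{1\le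 i\ne j\le q}\beta_i^3\Big)^{1/3}$ (real cube root), and $$\mathcal{R}_j=\frac38\widetilde{\beta_j}^2(\widetilde{\beta_j}+2)^2+\Big(\widetilde{\beta_j}+\frac32\Big)\Big(\sum_{1\le i\neq j\le q}\beta_i^2-\widetilde{\beta_j}^2\Big).$$ - $(S^4,D)$ is subcritical for the $\sigma_2$ Yamabe equation if $\frac38\beta_j^2(\beta_j+2)^2<\mathcal{R}_j$ for every $j=1,\dots,q$. - $(S^4,D)$ is critical if there exists $j\in\{1,\dots,q\}$ with $\frac38\beta_j^2(\beta_j+2)^2=\mathcal{R}_j$. - Otherwise $(S^4,D)$ is supercritical, which means that there exists $j\in\{1,\dots,q\}$ with $\frac38\beta_j^2(\beta_j+2)^2>\mathcal{R}_j$. A football is a conic $4$-sphere with exactly two conic points, having identical cone angles (equal orders $\beta_1=\beta_2$), whose metric has constant $\sigma_2$ curvature and is rotationally symmetric: after a conformal transformation of $S^4$ and stereographic projection taking the two conic points to $0$ and $\infty$, the metric is $e^{2u}g_E$ on $\mathbb{R}^4\setminus\{0\}$ with $g_E$ the Euclidean metric and $u=u(|x|)$ radial. *)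

(* Defs.v *)
From HB Require Import structures.
From mathcomp Require Import all_boot all_order all_algebra.
From mathcomp Require Import all_classical all_reals all_analysis.
Set Implicit Arguments.
Unset Strict Implicit.
Unset Printing Implicit Defensive.
Import Order.TTheory GRing.Theory Num.Theory.
Import numFieldNormedType.Exports.
Local Open Scope classical_set_scope.
Local Open Scope ring_scope.

Section Calculus.
Context {R : realType} {n : nat}.

Definition partial {V : normedModType R} (i : 'I_n) (f : 'rV[R]_n -> V) :
  'rV[R]_n -> V := fun x => 'D_(delta_mx 0 i) f x.

Fixpoint is_Ck (k : nat) (U : set 'rV[R]_n) (f : 'rV[R]_n -> R) : Prop :=
  (forall x, U x -> {for x, continuous f}) /\
  if k is k'.+1 then
    forall i : 'I_n, (forall x, U x -> derivable f x (delta_mx 0 i)) /\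
                     is_Ck k' U (partial i f)
  else True.

(* Meant for [U] open. *)
Definition smooth_on (U : set 'rV[R]_n) (f : 'rV[R]_n -> R) : Prop :=
  forall k, is_Ck k U f.

(* The library norm on row vectors is the sup norm, hence these. *)
Definition dot (u v : 'rV[R]_n) : R := \sum_(i < n) u 0 i * v 0 i.

Definition enorm (u : 'rV[R]_n) : R := Num.sqrt (dot u u).

End Calculus.

Section SymmetricFunctions.
Context {R : realType}.

(* The roots of the characteristic polynomial, with multiplicity; the default
   [::] is taken only when that polynomial does not split over R, which does
   not happen for G^-1 A with A symmetric and G positive definite. *)
Definition eigenvalues {n : nat} (M : 'M[R]_n) : seq R :=
  xget [::] [set s | char_poly M = \prod_(a <- s) ('X - a%:P)].

Definition elem_sym (k : nat) (s : seq R) : R :=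
  \sum_(I : {set 'I_(size s)} | #|I| == k) \prod_(i in I) s`_i.

End SymmetricFunctions.

(* Curvature of a metric [G = (g_ij)] given in local coordinates. *)
Section Curvature.
Context {R : realType} {n : nat}.
Implicit Types (G : 'rV[R]_n -> 'M[R]_n) (x : 'rV[R]_n).

(* Gamma^k_ij *)
Definition christoffel G (k i j : 'I_n) x : R :=
  2^-1 * \sum_(l < n) (invmx (G x)) k l *
    (partial i (fun y => G y j l) x + partial j (fun y => G y i l) x
     - partial l (fun y => G y i j) x).

(* Sign convention: the round sphere has positive Ricci curvature. *)
Definition ricci G x : 'M[R]_n := \matrix_(i, j)
  (\sum_(k < n) (partial k (christoffel G k i j) x
                 - partial j (christoffel G k i k) x)
   + \sum_(k < n) \sum_(l < n)
       (christoffel G k k l x * christoffel G l i j x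
        - christoffel G k j l x * christoffel G l i k x)).

Definition scalar_curv G x : R :=
  \sum_(i < n) \sum_(j < n) (invmx (G x)) i j * ricci G x i j.

End Curvature.

(* The normalization of the Schouten tensor is that of dimension 4. *)
Definition schouten {R : realType} (G : 'rV[R]_4 -> 'M[R]_4) (x : 'rV[R]_4) :
  'M[R]_4 := 2^-1 *: (ricci G x - (scalar_curv G x / 6) *: G x).

(* sigma_k (g^-1 A_g) *)
Definition sigma {R : realType} (k : nat) (G : 'rV[R]_4 -> 'M[R]_4)
    (x : 'rV[R]_4) : R :=
  elem_sym k (eigenvalues (invmx (G x) *m schouten G x)).

Section Sphere.
Context {R : realType}.

Definition sphere4 : set 'rV[R]_5 := [set x | dot x x = 1].

Definition tangent (x u : 'rV[R]_5) : Prop := dot x u = 0.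

(* Inverse stereographic projection R^4 -> S^4 from the pole (0,0,0,0,1) if
   [b = false] and from (0,0,0,0,-1) if [b = true]; the two maps form an atlas
   of S^4, and all local notions below are stated in both charts. *)
Definition stereo (b : bool) (y : 'rV[R]_4) : 'rV[R]_5 :=
  (dot y y + 1)^-1 *:
    row_mx (2 *: y) ((-1) ^+ b * (dot y y - 1))%:M : 'rV[R]_(4 + 1).

Definition pole (b : bool) : 'rV[R]_5 :=
  row_mx 0 ((-1) ^+ b)%:M : 'rV[R]_(4 + 1).

(* [g x u v] is the value g_x(u, v); only its values at points x of (a part
   of) S^4 and vectors u, v tangent to S^4 at x are meaningful. *)
Definition metric := 'rV[R]_5 -> 'rV[R]_5 -> 'rV[R]_5 -> R.

(* g_0, induced by the Euclidean structure of R^5. *)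
Definition round_metric : metric := fun _ u v => dot u v.

(* Great-circle distance, which is the Riemannian distance of g_0. *)
Definition round_dist (x y : 'rV[R]_5) : R := acos (dot x y).

(* Coordinate matrix of phi^* g. *)
Definition pullback (phi : 'rV[R]_4 -> 'rV[R]_5) (g : metric)
    (y : 'rV[R]_4) : 'M[R]_4 :=
  \matrix_(i, j) g (phi y) (partial i phi y) (partial j phi y).

Definition smooth_on_sphere (U : set 'rV[R]_5) (f : 'rV[R]_5 -> R) : Prop :=
  forall b, smooth_on (stereo b @^-1` U) (f \o stereo b).

Definition smooth_self_map (T : 'rV[R]_5 -> 'rV[R]_5) : Prop :=
  (forall x, sphere4 x -> sphere4 (T x)) /\
  forall j, smooth_on_sphere sphere4 (fun x => T x 0 j).

(* [T] is a conformal diffeomorphism of (S^4, g_0) with inverse [T']. *)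
Definition conformal_transformation (T T' : 'rV[R]_5 -> 'rV[R]_5) : Prop :=
  [/\ smooth_self_map T, smooth_self_map T',
      forall x, sphere4 x -> T' (T x) = x,
      forall x, sphere4 x -> T (T' x) = x &
      exists lam : 'rV[R]_5 -> R,
        (forall x, sphere4 x -> 0 < lam x) /\
        forall b y, pullback (T \o stereo b) round_metric y =
                    lam (stereo b y) *: pullback (stereo b) round_metric y].

Record conformal_divisor := ConformalDivisor {
  npoints : nat;
  point : 'I_npoints -> 'rV[R]_5;
  order : 'I_npoints -> R;
  point_sphere : forall i, sphere4 (point i);
  point_inj : injective point;
  order_itv : forall i, -1 < order i < 0 }.
Arguments point : clear implicits.
Arguments order : clear implicits.

Implicit Types (D : conformal_divisor) (g : metric).

Definition regular_set D : set 'rV[R]_5 :=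
  [set x | sphere4 x /\ forall i, x <> point D i].

Definition conic_singularity g (beta : R) (p : 'rV[R]_5) : Prop :=
  exists (delta M : R) (v : 'rV[R]_5 -> R), 0 < delta /\
    forall x, sphere4 x -> x <> p -> round_dist x p < delta ->
      `|v x| <= M /\
      forall a c, tangent x a -> tangent x c ->
        g x a c = expR (2 * v x) * (round_dist x p `^ (2 * beta))
                  * round_metric x a c.

(* g belongs to [g_D]. *)
Definition conformal_class D g : Prop :=
  (exists w : 'rV[R]_5 -> R,
     smooth_on_sphere (regular_set D) w /\
     forall x a c, regular_set D x -> tangent x a -> tangent x c ->
       g x a c = expR (2 * w x) * round_metric x a c) /\
  forall i, conic_singularity g (order D i) (point D i).

Definition C2_plus D g : Prop :=
  forall b y, regular_set D (stereo b y) ->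
    0 < sigma 1 (pullback (stereo b) g) y /\
    0 < sigma 2 (pullback (stereo b) g) y.

Definition constant_sigma2 D g : Prop :=
  exists K : R, forall b y, regular_set D (stereo b y) ->
    sigma 2 (pullback (stereo b) g) y = K.

(* Real cube root. *)
Definition cbrt (x : R) : R := Num.sg x * `|x| `^ (3^-1).

Definition order_tilde D (j : 'I_(npoints D)) : R :=
  cbrt (\sum_(i < npoints D | i != j) order D i ^+ 3).

Definition calR D (j : 'I_(npoints D)) : R :=
  let bt := order_tilde j in
  3 / 8 * bt ^+ 2 * (bt + 2) ^+ 2 +
  (bt + 3 / 2) * (\sum_(i < npoints D | i != j) order D i ^+ 2 - bt ^+ 2).

Definition calL D (j : 'I_(npoints D)) : R :=
  3 / 8 * order D j ^+ 2 * (order D j + 2) ^+ 2.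

Definition subcritical D : Prop := forall j : 'I_(npoints D), calL j < calR j.

Definition critical D : Prop := exists j : 'I_(npoints D), calL j = calR j.

Definition supercritical D : Prop := exists j : 'I_(npoints D), calL j > calR j.

Lemma supercritical_otherwise D :
  ~ subcritical D -> ~ critical D -> supercritical D.
Proof.
move=> nsub ncrit; apply: contrapT => nsup; apply: nsub => j.
case: (ltgtP (calL j) (calR j)) => // h; first by case: nsup; exists j.
by case: ncrit; exists j.
Qed.

(* [T] moves the two conic points to the points of S^4 that correspond to 0
   ([pole true]) and to infinity ([pole false]) in the chart [stereo false]. *)
Definition football D g : Prop :=
  [/\ conformal_class D g,
      npoints D = 2%N,
      forall i j, order D i = order D j,
      constant_sigma2 D g &
      exists i j : 'I_(npoints D), i <> j /\
      exists T T' : 'rV[R]_5 -> 'rV[R]_5,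
        [/\ conformal_transformation T T',
            T (point D i) = pole true,
            T (point D j) = pole false &
            exists u : R -> R, forall y : 'rV[R]_4, y <> 0 ->
              pullback (T' \o stereo false) g y =
              (expR (2 * u (enorm y)))%:M]].

End Sphere.
Arguments metric : clear implicits.
Arguments conformal_divisor : clear implicits.

(* Main.v *)
(** Send [p_j] to infinity and write [g = e^(2u)|dx|^2] on [R^4] minus the other
points. Both [f = -div(|grad u|^2 grad u)] and [sigma_2] are divergences in [u].
For [sigma_2 = K e^(4u)] let [a], [E], [B] be, on the superlevel set [{u > t}], the
total [f]-mass, the total [sigma_2]-mass (both including the masses concentrated at
the conic points) and the Lebesgue volume. A pointwise algebraic inequality,
AM-GM and the isoperimetric inequality (from Prekopa-Leindler and Brunn-Minkowski)
make [kappa y^4/8 + (3 - 2y)E - 3K e^(4t) B], with [y = (a/kappa)^(1/3)], monotone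
in [t]. As [v] is only bounded, the masses at the conic ends are obtained by cutting
off on dyadic shells, over which the energy of [u - beta log|x|] is bounded; so
the limits of the monotone quantity at the two ends of the range of [u] are [calL]
and [calR] up to a common affine map. When these agree every inequality is an
equality, so [Hess u = A I + b grad u (x) grad u]; then [x - grad u / A] is locally
constant, i.e. [u] is radial about one point. *)
From HB Require Import structures.
From mathcomp Require Import all_boot all_order all_algebra.
From mathcomp Require Import all_classical all_reals all_analysis.
From mathcomp Require Import measurable_realfun ring lra.
Require Import Defs.
Set Implicit Arguments.
Unset Strict Implicit.
Unset Printing Implicit Defensive.
Import Order.TTheory GRing.Theory Num.Theory.
Import numFieldNormedType.Exports.
Local Open Scope classical_set_scope.
Local Open Scope ring_scope.

(** Put [P = K e^(4t)] and [Q = 2E - a/2]. Formally the monotone quantity has derivative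
    [Q(-a')/(3 kappa y^2) + 2yP(-B') - 12PB]. On a level set, [-a'], [-B'] and [Q] are the integrals
    of [f/|grad u|], [1/|grad u|] and [T/|grad u|], where [T] is [tden] and
    [f T >= 3K e^(4u) |grad u|^4]. AM-GM bounds a multiple of [|grad u|] by [f], [T] and a constant
    with weights [Q/(3 kappa y^2)], [4PB/Q] and [2yP]. Divided by [|grad u|], integrated over the
    level set and combined with the isoperimetric inequality, this gives [Q(-a')/(3 kappa y^2) + 4PB
    + 2yP(-B') >= 16PB], so the derivative is nonnegative. The obstacle is that nothing makes these
    derivatives exist: critical values are not controlled, and [a], [E], [B] are only monotone and
    right-continuous in [t]. So levels are thickened to layers, tested by trapezoids in [u], and the
    differential inequality becomes one for increments to the right of each [t]. Likewise no
    derivative of [v] is bounded at a conic point, so the masses there are limits of fluxes. *)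

Local Notation cts f x := {for x, continuous f} (only parsing).

Ltac pos:=solve [repeat first [done | lra | exact: sqr_ge0 | exact: expR_gt0 | exact: expR_ge0 | exact: powR_ge0 | exact: ltW
 | apply: lt0r_neq0 | apply: mulr_ge0 | apply: mulr_gt0 | apply: divr_ge0 | apply: divr_gt0 | apply: exprn_ge0 | apply: exprn_gt0 | apply: addr_ge0]].

(** * Continuity of real-valued functions *)

Section Continuity.
Context {R : realType} {T : topologicalType}.
Implicit Types (f g : T -> R) (x : T).

Lemma cont_cst (c : R) x : cts (fun _ : T => c) x.
Proof. exact: cvg_cst. Qed.

Lemma cont_add f g x : cts f x -> cts g x ->
 cts (fun y => f y+g y) x.
Proof. exact: continuousD. Qed.

Lemma cont_opp f x : cts f x -> cts (fun y => - f y) x.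
Proof. exact: continuousN. Qed.

Lemma cont_sub f g x : cts f x -> cts g x ->
 cts (fun y => f y-g y) x.
Proof. by move=> cf cg; apply: cont_add => //; exact: cont_opp. Qed.

Lemma cont_mul f g x : cts f x -> cts g x ->
 cts (fun y => f y*g y) x.
Proof. exact: continuousM. Qed.

Lemma cont_exp f n x : cts f x -> cts (fun y => f y^+n) x.
Proof.
move=> cf; elim: n => [|n ih].
 exact: cont_cst.
have -> : (fun y => f y^+n.+1) = (fun y => f y*f y^+n).
 by apply/funext => y; rewrite exprS.
exact: cont_mul.
Qed.

Lemma cont_inv f x : f x != 0 -> cts f x -> cts (fun y => (f y)^-1) x.
Proof. exact: continuousV. Qed.

Lemma cont_sum (I : Type) (r : seq I) (P : pred I) (F : I -> T -> R) x :
 (forall i, cts (F i) x) ->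
 cts (fun y => \sum_(i <- r | P i) F i y) x.
Proof.
move=> cF; elim: r => [|i r ih].
 have -> : (fun y => \sum_(i <- [::] | P i) F i y) = (fun=> 0).
  by apply/funext => y; rewrite big_nil.
 exact: cont_cst.
have -> : (fun y => \sum_(j <- i :: r | P j) F j y) =
  (fun y => (if P i then F i y else 0) + \sum_(j <- r | P j) F j y).
 by apply/funext => y; rewrite big_cons; case: (P i); rewrite ?add0r.
by apply: cont_add => //; case: (P i) => //; exact: cont_cst.
Qed.

Lemma cont_comp (h : R -> R) f x : {for f x, continuous h} -> cts f x ->
 cts (fun y => h (f y)) x.
Proof. by move=> ch cf; apply: (@continuous_comp _ _ _ f h). Qed.

Lemma cont_near_eq f g x : (\forall y \near x, f y = g y) ->
 cts f x -> cts g x.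
Proof.
move=> fg cf; have fgx : f x = g x:=nbhs_singleton fg.
rewrite /prop_for /continuous_at -fgx; apply: cvg_trans cf.
by apply: near_eq_cvg; first [exact: fg | apply: filterS fg => y ->].
Qed.

Lemma open_preimage_gt f (k : R) : (forall x, cts f x) -> open [set x | k<f x].
Proof.
move=> cf; rewrite (_ : [set _ | _] = f @^-1` `]k, +oo[%classic).
 by apply: open_comp => [x _|]; [exact: cf|exact: interval_open].
by apply/seteqP; split => x /=; rewrite in_itv/= andbT.
Qed.

Lemma open_preimage_lt f (k : R) : (forall x, cts f x) -> open [set x | f x<k].
Proof.
move=> cf; rewrite (_ : [set _ | _] = [set x | - k < - f x]).
 by apply: open_preimage_gt => x; exact: cont_opp.
by apply/seteqP; split => x /=; rewrite ltrN2.
Qed.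

Lemma closed_preimage_le f (k : R) : (forall x, cts f x) -> closed [set x | f x<=k].
Proof.
move=> cf; rewrite (_ : [set _ | _] = ~` [set x | k<f x]).
 by apply: open_closedC; exact: open_preimage_gt.
by apply/seteqP; split => x /=; rewrite ltNge; [move=> ->|move/negP/negPn].
Qed.

End Continuity.

(** * Lebesgue and product measures under affine maps *)

Section Pushforward.
Context d1 d2 (T1 : measurableType d1) (T2 : measurableType d2) (R : realType).

Definition scaled_pushforward (m : {measure set T1 -> \bar R}) (f : T1 -> T2)
  (mf : measurable_fun setT f) (c : R) (c0 : 0<=c) : {measure set T2 -> \bar R} :=
 mscale (NngNum c0)
  (measure_function_pushforward__canonical__measure_function_Measure m mf).

Lemma scaled_pushforwardE (m : {measure set T1 -> \bar R}) (f : T1 -> T2)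
  (mf : measurable_fun setT f) (c : R) (c0 : 0<=c) A :
 scaled_pushforward m mf c0 A = (c%:E * m (f @^-1` A))%E.
Proof. by []. Qed.
End Pushforward.

Section AffineLebesgue.
Context {R : realType}.
Local Notation mu:=(@lebesgue_measure R).

Definition affR (k a : R) : measurableTypeR R -> measurableTypeR R :=
 fun x => k*x+a.

Lemma measurable_affR k a : measurable_fun setT (affR k a).
Proof.
apply: measurable_funD; last exact: measurable_cst.
by [].
Qed.

(** Lebesgue measure is determined by half-open intervals, and there it agrees with [k] times its
    image under [affR k a]. *)
Lemma lebesgue_affR (k : R) a A (k0 : 0<k) : measurable A ->
 mu (affR k a @^-1` A) = (((k)^-1)%:E * mu A)%E.
Proof.
move=> mA; have mm:=measurable_affR k a.
pose m:=scaled_pushforward mu mm (ltW k0).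
have mE : forall X, ocitv X -> mu X = m X.
 move=> _ [[c d] _ <-]; rewrite /m scaled_pushforwardE.
 have -> : affR k a @^-1` `]c, d]%classic =
      `](c-a)/k, (d-a)/k]%classic.
  apply/seteqP; split => x /=; rewrite /affR !in_itv/= ltr_pdivrMr// ler_pdivlMr//;
  by lra.
 rewrite /= !lebesgue_measure_itv/= !lte_fin.
 have -> : ((c-a)/k<(d-a)/k) = (c<d).
  by rewrite ltr_pM2r ?invr_gt0// ltrD2r.
 case: ifPn => _; last by rewrite mule0.
 rewrite -!EFinD -EFinM; congr EFin; field; lra.
have:=lebesgue_measure_unique mE mA; rewrite /m scaled_pushforwardE.
move=> ->; rewrite muleA -EFinM mulVf ?mul1e//; lra.
Qed.

End AffineLebesgue.

Lemma scaling_cancel {R : realType} (c d : R) (a b : \bar R) : 0<c -> 0<d ->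
 ((c*d)%:E*((c^-1)%:E*a*((d^-1)%:E*b)) = a*b)%E.
Proof.
move=> c0 d0; rewrite (muleACA (c^-1)%:E) -EFinM [LHS]muleA -EFinM.
by rewrite (_ : c*d*(c^-1/d) = 1) ?mul1e//; field; lra.
Qed.

Section AffineProduct.
Local Open Scope ereal_scope.
Context d1 d2 (T1 : measurableType d1) (T2 : measurableType d2) (R : realType).
Variable m1 : {sigma_finite_measure set T1 -> \bar R}.
Variable m2 : {sigma_finite_measure set T2 -> \bar R}.
Variables (f1 : T1 -> T1) (f2 : T2 -> T2) (c1 c2 : R).
Hypotheses (c10 : (0<c1)%R) (c20 : (0<c2)%R).
Hypothesis mf1 : measurable_fun setT f1.
Hypothesis mf2 : measurable_fun setT f2.
Hypothesis c1E : forall A, measurable A -> m1 (f1 @^-1` A) = (c1^-1)%:E * m1 A.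
Hypothesis c2E : forall A, measurable A -> m2 (f2 @^-1` A) = (c2^-1)%:E * m2 A.

Lemma measurable_prodmap :
 measurable_fun setT (fun z : T1*T2 => (f1 z.1, f2 z.2)).
Proof.
by apply/measurable_fun_pairP; split => /=;
 [exact: measurableT_comp mf1 measurable_fst
 |exact: measurableT_comp mf2 measurable_snd].
Qed.

(** Both sides agree on rectangles by the scaling of the two factors, and rectangles determine a
    product of sigma-finite measures. *)
Lemma product_measure_scaling A : measurable A ->
 (m1 \x m2) ((fun z : T1*T2 => (f1 z.1, f2 z.2)) @^-1` A) =
 ((c1*c2)^-1)%:E*(m1 \x m2) A.
Proof.
move=> mA; have mm:=measurable_prodmap.
have c0 : (0<=c1*c2)%R by pos.
pose n:=scaled_pushforward (m1 \x m2) mm c0.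
have nE B C : measurable B -> measurable C -> n (B `*` C) = m1 B * m2 C.
 move=> mB mC; rewrite /n scaled_pushforwardE.
 have -> : (fun z : T1*T2 => (f1 z.1, f2 z.2)) @^-1` (B `*` C) =
      (f1 @^-1` B) `*` (f2 @^-1` C) by [].
 rewrite /= product_measure1E; last 2 first.
  by rewrite -[X in measurable X]setTI; exact: mf1.
  by rewrite -[X in measurable X]setTI; exact: mf2.
 by move: (c1E mB) (c2E mC) => /= -> ->; exact: scaling_cancel.
have:=product_measure_unique nE mA; rewrite /n scaled_pushforwardE.
move=> ->; rewrite muleA -EFinM mulVf ?mul1e// gt_eqF// mulr_gt0//.
Qed.

End AffineProduct.

Section ProductSigmaFinite.
Local Open Scope ereal_scope.
Context d1 d2 (T1 : measurableType d1) (T2 : measurableType d2) (R : realType).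
Variable m1 : {sigma_finite_measure set T1 -> \bar R}.
Variable m2 : {sigma_finite_measure set T2 -> \bar R}.
Lemma product_sigma_finite : sigma_finite setT (m1 \x m2).
Proof.
have /sigma_finiteP[F [TF ndF Foo]]:=sigma_finiteT m1.
have /sigma_finiteP[G [TG ndG Goo]]:=sigma_finiteT m2.
exists (fun n => F n `*` G n).
 rewrite -setXTT TF TG; apply/seteqP; split => -[x y] /=.
  move=> [[n _ Fnx] [k _ Gky]]; exists (maxn n k) => //; split.
   by move: Fnx; apply/subsetPset/ndF/leq_maxl.
  by move: Gky; apply/subsetPset/ndG/leq_maxr.
 by move=> [n _ [Fx Gy]]; split; exists n.
move=> k; have [mF fF]:=Foo k; have [mG fG]:=Goo k.
split; first exact: measurableX.
by rewrite product_measure1E// lte_mul_pinfty// ge0_fin_numE.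
Qed.

(** A copy of the product measure that carries the sigma-finite structure, so that it can be a
    factor of a further product. *)
Definition prodmeas:=m1 \x m2.
HB.instance Definition _:=Measure.copy prodmeas (m1 \x m2).
HB.instance Definition _:=Measure_isSigmaFinite.Build _ _ _ prodmeas product_sigma_finite.

Lemma prodmeasE A B : measurable A -> measurable B ->
 prodmeas (A `*` B) = m1 A * m2 B.
Proof. exact: product_measure1E. Qed.

End ProductSigmaFinite.

(** * Lebesgue measure on row vectors of length four *)

Section Vol.
Context {R : realType}.
Local Notation mu:=(@lebesgue_measure R).
Local Notation M:=(measurableTypeR R).

Definition lam2 : {sigma_finite_measure set (M*M)%type -> \bar R}:=(prodmeas mu mu).
Definition lam3 : {sigma_finite_measure set (M*M*M)%type -> \bar R}:=(prodmeas lam2 mu).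
Definition lam4 : {sigma_finite_measure set (M*M*M*M)%type -> \bar R}:=(prodmeas lam3 mu).

(** Row vectors with their Borel sets. The volume on them is the image under [rv4] of the iterated
    product of one-dimensional Lebesgue measures. *)
Definition E4:=g_sigma_algebraType (@open 'rV[R]_4).

Definition rv4 (t : M*M*M*M) : E4 :=
 \row_(i<4) [:: t.1.1.1; t.1.1.2; t.1.2; t.2]`_i.

Lemma measurable_rv4_coord (i : 'I_4) :
 measurable_fun setT (fun t => (rv4 t : 'rV[R]_4) 0 i : M).
Proof.
have h (k : nat) : (k<4)%N ->
  measurable_fun setT (fun t : M*M*M*M =>
   [:: t.1.1.1; t.1.1.2; t.1.2; t.2]`_k : M).
 have m1:=@measurable_fst _ _ (M*M*M)%type M.
 have m2:=@measurable_fst _ _ (M*M)%type M.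
 have m3:=@measurable_fst _ _ M M.
 have m3':=@measurable_snd _ _ M M.
 have m2':=@measurable_snd _ _ (M*M)%type M.
 have m1':=@measurable_snd _ _ (M*M*M)%type M.
 case: k => [|[|[|[|//]]]] _ /=.
 - exact: (measurableT_comp m3 (measurableT_comp m2 m1)).
 - exact: (measurableT_comp m3' (measurableT_comp m2 m1)).
 - exact: (measurableT_comp m2' m1).
 - exact: m1'.
apply: eq_measurable_fun (h i (ltn_ord i)) => t _.
by rewrite mxE.
Qed.

(** An open set is the union of the half-open grid cubes of side [1/(n+1)] that it contains. There
    are countably many of them, and membership in one is a condition on the integer parts of the
    scaled coordinates. *)
Lemma measurable_rv4 : measurable_fun setT rv4.
Proof.
have h:=@measurability _ _ (M*M*M*M)%type E4 setT rv4 (@open 'rV[R]_4).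
apply: h => //.
move=> _ [U oU <-]; rewrite setTI.
pose cube (n : nat) (k : int*int*int*int) : set 'rV[R]_4 :=
 [set x | forall i : 'I_4,
   Num.floor (x 0 i*n.+1%:R) = [:: k.1.1.1; k.1.1.2; k.1.2; k.2]`_i].
have -> : rv4 @^-1` U = \bigcup_(nk : nat*(int*int*int*int))
  (if `[< cube nk.1 nk.2 `<=` U >] then rv4 @^-1` cube nk.1 nk.2 else set0).
 apply/seteqP; split => [t /= Ut|t [[n k] _] /=]; last first.
  by case: ifPn => // /asboolP h /h.
 move: oU; rewrite openE => /(_ _ Ut) /nbhs_ballP[e /= e0 he].
 have [n hn] : exists n : nat, n.+1%:R^-1<e.
  exists (Num.trunc e^-1); rewrite -[ltRHS]invrK ltf_pV2 ?posrE ?invr_gt0//.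
  exact: truncnS_gt.
 set x:=rv4 t in Ut he *.
 exists (n, (Num.floor ((x : 'rV_4) 0 0*n.+1%:R),
  Num.floor ((x : 'rV_4) 0 1*n.+1%:R), Num.floor ((x : 'rV_4) 0 2*n.+1%:R),
  Num.floor ((x : 'rV_4) 0 3*n.+1%:R))) => //=.
 have cx : cube n (Num.floor ((x : 'rV_4) 0 0*n.+1%:R),
  Num.floor ((x : 'rV_4) 0 1*n.+1%:R), Num.floor ((x : 'rV_4) 0 2*n.+1%:R),
  Num.floor ((x : 'rV_4) 0 3*n.+1%:R)) x.
  move=> [[|[|[|[|//]]]] Hi] /=; do ?[congr (Num.floor (_*_))];
  by congr (fun_of_matrix (x : 'rV_4)); apply/val_inj.
 case: ifPn => // /asboolP; case => y cy; apply: he.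
 split=> // i j; rewrite (ord1 i); move: (cy j) (cx j); set c:=nth _ _ _ => Ey Ex.
 rewrite /ball/=; apply: le_lt_trans hn.
 have n0 : 0<n.+1%:R :> R by [].
 rewrite -(ler_pM2r n0) mulVf ?gt_eqF//.
 have:=floor_itv (y 0 j*n.+1%:R); have:=floor_itv (x 0 j*n.+1%:R).
 rewrite Ey Ex => /andP[a1 a2] /andP[a3 a4].
 rewrite -[X in _*X]gtr0_norm// -normrM mulrBl ler_norml.
 by lra.
apply: countable_bigcupT_measurable => // -[n k] /=.
case: ifPn => // _.
have -> : rv4 @^-1` cube n k = \bigcap_(i : 'I_4)
  ((fun t => (rv4 t : 'rV[R]_4) 0 i : M) @^-1`
    [set z : R | Num.floor (z*n.+1%:R) = [:: k.1.1.1; k.1.1.2; k.1.2; k.2]`_i]).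
 by apply/seteqP; split => t /= h; [move=> i _; exact: h | move=> i; exact: h].
apply: fin_bigcap_measurable => // i _.
rewrite -[X in measurable X]setTI; apply: measurable_rv4_coord => //.
set c:=nth _ _ _.
have n0 : 0<n.+1%:R :> R by [].
rewrite (_ : [set _ | _] = `[c%:~R/n.+1%:R, (c+1)%:~R/n.+1%:R[%classic).
 by [].
by apply/seteqP; split => z /=; rewrite in_itv/= ler_pdivrMr// ltr_pdivlMr//
 -floor_eq => /eqP.
Qed.

Definition vol : {measure set E4 -> \bar R} :=
 measure_function_pushforward__canonical__measure_function_Measure
  lam4 measurable_rv4.

Lemma volE A : vol A = lam4 (rv4 @^-1` A).
Proof. by []. Qed.

Lemma open_measurableE4 (A : set 'rV[R]_4) : open A -> measurable (A : set E4).
Proof. by move=> oA; exact: sub_sigma_algebra. Qed.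

Lemma closed_measurableE4 (A : set 'rV[R]_4) : closed A -> measurable (A : set E4).
Proof.
move=> cA; rewrite -(setCK A); apply: measurableC.
by apply: open_measurableE4; exact: closed_openC.
Qed.

Lemma open_continuous_measurableE4 (A : set 'rV[R]_4) (F : 'rV[R]_4 -> R) :
 open A -> (forall x, A x -> cts F x) ->
 measurable_fun (A : set E4) (F : E4 -> R).
Proof.
move=> oA cF mA; have h:=@measurability _ _ E4 (measurableTypeR R) A F
 (@RGenOpens.G R).
apply: h => //; first exact: RGenOpens.measurableE.
move=> _ [_ [a [b ->]] <-].
apply: open_measurableE4; rewrite openE => x [Ax Fx].
apply: filterI; first by move: oA; rewrite openE => /(_ _ Ax).
have /=:=cF x Ax; apply.
by apply: open_nbhs_nbhs; split => //; exact: interval_open.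
Qed.

Lemma measurable_rv4_preimage A : measurable A -> measurable (rv4 @^-1` A).
Proof. by move=> mA; rewrite -[X in measurable X]setTI; exact: measurable_rv4. Qed.

Lemma vol_affine (k : R) (v : 'rV[R]_4) (A : set E4) : 0<k -> measurable A ->
 vol ((fun x : 'rV[R]_4 => k *: x+v) @^-1` A) = ((k ^- 4)%:E*vol A)%E.
Proof.
move=> k0 mA; rewrite !volE.
pose fm i:=affR k (v 0 i).
pose f2:=fun z : M*M => (fm 0 z.1, fm 1 z.2).
pose f3:=fun z : M*M*M => (f2 z.1, fm 2 z.2).
pose f4:=fun z : M*M*M*M => (f3 z.1, fm 3 z.2).
have -> : rv4 @^-1` ((fun x : 'rV[R]_4 => k *: x+v) @^-1` A) =
     f4 @^-1` (rv4 @^-1` A).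
 suff ft t : k *: (rv4 t : 'rV[R]_4)+v = rv4 (f4 t).
  by apply/seteqP; split => t /=; rewrite ft.
 apply/rowP => -[[|[|[|[|//]]]] Hi]; rewrite !mxE /= /fm /affR ?mxE /=;
 by congr (_+v 0 _); apply/val_inj.
have mf i : measurable_fun setT (fm i) by exact: measurable_affR.
have e i B : measurable B -> mu (fm i @^-1` B) = ((k^-1)%:E * mu B)%E.
 exact: lebesgue_affR.
have m2:=measurable_prodmap (mf 0) (mf 1).
have m3:=measurable_prodmap m2 (mf 2).
have k2 : 0<k*k by pos.
have k3 : 0<k*k*k by pos.
have e2:=@product_measure_scaling _ _ _ _ _ mu mu _ _ _ _ k0 k0 (mf 0) (mf 1) (e 0) (e 1).
have e3:=@product_measure_scaling _ _ _ _ _ lam2 mu _ _ _ _ k2 k0 m2 (mf 2) e2 (e 2).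
have e4:=@product_measure_scaling _ _ _ _ _ lam3 mu _ _ _ _ k3 k0 m3 (mf 3) e3 (e 3).
rewrite [LHS]e4; last exact: measurable_rv4_preimage.
by congr (_%:E*_)%E; rewrite !exprS expr0 mulr1 !mulrA.
Qed.

Lemma vol_bounded (r : R) :
 (vol [set x : 'rV[R]_4 | forall i : 'I_4, (`|x 0%R i| <= r)%R] < +oo)%E.
Proof.
rewrite volE.
pose I : set M:=`[-r, r]%classic.
have -> : rv4 @^-1` [set x : 'rV[R]_4 | forall i : 'I_4, `|x 0 i| <= r] = (I `*` I) `*` I `*` I.
 apply/seteqP; split => [t /= h|[[[a b] c] d] /= [[[]]]].
  have:=h 0; have:=h 1; have:=h 2; have:=h 3.
  by rewrite !mxE /I /= !in_itv !ler_norml => -> -> -> ->.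
 rewrite /I/= !in_itv /= -!ler_norml => ha hb hc hd.
 by move=> -[[|[|[|[|//]]]] Hi]; rewrite !mxE /=.
have mI : measurable I by exact: measurable_itv.
have fI : (mu I < +oo)%E by rewrite lebesgue_measure_itv/=; case: ifPn => //= _; rewrite ltry.
have mI2 : measurable (I `*` I) by exact: measurableX.
have mI3 : measurable ((I `*` I) `*` I) by exact: measurableX.
have e2 : lam2 (I `*` I) = (mu I * mu I)%E:=prodmeasE mu mu mI mI.
have e3 : lam3 (I `*` I `*` I) = (_ * mu I)%E:=prodmeasE lam2 mu mI2 mI.
have e4 : lam4 (I `*` I `*` I `*` I) = (_ * mu I)%E:=prodmeasE lam3 mu mI3 mI.
rewrite e4 e3 e2.
have /fineK <- : mu I \is a fin_num by rewrite ge0_fin_numE.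
by rewrite ltry.
Qed.

End Vol.

(** * Layer-cake formulas *)

Section LayerCake.
Local Open Scope ereal_scope.
Context d (T : measurableType d) (R : realType).
Variable m : {sigma_finite_measure set T -> \bar R}.
Local Notation mu:=(@lebesgue_measure R).

(** Tonelli's theorem for the region between 0 and the graph of [f]. *)
Lemma layer_cake (f : T -> R) : measurable_fun setT f -> (forall x, (0<=f x)%R) ->
 \int[m]_x (f x)%:E = \int[mu]_(s in `]0%R, +oo[) m [set x | (s<f x)%R].
Proof.
move=> mf f0.
pose A : set (T * measurableTypeR R):=[set z | (0<z.2)%R /\ (z.2<f z.1)%R].
have mA : measurable A.
 have -> : A = [set z | (0<z.2)%R] `&` [set z | (z.2<f z.1)%R] by [].
 apply: measurableI.
  rewrite (_ : [set _ | _] = snd @^-1` `]0%R, +oo[%classic); last first.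
   by apply/seteqP; split => z /=; rewrite in_itv/= andbT.
  by rewrite -[X in measurable X]setTI; apply: measurable_snd => //; exact: measurable_itv.
 rewrite (_ : [set _ | _] = (fun z : T * measurableTypeR R => f z.1-z.2)%R @^-1` `]0%R, +oo[%classic); last first.
  by apply/seteqP; split => z /=; rewrite in_itv/= andbT subr_gt0.
 rewrite -[X in measurable X]setTI.
 have mfg : measurable_fun setT (fun z : T * measurableTypeR R => f z.1-z.2)%R.
  by apply: measurable_funB;
   [exact: measurableT_comp mf measurable_fst|exact: measurable_snd].
 by apply: mfg => //; exact: measurable_itv.
have:=@fubini_tonelli _ _ _ _ _ m mu (fun z => (\1_A z)%:E)
 ltac:(by apply/measurable_EFinP; exact: measurable_indic) ltac:(by move=> z; rewrite lee_fin).
have -> : \int[m]_x \int[mu]_y (\1_A (x, y))%:E = \int[m]_x (f x)%:E.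
 apply: eq_integral => x _.
 rewrite (_ : (fun y => _) = (fun y => (\1_(`]0%R, f x[%classic : set (measurableTypeR R)) y)%:E)); last first.
  by apply/funext => y; rewrite !indicE; congr (_%:E); congr (_%:R); congr nat_of_bool;
   apply/idP/idP; rewrite !inE /A /= in_itv/= => /andP.
 have mI : measurable (`]0%R, f x[%classic : set (measurableTypeR R)).
  by [].
 rewrite integral_indic//= setIT lebesgue_measure_itv/= lte_fin; case: ltP => [_|fx0]; first by rewrite oppr0 adde0.
 by congr EFin; apply/eqP; rewrite eq_le f0 fx0.
move=> ->; rewrite [RHS]integral_mkcond; apply: eq_integral => s _.
rewrite /patch; case: ifPn => [/set_mem|/negP hs].
 rewrite /= in_itv/= andbT => s0.
 rewrite (_ : (fun x => _) = (fun x => (\1_[set x | (s<f x)%R] x)%:E)); last first.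
  by apply/funext => x; rewrite !indicE; congr (_%:E); congr (_%:R); congr nat_of_bool;
   apply/idP/idP; rewrite !inE /A /=; [case|].
 rewrite integral_indic ?setIT//.
 rewrite (_ : [set _ | _] = f @^-1` `]s, +oo[%classic); last first.
  by apply/seteqP; split => z /=; rewrite in_itv/= andbT.
 by rewrite -[X in measurable X]setTI; apply: mf => //; exact: measurable_itv.
rewrite (_ : (fun x => _) = cst 0) ?integral0//.
apply/funext => x /=; rewrite indicE (_ : (_ \in _) = false)//.
apply/negP => /set_mem[/= s0 _]; apply: hs; apply/mem_set.
by rewrite /= in_itv/= s0.
Qed.

Lemma measurable_superlevel (f : T -> R) (k : R) : measurable_fun setT f ->
 measurable [set x | (k<f x)%R].
Proof.
move=> mf; rewrite (_ : [set _ | _] = f @^-1` `]k, +oo[%classic); last first.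
 by apply/seteqP; split => z /=; rewrite in_itv/= andbT.
by rewrite -[X in measurable X]setTI; apply: mf => //; exact: measurable_itv.
Qed.

Lemma measurable_distribution (f : T -> R) D : measurable_fun setT f ->
 measurable_fun (D : set (measurableTypeR R)) (fun s : measurableTypeR R => m [set x | (s<f x)%R]).
Proof.
move=> mf; apply: measurable_funTS.
pose A : set (measurableTypeR R*T):=[set z | (z.1<f z.2)%R].
have mA : measurable A.
 rewrite (_ : A = [set z | (0<f z.2-z.1)%R]); last first.
  by apply/seteqP; split => z; rewrite /A /= subr_gt0.
 have mfg : measurable_fun setT (fun z : measurableTypeR R*T => f z.2-z.1)%R.
  by apply: measurable_funB;
   [exact: measurableT_comp mf measurable_snd|exact: measurable_fst].
 rewrite (_ : [set _ | _] = (fun z : measurableTypeR R*T => f z.2-z.1)%R @^-1` `]0%R, +oo[%classic); last first.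
  by apply/seteqP; split => z /=; rewrite in_itv/= andbT.
 by rewrite -[X in measurable X]setTI; apply: mfg => //; exact: measurable_itv.
have:=@measurable_fun_xsection _ _ _ _ _ m A mA.
apply: eq_measurable_fun => s _ /=; congr (m _).
by apply/seteqP; split => x /=; rewrite /xsection/= inE.
Qed.

(** Levels from 1 on have empty superlevel sets. Restricting to levels below 1 matters later, where
    the sets being compared must be nonempty. *)
Lemma layer_cake1 (f : T -> R) : measurable_fun setT f ->
 (forall x, (0<=f x<=1)%R) ->
 \int[m]_x (f x)%:E = \int[mu]_(s in `]0%R, 1%R[) m [set x | (s<f x)%R].
Proof.
move=> mf f01; rewrite layer_cake//; last by move=> x; have /andP[]:=f01 x.
rewrite integral_mkcond [RHS]integral_mkcond; apply: eq_integral => s _.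
rewrite /patch; case: ifPn => h1; case: ifPn => h2 //.
 move/set_mem: h1; rewrite /= in_itv/= andbT => s0.
 have s1 : (1<=s)%R.
  by rewrite leNgt; apply/negP => s1; case/negP: h2; apply/mem_set; rewrite /= in_itv/= s0.
 rewrite (_ : [set _ | _] = set0) ?measure0//.
 apply/seteqP; split => x //= sx.
 by have /andP[_]:=f01 x; rewrite leNgt (le_lt_trans s1 sx).
move/set_mem: h2; rewrite /= in_itv/= => /andP[s0 _].
by case/negP: h1; apply/mem_set; rewrite /= in_itv/= s0.
Qed.

End LayerCake.

(** * The Prekopa-Leindler inequality *)

Section BrunnMinkowski1.
Context {R : realType}.
Local Notation mu:=(@lebesgue_measure R).
Variable l : R.
Hypothesis l01 : 0<l<1.

Lemma weighted_amgm (a b : R) : 0<=a -> 0<=b ->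
 a `^ (1-l)*b `^ l<=(1-l)*a+l*b.
Proof.
move=> a0 b0; have /andP[l0 l1]:=l01.
have l1' : 0<1-l by lra.
have:=@conjugate_powR R (a `^ (1-l)) (b `^ l) (1-l)^-1 l^-1
 (powR_ge0 _ _) (powR_ge0 _ _).
rewrite !invr_gt0 !invrK -!powRrM !mulfV ?gt_eqF// !powRr1//.
by lra.
Qed.

(** The translates [(1-l)A + l b0] and [lB + (1-l)a0] both lie in [C]. With [a0] close to [sup A]
    and [b0] close to [inf B] they overlap only in an interval of length [e], so their measures add
    up to within [e]. The extrema are only approximated because they need not be attained. *)
Lemma brunn_minkowski1 (A B C : set (measurableTypeR R)) (n : R) :
 measurable A -> measurable B -> measurable C -> A !=set0 -> B !=set0 ->
 (forall x, A x -> `|x| <= n) -> (forall x, B x -> `|x| <= n) ->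
 (forall x y, A x -> B y -> C ((1-l)*x+l*y)) ->
 ((1-l)%:E * mu A+l%:E * mu B<=mu C)%E.
Proof.
move=> mA mB mC A0 B0 Ab Bb ABC; have /andP[l0 l1]:=l01.
have l1' : 0<1-l by lra.
have sA : has_sup (A : set R).
 by split => //; exists n => x /Ab; rewrite ler_norml => /andP[].
have iB : has_inf (B : set R).
 by split => //; exists (- n) => x /Bb; rewrite ler_norml => /andP[].
apply/lee_addgt0Pr => e e0.
have [a0 Aa0 a0s]:=sup_adherent e0 sA.
have [b0 Bb0 b0s]:=inf_adherent e0 iB.
pose A':=affR (1-l)^-1 (- (l*b0/(1-l))) @^-1` A.
pose B':=affR l^-1 (- ((1-l)*a0/l)) @^-1` B.
have mA' : measurable A' by rewrite -[X in measurable X]setTI; exact: measurable_affR.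
have mB' : measurable B' by rewrite -[X in measurable X]setTI; exact: measurable_affR.
have muA' : mu A' = ((1-l)%:E * mu A)%E.
 by rewrite lebesgue_affR ?invr_gt0// invrK.
have muB' : mu B' = (l%:E * mu B)%E.
 by rewrite lebesgue_affR ?invr_gt0// invrK.
rewrite -muA' -muB'.
pose I : set (measurableTypeR R) :=
 `[(1-l)*(sup A-e)+l*inf B, (1-l)*sup A+l*(inf B+e)]%classic.
have mI : measurable I by exact: measurable_itv.
have muI : mu I = e%:E.
 rewrite /I lebesgue_measure_itv/= lte_fin ifT; last by nra.
 by rewrite -EFinD; congr EFin; ring.
have sub : A' `&` B' `<=` I.
 move=> x [A'x B'x]; rewrite /I /= in_itv/=; apply/andP; split.
  have : inf B<=l^-1*x-(1-l)*a0/l by apply: ge_inf; [case: iB|exact: B'x].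
  rewrite -(ler_pM2l l0) => h; rewrite (_ : l*(_-_) = x-(1-l)*a0) in h; last by field; lra.
  by nra.
 have : (1-l)^-1*x-l*b0/(1-l)<=sup A by apply: ub_le_sup; [case: sA|exact: A'x].
 rewrite -(ler_pM2l l1') => h; rewrite (_ : (1-l)*(_-_) = x-l*b0) in h; last by field; lra.
 by nra.
have A'C : A' `<=` C.
 move=> x A'x; have:=ABC _ _ A'x Bb0; rewrite /affR.
 by rewrite (_ : _+_ = x)//; field; lra.
have B'C : B' `<=` C.
 move=> x B'x; have:=ABC _ _ Aa0 B'x; rewrite /affR.
 by rewrite (_ : _+_ = x)//; field; lra.
have h1 : (mu B'<=mu (B' `\` A')+mu I)%E.
 apply: (@le_trans _ _ (mu ((B' `\` A') `|` I))); last first.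
  by apply: measureU2 => //; exact: measurableD.
 apply: le_measure; rewrite ?inE//; first by apply: measurableU => //; exact: measurableD.
 move=> x B'x; have [A'x|nA'x]:=pselect (A' x); [right|left] => //.
 exact: sub.
have h2 : (mu A'+mu (B' `\` A')<=mu C)%E.
 rewrite -measureU//; last 2 first.
  exact: measurableD.
  by apply/seteqP; split => x // [A'x []].
 apply: le_measure; rewrite ?inE//; first by apply: measurableU => //; exact: measurableD.
 by move=> x [/A'C|[/B'C]].
apply: le_trans (leeD2l _ h1) _; rewrite addeA muI.
exact: leeD2r.
Qed.

End BrunnMinkowski1.

Section PrekopaLeindler.
Context {R : realType}.
Local Notation mu:=(@lebesgue_measure R).
Local Notation M:=(measurableTypeR R).

Definition box1 (n : nat) : set M:=`[- n%:R, n%:R]%classic.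

Variable l : R.
Hypothesis l01 : 0<l<1.

(** Bounded functions supported in one of the boxes of an exhausting family: their integrals are
    finite, and the class is stable under slicing and under integration in one variable. *)
Definition pl_class d (T : measurableType d) (Bx : nat -> set T) (f : T -> R) :=
 [/\ measurable_fun setT f, (forall x, 0<=f x) &
   exists (K : R) (n : nat), 0<=K /\ forall x, f x<=K /\ (~ Bx n x -> f x = 0)].

Definition RI d (T : measurableType d) (m : {measure set T -> \bar R}) (f : T -> R) : R :=
 fine (\int[m]_x (f x)%:E)%E.

(** The map [c] that forms convex combinations is a parameter, so that the inequality can be
    tensored one coordinate at a time. *)
Definition PL d (T : measurableType d) (m : {measure set T -> \bar R})
  (Bx : nat -> set T) (c : T -> T -> T) :=
 forall f g h, pl_class Bx f -> pl_class Bx g -> pl_class Bx h ->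
 (forall x y, f x `^ (1-l)*g y `^ l<=h (c x y)) ->
 RI m f `^ (1-l)*RI m g `^ l<=RI m h.

Lemma RI_ge0 d (T : measurableType d) (m : {measure set T -> \bar R}) f :
 (forall x, 0<=f x) -> 0<=RI m f.
Proof. by move=> f0; apply: fine_ge0; apply: integral_ge0 => x _; rewrite lee_fin. Qed.

Lemma pl_class_fin d (T : measurableType d) (m : {measure set T -> \bar R})
  (Bx : nat -> set T) (f : T -> R) :
 (forall n, measurable (Bx n)) -> (forall n, (m (Bx n) < +oo)%E) ->
 pl_class Bx f -> (\int[m]_x (f x)%:E)%E = (RI m f)%:E.
Proof.
move=> mB fB [mf f0 [K [n [K0 Kn]]]]; rewrite /RI fineK// ge0_fin_numE; last first.
 by apply: integral_ge0 => x _; rewrite lee_fin.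
apply: (@le_lt_trans _ _ (\int[m]_(x in Bx n) (cst K%:E x))%E); last first.
 rewrite integral_cst// -(fineK (_ : m (Bx n) \is a fin_num)) -?EFinM ?ltry//.
 by rewrite ge0_fin_numE.
rewrite [leRHS]integral_mkcond; apply: ge0_le_integral => //.
- by move=> x _; rewrite lee_fin.
- exact/measurable_EFinP.
- by apply/(measurable_restrictT _ _).1 => //; exact: measurable_cst.
- move=> x _; rewrite /patch; case: ifPn => [_|/negP hx]; first by rewrite lee_fin; have []:=Kn x.
 by have [_ ->//]:=Kn x; move=> Bxx; apply: hx; exact/mem_set.
Qed.

Lemma measurable_box1 n : measurable (box1 n).
Proof. exact: measurable_itv. Qed.

Lemma box1_fin n : (mu (box1 n) < +oo)%E.
Proof. by rewrite lebesgue_measure_itv/=; case: ifPn => _; rewrite -?EFinD ltry. Qed.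

Definition comb1 (x y : M) : M:=(1-l)*x+l*y.

Lemma sup_pl_class (f : M -> R) : pl_class box1 f -> RI mu f != 0 ->
 let F:=sup (range f) in
 [/\ 0<F, (forall x, f x<=F) & forall s, s<1 -> exists x, s*F<f x].
Proof.
move=> [mf f0 [K [n [K0 Kn]]]] If F.
have sF : has_sup (range f).
 by split; [exists (f 0); exists 0 | exists K => _ [x _ <-]; have []:=Kn x].
have ubF x : f x<=F by apply: ub_le_sup; [case: sF | exists x].
have F0 : 0<F.
 rewrite lt_neqAle (le_trans (f0 0) (ubF 0)) andbT; apply/eqP => F0.
 case/eqP: If; rewrite /RI (_ : (fun x => _) = cst 0%E) ?integral0//.
 by apply/funext => x /=; congr EFin; apply/eqP; rewrite eq_le f0 F0 ubF.
split => // s s1; have e0 : 0<F-s*F by nra.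
by have [_ [x _ <-] hx]:=sup_adherent e0 sF; exists x; move: hx; rewrite -/F; lra.
Qed.

(** Divided by their suprema, [f] and [g] have nonempty superlevel sets at every level in []0, 1[],
    and the one-dimensional Brunn-Minkowski inequality applies to these. Integration over the level
    gives a bound by an arithmetic mean, which dominates the geometric mean. *)
Lemma prekopa_leindler1 : PL mu box1 comb1.
Proof.
have /andP[l0 l1]:=l01; have l1' : 0<1-l by lra.
move=> f g h cf cg ch fgh.
have h0 : 0<=RI mu h by apply: RI_ge0; case: ch.
have [->|If]:=eqVneq (RI mu f) 0; first by rewrite powR0 ?gt_eqF// mul0r.
have [->|Ig]:=eqVneq (RI mu g) 0; first by rewrite (powR0 (x:=l)) ?gt_eqF// mulr0.
have [F0 fF Fs]:=sup_pl_class cf If; have [G0 gG Gs]:=sup_pl_class cg Ig.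
set F:=sup (range f) in F0 fF Fs; set G:=sup (range g) in G0 gG Gs.
have [mf f0 _]:=cf; have [mg g0 _]:=cg; have [mh hh0 _]:=ch.
pose H:=F `^ (1-l)*G `^ l.
have H0 : 0<H by rewrite mulr_gt0// powR_gt0.
have intdiv (k : M -> R) (K : R) : pl_class box1 k -> 0<K ->
  (\int[mu]_x (k x/K)%:E = (RI mu k/K)%:E)%E.
 move=> ck K0; have [mk k0 _]:=ck.
 under eq_integral do rewrite EFinM.
 rewrite ge0_integralZr//=; last 3 first.
  exact/measurable_EFinP.
  by move=> x _; rewrite lee_fin.
  by rewrite lee_fin invr_ge0 ltW.
 by rewrite (pl_class_fin measurable_box1 box1_fin ck).
have mdiv (k : M -> R) (K : R) : measurable_fun setT k -> measurable_fun setT (fun x => k x/K).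
 by move=> mk; apply: measurable_funM => //; exact: measurable_cst.
have lv (k : M -> R) (K s : R) : 0<K -> [set x | s<k x/K] = [set x | s*K<k x].
 by move=> K0; apply/seteqP; split => x /=; rewrite ltr_pdivlMr.
suff key : (1-l)*(RI mu f/F)+l*(RI mu g/G)<=RI mu h/H.
 have If0 : 0<=RI mu f/F by rewrite divr_ge0 ?RI_ge0// ltW.
 have Ig0 : 0<=RI mu g/G by rewrite divr_ge0 ?RI_ge0// ltW.
 have:=le_trans (weighted_amgm l01 If0 Ig0) key.
 rewrite ler_pdivlMr// /H mulrACA -(powRM _ If0 (ltW F0)) -(powRM _ Ig0 (ltW G0)).
 by rewrite !divfK ?gt_eqF.
rewrite -lee_fin EFinD (EFinM (1-l)) (EFinM l).
rewrite -(intdiv f F)// -(intdiv g G)// -(intdiv h H)//.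
rewrite layer_cake1; [|exact: mdiv|]; last first.
 by move=> x; rewrite divr_ge0 ?(ltW F0)//= ler_pdivrMr// mul1r.
rewrite layer_cake1; [|exact: mdiv|]; last first.
 by move=> x; rewrite divr_ge0 ?(ltW G0)//= ler_pdivrMr// mul1r.
rewrite [leRHS]layer_cake; [|exact: mdiv|]; last by move=> x; rewrite divr_ge0 ?(ltW H0).
have mI : measurable (`]0, 1[%classic : set M) by [].
have md (k : M -> R) D : measurable_fun setT k -> measurable_fun D (fun s : M => mu [set x | s<k x]).
 exact: measurable_distribution.
have l10 : (0<=(1-l)%:E)%E by rewrite ltW.
have l00 : (0<=l%:E)%E by rewrite ltW.
rewrite -!ge0_integralZl//; try (by apply: md; exact: mdiv).
rewrite -ge0_integralD//; last 4 first.
- by move=> x _; rewrite mule_ge0.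
- by apply: measurable_funeM; apply: md; exact: mdiv.
- by move=> x _; rewrite mule_ge0.
- by apply: measurable_funeM; apply: md; exact: mdiv.
apply: (@le_trans _ _ (\int[mu]_(s in `]0%R, 1%R[) mu [set x | (s<h x/H)%R])%E); last first.
 have mI2 : measurable (`]0, +oo[%classic : set M) by [].
 apply: ge0_subset_integral => //; first by apply: md; exact: mdiv.
 by move=> s /=; rewrite !in_itv/= => /andP[->].
apply: ge0_le_integral => //.
- by move=> x _; rewrite adde_ge0// mule_ge0.
- by apply: emeasurable_funD; apply: measurable_funeM; apply: md; exact: mdiv.
- by apply: md; exact: mdiv.
move=> s /=; rewrite in_itv/= => /andP[s0 s1]; rewrite !lv//.
have [_ _ [Kf [nf [_ Kfn]]]]:=cf; have [_ _ [Kg [ng [_ Kgn]]]]:=cg.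
have bd (k : M -> R) (n : nat) (K r : R) (N : R) : 0<K -> n%:R<=N -> (forall x, k x<=r /\ (~ box1 n x -> k x = 0)) ->
  forall x, s*K<k x -> `|x| <= N.
 move=> K0 nN Kn x sx; apply: le_trans nN; rewrite ler_norml.
 have [|nx]:=pselect (box1 n x); first by [].
 have [_ /(_ nx) kx]:=Kn x; move: sx; rewrite kx => sx.
 have sK : 0<s*K by pos.
 by lra.
apply: (@brunn_minkowski1 R l l01 _ _ _ (maxn nf ng)%:R);
 try exact: measurable_superlevel.
- exact: Fs.
- exact: Gs.
- by apply: bd Kfn => //; rewrite ler_nat leq_maxl.
- by apply: bd Kgn => //; rewrite ler_nat leq_maxr.
move=> x y /= fx gy; apply: lt_le_trans (fgh x y).
have -> : s*H = (s*F) `^ (1-l)*(s*G) `^ l.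
 rewrite !powRM ?ltW// mulrACA -powRD; last by rewrite (gt_eqF s0) implybT.
 by rewrite subrK powRr1// ltW.
have sF0 : 0<s*F by pos.
have sG0 : 0<s*G by pos.
have fx0:=lt_trans sF0 fx; have gy0:=lt_trans sG0 gy.
by apply: ltr_pM; rewrite ?powR_ge0//; apply: gt0_ltr_powR; rewrite ?nnegrE ?ltW.
Qed.

Section Tensor.
Context d (T : measurableType d) (m : {sigma_finite_measure set T -> \bar R}).
Variables (Bx : nat -> set T) (c : T -> T -> T).
Hypothesis mBx : forall n, measurable (Bx n).
Hypothesis fBx : forall n, (m (Bx n) < +oo)%E.

Definition boxX (n : nat) : set (T*M):=Bx n `*` box1 n.
Definition combX (x y : T*M) : T*M:=(c x.1 y.1, comb1 x.2 y.2).

Lemma marginal_fin (f : T*M -> R) : pl_class boxX f ->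
 pl_class Bx (fun x => RI mu (fun s => f (x, s))) /\
 (forall x, pl_class box1 (fun s => f (x, s))).
Proof.
move=> [mf f0 [K [n [K0 Kn]]]].
have cs x : pl_class box1 (fun s => f (x, s)).
 split => //.
  exact: measurable_fun_pair2.
 by exists K, n; split => // s; have [? h]:=Kn (x, s); split => // ns; apply: h => -[].
split => //; split.
- apply: (measurableT_comp (f:=fine)); first exact: fine_measurable.
 apply: (@measurable_fun_fubini_tonelli_F _ _ _ _ _ mu (fun z => (f z)%:E)).
  exact/measurable_EFinP.
 by [].
- by move=> x; exact: RI_ge0.
have b0 : (0<=fine (mu (box1 n)))%R by exact: fine_ge0.
exists (K*fine (mu (box1 n))), n; split; first by pos.
move=> x; split.
 rewrite -lee_fin -(pl_class_fin measurable_box1 box1_fin (cs x)) EFinM fineK; last first.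
  by rewrite ge0_fin_numE// box1_fin.
 rewrite -integral_cst; last exact: measurable_box1.
 rewrite [leRHS]integral_mkcond; have [ms _ _]:=cs x; apply: ge0_le_integral => //.
 + by move=> s _; rewrite lee_fin.
 + exact/measurable_EFinP.
 + apply/(measurable_restrictT _ _).1; [exact: measurable_box1|exact: measurable_cst].
 + move=> s _; rewrite /patch; case: ifPn => [_|/negP hx]; first by rewrite lee_fin; have []:=Kn (x, s).
  by have [_ ->//]:=Kn (x, s); move=> [_ /= Bxx]; apply: hx; exact/mem_set.
move=> nBx; rewrite /RI (_ : (fun s => _) = cst 0%E) ?integral0//.
by apply/funext => s /=; congr EFin; have [_ ->//]:=Kn (x, s); case.
Qed.

Lemma RI_fubini (f : T*M -> R) : pl_class boxX f ->
 RI (prodmeas m mu) f = RI m (fun x => RI mu (fun s => f (x, s))).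
Proof.
move=> cf; have [cF cs]:=marginal_fin cf; have [mf f0 _]:=cf.
rewrite /RI [X in fine X](_ : _ = (\int[m \x mu]_z (f z)%:E)%E)//.
rewrite (@fubini_tonelli1 _ _ _ _ _ m mu (fun z => (f z)%:E)); last 2 first.
 exact/measurable_EFinP.
 by [].
by congr fine; apply: eq_integral => x _; exact: pl_class_fin measurable_box1 box1_fin (cs x).
Qed.

(** Slices satisfy the one-dimensional inequality, which is exactly the hypothesis of the inequality
    on the first factor for the three marginals. *)
Lemma prekopa_leindler_tensor : PL m Bx c -> PL (prodmeas m mu) boxX combX.
Proof.
move=> plT f g h cf cg ch fgh.
have [cF cfs]:=marginal_fin cf; have [cG cgs]:=marginal_fin cg.
have [cH chs]:=marginal_fin ch.
rewrite !RI_fubini//; apply: plT => // x y.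
by apply: prekopa_leindler1 => // s t; exact: (fgh (x, s) (y, t)).
Qed.

Lemma measurable_boxX n : measurable (boxX n).
Proof. by apply: measurableX => //; exact: measurable_box1. Qed.

Lemma boxX_fin n : (prodmeas m mu (boxX n) < +oo)%E.
Proof.
rewrite prodmeasE//; last exact: measurable_box1.
by rewrite lte_mul_pinfty// ?ge0_fin_numE// box1_fin.
Qed.

End Tensor.
End PrekopaLeindler.

(** * The Brunn-Minkowski inequality in dimension four *)

Section BrunnMinkowski.
Context {R : realType}.
Local Notation mu:=(@lebesgue_measure R).
Local Notation M:=(measurableTypeR R).
Local Notation E:='rV[R]_4.

Definition box4 : nat -> set (M*M*M*M):=boxX (boxX (boxX (@box1 R))).

Definition ball4 (r : R) : set E:=[set x | dot x x<r^+2].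

Definition Vol (A : set E) : R:=fine (vol (A : set (@E4 R))).

Lemma prekopa_leindler4 (l : R) : 0<l<1 ->
 PL l (@lam4 R) box4 (combX l (combX l (combX l (comb1 l)))).
Proof.
move=> l01.
have m1:=@measurable_box1 R; have f1:=@box1_fin R.
have m2 n:=@measurable_boxX R _ _ _ m1 n.
have f2 n:=@boxX_fin R _ _ mu _ m1 f1 n.
have m3 n:=@measurable_boxX R _ _ _ m2 n.
have f3 n:=@boxX_fin R _ _ (@lam2 R) _ m2 f2 n.
apply: prekopa_leindler_tensor => //.
apply: prekopa_leindler_tensor => //.
apply: prekopa_leindler_tensor => //.
exact: prekopa_leindler1.
Qed.

Lemma Vol_ge0 A : 0<=Vol A.
Proof. by rewrite /Vol. Qed.

Lemma bounded_vol_fin (A : set E) (r : R) : measurable (A : set E4) ->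
 (forall x, A x -> forall i, `|x 0 i| <= r) -> vol A \is a fin_num.
Proof.
move=> mA Ar; rewrite ge0_fin_numE//; apply: le_lt_trans (vol_bounded r).
have sub : A `<=` [set x : E | forall i : 'I_4, `|x 0 i| <= r] by [].
suff mB : measurable ([set x : E | forall i : 'I_4, `|x 0 i| <= r] : set (@E4 R)).
 by apply: le_measure; rewrite ?inE.
apply: closed_measurableE4.
rewrite (_ : [set _ | _] = \bigcap_(i : 'I_4) ((fun x : E => x 0 i) @^-1` [set z | `|z| <= r])); last first.
 by apply/seteqP; split => x /= h; [move=> i _; exact: h | move=> i; exact: h].
apply: closed_bigI => i _.
apply: closed_comp => [x _|]; first exact: coord_continuous.
rewrite (_ : [set z | _] = `[- r, r]%classic).
 exact: interval_closed.
by apply/seteqP; split => z /=; rewrite in_itv/= ler_norml.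
Qed.

Lemma Vol_le (A B : set E) (r : R) : measurable (A : set E4) -> measurable (B : set E4) ->
 (forall x, B x -> forall i, `|x 0 i| <= r) -> A `<=` B -> Vol A<=Vol B.
Proof.
move=> mA mB Br AB; apply: fine_le.
- by apply: (bounded_vol_fin (r:=r)) => // x /AB/Br.
- exact: (bounded_vol_fin (r:=r)).
by apply: le_measure; rewrite ?inE.
Qed.

(** Prekopa-Leindler for three indicator functions. The common bound [r] puts them in one box and
    makes all volumes finite. *)
Lemma brunn_minkowski_mul (l : R) (A B C : set E) (r : R) : 0<l<1 ->
 measurable (A : set E4) -> measurable (B : set E4) -> measurable (C : set E4) ->
 (forall x, A x -> forall i, `|x 0 i| <= r) ->
 (forall x, B x -> forall i, `|x 0 i| <= r) ->
 (forall x, C x -> forall i, `|x 0 i| <= r) ->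
 (forall x y, A x -> B y -> C ((1-l) *: x+l *: y)) ->
 Vol A `^ (1-l)*Vol B `^ l<=Vol C.
Proof.
move=> l01 mA mB mC Ar Br Cr ABC; have /andP[l0 l1]:=l01.
pose n:=(Num.trunc r).+1.
have rn : r<=n%:R by rewrite ltW// truncnS_gt.
have cls (X : set E) : measurable (X : set E4) -> (forall x, X x -> forall i, `|x 0 i| <= r) ->
  pl_class box4 (fun t => \1_(rv4 @^-1` X : set (M*M*M*M)) t : R).
 move=> mX Xr; split.
 - by apply: measurable_indic; exact: measurable_rv4_preimage.
 - by [].
 - exists 1, n; split => // t; split; first by [].
  move=> nt; rewrite indicE memNset//= => Xt; apply: nt.
  have h i:=le_trans (Xr _ Xt i) rn.
  have:=h 0; have:=h 1; have:=h 2; have:=h 3; rewrite !mxE /= !ler_norml.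
  by [].
have RIE (X : set E) : measurable (X : set E4) -> RI lam4 (fun t => \1_(rv4 @^-1` X : set (M*M*M*M)) t : R) = Vol X.
 move=> mX; rewrite /RI integral_indic//= ?setIT//.
 exact: measurable_rv4_preimage.
rewrite -!RIE//; apply: prekopa_leindler4 => //; try exact: cls.
move=> x y; rewrite !indicE.
have [Ax|nAx]:=boolP (x \in _); last by rewrite powR0 ?mul0r ?ler0n// gt_eqF// subr_gt0.
have [By|nBy]:=boolP (y \in _); last by rewrite (powR0 (x:=l)) ?mulr0 ?ler0n// gt_eqF.
rewrite !powR1 mulr1 mem_set//=.
move/set_mem: Ax => /= Ax; move/set_mem: By => /= By.
have:=ABC _ _ Ax By; congr (C _).
apply/rowP => -[[|[|[|[|//]]]] Hi]; rewrite !mxE /=;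
by [].
Qed.

Lemma measurable_affine (k : R) (v : E) (A : set E) : measurable (A : set E4) ->
 measurable (((fun x : E => k *: x+v) @^-1` A) : set E4).
Proof.
move=> mA; have mf : measurable_fun setT ((fun x : E => k *: x+v) : @E4 R -> @E4 R).
 have h:=@measurability _ _ (@E4 R) (@E4 R) setT (fun x : E => k *: x+v) (@open E).
 apply: h => //.
 move=> _ [U oU <-]; rewrite setTI; apply: open_measurableE4.
 apply: open_comp => // x _.
 have ck : cts (fun y : E => k *: y) x by exact: scaler_continuous.
 exact: (continuousD ck (@cst_continuous _ _ v _)).
by rewrite -[X in measurable X]setTI; exact: mf.
Qed.

Lemma Vol_scale (k : R) (A : set E) (r : R) : 0<k -> measurable (A : set E4) ->
 (forall x, A x -> forall i, `|x 0 i| <= r) ->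
 Vol ((fun x : E => k^-1 *: x) @^-1` A) = k^+4*Vol A.
Proof.
move=> k0 mA Ar; rewrite /Vol.
rewrite (_ : (fun x : E => k^-1 *: x) @^-1` A = (fun x : E => k^-1 *: x+0) @^-1` A); last first.
 by apply/seteqP; split => x /=; rewrite addr0.
rewrite vol_affine ?invr_gt0// fineM//.
 by rewrite exprVn invrK.
exact: bounded_vol_fin Ar.
Qed.

Lemma dot_coord (x : E) (i : 'I_4) (r : R) : 0<=r -> dot x x<=r^+2 -> `|x 0 i| <= r.
Proof.
move=> r0 xr; rewrite -(ler_pXn2r (_ : 0<2)%N)// ?nnegrE// -normrX ger0_norm ?sqr_ge0//.
apply: le_trans xr; rewrite /dot (bigD1 i)//= -expr2 lerDl.
by apply: sumr_ge0 => j _; rewrite -expr2 sqr_ge0.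
Qed.

Lemma continuous_dot : continuous (fun x : E => dot x x).
Proof.
by move=> x; apply: cont_sum => i; apply: cont_mul; exact: coord_continuous.
Qed.

Lemma open_ball4 r : open (ball4 r).
Proof.
rewrite (_ : ball4 r = (fun x : E => dot x x) @^-1` `]-oo, r^+2[%classic); last first.
 by [].
by apply: open_comp => [x _|]; [exact: continuous_dot|exact: interval_open].
Qed.

Lemma measurable_ball4 r : measurable (ball4 r : set E4).
Proof. by apply: open_measurableE4; exact: open_ball4. Qed.

Lemma ball4_bounded r x : 0<=r -> ball4 r x -> forall i, `|x 0 i| <= r.
Proof. by move=> r0 /ltW h i; exact: dot_coord. Qed.

Definition omega : R:=Vol (ball4 1).

Lemma omega_ge0 : 0<=omega.
Proof. exact: Vol_ge0. Qed.

Lemma dotZ (k : R) (x : E) : dot (k *: x) (k *: x) = k^+2*dot x x.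
Proof. by rewrite mulr_sumr; apply: eq_bigr => i _; rewrite !mxE; ring. Qed.

Lemma Vol_ball4 r : 0<r -> Vol (ball4 r) = r^+4*omega.
Proof.
move=> r0; have b1 : forall x, ball4 1 x -> forall i, `|x 0 i| <= 1.
 by move=> x; apply: ball4_bounded.
have:=Vol_scale r0 (measurable_ball4 1) b1; rewrite -/omega => <-.
congr Vol; apply/seteqP; split => x; rewrite /ball4 /= dotZ expr1n exprVn mulrC ltr_pdivrMr ?mul1r// exprn_gt0//.
Qed.

(** With fourth roots [a] and [b] of the volumes of [A] and of the unit ball, the additive form of
    Brunn-Minkowski gives [(a + e b)^4 >= a^4 + 4 e a^3 b]. Only this first-order part in [e] is
    kept, as it is what the isoperimetric inequality uses. *)
Lemma brunn_minkowski_ball (A C : set E) (e r : R) : 0<e ->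
 measurable (A : set E4) -> measurable (C : set E4) ->
 (forall x, A x -> forall i, `|x 0 i| <= r) ->
 (forall x, C x -> forall i, `|x 0 i| <= r) ->
 (forall x y, A x -> ball4 e y -> C (x+y)) ->
 Vol A+4*e*(Vol A `^ (3/4)*omega `^ 4^-1)<=Vol C.
Proof.
move=> e0 mA mC Ar Cr AC.
have [A0|A0]:=eqVneq (Vol A) 0.
 by rewrite A0 powR0 ?mul0r ?mulr0 ?addr0 ?Vol_ge0//.
have AC' : A `<=` C.
 move=> x Ax; rewrite -[x]addr0; apply: AC => //; rewrite /ball4 /= /dot big1 ?exprn_gt0//.
 by move=> i _; rewrite mxE mul0r.
have [om0|om0]:=eqVneq omega 0.
 rewrite om0 (powR0 (x:=4^-1)) ?mulr0 ?addr0 ?invr_eq0//; exact: (Vol_le (r:=r)).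
have VA : 0<Vol A by rewrite lt_neqAle eq_sym A0 Vol_ge0.
have Vom : 0<omega by rewrite lt_neqAle eq_sym om0 Vol_ge0.
pose a:=Vol A `^ 4^-1; pose b:=omega `^ 4^-1.
have a0 : 0<a by exact: powR_gt0.
have b0 : 0<b by exact: powR_gt0.
have pow4 (z : R) : 0<=z -> (z `^ 4^-1)^+4 = z.
 by move=> z0; rewrite -powR_mulrn ?powR_ge0// -powRrM mulVf// powRr1.
have a4 : a^+4 = Vol A by exact: pow4 (Vol_ge0 A).
have b4 : b^+4 = omega by exact: pow4 omega_ge0.
have a3 : Vol A `^ (3/4) = a^+3 by rewrite -powR_mulrn ?ltW// -powRrM mulrC.
rewrite a3 -/b -a4; clearbody a b.
have eb0 : 0<e*b by pos.
apply: (@le_trans _ _ ((a+e*b)^+4)).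
 by nra.
have [S SE] : exists S, S = a+e*b by eexists.
have S0 : 0<S by lra.
rewrite -SE.
(* With this weight the dilates [A/(1-l)] and the ball of radius [e/l] have the same volume [S^4],
   which is then also their weighted geometric mean. *)
have [l lE] : exists l, l = e*b/S by eexists.
have l0 : 0<l by rewrite lE divr_gt0.
have l1E : 1-l = a/S by rewrite lE -[1](divff (lt0r_neq0 S0)) -mulrBl {1}SE addrK.
have l1 : l<1 by rewrite -subr_gt0 l1E divr_gt0.
have l1' : 0<1-l by lra.
have l01 : 0<l<1 by lra.
pose A':=(fun x : E => (1-l) *: x) @^-1` A.
pose B':=(fun x : E => (e^-1 * l) *: x) @^-1` ball4 1.
have mA' : measurable (A' : set E4).
 rewrite /A' (_ : (fun x : E => _) = (fun x : E => (1-l) *: x+0)); last first.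
  by apply/funext => x; rewrite addr0.
 exact: measurable_affine.
have mB' : measurable (B' : set E4).
 rewrite /B' (_ : (fun x : E => _) = (fun x : E => (e^-1 * l) *: x+0)); last first.
  by apply/funext => x; rewrite addr0.
 by apply: measurable_affine; exact: measurable_ball4.
have b1 : forall x, ball4 1 x -> forall i, `|x 0 i| <= 1.
 by move=> x; apply: ball4_bounded.
have el0 : 0<e^-1 * l by rewrite mulr_gt0 ?invr_gt0.
have VA' : Vol A' = S^+4.
 have l1v : 0<(1-l)^-1 by rewrite invr_gt0.
 have:=Vol_scale l1v mA Ar; rewrite invrK -/A' => ->.
 by rewrite -a4 l1E invf_div -exprMn divfK ?gt_eqF.
have VB' : Vol B' = S^+4.
 have elv : 0<(e^-1 * l)^-1 by rewrite invr_gt0.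
 have:=Vol_scale elv (measurable_ball4 1) b1; rewrite invrK -/B' => ->.
 rewrite -/omega -b4 -exprMn; congr (_^+4); rewrite lE; field.
 by rewrite !gt_eqF.
have -> : S^+4 = Vol A' `^ (1-l)*Vol B' `^ l.
 have S4 : 0<S^+4 by rewrite exprn_gt0.
 by rewrite VA' VB' -powRD ?subrK ?powRr1 ?(ltW S4)// (gt_eqF S4) implybT.
pose r':=Num.max r 0/(1-l)+(e^-1 * l)^-1+r.
have rm : 0<=Num.max r 0 by rewrite le_max lexx orbT.
have [r0|r0]:=leP 0 r; last first.
 exfalso; have : Vol A = 0.
  rewrite (_ : A = set0) /Vol ?measure0//; apply/seteqP; split => // x Ax.
  by have:=Ar x Ax 0; rewrite leNgt (lt_le_trans r0).
 by move/eqP; rewrite (negbTE A0).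
have p1 : 0<=Num.max r 0/(1-l) by rewrite divr_ge0// ltW.
have p2 : 0<=(e^-1 * l)^-1 by rewrite invr_ge0 ltW.
apply: (@brunn_minkowski_mul l A' B' C r') => //.
- move=> x A'x i; have:=Ar _ A'x i; rewrite mxE normrM (gtr0_norm l1') => h.
 apply: (@le_trans _ _ (Num.max r 0/(1-l))).
  by rewrite ler_pdivlMr// mulrC (le_trans h)// le_max lexx.
 by rewrite /r' -addrA lerDl addr_ge0.
- move=> x B'x i; have:=b1 _ B'x i; rewrite mxE normrM (gtr0_norm el0) => h.
 apply: (@le_trans _ _ ((e^-1 * l)^-1)).
  by rewrite -[leRHS]mul1r ler_pdivlMr// mulrC.
 by rewrite /r' addrAC lerDr addr_ge0.
- by move=> x Cx i; rewrite (le_trans (Cr x Cx i))// /r' lerDr addr_ge0.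
- move=> x y A'x B'y; apply: AC => //.
 move: B'y; rewrite /B' /ball4 /= !dotZ expr1n exprMn exprVn -mulrA mulrC.
 by rewrite ltr_pdivrMr ?mul1r// exprn_gt0.
Qed.
End BrunnMinkowski.

(** * Derivatives along lines, differentiability and symmetry of second derivatives *)

Lemma mean_value {R : realType} (g dg : R -> R) (a b : R) : a<=b ->
 (forall t, a<=t<=b -> is_derive t 1 g (dg t)) ->
 exists2 c, a<=c<=b & g b-g a = dg c*(b-a).
Proof.
move=> ab H; have [||c cab E]:=@MVT_segment R g dg a b ab.
- by move=> t; rewrite in_itv/= => /andP[t0 t1]; apply: H; rewrite !ltW.
- by apply: derivable_within_continuous => t; rewrite in_itv/= => t01; have []:=H t t01.
by exists c; rewrite ?in_itv in cab *.
Qed.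

Section LinesV.
Context {R : realType} {V W : normedModType R}.
Implicit Types (f : V -> W) (a v : V).

Lemma line_quotientE f (a v : V) (t : R) :
 (fun h : R => h^-1 *: (((fun s : R => f (a+s *: v)) \o shift t) (h *: 1) -
             f (a+t *: v))) =
 (fun h : R => h^-1 *: ((f \o shift (a+t *: v)) (h *: v)-f (a+t *: v))).
Proof.
apply/funext => h /=; congr (_ *: (f _-_)).
have -> : h%:A = h :> R by rewrite /GRing.scale/= mulr1.
by rewrite scalerDl addrCA.
Qed.

Lemma is_derive_line f (a v : V) (t : R) (df : W) : is_derive (a+t *: v) v f df ->
 is_derive t 1 (fun s : R => f (a+s *: v)) df.
Proof.
move=> [d1 d2]; split; first by rewrite /derivable line_quotientE.
by rewrite /derive line_quotientE.
Qed.

Lemma is_derive_line0 f (a v : V) (df : W) : is_derive a v f df ->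
 is_derive (0 : R) 1 (fun s : R => f (a+s *: v)) df.
Proof. by move=> d; apply: is_derive_line; rewrite scale0r addr0. Qed.

Lemma is_derive_line_inv f (a v : V) (df : W) :
 is_derive (0 : R) 1 (fun s : R => f (a+s *: v)) df -> is_derive a v f df.
Proof.
move=> [d1 d2]; have e : a+(0 : R) *: v = a by rewrite scale0r addr0.
by split; [move: d1|move: d2]; rewrite /derivable /derive line_quotientE e.
Qed.

End LinesV.

Section Lines.
Context {R : realType} {n : nat}.
Local Notation E:='rV[R]_n.
Local Notation e_ i:=(delta_mx 0 i : E).
Implicit Types (f g : E -> R) (U : set E) (x v : E).

Lemma derivable_is_derive f x v : derivable f x v -> is_derive x v f ('D_v f x).
Proof. by []. Qed.

Definition C1at f x :=
 \forall y \near x, forall i, derivable f y (e_ i) /\ cts (partial i f) y.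

Lemma norm_row_le (h : E) (i : 'I_n) : `|h 0 i| <= `|h|.
Proof.
have -> : `|h| = mx_norm h by [].
by rewrite mx_normrE; apply/bigmax_geP; right => /=; exists (0, i).
Qed.

Lemma norm_row_bound (h : E) (r : R) : 0<=r -> (forall i, `|h 0 i| <= r) -> `|h| <= r.
Proof.
move=> r0 hr; have -> : `|h| = mx_norm h by [].
rewrite mx_normrE; apply/bigmax_leP; split => // -[i j] _ /=.
by rewrite (ord1 i).
Qed.

(** The increment is telescoped through the points [x + hk k], which move one coordinate at a time;
    each step is a mean value along a coordinate direction, where the partial derivative is close to
    its value at [x]. *)
Lemma C1at_eps f x : C1at f x -> forall e : R, 0<e -> exists2 d : R, 0<d &
 forall h, `|h| < d -> `|f (x+h)-f x - \sum_i h 0 i * partial i f x| <= e * `|h|.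
Proof.
move=> cf e e0.
have e0' : 0<e/n.+1%:R by pos.
have [d d0 hd] : exists2 d : R, 0<d & forall y, `|y-x| < d -> forall i,
  derivable f y (e_ i) /\ `|partial i f y-partial i f x| <= e/n.+1%:R.
 have cx i : cts (partial i f) x by have []:=nbhs_singleton cf i.
 have : \forall y \near x, forall i, derivable f y (e_ i) /\ `|partial i f y-partial i f x| <= e/n.+1%:R.
  have H i : \forall y \near x, `|partial i f y-partial i f x| <= e/n.+1%:R.
   have /cvgrPdist_le:=cx i => /(_ _ e0'); apply: filterS => y.
   by rewrite distrC.
  have {}H : \forall y \near x, forall i, `|partial i f y-partial i f x| <= e/n.+1%:R.
   exact: (@filter_forall E 'I_n
    (fun i y => `|partial i f y-partial i f x| <= e/n.+1%:R) (nbhs x)).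
  near=> y => i; split; last by move: i; near: y.
  by have [] : derivable f y (e_ i) /\ cts (partial i f) y by move: i; near: y.
 move=> /nbhs_normP[d /= d0 hd]; exists d => // y yx i; apply: hd.
 by rewrite /= distrC.
exists d => // h hd'.
pose hk (k : nat) : E:=\row_i (if (i<k)%N then h 0 i else 0).
have h0 : hk 0%N = 0 by apply/rowP => i; rewrite !mxE ltn0.
have hn : hk n = h by apply/rowP => i; rewrite !mxE ltn_ord.
have hS (k : 'I_n) : hk k.+1 = hk k+h 0 k *: e_ k.
 apply/rowP => i; rewrite !mxE /= ltnS leq_eqVlt -val_eqE /=.
 case: eqP => [ik|_]; last by rewrite mulr0 addr0.
 rewrite ik ltnn add0r mulr1 /=; congr (h 0 _); exact/val_inj.
have step (k : 'I_n) : `|f (x+hk k.+1)-f (x+hk k)-h 0 k * partial k f x| <= `|h| * (e/n.+1%:R).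
 have inb (t : R) : 0<=t<=1 -> `|(x+hk k+(t*h 0 k) *: e_ k)-x| < d.
  move=> /andP[t0 t1]; apply: le_lt_trans hd'; rewrite -(addrA x) (addrC x) addrK.
  apply: norm_row_bound => // i; rewrite !mxE eqxx /=.
  case: (ltnP i k) => ik.
   have -> : (i == k) = false by apply/eqP => e1; move: ik; rewrite e1 ltnn.
   by rewrite mulr0 addr0 norm_row_le.
  rewrite add0r; case: eqP => [_|_]; last by rewrite mulr0 normr0.
  rewrite mulr1 normrM (ger0_norm t0) (le_trans _ (norm_row_le h k))//.
  by rewrite ler_piMl.
 pose g (t : R):=f (x+hk k+(t*h 0 k) *: e_ k).
 have dg (t : R) : 0<=t<=1 -> is_derive t 1 g (partial k f (x+hk k+(t*h 0 k) *: e_ k)*h 0 k).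
  move=> t01; have [dk _]:=hd _ (inb t t01) k.
  have h1:=is_derive_line (derivable_is_derive dk).
  have h2 : is_derive t 1 (fun s : R => s*h 0 k) (h 0 k).
   by apply: is_derive_eq; rewrite /GRing.scale/=; ring.
  exact: (@is_derive1_comp R (fun s : R => f (x+hk k+s *: e_ k)) _ t _ _ h1 h2).
 have [c c01 gE]:=mean_value ler01 dg.
 rewrite hS addrA; have -> : f (x+hk k+h 0 k *: e_ k) = g 1 by rewrite /g mul1r.
 have -> : f (x+hk k) = g 0 by rewrite /g mul0r scale0r addr0.
 rewrite gE subr0 mulr1 mulrC -mulrBr normrM ler_pM// ?norm_row_le//.
 by have []:=hd _ (inb c c01) k.
have -> : f (x+h)-f x = \sum_(k<n) (f (x+hk k.+1)-f (x+hk k)).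
 rewrite -(big_mkord xpredT (fun k => f (x+hk k.+1)-f (x+hk k))).
 by rewrite telescope_sumr// hn h0 addr0.
rewrite -sumrB; apply: le_trans (ler_norm_sum _ _ _) _.
apply: (@le_trans _ _ (\sum_(k<n) `|h| * (e/n.+1%:R))); first exact: ler_sum.
rewrite sumr_const card_ord -[leLHS]mulr_natr -mulrA [leRHS]mulrC ler_wpM2l//.
by rewrite -mulrA ler_piMr ?(ltW e0)// mulrC ler_pdivrMr// mul1r ler_nat.
Unshelve. all: by end_near.
Qed.

End Lines.

Section Differential.
Context {R : realType} {n : nat}.
Local Notation E:='rV[R]_n.
Local Notation e_ i:=(delta_mx 0 i : E).
Implicit Types (f g : E -> R) (U : set E) (x v : E).

Definition lin_form (c : 'I_n -> R) (h : E) : R:=\sum_i h 0 i*c i.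

Lemma lin_form_linear c : linear (lin_form c : E -> R).
Proof.
move=> k u v; rewrite /lin_form /GRing.scale/= mulr_sumr -big_split /=.
by apply: eq_bigr => i _; rewrite !mxE mulrDl mulrA.
Qed.

HB.instance Definition _ c:=GRing.isLinear.Build R E R *:%R (lin_form c) (lin_form_linear c).

Lemma continuous_lin_form c : continuous (lin_form c).
Proof.
by move=> x; apply: cont_sum => i; apply: cont_mul; [exact: coord_continuous|exact: cont_cst].
Qed.

Lemma C1at_expansion f x : C1at f x ->
 f \o shift x = cst (f x)+lin_form (fun i => partial i f x) +o_ (0 : E) id.
Proof.
move=> /C1at_eps H; apply/eqaddoP => e e0.
have [d d0 hd]:=H _ e0.
suff HH : nbhs (0 : E) [set h | `|(f \o shift x-(cst (f x) +
  lin_form (fun i => partial i f x))) h| <= e * `|h| ] by [].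
apply/nbhs_ballP; exists d => // h; rewrite -ball_normE /= sub0r normrN => hh.
have -> : (f \o shift x-(cst (f x)+lin_form (fun i => partial i f x))) h =
  f (x+h)-f x - \sum_i h 0 i * partial i f x.
 transitivity (f (h+x)-(f x + \sum_i h 0 i * partial i f x)) => //.
 by rewrite (addrC h) opprD addrA.
exact: hd.
Qed.

Lemma C1at_diffE f x v : C1at f x ->
 differentiable f x /\ 'd f x v = \sum_i v 0 i * partial i f x.
Proof.
move=> cf; have ex:=C1at_expansion cf.
have dE:=diff_unique (@continuous_lin_form _) ex.
split; last by rewrite dE.
apply/diff_locallyP; rewrite dE; split => //.
exact: continuous_lin_form.
Qed.

Lemma C1at_is_derive f x v : C1at f x ->
 is_derive x v f (\sum_i v 0 i * partial i f x).
Proof.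
move=> cf; have [df dE]:=C1at_diffE v cf.
by split; [exact: diff_derivable|rewrite deriveE].
Qed.

(** The inner map is only assumed differentiable in the direction [v], so the chain rule is applied
    to its restriction to the line through [x]. *)
Lemma is_derive_chain (V : normedModType R) f (tau : V -> E) (x : V) (v : V) (w : E) : C1at f (tau x) ->
 (forall i, is_derive x v (fun y => tau y 0 i) (w 0 i)) ->
 is_derive x v (fun y => f (tau y)) (\sum_i w 0 i * partial i f (tau x)).
Proof.
move=> cf dt.
have dtau : derivable tau x v by apply/derivable_mxP => i j; rewrite (ord1 i); have []:=dt j.
have Dtau : 'D_v tau x = w.
 by rewrite derive_mx//; apply/rowP => j; rewrite mxE; have [_ ->]:=dt j.
have [df dE]:=C1at_diffE w cf.
have dtau' : is_derive x v tau w by [].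
have [d1 D1]:=is_derive_line0 dtau'.
set c:=(fun s : R => tau (x+s *: v)) in d1 D1.
have c0 : c 0 = tau x by rewrite /c scale0r addr0.
have d1' : differentiable c 0 by apply/derivable1_diffP.
have df' : differentiable f (c 0) by rewrite c0.
have dc : differentiable (f \o c) 0 by exact: differentiable_comp.
apply: is_derive_line_inv; split; first by apply/derivable1_diffP.
have -> : 'D_1 (fun s : R => f (tau (x+s *: v))) 0 = 'd (f \o c) 0 1 by rewrite -deriveE.
by rewrite diff_comp//= -(deriveE _ d1') D1 c0.
Qed.

Lemma is_derive_comp1 (V : normedModType R) (phi : R -> R) (u : V -> R) (x v : V) (a b : R) :
 is_derive (u x) 1 phi a -> is_derive x v u b -> is_derive x v (fun y => phi (u y)) (a*b).
Proof.
move=> hphi hu; have h1:=is_derive_line0 hu.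
set c:=(fun s : R => u (x+s *: v)) in h1.
have hphi' : is_derive (c 0) 1 phi a by rewrite /c scale0r addr0.
exact: is_derive_line_inv (is_derive1_comp hphi' h1).
Qed.

Lemma near_is_derive f g x v (df : R) : (\forall y \near x, f y = g y) ->
 is_derive x v f df -> is_derive x v g df.
Proof.
move=> fg [d1 d2].
have [v0|v0]:=eqVneq v 0.
 by rewrite v0 in d2 *; split; [exact: derivable0|rewrite derive0 -d2 derive0].
split.
 by apply: near_eq_derivable d1 => //.
by rewrite -d2; apply/esym; exact: near_eq_derive.
Qed.

Lemma near_partial f g x i : (\forall y \near x, f y = g y) -> partial i f x = partial i g x.
Proof.
by move=> fg; apply: near_eq_derive.
Qed.

End Differential.

Section SchwarzAux.
Context {R : realType}.
Implicit Types A B C D F h e u v : R.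

Lemma sd_inj h A B C D u v : h != 0 -> A-B-C+D = h^+2*u ->
 A-C-B+D = h^+2*v -> u = v.
Proof.
move=> h0 e1 e2; have hh : h^+2 != 0 by rewrite expf_neq0.
by nra.
Qed.

Lemma dist_half A B C e : `|B-C| <= e/2 -> `|A-C| <= e/2 -> `|A-B| <= e.
Proof. by rewrite !ler_norml => /andP[? ?] /andP[? ?]; apply/andP; split; lra. Qed.

End SchwarzAux.

Section Schwarz.
Context {R : realType} {n : nat}.
Local Notation E:='rV[R]_n.
Local Notation e_ i:=(delta_mx 0 i : E).
Implicit Types (f g : E -> R) (U : set E) (x v : E).

Lemma second_difference f x (i j : 'I_n) (d : R) : 0<d ->
 (forall y, `|y-x| < d -> derivable f y (e_ i) /\ derivable (partial i f) y (e_ j)) ->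
 forall h : R, 0<h -> 2*h<d -> exists2 y, `|y-x| < d &
  f (x+h *: e_ i+h *: e_ j)-f (x+h *: e_ i)-f (x+h *: e_ j)+f x =
  h^+2 * partial j (partial i f) y /\ `|y-x| <= 2*h.
Proof.
move=> d0 H h h0 hd.
have nb (s t : R) : 0<=s<=h -> 0<=t<=h -> `|x+s *: e_ i+t *: e_ j-x| <= 2*h.
 move=> /andP[s0 sh] /andP[t0 th]; rewrite -(addrA x) (addrC x) addrK.
 apply: norm_row_bound => [|k]; first by lra.
 rewrite !mxE /=; apply: le_trans (ler_normD _ _) _.
 have hb (z : R) (b : bool) : 0<=z -> z<=h -> `|z*b%:R| <= h.
  by move=> z0 zh; case: b; rewrite ?mulr1 ?mulr0 ?normr0 ?ger0_norm// ltW.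
 by rewrite mulr_natl lerD// hb.
have nb' (s t : R) : 0<=s<=h -> 0<=t<=h -> `|x+s *: e_ i+t *: e_ j-x| < d.
 by move=> hs ht; exact: le_lt_trans (nb _ _ hs ht) hd.
pose g (s : R):=f (x+h *: e_ j+s *: e_ i)-f (x+s *: e_ i).
have dg (s : R) : 0<=s<=h -> is_derive s 1 g
  (partial i f (x+s *: e_ i+h *: e_ j)-partial i f (x+s *: e_ i)).
 move=> hs; have hh : 0<=h<=h by lra.
 have h00 : 0<=(0 : R)<=h by lra.
 have [d1 _]:=H _ (nb' s h hs hh).
 have:=nb' s 0 hs h00; rewrite scale0r addr0 => /H[d2 _].
 rewrite addrAC in d1.
 have:=is_derive_line (derivable_is_derive d1).
 have:=is_derive_line (derivable_is_derive d2).
 move=> i2 i1; rewrite /g (addrAC x (s *: _)).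
 exact: is_deriveB.
have [s hs gE]:=mean_value (ltW h0) dg.
pose k (t : R):=partial i f (x+s *: e_ i+t *: e_ j).
have dk (t : R) : 0<=t<=h -> is_derive t 1 k (partial j (partial i f) (x+s *: e_ i+t *: e_ j)).
 move=> ht; have [_ d2]:=H _ (nb' s t hs ht).
 exact: is_derive_line (derivable_is_derive d2).
have [t ht kE]:=mean_value (ltW h0) dk.
exists (x+s *: e_ i+t *: e_ j); first exact: nb'.
split; last exact: nb.
move: gE; rewrite /g scale0r !addr0 (addrAC x (h *: e_ j)) subr0.
have -> : partial i f (x+s *: e_ i) = k 0 by rewrite /k scale0r addr0.
rewrite -/(k h) kE subr0 expr2 => e1.
by lra.
Qed.

(** The same second difference, divided by [h^2], is a value of each mixed derivative at some point
    near [x]; continuity brings both values back to [x]. *)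
Lemma schwarz f x (i j : 'I_n) :
 (\forall y \near x, forall k l, derivable f y (e_ k) /\ derivable (partial k f) y (e_ l)) ->
 (forall k l, cts (partial l (partial k f)) x) ->
 partial i (partial j f) x = partial j (partial i f) x.
Proof.
move=> nf cf; apply/eqP; rewrite -subr_eq0 -normr_le0; apply/ler_addgt0Pr => e e0.
rewrite add0r.
have e20 : 0<e/2 by lra.
have [d d0 hd] : exists2 d : R, 0<d & forall y, `|y-x| < d ->
 [/\ forall k l, derivable f y (e_ k) /\ derivable (partial k f) y (e_ l),
  `|partial i (partial j f) x-partial i (partial j f) y| <= e/2 &
  `|partial j (partial i f) x-partial j (partial i f) y| <= e/2].
 have /cvgrPdist_le/(_ _ e20) c1:=cf j i.
 have /cvgrPdist_le/(_ _ e20) c2:=cf i j.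
 have : \forall y \near x, [/\ forall k l, derivable f y (e_ k) /\ derivable (partial k f) y (e_ l),
  `|partial i (partial j f) x-partial i (partial j f) y| <= e/2 &
  `|partial j (partial i f) x-partial j (partial i f) y| <= e/2].
  by apply: filterS3 nf c1 c2 => y a1 a2 a3; split; [exact: a1|exact: a2|exact: a3].
 move=> /nbhs_normP[d /= d0 hd]; exists d => // y yx; apply: hd.
 by rewrite /= distrC.
have h0 : 0<d/4 by lra.
have h2 : 2*(d/4)<d by lra.
have [y1 y1d [E1 _]]:=second_difference d0 (fun y yd => let: And3 A _ _:=hd y yd in A i j) h0 h2.
have [y2 y2d [E2 _]]:=second_difference d0 (fun y yd => let: And3 A _ _:=hd y yd in A j i) h0 h2.
rewrite (addrAC x) in E2.
have hne : d/4 != 0 by rewrite gt_eqF.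
have E3:=sd_inj hne E1 E2.
have [_ _ k1]:=hd _ y1d; have [_ k2 _]:=hd _ y2d.
rewrite E3 in k1; exact: dist_half k1 k2.
Qed.

End Schwarz.

(** * Calculus of functions of class C^k on an open set *)

Section Ck.
Context {R : realType} {n : nat}.
Local Notation E:='rV[R]_n.
Local Notation e_ i:=(delta_mx 0 i : E).
Implicit Types (f g : E -> R) (U V : set E) (x v : E) (k m : nat).

Lemma is_Ck_cont k U f x : is_Ck k U f -> U x -> cts f x.
Proof. by case: k => [|k] [H _]; exact: H. Qed.

Lemma is_Ck_derivable k U f x i : is_Ck k.+1 U f -> U x -> is_derive x (e_ i) f (partial i f x).
Proof. by move=> [_ H] Ux; have [d _]:=H i; split => //; exact: d. Qed.

Lemma is_Ck_partial k U f i : is_Ck k.+1 U f -> is_Ck k U (partial i f).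
Proof. by move=> [_ H]; have []:=H i. Qed.

Lemma is_CkW k U f : is_Ck k.+1 U f -> is_Ck k U f.
Proof.
elim: k f => [|k ih] f [H1 H2]; first by [].
by split => // i; have [d H]:=H2 i; split => //; exact: ih.
Qed.

Lemma is_Ck_le k m U f : (k<=m)%N -> is_Ck m U f -> is_Ck k U f.
Proof.
move=> /subnK <-; elim: (m-k)%N => [//|j ih].
by rewrite addSn => /is_CkW.
Qed.

Lemma is_Ck_sub k U V f : V `<=` U -> is_Ck k U f -> is_Ck k V f.
Proof.
move=> VU; elim: k f => [|k ih] f [H1 H2]; first by split => // x /VU/H1.
split=> [x /VU/H1//|i]; have [d H]:=H2 i.
by split => [x /VU/d//|]; exact: ih.
Qed.

Lemma open_near_eq U f g x : open U -> (forall y, U y -> f y = g y) -> U x ->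
 \forall y \near x, f y = g y.
Proof. by move=> oU fg Ux; apply: filterS (open_nbhs_nbhs (conj oU Ux)) => y /fg. Qed.

Lemma is_Ck_eq k U f g : open U -> (forall x, U x -> f x = g x) -> is_Ck k U f -> is_Ck k U g.
Proof.
move=> oU; elim: k f g => [|k ih] f g fg [H1 H2].
 split => // x Ux; apply: cont_near_eq (H1 x Ux); exact: open_near_eq oU fg Ux.
split=> [x Ux|i]; first by apply: cont_near_eq (H1 x Ux); exact: open_near_eq oU fg Ux.
have [d H]:=H2 i; split=> [x Ux|].
 have []:=near_is_derive (open_near_eq oU fg Ux) (derivable_is_derive (d x Ux)).
 by [].
apply: ih H => x Ux; apply: near_partial; exact: open_near_eq oU fg Ux.
Qed.

Lemma is_CkS_intro k U f (df : 'I_n -> E -> R) : open U ->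
 (forall x, U x -> cts f x) ->
 (forall i x, U x -> is_derive x (e_ i) f (df i x)) ->
 (forall i, is_Ck k U (df i)) -> is_Ck k.+1 U f.
Proof.
move=> oU cf dfE Hdf; split => // i; split=> [x Ux|]; first by have []:=dfE i x Ux.
apply: is_Ck_eq (Hdf i) => // x Ux; have [_ dE]:=dfE i x Ux; exact/esym/dE.
Qed.

Lemma is_Ck_C1at U f x : open U -> is_Ck 1 U f -> U x -> C1at f x.
Proof.
move=> oU H Ux; apply: filterS (open_nbhs_nbhs (conj oU Ux)) => y Uy i.
have [H1 H2]:=H; have [d H3]:=H2 i; split; first exact: d.
by have [H4 _]:=H3; exact: H4.
Qed.

Lemma is_Ck_cst k U (c : R) : open U -> is_Ck k U (fun=> c).
Proof.
move=> oU; elim: k c => [|k ih] c.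
 by split => // x _; exact: cont_cst.
apply: (@is_CkS_intro k U _ (fun _ _ => 0)) => // x _; exact: cont_cst.
Qed.

Lemma is_derive_coord x v (i : 'I_n) : is_derive x v (fun y : E => y 0 i) (v 0 i).
Proof.
have d : derivable (id : E -> E) x v by [].
have /derivable_mxP H:=d; split; first exact: H.
by have:=derive_mx d; rewrite derive_id => /matrixP/(_ 0 i); rewrite mxE => <-.
Qed.

Lemma is_Ck_coord k U (i : 'I_n) : open U -> is_Ck k U (fun y : E => y 0 i).
Proof.
move=> oU; case: k => [|k].
 by split => // x _; exact: coord_continuous.
apply: (@is_CkS_intro k U _ (fun j _ => e_ j 0 i)) => // [x _|j x _|j].
- exact: coord_continuous.
- exact: is_derive_coord.
- exact: is_Ck_cst.
Qed.

Lemma is_Ck_add k U f g : open U -> is_Ck k U f -> is_Ck k U g -> is_Ck k U (fun x => f x+g x).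
Proof.
move=> oU; elim: k f g => [|k ih] f g cf cg.
 by split => // x Ux; apply: cont_add; [exact: is_Ck_cont cf Ux|exact: is_Ck_cont cg Ux].
apply: (@is_CkS_intro k U _ (fun i x => partial i f x+partial i g x)) => //.
- by move=> x Ux; apply: cont_add; [exact: is_Ck_cont cf Ux|exact: is_Ck_cont cg Ux].
- by move=> i x Ux; have d1:=is_Ck_derivable i cf Ux; have d2:=is_Ck_derivable i cg Ux;
  exact: is_deriveD.
- by move=> i; apply: ih; exact: is_Ck_partial.
Qed.

Lemma is_Ck_mul k U f g : open U -> is_Ck k U f -> is_Ck k U g -> is_Ck k U (fun x => f x*g x).
Proof.
move=> oU; elim: k f g => [|k ih] f g cf cg.
 by split => // x Ux; apply: cont_mul; [exact: is_Ck_cont cf Ux|exact: is_Ck_cont cg Ux].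
apply: (@is_CkS_intro k U _ (fun i x => f x * partial i g x+g x * partial i f x)) => //.
- by move=> x Ux; apply: cont_mul; [exact: is_Ck_cont cf Ux|exact: is_Ck_cont cg Ux].
- by move=> i x Ux; have d1:=is_Ck_derivable i cf Ux; have d2:=is_Ck_derivable i cg Ux;
  exact: is_deriveM.
- move=> i; apply: is_Ck_add => //; apply: ih; try exact: is_Ck_partial; exact: is_CkW.
Qed.

Lemma is_Ck_scale k U (c : R) f : open U -> is_Ck k U f -> is_Ck k U (fun x => c*f x).
Proof. by move=> oU cf; apply: is_Ck_mul => //; exact: is_Ck_cst. Qed.

Lemma is_Ck_opp k U f : open U -> is_Ck k U f -> is_Ck k U (fun x => - f x).
Proof.
move=> oU cf; apply: (@is_Ck_eq k U (fun x => -1*f x)) => // [x _|]; first by lra.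
exact: is_Ck_scale.
Qed.

Lemma is_Ck_sub_fun k U f g : open U -> is_Ck k U f -> is_Ck k U g -> is_Ck k U (fun x => f x-g x).
Proof. by move=> oU cf cg; apply: is_Ck_add => //; exact: is_Ck_opp. Qed.

Lemma is_Ck_exp k U f m : open U -> is_Ck k U f -> is_Ck k U (fun x => f x^+m).
Proof.
move=> oU cf; elim: m => [|m ih].
 by apply: (@is_Ck_eq k U (fun=> 1)) => //; exact: is_Ck_cst.
by apply: (@is_Ck_eq k U (fun x => f x*f x^+m)) => // [x _|]; [rewrite exprS|exact: is_Ck_mul].
Qed.

Lemma is_Ck_sum k U (I : Type) (r : seq I) (P : pred I) (F : I -> E -> R) : open U ->
 (forall i, is_Ck k U (F i)) -> is_Ck k U (fun x => \sum_(i <- r | P i) F i x).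
Proof.
move=> oU cF; elim: r => [|i r ih].
 by apply: (@is_Ck_eq k U (fun=> 0)) => // [x _|]; [rewrite big_nil|exact: is_Ck_cst].
apply: (@is_Ck_eq k U (fun x => (if P i then F i x else 0) + \sum_(j <- r | P j) F j x)) => //.
 by move=> x _; rewrite big_cons; case: (P i); rewrite ?add0r.
by apply: is_Ck_add => //; case: (P i) => //; exact: is_Ck_cst.
Qed.

Lemma is_Ck_inv k U f : open U -> (forall x, U x -> f x != 0) -> is_Ck k U f ->
 is_Ck k U (fun x => (f x)^-1).
Proof.
move=> oU f0; elim: k => [|k ih] cf.
 by split => // x Ux; apply: cont_inv; [exact: f0|exact: is_Ck_cont cf Ux].
apply: (@is_CkS_intro k U _ (fun i x => - (partial i f x*((f x)^-1*(f x)^-1)))) => //.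
- by move=> x Ux; apply: cont_inv; [exact: f0|exact: is_Ck_cont cf Ux].
- move=> i x Ux; have [d1 d2]:=is_Ck_derivable i cf Ux.
 split; first by apply: derivableV => //; exact: f0.
 rewrite deriveV//; last exact: f0.
 by rewrite /GRing.scale/= -invfM mulNr mulrC.
- move=> i; apply: is_Ck_opp => //; apply: is_Ck_mul => //; first exact: is_Ck_partial.
 by apply: is_Ck_mul => //; apply: ih; exact: is_CkW.
Qed.

Lemma is_Ck_ln k U f : open U -> (forall x, U x -> 0<f x) -> is_Ck k U f ->
 is_Ck k U (fun x => ln (f x)).
Proof.
move=> oU f0 cf.
have cl x : U x -> cts (fun x => ln (f x)) x.
 by move=> Ux; apply: cont_comp; [apply: continuous_ln; exact: f0|exact: is_Ck_cont cf Ux].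
case: k cf => [|k] cf; first by [].
apply: (@is_CkS_intro k U _ (fun i x => (f x)^-1 * partial i f x)) => //.
- move=> i x Ux; apply: (is_derive_comp1 _ (is_Ck_derivable i cf Ux)).
 by apply: is_derive1_ln; exact: f0.
- move=> i; apply: is_Ck_mul => //; last exact: is_Ck_partial.
 apply: is_Ck_inv => // [x Ux|]; first by rewrite gt_eqF// f0.
 exact: is_CkW.
Qed.

Lemma is_Ck_expR k U f : open U -> is_Ck k U f -> is_Ck k U (fun x => expR (f x)).
Proof.
move=> oU; elim: k => [|k ih] cf.
 by split => // x Ux; apply: cont_comp; [exact: continuous_expR|exact: is_Ck_cont cf Ux].
apply: (@is_CkS_intro k U _ (fun i x => expR (f x) * partial i f x)) => //.
- by move=> x Ux; apply: cont_comp; [exact: continuous_expR|exact: is_Ck_cont cf Ux].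
- by move=> i x Ux; apply: (is_derive_comp1 _ (is_Ck_derivable i cf Ux)); exact: is_derive_expR.
- move=> i; apply: is_Ck_mul => //; last exact: is_Ck_partial.
 by apply: ih; exact: is_CkW.
Qed.

Lemma continuous_row (T : topologicalType) (tau : T -> E) (x : T) :
 (forall j, cts (fun y => tau y 0 j) x) -> cts tau x.
Proof.
move=> ct; apply/cvgrPdist_le => e e0.
have H j : \forall y \near x, `|tau x 0 j-tau y 0 j| <= e.
 by have /cvgrPdist_le:=ct j; apply.
have:=@filter_forall T 'I_n (fun j y => `|tau x 0 j-tau y 0 j| <= e) (nbhs x) (nbhs_filter x) H.
apply: filterS => y hy; apply: norm_row_bound => [|j]; first exact: ltW.
by rewrite !mxE.
Qed.

Lemma is_Ck_comp k U V f (tau : E -> E) : open U -> open V ->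
 (forall x, U x -> V (tau x)) -> (forall j, is_Ck k U (fun x => tau x 0 j)) ->
 is_Ck k V f -> is_Ck k U (fun x => f (tau x)).
Proof.
move=> oU oV UV; elim: k f => [|k ih] f ct cf.
 split => // x Ux; apply: (@continuous_comp _ _ _ tau f).
  by apply: continuous_row => j; exact: is_Ck_cont (ct j) Ux.
 exact: is_Ck_cont cf (UV x Ux).
apply: (@is_CkS_intro k U _ (fun i x => \sum_j partial i (fun y => tau y 0 j) x * partial j f (tau x))) => //.
- move=> x Ux; apply: (@continuous_comp _ _ _ tau f).
  by apply: continuous_row => j; exact: is_Ck_cont (ct j) Ux.
 exact: is_Ck_cont cf (UV x Ux).
- move=> i x Ux.
 pose w : E:=\row_j partial i (fun y => tau y 0 j) x.
 have -> : \sum_j partial i (fun y => tau y 0 j) x * partial j f (tau x) =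
      \sum_j w 0 j * partial j f (tau x).
  by apply: eq_bigr => j _; rewrite mxE.
 apply: is_derive_chain; last by move=> j; rewrite mxE; exact: is_Ck_derivable (ct j) Ux.
 apply: (is_Ck_C1at oV) (UV x Ux).
 exact: is_Ck_le cf.
- move=> i; apply: is_Ck_sum => // j; apply: is_Ck_mul => //; first exact: is_Ck_partial.
 by apply: ih => [l|]; [exact: is_CkW|exact: is_Ck_partial].
Qed.

Lemma is_Ck_schwarz U f x (i j : 'I_n) : open U -> is_Ck 2 U f -> U x ->
 partial i (partial j f) x = partial j (partial i f) x.
Proof.
move=> oU cf Ux; apply: schwarz => [|k l].
 apply: filterS (open_nbhs_nbhs (conj oU Ux)) => y Uy k l.
 have [d1 _]:=is_Ck_derivable k cf Uy.
 by have [d2 _]:=is_Ck_derivable l (is_Ck_partial k cf) Uy.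
exact: is_Ck_cont (is_Ck_partial l (is_Ck_partial k cf)) Ux.
Qed.

End Ck.

(** * Integration on R^4 and the divergence theorem *)

Section Integral.
Context {R : realType}.
Local Notation E:='rV[R]_4.
Implicit Types (f g : E -> R) (A D : set E) (r c : R).

Definition cube r : set E:=[set x | `|x| <= r].

(** The norm is the sup norm of row vectors, so the support lies in a compact cube; such functions
    are bounded, uniformly continuous and integrable. *)
Definition Cc f:=(forall x, cts f x) /\
 exists r, forall x, r < `|x| -> f x = 0.

Definition itg f:=vol.-integrable [set: @E4 R] (EFin \o (f : E4 -> R)).

Definition Int f : R:=Rintegral vol [set: @E4 R] (f : E4 -> R).

Definition mble f:=measurable_fun [set: @E4 R] (f : E4 -> R).

Lemma cubeE r : 0<=r -> cube r = [set x : E | forall i : 'I_4, `|x 0 i| <= r].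
Proof.
move=> r0; apply/seteqP; split => x /=; last exact: norm_row_bound.
by move=> xr i; apply: le_trans xr; exact: norm_row_le.
Qed.

Lemma cube_coord r x : cube r x -> forall i, `|x 0 i| <= r.
Proof. by move=> xr i; apply: le_trans xr; exact: norm_row_le. Qed.

Lemma closed_cube r : closed (cube r).
Proof. by apply: closed_preimage_le => x; exact: norm_continuous. Qed.

Lemma measurable_cube r : measurable (cube r : set E4).
Proof. by apply: closed_measurableE4; exact: closed_cube. Qed.

Lemma vol_cube_fin r : vol (cube r) \is a fin_num.
Proof. by apply: (bounded_vol_fin (r:=r)) (@cube_coord r); exact: measurable_cube. Qed.

Lemma compact_cube r : compact (cube r).
Proof.
apply: bounded_closed_compact; last exact: closed_cube.
by exists r; split; [exact: num_real|move=> M rM x /= xr; rewrite (le_trans xr)// ltW].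
Qed.

Lemma Cc_bounded f : Cc f -> exists2 K : R, 0<=K & forall x, `|f x| <= K.
Proof.
move=> [cf [r fr]].
have cK : compact (f @` cube r).
 apply: continuous_compact (@compact_cube r); apply: continuous_subspaceT => x; exact: cf.
have [M HM] : exists M : R, forall y, (f @` cube r) y -> `|y| <= M.
 have [M0 [_ h]]:=compact_bounded cK; exists (M0+1) => y; apply: h; lra.
exists (Num.max M 0); first by rewrite le_max lexx orbT.
move=> x; have [xr|xr]:=leP `|x| r; last by rewrite fr// normr0 le_max lexx orbT.
by rewrite le_max HM//; exists x.
Qed.

Lemma Cc_uniform f : Cc f -> forall e, 0<e -> exists2 d : R, 0<d &
 forall x h, `|h| < d -> `|f (x+h)-f x| <= e.
Proof.
move=> [cf [r fr]] e e0.
have /compact_near_coveringP cov:=@compact_cube (r+1).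
pose P (h x : E):=`|f (x+h)-f x| <= e.
have H : \forall h \near nbhs (0 : E), cube (r+1) `<=` P h.
 apply: (cov E (nbhs (0 : E)) P _) => x _.
 have e2 : 0<e/2 by lra.
 have /cvgrPdist_le/(_ _ e2)/nbhs_ballP[d /= d0 hd]:=cf x.
 have d2 : 0<d/2 by lra.
 exists (ball x (d/2), ball (0 : E) (d/2)) => /=.
  by split; exact: nbhsx_ballx.
 move=> [y h] [/= yx h0]; rewrite /P.
 move: yx h0; rewrite -!ball_normE /= sub0r normrN => yx h0.
 have b1 : `|f x-f y| <= e/2 by apply: hd; rewrite -ball_normE /=; lra.
 have b2 : `|f x-f (y+h)| <= e/2.
  apply: hd; rewrite -ball_normE /= opprD addrA.
  by apply: le_lt_trans (ler_normB _ _) _; lra.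
 by move: b1 b2; rewrite !ler_norml => /andP[? ?] /andP[? ?]; apply/andP; split; lra.
move/nbhs_ballP : H => [d /= d0 hd].
exists (Num.min d 1); first by rewrite lt_min d0 ltr01.
move=> x h; rewrite lt_min => /andP[hd' h1].
have [xr|xr]:=leP `|x| (r+1).
 by apply: (hd h) => //; rewrite -ball_normE /= sub0r normrN.
have xhr : r < `|x+h|.
 have:=ler_normB (x+h) h; rewrite addrK => hh; lra.
by rewrite !fr ?subrr ?normr0; lra.
Qed.

Lemma continuous_mble f : (forall x, cts f x) -> mble f.
Proof. by move=> cf; apply: open_continuous_measurableE4 => //; exact: openT. Qed.

Lemma measurable_indicM A f : open A -> (forall x, A x -> cts f x) ->
 mble (fun x => \1_A x*f x).
Proof.
move=> oA cf; have mA : measurable (A : set E4) by exact: open_measurableE4.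
have h:=open_continuous_measurableE4 oA cf.
have [H _]:=measurable_restrictT (f : E4 -> measurableTypeR R) mA.
rewrite /mble (_ : (fun x => _) = (f : E4 -> R) \_ A).
 by apply: H.
by apply/funext => x; rewrite /patch indicE; case: (x \in _); rewrite ?mul1r ?mul0r.
Qed.

Lemma itg_bounded f r c : mble f -> (forall x, `|f x| <= c) -> (forall x, r < `|x| -> f x = 0) -> itg f.
Proof.
move=> mf fc fr; have c0 : 0<=c by apply: le_trans (fc 0).
have h1 : vol.-integrable [set: @E4 R] (fun x => (c%:E*(\1_(cube r : set E4) x)%:E)%E).
 apply: integrableZl => //.
 apply/integrableP; split; first by apply/measurable_EFinP/measurable_indic; exact: measurable_cube.
 rewrite (eq_integral (fun x => (\1_(cube r : set E4) x)%:E)); last first.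
  by move=> x _; rewrite gee0_abs// lee_fin.
 by rewrite integral_indic//= ?setIT; [have:=vol_cube_fin r; rewrite ge0_fin_numE|exact: measurable_cube].
apply: le_integrable h1 => //; first exact/measurable_EFinP.
move=> x _; rewrite -EFinM/= lee_fin (ger0_norm (mulr_ge0 c0 _))//.
have [xr|xr]:=leP `|x| r; last by rewrite fr// normr0 mulr_ge0.
by rewrite indicE mem_set ?mulr1.
Qed.

Lemma itg_Cc f : Cc f -> itg f.
Proof.
move=> cf; have [K K0 fK]:=Cc_bounded cf; have [c1 [r fr]]:=cf.
by apply: (itg_bounded (r:=r) (c:=K)) => //; exact: continuous_mble.
Qed.

Lemma itg_eq f g : (forall x, f x = g x) -> itg f -> itg g.
Proof. by move=> /funext ->. Qed.

Lemma itg_mble f : itg f -> mble f.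
Proof. by move=> /integrableP[/measurable_EFinP]. Qed.

Lemma itg_dom f g : mble f -> (forall x, `|f x| <= g x) -> itg g -> itg f.
Proof.
move=> mf fg; apply: le_integrable => //; first exact/measurable_EFinP.
by move=> x _; rewrite /= lee_fin (le_trans (fg x))// ler_norm.
Qed.

Lemma itg_add f g : itg f -> itg g -> itg (fun x => f x+g x).
Proof. by move=> hf hg; exact: (integrableD measurableT hf hg). Qed.

Lemma itg_scale c f : itg f -> itg (fun x => c*f x).
Proof. by move=> hf; exact: (integrableZl measurableT c hf). Qed.

Lemma itg_sub f g : itg f -> itg g -> itg (fun x => f x-g x).
Proof. by move=> hf hg; exact: (integrableB measurableT hf hg). Qed.

Lemma itg0 : itg (fun=> 0).
Proof. by apply: itg_Cc; split; [move=> x; exact: cont_cst|exists 0]. Qed.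

Lemma itg_sum (I : Type) (s : seq I) (P : pred I) (F : I -> E -> R) :
 (forall i, itg (F i)) -> itg (fun x => \sum_(i <- s | P i) F i x).
Proof.
move=> h; elim: s => [|i s ih]; first by apply: (itg_eq _ itg0) => x; rewrite big_nil.
case Pi: (P i); last by apply: (itg_eq _ ih) => x; rewrite big_cons Pi.
by apply: (itg_eq _ (itg_add (h i) ih)) => x; rewrite big_cons Pi.
Qed.

Lemma Int_eq f g : (forall x, f x = g x) -> Int f = Int g.
Proof. by move=> /funext ->. Qed.

Lemma Int_add f g : itg f -> itg g -> Int (fun x => f x+g x) = Int f+Int g.
Proof. by move=> hf hg; apply: RintegralD. Qed.

Lemma Int_sub f g : itg f -> itg g -> Int (fun x => f x-g x) = Int f-Int g.
Proof. by move=> hf hg; apply: RintegralB. Qed.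

Lemma Int_scale c f : itg f -> Int (fun x => c*f x) = c*Int f.
Proof. by move=> hf; apply: RintegralZl. Qed.

Lemma Int0 : Int (fun=> 0) = 0.
Proof.
have e0 : Int (fun x : E => 0*0) = 0 by rewrite (Int_scale 0 itg0) mul0r.
by rewrite -[RHS]e0; apply: Int_eq => x; rewrite mul0r.
Qed.

Lemma Int_sum (I : Type) (s : seq I) (P : pred I) (F : I -> E -> R) :
 (forall i, itg (F i)) -> Int (fun x => \sum_(i <- s | P i) F i x) = \sum_(i <- s | P i) Int (F i).
Proof.
move=> h; elim: s => [|i s ih].
 by rewrite big_nil; rewrite -[RHS]Int0; apply: Int_eq => x; rewrite big_nil.
rewrite big_cons; case Pi: (P i); last by rewrite -ih; apply: Int_eq => x; rewrite big_cons Pi.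
by rewrite -ih -Int_add//; [apply: Int_eq => x; rewrite big_cons Pi|exact: itg_sum].
Qed.

Lemma Int_le f g : itg f -> itg g -> (forall x, f x<=g x) -> Int f<=Int g.
Proof. by move=> hf hg fg; apply: le_Rintegral. Qed.

Lemma Int_ge0 f : (forall x, 0<=f x) -> 0<=Int f.
Proof. by move=> h; apply: Rintegral_ge0. Qed.

Lemma itg_indic A r : measurable (A : set E4) -> A `<=` cube r -> itg (\1_A).
Proof.
move=> mA Ar; apply: (itg_bounded (r:=r) (c:=1)).
- exact: measurable_indic.
- by move=> x; rewrite ger0_norm// indicE; case: (_ \in _).
- move=> x xr; rewrite indicE memNset// => /Ar; rewrite /cube/= leNgt.
 by lra.
Qed.

Lemma Int_indic A : measurable (A : set E4) -> Int (\1_A) = Vol A.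
Proof.
move=> mA; rewrite /Int /Rintegral; congr fine.
by transitivity (vol (A `&` setT)); [exact: integral_indic|rewrite setIT].
Qed.

Lemma Int_norm_le f r c : mble f -> (forall x, `|f x| <= c) -> (forall x, r < `|x| -> f x = 0) ->
 `|Int f| <= c*Vol (cube r).
Proof.
move=> mf fc fr; have hf:=itg_bounded mf fc fr.
have c0 : 0<=c by apply: le_trans (fc 0).
have mc:=@measurable_cube r.
have h1 : itg (\1_(cube r)) by exact: itg_indic mc (@subset_refl _ _).
have h2:=itg_scale c h1; have h3:=itg_scale (- c) h1.
have fb x : - c * \1_(cube r) x<=f x<=c * \1_(cube r) x.
 have [xr|xr]:=leP `|x| r; last by rewrite fr// indicE memNset ?mulr0 ?lexx// /cube/= leNgt xr.
 by rewrite indicE mem_set// !mulr1 -ler_norml.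
rewrite ler_norml -(Int_indic mc) -mulNr -!Int_scale//.
by apply/andP; split; apply: Int_le => // x; have /andP[]:=fb x.
Qed.

Lemma Int_translate f v : mble f -> itg f -> itg (fun x => f (x+v)) -> Int (fun x => f (x+v)) = Int f.
Proof.
move=> mf hf hfv.
have mt : measurable_fun setT ((fun x : E => x+v) : @E4 R -> @E4 R).
 have h:=@measurability _ _ (@E4 R) (@E4 R) setT (fun x : E => x+v) (@open E).
 apply: h => //.
 move=> _ [U oU <-]; rewrite setTI; apply: open_measurableE4.
 apply: open_comp => // x _.
 exact: (continuousD (@cvg_id _ _) (@cst_continuous _ _ v _)).
rewrite /Int /Rintegral; congr fine.
have:=@integral_pushforward _ _ _ _ R _ mt vol setT (EFin \o (f : E4 -> R)).
rewrite preimage_setT => /(_ _ hfv measurableT) <-; last exact/measurable_EFinP.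
apply: (@eq_measure_integral _ (@E4 R) R setT vol
 (measure_function_pushforward__canonical__measure_function_Measure vol mt)) => A mA _.
transitivity (vol ((fun x : E => 1 *: x+v) @^-1` A)).
 by congr (vol _); apply/seteqP; split => x; rewrite /= scale1r.
by rewrite vol_affine// expr1n invr1 mul1e.
Qed.

End Integral.

Section Divergence.
Context {R : realType}.
Local Notation E:='rV[R]_4.
Local Notation e_ i:=(delta_mx 0 i : E).
Implicit Types (f g eta : E -> R) (r c : R).

Lemma C1at_cont f x : C1at f x -> cts f x.
Proof. by move=> cf; apply: differentiable_continuous; have []:=C1at_diffE 0 cf. Qed.

Lemma C1at_derivable f x i : C1at f x -> is_derive x (e_ i) f (partial i f x).
Proof. by move=> cf; have [d _]:=nbhs_singleton cf i; split. Qed.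

Lemma C1at_partial_cont f x i : C1at f x -> cts (partial i f) x.
Proof. by move=> cf; have []:=nbhs_singleton cf i. Qed.

Lemma near0_partial f (x : E) (i : 'I_4) : (\forall y \near x, f y = 0) -> \forall y \near x, partial i f y = 0.
Proof.
move=> /nbhs_interior; apply: filterS => y fy.
have -> : partial i f y = partial i (fun=> 0) y by apply: near_partial.
by rewrite /partial derive_cst.
Qed.

Lemma Cc_intro f r : (forall x, r < `|x| -> f x = 0) ->
 (forall x, cts f x \/ \forall y \near x, f y = 0) -> Cc f.
Proof.
move=> fr H; split; last by exists r.
move=> x; have [//|f0]:=H x.
apply: (@cont_near_eq _ _ (fun=> 0)); last exact: cont_cst.
by apply: filterS f0 => y ->.
Qed.

Lemma near_far r (x : E) : r < `|x| -> \forall y \near x, r < `|y|.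
Proof.
move=> rx; have op : open [set y : E | r < `|y|] by apply: open_preimage_gt => y; exact: norm_continuous.
exact: open_nbhs_nbhs.
Qed.

Lemma partial_far f r i : (forall x, r < `|x| -> f x = 0) -> forall x, r < `|x| -> partial i f x = 0.
Proof.
move=> fr x rx; have h : \forall y \near x, f y = 0 by apply: filterS (near_far rx) => y; exact: fr.
by have:=near0_partial i h => /nbhs_singleton.
Qed.

Lemma norm_scale_delta (c : R) (i : 'I_4) : 0<=c -> `|c *: e_ i| <= c.
Proof.
move=> c0; rewrite normrZ (ger0_norm c0) ler_piMr//.
by apply: norm_row_bound => // j; rewrite mxE; case: (_ && _); rewrite ?normr1 ?normr0.
Qed.

(** Difference quotients have integral 0 by translation invariance, and they converge uniformly to
    the derivative with supports in one cube. *)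
Lemma Int_partial f i : Cc f -> (forall x, derivable f x (e_ i)) ->
 (forall x, cts (partial i f) x) -> Int (partial i f) = 0.
Proof.
move=> cf df cg; set g:=partial i f.
have [c1 [r fr]]:=cf.
have ccg : Cc g by split => //; exists r; exact: partial_far.
have [c2 [r2 gr]]:=ccg.
have ig:=itg_Cc ccg; have iF:=itg_Cc cf.
suff : `|Int g| <= 0 by rewrite normr_le0 => /eqP.
apply/ler_addgt0Pr => e e0; rewrite add0r.
 set V:=Vol (cube (Num.max r r2+1) : set E).
 have V0 : 0<=V by exact: Vol_ge0.
 have e1 : 0<e/(V+1) by rewrite divr_gt0// ltr_wpDl.
 have [d d0 hd]:=Cc_uniform ccg e1.
 have [h h0 hh] : exists2 h : R, 0<h & h<d /\ h<1.
  exists (Num.min d 1/2); first by rewrite divr_gt0// lt_min d0 ltr01.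
  have m0 : 0<Num.min d 1 by rewrite lt_min d0 ltr01.
  by have /andP[? ?] : (Num.min d 1<=d) && (Num.min d 1<=1); [rewrite !ge_min !lexx orbT|split; lra].
 have [hd' h1]:=hh.
 have cft : Cc (fun x => f (x+h *: e_ i)).
  apply: (@Cc_intro _ (r+1)) => [x xr|x].
   apply: fr; have:=norm_scale_delta i (ltW h0).
   by have:=ler_normB (x+h *: e_ i) (h *: e_ i); rewrite addrK => *; lra.
  left; have ct : cts (fun x : E => x+h *: e_ i) x.
   exact: (continuousD (@cvg_id _ _) (@cst_continuous _ _ _ _)).
  by apply: (@continuous_comp _ _ _ (fun x : E => x+h *: e_ i) f); [exact: ct|exact: c1].
 pose G x:=h^-1*(f (x+h *: e_ i)-f x)-g x.
 have GE x : exists2 c, 0<=c<=h & G x = g (x+c *: e_ i)-g x.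
  have [|c c0h cE]:=@mean_value R (fun t : R => f (x+t *: e_ i)) (fun t => g (x+t *: e_ i)) 0 h (ltW h0).
   by move=> t _; apply: is_derive_line; apply: derivable_is_derive.
  exists c => //; rewrite /G; move: cE; rewrite scale0r addr0 subr0 => ->.
  by rewrite mulrCA mulVf ?mulr1// gt_eqF.
 have Gb x : `|G x| <= e/(V+1).
  have [c /andP[c0 ch] ->]:=GE x; apply: hd.
  by apply: le_lt_trans (norm_scale_delta i c0) _; exact: le_lt_trans hd'.
 have Gr x : Num.max r r2+1 < `|x| -> G x = 0.
  have [c /andP[c0 ch] ->]:=GE x => xr.
  have rr : r2<=Num.max r r2 by rewrite le_max lexx orbT.
  have:=norm_scale_delta i c0; have:=ler_normB (x+c *: e_ i) (c *: e_ i); rewrite addrK => *.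
  by rewrite !gr ?subrr//; lra.
 have ift:=itg_Cc cft.
 have i1:=itg_sub ift iF; have i2:=itg_scale h^-1 i1; have i3:=itg_sub i2 ig.
 have IG : Int G = - Int g.
  rewrite /G Int_sub// Int_scale// Int_sub// Int_translate ?subrr ?mulr0 ?sub0r//.
  exact: continuous_mble.
 rewrite -normrN -IG.
 have : `|Int G| <= e/(V+1)*V by apply: Int_norm_le Gr => //; exact: itg_mble i3.
 move=> /le_trans; apply; rewrite mulrAC ler_pdivrMr ?ltr_wpDl//.
 by rewrite ler_wpM2l ?(ltW e0)// ltW// ltrDl.
Qed.

Lemma C1_cont_mul_partial eta f x i :
 (C1at eta x /\ C1at f x) \/ (\forall y \near x, eta y = 0) ->
 cts (fun y => partial i eta y*f y) x.
Proof.
move=> [[c1 c2]|h]; first by apply: cont_mul; [exact: C1at_partial_cont|exact: C1at_cont].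
apply: (@cont_near_eq _ _ (fun=> 0)); last exact: cont_cst.
by apply: filterS (near0_partial i h) => y ->; rewrite mul0r.
Qed.

(** The alternative in the second hypothesis admits fields that are singular at points near which
    the test function vanishes; there all products are extended by 0. *)
Lemma divergence_thm eta (X : 'I_4 -> E -> R) r :
 (forall x, r < `|x| -> eta x = 0) ->
 (forall x, (C1at eta x /\ forall i, C1at (X i) x) \/ (\forall y \near x, eta y = 0)) ->
 [/\ Cc (fun x => \sum_i partial i eta x*X i x), Cc (fun x => eta x * \sum_i partial i (X i) x) &
  Int (fun x => \sum_i partial i eta x*X i x) = - Int (fun x => eta x * \sum_i partial i (X i) x)].
Proof.
move=> er H.
have ccf i : Cc (fun x => eta x*X i x).
 apply: (@Cc_intro _ r) => [x xr|x]; first by rewrite er ?mul0r.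
 have [[c1 c2]|h]:=H x; [left; apply: cont_mul; [exact: (C1at_cont c1)|exact: (C1at_cont (c2 i))]|right].
 by apply: filterS h => y ->; rewrite mul0r.
have cc1 i : Cc (fun x => partial i eta x*X i x).
 apply: (@Cc_intro _ r) => [x xr|x]; first by rewrite (partial_far i er) ?mul0r.
 left; apply: C1_cont_mul_partial; have [[c1 c2]|h]:=H x; [by left; split; [exact: c1|exact: (c2 i)]|by right].
have cc2 i : Cc (fun x => eta x * partial i (X i) x).
 apply: (@Cc_intro _ r) => [x xr|x]; first by rewrite er ?mul0r.
 have [[c1 c2]|h]:=H x; last right.
  by left; have c3:=@C1at_partial_cont _ x i (c2 i); have c4:=C1at_cont c1; exact: cont_mul c4 c3.
 by apply: filterS h => y ->; rewrite mul0r.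
have dE i x : is_derive x (e_ i) (fun x => eta x*X i x) (partial i eta x*X i x+eta x * partial i (X i) x).
 have [[c1 c2]|h]:=H x.
  have d1:=C1at_derivable i c1; have d2:=C1at_derivable i (c2 i).
  apply: is_derive_eq (is_deriveM d1 d2) _.
  by rewrite addrC /GRing.scale/= (mulrC (X i x)).
 rewrite (nbhs_singleton h) (nbhs_singleton (near0_partial i h)) !mul0r addr0.
 have d0 : is_derive x (e_ i) (fun _ : E => 0 : R) 0 by exact: is_derive_cst.
 apply: near_is_derive d0.
 by apply: filterS h => y ->; rewrite mul0r.
have pE i : (fun x => partial i (fun x => eta x*X i x) x) = (fun x => partial i eta x*X i x+eta x * partial i (X i) x).
 by apply/funext => x; have [_]:=dE i x.
have z i : Int (fun x => partial i eta x*X i x) = - Int (fun x => eta x * partial i (X i) x).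
 apply/eqP; rewrite -addr_eq0 -Int_add; [|exact: itg_Cc|exact: itg_Cc].
 rewrite -pE; apply/eqP; apply: Int_partial; [exact: ccf|by move=> x; have []:=dE i x|move=> x].
 rewrite (_ : partial i (fun x => eta x*X i x) = (fun x => partial i eta x*X i x+eta x * partial i (X i) x)).
  by apply: cont_add; [have [c _]:=cc1 i; exact: c|have [c _]:=cc2 i; exact: c].
 exact: pE.
split.
- apply: (@Cc_intro _ r) => [x xr|x]; first by rewrite big1// => i; rewrite (partial_far i er) ?mul0r.
 by left; apply: cont_sum => i; have [c _]:=cc1 i; exact: c.
- apply: (@Cc_intro _ r) => [x xr|x]; first by rewrite er ?mul0r.
 left; rewrite (_ : (fun x => _) = (fun x => \sum_i eta x * partial i (X i) x)).
  by apply: cont_sum => i; have [c _]:=cc2 i; exact: c.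
 by apply/funext => y; rewrite mulr_sumr.
- rewrite (Int_sum _ _ (fun i => itg_Cc (cc1 i))) (eq_bigr _ (fun i _ => z i)) sumrN -Int_sum.
  by congr (- _); apply: Int_eq => x; rewrite mulr_sumr.
 by move=> i; exact: itg_Cc.
Qed.

End Divergence.

(** * The isoperimetric inequality *)

Section EuclideanNorm.
Context {R : realType} {n : nat}.
Local Notation E:='rV[R]_n.
Implicit Types (u v : E).

Lemma dot_ge0 u : 0<=dot u u.
Proof. by apply: sumr_ge0 => i _; rewrite -expr2 sqr_ge0. Qed.

Lemma dotC u v : dot u v = dot v u.
Proof. by apply: eq_bigr => i _; rewrite mulrC. Qed.

Lemma enorm_ge0 u : 0<=enorm u.
Proof. exact: sqrtr_ge0. Qed.

Lemma enorm_sqr u : enorm u^+2 = dot u u.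
Proof. by rewrite sqr_sqrtr// dot_ge0. Qed.

Lemma dot_eq0 u : dot u u = 0 -> u = 0.
Proof.
move=> /eqP; rewrite psumr_eq0; last by move=> i _; rewrite -expr2 sqr_ge0.
move=> /allP h; apply/rowP => i; rewrite mxE.
by have:=h i (mem_index_enum i); rewrite implyTb mulf_eq0 orbb => /eqP.
Qed.

Lemma cauchy_schwarz_sqr u v : dot u v^+2<=dot u u*dot v v.
Proof.
have [v0|v0]:=eqVneq (dot v v) 0.
 rewrite v0 mulr0 (dot_eq0 v0) (_ : dot u 0 = 0) ?expr0n//.
 by apply: big1 => i _; rewrite mxE mulr0.
have vp : 0<dot v v by rewrite lt_neqAle eq_sym v0 dot_ge0.
have : 0<=dot v v*(dot u u*dot v v-dot u v^+2).
 have -> : dot v v*(dot u u*dot v v-dot u v^+2) = dot (dot v v *: u-dot u v *: v) (dot v v *: u-dot u v *: v).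
  have e a b : dot (a *: u-b *: v) (a *: u-b *: v) = a^+2*dot u u-2*a*b*dot u v+b^+2*dot v v.
   rewrite /dot !mulr_sumr -sumrB -big_split /=; apply: eq_bigr => i _; rewrite !mxE; ring.
  by rewrite e; ring.
 exact: dot_ge0.
by nra.
Qed.

Lemma cauchy_schwarz u v : dot u v<=enorm u*enorm v.
Proof.
apply: le_trans (ler_norm _) _.
rewrite -(ler_pXn2r (_ : 0<2)%N)// ?nnegrE ?mulr_ge0 ?enorm_ge0//.
by rewrite exprMn !enorm_sqr real_normK ?num_real// cauchy_schwarz_sqr.
Qed.

End EuclideanNorm.

Section Isoperimetric.
Context {R : realType}.
Local Notation E:='rV[R]_4.
Local Notation e_ i:=(delta_mx 0 i : E).
Local Notation mu:=(@lebesgue_measure R).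

Definition grad (f : E -> R) (x : E) : E:=\row_i partial i f x.

Lemma layer_cake_vol (f : E -> R) : mble f -> (forall x, 0<=f x) ->
 (\int[vol]_x (f x)%:E = \int[mu]_(s in `]0%R, +oo[) vol [set x | (s<f x)%R])%E.
Proof.
move=> mf f0.
have mg : measurable_fun setT (fun t => f (rv4 t)):=measurableT_comp mf (@measurable_rv4 R).
have:=layer_cake (@lam4 R) mg (fun x => f0 _) => <-.
have:=@ge0_integral_pushforward _ _ _ _ R _ (@measurable_rv4 R) (@lam4 R) setT (EFin \o (f : E4 -> R)) measurableT.
rewrite preimage_setT; apply; first exact/measurable_EFinP.
by move=> x _; rewrite /= lee_fin.
Qed.

Lemma measurable_distribution_vol (f : E -> R) D : mble f ->
 measurable_fun (D : set (measurableTypeR R)) (fun s : measurableTypeR R => vol ([set x | (s<f x)%R] : set (@E4 R))).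
Proof.
move=> mf.
have mg : measurable_fun setT (fun t => f (rv4 t)):=measurableT_comp mf (@measurable_rv4 R).
exact: measurable_distribution mg.
Qed.

Lemma measurable_superlevelE (f : E -> R) k : mble f -> measurable ([set x | k<f x] : set E4).
Proof. exact: measurable_superlevel. Qed.

Lemma Int_EFin (f : E -> R) : itg f -> (Int f)%:E = (\int[vol]_x (f x)%:E)%E.
Proof. by move=> hf; rewrite /Int /Rintegral fineK//; exact: integrable_fin_num. Qed.

(** A gain [c] in the volume of the superlevel set at each level in []0, H[] integrates to [c*H]. *)
Lemma Int_layer_cake_le (f g : E -> R) (c H : R) : 0<=c -> 0<H -> itg f -> itg g ->
 (forall x, 0<=f x) -> (forall x, 0<=g x) ->
 (forall s, 0<s -> ((vol [set x | (s<f x)%R])+((if (s<H)%R then c else 0)%:E)<=vol [set x | (s<g x)%R])%E) ->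
 Int f+c*H<=Int g.
Proof.
move=> c0 H0 hf hg f0 g0 le; rewrite -lee_fin EFinD !Int_EFin//.
have mf:=itg_mble hf; have mg:=itg_mble hg.
rewrite !layer_cake_vol//.
have mI : measurable (`]0, +oo[%classic : set (measurableTypeR R)) by [].
have mJ : measurable (`]0, H[%classic : set (measurableTypeR R)) by [].
have -> : ((c*H)%:E = \int[mu]_(s in `]0%R, +oo[) (c * \1_(`]0%R, H[%classic : set R) s)%:E)%E.
 rewrite (@integralZl_indic _ _ _ mu _ mI (fun=> `]0, H[%classic) c)//; last by move=> h; move: c0; rewrite leNgt h.
 rewrite integral_indic// (_ : _ `&` _ = `]0, H[%classic); last first.
  apply/seteqP; split => s /=; rewrite !in_itv/= andbT; first by case.
  by lra.
 have muH : mu (`]0, H[%classic : set R) = H%:E by rewrite lebesgue_measure_itv/= lte_fin H0 -EFinB subr0.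
 by rewrite EFinM -muH.
rewrite -ge0_integralD//=; first last.
- by apply/measurable_EFinP; apply: measurable_funM => //; exact: measurable_indic.
- by move=> s _; rewrite lee_fin mulr_ge0.
- exact: measurable_distribution_vol.
- by move=> s _; exact: (measure_ge0 vol).
apply: ge0_le_integral => //=.
- move=> s _; apply: adde_ge0; first exact: (measure_ge0 vol).
 by rewrite lee_fin mulr_ge0.
- apply: emeasurable_funD; first exact: measurable_distribution_vol.
 by apply/measurable_EFinP; apply: measurable_funM => //; exact: measurable_indic.
- exact: measurable_distribution_vol.
- move=> s; rewrite in_itv/= andbT => s0; apply: le_trans (le s s0).
 rewrite leeD2l// lee_fin indicE mem_setE in_itv/= s0 /=; case: (s<H); rewrite ?mulr1 ?mulr0 //.
Qed.

Lemma C1at_grad_cont (f : E -> R) x : C1at f x -> cts (fun x => enorm (grad f x)) x.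
Proof.
move=> cf; rewrite (_ : (fun x => _) = (fun x => Num.sqrt (\sum_i (partial i f x)^+2))).
 apply: cont_comp; first exact: sqrt_continuous.
 by apply: cont_sum => i; apply: cont_exp; exact: C1at_partial_cont.
apply/funext => y; rewrite /enorm /dot; congr Num.sqrt.
by apply: eq_bigr => i _; rewrite !mxE expr2.
Qed.

(** A functional form that avoids perimeters. To first order [psi (x+y) >= psi x - e |grad psi|] for
    [|y| < e], so the superlevel set of [psi + e(|grad psi| + eta)] at a positive level contains the
    [e]-neighbourhood of that of [psi]. Brunn-Minkowski gives a gain at each level below [H];
    integrating over the levels and dividing by [e] gives the claim up to [eta]. *)
Lemma isoperimetric (psi : E -> R) (r H : R) : (forall x, 0<=psi x) ->
 (forall x, r < `|x| -> psi x = 0) -> (forall x, C1at psi x) -> 0<H ->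
 4*H*(Vol [set x | H<=psi x] `^ (3/4)*omega `^ 4^-1)<=Int (fun x => enorm (grad psi x)).
Proof.
move=> p0 pr cp H0.
have cc : Cc psi by split; [move=> x; exact: C1at_cont|exists r].
have ccg : Cc (fun x => enorm (grad psi x)).
 apply: (@Cc_intro _ _ r) => [x xr|x]; last by left; exact: C1at_grad_cont.
 have -> : grad psi x = 0 by apply/rowP => i; rewrite !mxE (partial_far i pr).
 by rewrite /enorm /dot big1 ?sqrtr0// => i; rewrite mxE mul0r.
have mB : measurable ([set x | H<=psi x] : set (@E4 R)).
 rewrite (_ : [set _ | _] = ~` [set x | psi x<H]).
  apply: measurableC; apply: open_measurableE4; apply: open_preimage_lt => x; exact: C1at_cont.
 by apply/seteqP; split => x /=; rewrite leNgt => /negP.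
set c:=_ `^ _*_ `^ _; have c0 : 0<=c by rewrite mulr_ge0 ?powR_ge0.
set V:=Vol (cube (r+1) : set E).
have V0 : 0<=V by exact: Vol_ge0.
apply/ler_addgt0Pr => eta0 eta0p.
have [eta eta_p etaV] : exists2 eta : R, 0<eta & eta*V<=eta0.
 exists (eta0/(V+1)); first by rewrite divr_gt0// ltr_wpDl.
 by rewrite mulrAC ler_pdivrMr ?ltr_wpDl// ler_wpM2l ?(ltW eta0p)// lerDl.
have [d d0 hd]:=Cc_uniform ccg eta_p.
pose e:=Num.min d 1/2.
have m0 : 0<Num.min d 1 by rewrite lt_min d0 ltr01.
have e0 : 0<e by pos.
have [ed e1] : e<d /\ e<1.
 by have /andP[? ?] : (Num.min d 1<=d) && (Num.min d 1<=1); [rewrite !ge_min !lexx orbT|split; rewrite /e; lra].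
clearbody e.
have icube : itg (\1_(cube (r+1))) by apply: itg_indic (@measurable_cube R _) (@subset_refl _ _).
(* The constant [eta] pays for the oscillation of the gradient over distance [e]; the indicator
   keeps this term integrable. *)
pose Psi x:=psi x+e*(enorm (grad psi x)+eta * \1_(cube (r+1)) x).
have i1:=itg_Cc ccg; have i2:=itg_scale eta icube; have i3:=itg_add i1 i2; have i4:=itg_scale e i3.
have ip:=itg_Cc cc; have iP : itg Psi by apply: itg_add.
have P0 x : 0<=Psi x.
 by rewrite addr_ge0// mulr_ge0 ?(ltW e0)// addr_ge0 ?enorm_ge0// mulr_ge0// ltW.
have step s x y : 0<s -> s<psi x -> ball4 e y -> s<Psi (x+y).
 move=> s0 sx ye.
 have ye' (c' : R) : 0<=c'<=1 -> `|c' *: y| <= e.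
  move=> /andP[c'0 c'1]; rewrite normrZ (ger0_norm c'0).
  have yb : `|y| <= e by apply: norm_row_bound (ltW e0) (ball4_bounded (ltW e0) ye).
  by rewrite -(mul1r e) ler_pM.
 have xr : `|x| <= r by rewrite leNgt; apply/negP => /pr h; move: sx; rewrite h ltNge ltW.
 have xyc : cube (r+1) (x+y).
  rewrite /cube/=; have:=ye' 1; rewrite scale1r => h; apply: le_trans (ler_normD _ _) _.
  have hy : `|y| <= e by apply: h; rewrite ler01 lexx.
  by apply: lerD => //; apply: le_trans hy _; exact: ltW.
 rewrite /Psi indicE mem_set// mulr1.
 pose g t:=psi (x+t *: y).
 have [|t /andP[t0 t1] tE]:=@mean_value R g (fun t => \sum_i y 0 i * partial i psi (x+t *: y)) 0 1 ler01.
  by move=> t _; apply: is_derive_line; exact: C1at_is_derive.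
 move: tE; rewrite /g scale1r scale0r addr0 subr0 mulr1 => tE.
 have b1 : - (\sum_i y 0 i * partial i psi (x+t *: y))<=e*(enorm (grad psi (x+y))+eta).
  have -> : - (\sum_i y 0 i * partial i psi (x+t *: y)) = dot (- y) (grad psi (x+t *: y)).
   by rewrite -sumrN; apply: eq_bigr => i _; rewrite !mxE mulNr.
  apply: le_trans (cauchy_schwarz _ _) _; apply: ler_pM; rewrite ?enorm_ge0//.
   rewrite /enorm -(ger0_norm (ltW e0)) -sqrtr_sqr ler_wsqrtr//.
   rewrite (_ : dot _ _ = dot y y); first exact: ltW.
   by apply: eq_bigr => i _; rewrite !mxE mulrNN.
  have hh : `|(t-1) *: y| < d.
   rewrite -normrN -scaleNr opprB; apply: le_lt_trans ed; apply: ye'.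
   by apply/andP; split; lra.
  have:=hd (x+y) ((t-1) *: y) hh.
  have -> : x+y+(t-1) *: y = x+t *: y by rewrite scalerBl scale1r addrA addrAC addrK.
  rewrite ler_norml => /andP[_]; rewrite lerBlDl.
  by [].

 move: sx tE b1; set A:=psi x; set B:=psi (x+y); set C:=\sum_i _; set D:=e*_.
 clearbody A B C D; move=> *; lra.
have Pr x : r+1 < `|x| -> Psi x = 0.
 move=> xr; have xr' : r < `|x| by lra.
 rewrite /Psi pr// indicE memNset; last by rewrite /cube/= leNgt xr.
 have -> : grad psi x = 0 by apply/rowP => i; rewrite !mxE (partial_far i pr).
 rewrite /enorm /dot big1 ?sqrtr0; last by move=> i _; rewrite mxE mul0r.
 have -> : (false%:R : R) = 0 by [].
 by ring.
have ec0 : 0<=4*e*c:=mulr_ge0 (mulr_ge0 (ler0n _ _) (ltW e0)) c0.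
have main : Int psi+(4*e*c)*H<=Int Psi.
 apply: Int_layer_cake_le => //.
 move=> s s0.
 have mA:=measurable_superlevelE s (itg_mble ip).
 have mC:=measurable_superlevelE s (itg_mble iP).
 have bA x : s<psi x -> forall i, `|x 0 i| <= r+1.
  move=> sx; apply: cube_coord; rewrite /cube/=; have : `|x| <= r.
   by rewrite leNgt; apply/negP => /pr h; move: sx; rewrite h ltNge ltW.
  by move=> h; lra.
 have bC x : s<Psi x -> forall i, `|x 0 i| <= r+1.
  move=> sx; apply: cube_coord; rewrite /cube/= leNgt; apply/negP => /Pr h.
  by move: sx; rewrite h ltNge ltW.
 have bm:=brunn_minkowski_ball e0 mA mC bA bC (fun x y ax by_ => step s x y s0 ax by_).
 have fA:=bounded_vol_fin mA bA; have fC:=bounded_vol_fin mC bC.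
 rewrite -(fineK fA) -(fineK fC) -EFinD lee_fin; apply: le_trans bm.
 rewrite lerD2l; case: ifPn => sH; last first.
  by apply: mulr_ge0; [exact: (mulr_ge0 (ler0n _ _) (ltW e0))|exact: mulr_ge0 (powR_ge0 _ _) (powR_ge0 _ _)].
 apply: ler_wpM2l; first exact: (mulr_ge0 (ler0n _ _) (ltW e0)).
 apply: ler_wpM2r; first exact: powR_ge0.
 have VV : Vol [set x | H<=psi x]<=Vol [set x | s<psi x].
  by apply: (Vol_le mB mA bA) => x /=; apply: lt_le_trans.
 apply: (ge0_ler_powR _ _ _ VV); rewrite ?nnegrE; [exact: divr_ge0|exact: Vol_ge0|exact: Vol_ge0].
move: main; rewrite /Psi Int_add// Int_scale// Int_add// Int_scale// Int_indic; last exact: measurable_cube.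
rewrite lerD2l -/V => main.
rewrite -(ler_pM2l e0); apply: le_trans (le_trans _ main) _.
 by lra.
by rewrite ler_wpM2l ?(ltW e0)// lerD2l.
Qed.

Lemma omega_gt0 : 0<(@omega R).
Proof.
rewrite lt_neqAle omega_ge0 andbT eq_sym; apply/negP => /eqP om0.
pose I : set (measurableTypeR R):=`[- (1/4), 1/4]%classic.
have mI : measurable I by exact: measurable_itv.
have muI : mu I = (2^-1)%:E.
 by rewrite lebesgue_measure_itv/= lte_fin ifT; [rewrite -EFinB; congr _%:E; lra|lra].
pose Q : set E:=[set x | forall i : 'I_4, `|x 0 i| <= 1/4].
have QE : rv4 @^-1` Q = (I `*` I) `*` I `*` I.
 apply/seteqP; split => [t /= h|[[[a b] c] d] /= [[[]]]].
  have:=h 0; have:=h 1; have:=h 2; have:=h 3.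
  by rewrite !mxE /I /= !in_itv !ler_norml => -> -> -> ->.
 rewrite /I/= !in_itv /= -!ler_norml => ha hb hc hd.
 by move=> -[[|[|[|[|//]]]] Hi]; rewrite !mxE /=.
have mI2 : measurable (I `*` I) by exact: measurableX.
have mI3 : measurable ((I `*` I) `*` I) by exact: measurableX.
have e2 : lam2 (I `*` I) = (mu I * mu I)%E:=prodmeasE mu mu mI mI.
have e3 : lam3 (I `*` I `*` I) = (_ * mu I)%E:=prodmeasE lam2 mu mI2 mI.
have e4 : lam4 (I `*` I `*` I `*` I) = (_ * mu I)%E:=prodmeasE lam3 mu mI3 mI.
have VQ : Vol Q = 2^-1^+4.
 by rewrite /Vol volE QE e4 e3 e2 muI !exprS mulr1 !mulrA.
have mQ : measurable (Q : set E4).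
 rewrite (_ : Q = cube (1/4)); first exact: measurable_cube.
 by rewrite cubeE.
have : Vol Q<=omega.
 apply: (Vol_le mQ (measurable_ball4 1) (r:=1)) => [x|x Qx].
  exact: ball4_bounded.
 rewrite /ball4/= expr1n; apply: (@le_lt_trans _ _ (\sum_(i<4) (1/16))).
  apply: ler_sum => i _; rewrite -expr2 -real_normK ?num_real//.
  have -> : 1/16 = (1/4 : R)^+2 by lra.
  by rewrite ler_pXn2r ?nnegrE//.
 by rewrite sumr_const card_ord; lra.
by lra.
Qed.

End Isoperimetric.

(** * Limits of integrals *)

Section Convergence.
Context {R : realType}.
Local Notation E:='rV[R]_4.
Implicit Types (f g : E -> R).

Lemma cvg_harmonic (u : nat -> R) (l C : R) (k0 : nat) : 0<=C ->
 (forall k, (k0<=k)%N -> `|u k-l| <= C/k.+1%:R) -> u k @[k --> \oo] --> l.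
Proof.
move=> C0 H; apply/cvgrPdist_le => e e0.
exists (maxn k0 (Num.trunc (C/e)).+1) => // k /=; rewrite geq_max => /andP[k1 k2].
rewrite distrC; apply: le_trans (H k k1) _.
rewrite ler_pdivrMr ?ltr0n// mulrC -ler_pdivrMr//.
apply: le_trans (ltW (truncnS_gt (C/e))) _.
by rewrite ler_nat; apply: leq_trans k2 _.
Qed.

Lemma cvg_addl (u : nat -> R) (l : R) (k0 : nat) : u k @[k --> \oo] --> l -> u (k0+k)%N @[k --> \oo] --> l.
Proof.
move=> /cvgrPdist_le H; apply/cvgrPdist_le => e e0; have [N _ hN]:=H e e0.
by exists N => // k /= Nk; apply: hN => /=; exact: leq_trans Nk (leq_addl _ _).
Qed.

Lemma near_all (P : E -> Prop) (x : E) : (forall y, P y) -> \forall y \near x, P y.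
Proof. by move=> h; apply: filterS (open_nbhs_nbhs (conj openT I)). Qed.

Lemma EFin_cvg (u : nat -> R) (l : R) : (u k)%:E @[k --> \oo] --> l%:E -> u k @[k --> \oo] --> l.
Proof. by move=> /fine_cvg. Qed.

Lemma Int_dominated (f_ : nat -> E -> R) f g : (forall n, mble (f_ n)) -> itg f -> itg g ->
 (forall x, f_ n x @[n --> \oo] --> f x) -> (forall n x, `|f_ n x| <= g x) ->
 Int (f_ n) @[n --> \oo] --> Int f.
Proof.
move=> mf_ hf hg cf fg; apply: EFin_cvg.
have hfn n : itg (f_ n) by apply: itg_dom hg.
rewrite (_ : (fun k => (Int (f_ k))%:E) = (fun k => \int[vol]_x (f_ k x)%:E)%E); last first.
 by apply/funext => k; rewrite Int_EFin.
rewrite Int_EFin//.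
apply: (@dominated_cvg _ _ _ vol setT measurableT (fun n x => (f_ n x)%:E) (fun x => (f x)%:E) (fun x => (g x)%:E)) => //.
- by move=> n; apply/measurable_EFinP; exact: mf_.
- by move=> x _; apply: cvg_EFin => //; [exact: nearW|exact: cf].
- by move=> n x _; rewrite lee_fin.
Qed.

(** Integrability of the limit is a conclusion, drawn from the convergence of the integrals: this is
    how the total curvature integrals are found to be finite. *)
Lemma Int_monotone (f_ : nat -> E -> R) f (l : R) : (forall n, itg (f_ n)) -> mble f ->
 (forall x, {homo f_^~ x : n m/(n<=m)%N >-> n<=m}) -> (forall n x, f_ n x<=f x) ->
 (forall x, f_ n x @[n --> \oo] --> f x) -> Int (f_ n) @[n --> \oo] --> l ->
 itg f /\ Int f = l.
Proof.
move=> hf mf nd le cf cI.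
have h0:=hf 0%N.
pose g n x : R:=f_ n x-f_ 0%N x.
have hg n : itg (g n) by exact: itg_sub.
have g0 n x : 0<=g n x by rewrite subr_ge0 nd.
have m1 n : measurable_fun setT (fun x : @E4 R => (g n x)%:E) by apply/measurable_EFinP; exact: itg_mble (hg n).
have m2 n (x : @E4 R) : setT x -> (0<=(g n x)%:E)%E by move=> _; rewrite lee_fin.
have m3 (x : @E4 R) : setT x -> {homo (fun n => (g n x)%:E) : n m/(n<=m)%N >-> (n<=m)%E}.
 by move=> _ n m nm; rewrite lee_fin lerB// nd.
have:=@cvg_monotone_convergence _ _ R vol setT measurableT (fun n x => (g n x)%:E) m1 m2 m3.
rewrite (_ : (fun n => \int[vol]_x (g n x)%:E)%E = (fun n => (Int (f_ n)-Int (f_ 0%N))%:E)); last first.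
 by apply/funext => n; rewrite -Int_EFin// /g Int_sub.
rewrite (eq_integral (fun x : @E4 R => (f x-f_ 0%N x)%:E)); last first.
 move=> x _; apply/cvg_lim => //; apply: cvg_EFin; first exact: nearW.
 by apply: cvgB; [exact: cf|exact: cvg_cst].
move=> c1.
have c2 : (Int (f_ n)-Int (f_ 0%N))%:E @[n --> \oo] --> (l-Int (f_ 0%N))%:E.
 by apply: cvg_EFin; [exact: nearW|apply: cvgB => //; exact: cvg_cst].
have e1 : (\int[vol]_x (f x-f_ 0%N x)%:E = (l-Int (f_ 0%N))%:E)%E by exact: cvg_unique c1 c2.
have md : mble (fun x => f x-f_ 0%N x) by apply: measurable_funB => //; exact: itg_mble.
have hd : itg (fun x => f x-f_ 0%N x).
 apply/integrableP; split; first exact/measurable_EFinP.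
 rewrite (eq_integral (fun x : @E4 R => (f x-f_ 0%N x)%:E)); first by rewrite e1 ltry.
 by move=> x _; rewrite gee0_abs// lee_fin subr_ge0.
have hf' : itg f by apply: itg_eq (itg_add hd h0) => x; rewrite subrK.
split => //; have /eqP : (Int (fun x => f x-f_ 0%N x))%:E = (l-Int (f_ 0%N))%:E by rewrite Int_EFin.
by rewrite eqe Int_sub// => /eqP/addIr.
Qed.

Lemma cvg_bigsum (I : finType) (f : I -> nat -> R) (l : I -> R) :
 (forall i, f i k @[k --> \oo] --> l i) ->
 (\sum_i f i k) @[k --> \oo] --> \sum_i l i.
Proof.
move=> h; elim: (index_enum I) => [|i s IH].
 by rewrite big_nil (_ : (fun k => _) = (fun=> 0)); [exact: cvg_cst|apply/funext => k; rewrite big_nil].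
rewrite big_cons (_ : (fun k => _) = (fun k => f i k + \sum_(j <- s) f j k)); first exact: cvgD.
by apply/funext => k; rewrite big_cons.
Qed.

End Convergence.

Lemma ord4P (i : 'I_4) : i = ord0 \/ i = lift ord0 ord0 \/ i = lift ord0 (lift ord0 ord0) \/ i = lift ord0 (lift ord0 (lift ord0 ord0)).
Proof. case: i => -[|[|[|[|//]]]] p; [left|right; left|do 2 right; left|do 3 right]; exact: val_inj. Qed.

(** * Pointwise algebra of the Schouten tensor *)

Section Sigma2Algebra.
Context {R : realType}.
Implicit Types (p w : 'I_4 -> R) (h A : 'I_4 -> 'I_4 -> R).

Definition nrm2 p:=\sum_i p i^+2.
Definition trc h:=\sum_i h i i.
Definition hvec h p i:=\sum_j h i j * p j.
Definition hpp h p:=\sum_i p i*hvec h p i.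
Definition hs2 h:=\sum_i \sum_j h i j^+2.
(** For [h] the Hessian and [p] the gradient of [u], [sig1] and [sig2] are the first two elementary
    symmetric functions, with respect to the flat metric, of the Schouten tensor [schoutenA h p] of
    [e^(2u)|dx|^2]. *)
Definition sig1 h p:=- trc h-nrm2 p.
Definition sig2 h p:=2^-1*(trc h^+2-hs2 h)+2^-1*nrm2 p*trc h+hpp h p.
(** Minus the divergence of [|p|^2 p]. In terms of [A = schoutenA h p] it is
    [3 A(p,p) + tden h p]. *)
Definition fden h p:=- (nrm2 p*trc h+2*hpp h p).
(** For [p] nonzero this is [|p|^2] times the trace of [schoutenA h p] on the hyperplane orthogonal
    to [p]. On a level set with mean curvature [H] it reads [|p|^3 H - (3/2)|p|^4]. *)
Definition tden h p:=hpp h p-nrm2 p*trc h-3/2*nrm2 p^+2.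
Definition schoutenA h p i j:=- h i j+p i * p j-2^-1*nrm2 p*(i == j)%:R.

End Sigma2Algebra.

Ltac sum4:=rewrite ?/hs2 ?/hpp ?/hvec ?/nrm2 ?/trc !(big_ord_recl, big_ord0) /=.

Ltac case4 i:=have [->|[->|[->|->]]]:=ord4P i.

Section Sigma2Identities.
Context {R : realType}.
Implicit Types (p w : 'I_4 -> R) (h A : 'I_4 -> 'I_4 -> R).

Lemma sum_deltar (F : 'I_4 -> R) j : \sum_i F i*(j == i)%:R = F j.
Proof. by case4 j; sum4; ring. Qed.

Lemma sum_deltal (F : 'I_4 -> R) j : \sum_i F i*(i == j)%:R = F j.
Proof. by case4 j; sum4; ring. Qed.

Lemma hs2_expand A p (a b c d : R) : (forall i j, A i j = A j i) ->
 hs2 (fun i j => a*A i j+b*(p i*hvec A p j+hvec A p i * p j)+c*(p i * p j)+d*(i == j)%:R) =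
 a^+2*hs2 A+2*b^+2*(nrm2 p*nrm2 (hvec A p)+hpp A p^+2)+c^+2*nrm2 p^+2+4*d^+2
 + 4*a*b*nrm2 (hvec A p)+2*a*c*hpp A p+2*a*d*trc A
 + 4*b*c*nrm2 p*hpp A p+4*b*d*hpp A p+2*c*d*nrm2 p.
Proof.
move=> sA.
have [w wE] : exists w, w = hvec A p by eexists.
have E1 : \sum_i \sum_j A i j*(p i*w j) = nrm2 w.
 rewrite exchange_big; apply: eq_bigr => j _; rewrite expr2 {3}wE mulr_sumr.
 by apply: eq_bigr => i _; rewrite (sA i j); ring.
have E2 : \sum_i \sum_j A i j*(w i * p j) = nrm2 w.
 apply: eq_bigr => i _; rewrite expr2 {3}wE mulr_sumr.
 by apply: eq_bigr => j _; ring.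
have E3 : \sum_i \sum_j A i j*(p i * p j) = hpp A p.
 apply: eq_bigr => i _; rewrite mulr_sumr.
 by apply: eq_bigr => j _; ring.
have E4 : trc A = \sum_i \sum_j A i j*(i == j)%:R.
 apply: eq_bigr => i _; rewrite (bigD1 i)//= eqxx mulr1 big1 ?addr0// => j ji.
 by rewrite eq_sym (negbTE ji) mulr0.
have E5 : hpp A p = \sum_i p i*w i by rewrite wE.
rewrite -E3 E4 -{1}wE; rewrite E3 E5.
have -> : 4*a*b*nrm2 (hvec A p) = 2*a*b*(\sum_i \sum_j A i j*(p i*w j) + \sum_i \sum_j A i j*(w i * p j)).
 by rewrite E1 E2 -wE; ring.
have -> : 2*a*c*(\sum_i p i*w i) = 2*a*c*(\sum_i \sum_j A i j*(p i * p j)) by rewrite E3 E5.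
clear E1 E2 E3 E4 E5; rewrite -!wE; clear wE.
have -> : hs2 (fun i j => a*A i j+b*(p i*w j+w i * p j)+c*(p i * p j)+d*(i == j)%:R) =
 a^+2*hs2 A+2*a * \sum_i \sum_j A i j*(b*(p i*w j+w i * p j)+c*(p i * p j)+d*(i == j)%:R)
 + hs2 (fun i j => b*(p i*w j+w i * p j)+c*(p i * p j)+d*(i == j)%:R).
 rewrite /hs2 !mulr_sumr -!big_split /=; apply: eq_bigr => i _.
 rewrite !mulr_sumr -!big_split /=; apply: eq_bigr => j _; ring.
have -> : \sum_i \sum_j A i j*(b*(p i*w j+w i * p j)+c*(p i * p j)+d*(i == j)%:R) =
 b*(\sum_i \sum_j A i j*(p i*w j) + \sum_i \sum_j A i j*(w i * p j))+c*(\sum_i \sum_j A i j*(p i * p j))+d * \sum_i \sum_j A i j*(i == j)%:R.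
 rewrite !mulrDr !mulr_sumr -!big_split /=; apply: eq_bigr => i _.
 rewrite !mulr_sumr -!big_split /=; apply: eq_bigr => j _; ring.
have -> : hs2 (fun i j => b*(p i*w j+w i * p j)+c*(p i * p j)+d*(i == j)%:R) =
 2*b^+2*(nrm2 p*nrm2 w+(\sum_i p i*w i)^+2)+c^+2*nrm2 p^+2+4*d^+2
 + 4*b*c*nrm2 p*(\sum_i p i*w i)+4*b*d*(\sum_i p i*w i)+2*c*d*nrm2 p.
 rewrite /hs2 /nrm2 !big_ord_recl !big_ord0 /=.
 by lra.
ring.
Qed.

Lemma nrm2_ge0 p : 0<=nrm2 p.
Proof. by apply: sumr_ge0 => i _; rewrite sqr_ge0. Qed.

Lemma nrm2_eq0 p : nrm2 p = 0 -> forall i, p i = 0.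
Proof.
move=> /eqP; rewrite psumr_eq0; last by move=> i _; rewrite sqr_ge0.
by move=> /allP h i; have:=h i (mem_index_enum i); rewrite implyTb sqrf_eq0 => /eqP.
Qed.

Lemma hs2_ge0 h : 0<=hs2 h.
Proof. by apply: sumr_ge0 => i _; exact: nrm2_ge0. Qed.

Lemma hs2_eq0 h : hs2 h = 0 -> forall i j, h i j = 0.
Proof.
move=> /eqP; rewrite psumr_eq0; last by move=> i _; exact: nrm2_ge0.
by move=> /allP H i; have /eqP:=H i (mem_index_enum i) => /nrm2_eq0.
Qed.

Lemma trc_schoutenA h p : trc (schoutenA h p) = - trc h-nrm2 p.
Proof. by rewrite /schoutenA; sum4; field. Qed.

Lemma hpp_schoutenA h p : hpp (schoutenA h p) p = - hpp h p+2^-1*nrm2 p^+2.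
Proof. by rewrite /schoutenA; sum4; field. Qed.

Lemma hs2_schoutenA h p : hs2 (schoutenA h p) = hs2 h+nrm2 p^+2-2*hpp h p+nrm2 p*trc h.
Proof. by rewrite /schoutenA; sum4; field. Qed.

Local Notation symm h:=(forall i j, h i j = h j i).

Lemma schoutenA_sym h p : (symm h) -> forall i j, schoutenA h p i j = schoutenA h p j i.
Proof. by move=> sh i j; rewrite /schoutenA sh (mulrC (p i)) (eq_sym i). Qed.

(** For [p] nonzero, [|p|^4] times the trace-free part of the restriction of [schoutenA h p] to the
    hyperplane orthogonal to [p]. *)
Definition tfreeB h p i j:=let A:=schoutenA h p in let N:=nrm2 p in
 N^+2*A i j + - N*(p i*hvec A p j+hvec A p i * p j)+(hpp A p+tden h p/3)*(p i * p j)
 + - (tden h p/3*N)*(i == j)%:R.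

(** Split [A] into its normal entry [al], its mixed part [m] and its tangential block, with trace
    [ta] and trace-free part [A0]. Then [sig2 = al ta + ta^2/3 - |m|^2 - |A0|^2/2], while
    [fden tden = |p|^4 (3 al ta + ta^2)]. The difference is the sum of squares on the right, with
    denominators cleared. *)
Lemma sigma2_identity h p : (symm h) ->
 nrm2 p^+2*(fden h p*tden h p-3*nrm2 p^+2*sig2 h p) =
 3*nrm2 p^+2*(nrm2 p*nrm2 (hvec (schoutenA h p) p)-hpp (schoutenA h p) p^+2)
 + 3/2*hs2 (tfreeB h p).
Proof.
move=> sh; have sA:=schoutenA_sym p sh.
rewrite /tfreeB hs2_expand// trc_schoutenA hs2_schoutenA hpp_schoutenA /fden /sig2 /tden.
by lra.
Qed.

Lemma hvec_gap h p : nrm2 p*(nrm2 p*nrm2 (hvec h p)-hpp h p^+2) =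
 nrm2 (fun i => nrm2 p*hvec h p i-hpp h p * p i).
Proof. by sum4; ring. Qed.

Lemma fden_tden_ge h p : (symm h) ->
 3*nrm2 p^+2*sig2 h p<=fden h p*tden h p.
Proof.
move=> sh; have [N0|N0]:=eqVneq (nrm2 p) 0.
 rewrite N0 /fden /tden N0 (_ : hpp h p = 0) /hpp ?big1//.
  by lra.
 by move=> i _; rewrite (nrm2_eq0 N0) mul0r.
have Np : 0<nrm2 p by rewrite lt_neqAle eq_sym N0 nrm2_ge0.
rewrite -subr_ge0 -(pmulr_rge0 _ (exprn_gt0 2 Np)) sigma2_identity//.
apply: addr_ge0; last by rewrite mulr_ge0 ?hs2_ge0//.
rewrite mulr_ge0 ?mulr_ge0 ?exprn_ge0 ?nrm2_ge0//.
by rewrite -(pmulr_rge0 _ Np) hvec_gap nrm2_ge0.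
Qed.

(** The product is positive by the previous inequality, and [fden + 2 tden = 3 |p|^2 sig1] is
    positive, so both factors are. *)
Lemma fden_tden_gt0 h p : (symm h) -> 0<sig1 h p -> 0<sig2 h p ->
 0<nrm2 p -> 0<fden h p /\ 0<tden h p.
Proof.
move=> sh s1 s2 N0; have h1:=fden_tden_ge p sh.
have h2 : 0<fden h p*tden h p by apply: lt_le_trans h1; rewrite !mulr_gt0.
have h3 : 0<fden h p+2*tden h p.
 have -> : fden h p+2*tden h p = 3*(nrm2 p*sig1 h p) by rewrite /fden /tden /sig1; field.
 by pos.
by nra.
Qed.

Lemma fden_tden_ge0 h p : (symm h) -> 0<sig1 h p -> 0<sig2 h p ->
 0<=fden h p /\ 0<=tden h p.
Proof.
move=> sh s1 s2; have [N0|N0]:=eqVneq (nrm2 p) 0.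
 rewrite /fden /tden N0 (_ : hpp h p = 0) /hpp ?big1//.
  by lra.
 by move=> i _; rewrite (nrm2_eq0 N0) mul0r.
have Np : 0<nrm2 p by rewrite lt_neqAle eq_sym N0 nrm2_ge0.
by have [/ltW ? /ltW]:=fden_tden_gt0 sh s1 s2 Np.
Qed.

(** In the equality case both squares of [sigma2_identity] vanish: [p] is an eigenvector of the
    Schouten tensor, and the tensor is scalar on the orthogonal hyperplane. *)
Lemma fden_tden_eq h p : (symm h) -> 0<nrm2 p ->
 fden h p*tden h p = 3*nrm2 p^+2*sig2 h p ->
 exists b, forall i j, h i j = (- tden h p/(3*nrm2 p)-nrm2 p/2)*(i == j)%:R+b*(p i * p j).
Proof.
move=> sh N0 eqH; have N1:=lt0r_neq0 N0.
have:=sigma2_identity p sh; rewrite eqH subrr mulr0 => /esym/eqP.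
set A:=schoutenA h p; set N:=nrm2 p in N0 N1 *.
have g0 : 0<=N*nrm2 (hvec A p)-hpp A p^+2 by rewrite -(pmulr_rge0 _ N0) hvec_gap nrm2_ge0.
have b0:=hs2_ge0 (tfreeB h p).
rewrite paddr_eq0; last 2 first.
- by pos.
- by lra.
move=> /andP[/eqP e1 /eqP e2].
have {}e1 : N*nrm2 (hvec A p)-hpp A p^+2 = 0.
 by apply: (mulfI (x:=3*N^+2)); rewrite ?mulr0// mulf_neq0 ?expf_neq0// pnatr_eq0.
have {}e2 : hs2 (tfreeB h p) = 0.
 by lra.
have wE i : hvec A p i = hpp A p/N * p i.
 have : nrm2 (fun i => N*hvec A p i-hpp A p * p i) = 0 by rewrite -hvec_gap e1 mulr0.
 move=> /nrm2_eq0/(_ i)/eqP; rewrite subr_eq0 => /eqP e; apply: (mulfI N1); rewrite e.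
 by field.
exists ((N^+2-hpp A p+tden h p/3)/N^+2) => i j.
have:=hs2_eq0 e2 i j; rewrite /tfreeB -/A -/N !wE /A [in N^+2*_]/schoutenA -/N -/A.
move: (hpp A p) (tden h p) (p i) (p j) (h i j) ((i == j)%:R) => a t pi pj hij d e.
have -> : hij = ((- t/(3*N)-N/2)*d+(N^+2-a+t/3)/N^+2*(pi * pj))-N ^- 2 *
 (N^+2*(- hij+pi * pj-2^-1*N*d) + - N*(pi*(a/N * pj)+a/N * pi * pj)+(a+t/3)*(pi * pj) + - (t/3*N)*d).
 by field.
by nra.
Qed.

(** AM-GM for the four numbers [a], [b], [d/2], [d/2]. *)
Lemma amgm4 (a b d x : R) : 0<=a -> 0<=b -> 0<=d -> x^+4<=64*a*b*d^+2 -> x<=a+b+d.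
Proof.
move=> a0 b0 d0 h; have [x0|x0]:=leP x 0.
 by lra.
rewrite -(ler_pXn2r (_ : 0<4)%N)// ?nnegrE ?(ltW x0) ?addr_ge0//.
apply: le_trans h _.
have h1 : 4*a*b<=(a+b)^+2 by rewrite -subr_ge0 (_ : _-_ = (a-b)^+2) ?sqr_ge0//; ring.
have h2 : 4*(a+b)*d<=(a+b+d)^+2 by rewrite -subr_ge0 (_ : _-_ = (a+b-d)^+2) ?sqr_ge0//; ring.
have h3 : 0<=4*(a+b)*d by pos.
by nra.
Qed.

End Sigma2Identities.

(** * Cut-off functions of one variable *)

Section Spline.
Context {R : realType}.
Implicit Types s : R.

Definition pos s : R:=Num.max s 0.

Lemma pos_le0 s : s<=0 -> pos s = 0.
Proof. by rewrite /pos => h; apply/max_idPr. Qed.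

Lemma pos_ge0 s : 0<=s -> pos s = s.
Proof. by rewrite /pos => h; apply/max_idPl. Qed.

Lemma pos_continuous s : cts pos s.
Proof.
have -> : pos = (fun s => (s + `|s|)/2).
 apply/funext => t; have [t0|t0]:=leP t 0.
  by rewrite pos_le0// ler0_norm// subrr mul0r.
 by rewrite pos_ge0 ?(ltW t0)// gtr0_norm//; field.
apply: cont_mul; last exact: cont_cst.
by apply: cont_add; [exact: cvg_id|exact: norm_continuous].
Qed.

Lemma is_derive_expn n s : is_derive s 1 (fun y : R => y^+n.+1) (n.+1%:R*s^+n).
Proof.
elim: n => [|n ih].
 have -> : (fun y : R => y^+1) = id by [].
 by apply: is_derive_eq; rewrite expr0 mulr1.
have -> : (fun y : R => y^+n.+2) = (fun y => y*y^+n.+1) by [].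
apply: (is_derive_eq (is_deriveM (is_derive_id _ _) ih)).
rewrite /GRing.scale/= exprS [n.+2%:R]mulrS; ring.
Qed.

Lemma is_derive_pos n s : is_derive s 1 (fun s => pos s^+n.+2) (n.+2%:R * pos s^+n.+1).
Proof.
have [s0|s0|->]:=ltgtP s 0.
- rewrite pos_le0 ?(ltW s0)// expr0n mulr0.
 have d0 : is_derive s 1 (fun _ : R => 0 : R) 0 by exact: is_derive_cst.
 have:=@lt_nbhsl _ _ _ s0 => nb; apply: (near_eq_is_derive _ d0); move: nb.
 by apply: filterS => y /= y0; rewrite pos_le0 ?expr0n// ltW.
- rewrite pos_ge0 ?(ltW s0)//.
 have d0 : is_derive s 1 (fun y : R => y^+n.+2) (n.+2%:R*s^+n.+1).
  exact: is_derive_expn.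
 have:=@lt_nbhsr _ _ _ s0 => nb; apply: (near_eq_is_derive _ d0); move: nb.
 by apply: filterS => y /= y0; rewrite pos_ge0// ltW.
rewrite pos_ge0// expr0n mulr0.
have H : h^-1 *: (((fun y => pos y^+n.+2) \o shift 0) (h *: 1)-pos 0^+n.+2) @[h --> (0 : R)^'] --> (0 : R).
 apply/cvgrPdist_le => e e0; rewrite near_withinE.
 apply/nbhs_ballP; exists (Num.min e 1) => /=; first by rewrite lt_min e0 ltr01.
 move=> h; rewrite /ball/= sub0r normrN lt_min => /andP[he h1] h0.
 rewrite sub0r normrN addr0 (_ : h%:A = h); last by rewrite /GRing.scale/= mulr1.
 rewrite [pos 0]pos_ge0// expr0n subr0 /GRing.scale/= normrM normfV.
 have hn : `|pos h| <= `|h|.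
  have [h2|h2]:=leP h 0; first by rewrite pos_le0// normr0.
  by rewrite pos_ge0// ltW.
 rewrite ler_pdivrMl ?normr_gt0// normrX mulrC.
 apply: (@le_trans _ _ (`|h| ^+ 2)); last by rewrite ler_wpM2r// ltW.
 apply: (@le_trans _ _ (`|h| ^+ n.+2)); first by rewrite lerXn2r//.
 by apply: ler_wiXn2l => //; exact: ltW.
split; first by apply/cvg_ex; exists 0; exact: H.
by rewrite /derive; apply: cvg_lim.
Qed.

(** A piecewise cubic step from 0 to 1 of class C2. Its second derivative [ddth] is piecewise linear
    with values 0, 8, -8, 0 at 0, 1/4, 3/4, 1, which gives the bounds 2 and 8 on the derivatives. *)
Definition th s:=16/3*(pos s^+3-2 * pos (s-1/4)^+3+2 * pos (s-3/4)^+3-pos (s-1)^+3).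
Definition dth s:=16*(pos s^+2-2 * pos (s-1/4)^+2+2 * pos (s-3/4)^+2-pos (s-1)^+2).
Definition ddth s:=32*(pos s-2 * pos (s-1/4)+2 * pos (s-3/4)-pos (s-1)).

Lemma is_derive_pos_shift n (k s : R) : is_derive s 1 (fun s => pos (s-k)^+n.+2) (n.+2%:R * pos (s-k)^+n.+1).
Proof.
have h2 : is_derive s 1 (fun s : R => s-k) 1 by apply: is_derive_eq; rewrite subr0.
have:=@is_derive_comp1 R R (fun s => pos s^+n.+2) (fun s : R => s-k) s 1 _ _ (is_derive_pos n (s-k)) h2.
by rewrite mulr1.
Qed.

Lemma is_derive_lin4 (f1 f2 f3 f4 : R -> R) (d1 d2 d3 d4 c s : R) :
 is_derive s 1 f1 d1 -> is_derive s 1 f2 d2 -> is_derive s 1 f3 d3 -> is_derive s 1 f4 d4 ->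
 is_derive s 1 (fun s => c*(f1 s-2*f2 s+2*f3 s-f4 s)) (c*(d1-2*d2+2*d3-d4)).
Proof. by move=> h1 h2 h3 h4; apply: is_derive_eq; rewrite /GRing.scale/=; ring. Qed.

Local Notation dps:=(is_derive_pos_shift _ _ _).

Lemma is_derive_th s : is_derive s 1 th (dth s).
Proof.
have h0 : is_derive s 1 (fun s => pos s^+3) (3 * pos s^+2) by exact: is_derive_pos.
apply: (is_derive_eq (is_derive_lin4 _ h0 dps dps dps)).
by rewrite /dth; field.
Qed.

Lemma is_derive_dth s : is_derive s 1 dth (ddth s).
Proof.
have h0 : is_derive s 1 (fun s => pos s^+2) (2 * pos s^+1) by exact: is_derive_pos.
apply: (is_derive_eq (is_derive_lin4 _ h0 dps dps dps)).
by rewrite /ddth; ring.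
Qed.

Lemma derive_continuous (f : R -> R) s d : is_derive s 1 f d -> cts f s.
Proof.
by move=> [h _]; apply: differentiable_continuous; apply/derivable1_diffP.
Qed.

Lemma ddth_continuous s : cts ddth s.
Proof.
have ps k : cts (fun s => pos (s-k)) s.
 apply: cont_comp; first exact: pos_continuous.
 by apply: cont_sub; [exact: cvg_id|exact: cont_cst].
apply: cont_mul; first exact: cont_cst.
apply: cont_sub; last exact: ps.
apply: cont_add; last by apply: cont_mul; [exact: cont_cst|exact: ps].
by apply: cont_sub; [exact: pos_continuous|apply: cont_mul; [exact: cont_cst|exact: ps]].
Qed.

Lemma dth_continuous s : cts dth s.
Proof. exact: derive_continuous (is_derive_dth s). Qed.

Lemma th_le0 s : s<=0 -> [/\ th s = 0, dth s = 0 & ddth s = 0].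
Proof.
move=> s0; rewrite /th /dth /ddth !pos_le0; try lra.
by rewrite !expr0n !(mulr0, subrr, addr0, subr0).
Qed.

Lemma th_ge1 s : 1<=s -> [/\ th s = 1, dth s = 0 & ddth s = 0].
Proof.
move=> s1; rewrite /th /dth /ddth !pos_ge0; try lra.
by split; field.
Qed.

Lemma dth_bounds s : 0<=dth s<=2 /\ `|ddth s| <= 8.
Proof.
have [s0|s0]:=leP s 0; first by have [_ -> ->]:=th_le0 s0; rewrite normr0 lexx /=; split.
have [s1|s1]:=leP 1 s; first by have [_ -> ->]:=th_ge1 s1; rewrite normr0 lexx /=; split.
rewrite /dth /ddth (pos_ge0 (ltW s0)) (pos_le0 (_ : s-1<=0)); last lra.
have [s2|s2]:=leP s (1/4).
 rewrite !pos_le0; [|lra|lra]; rewrite ler_norml; split; last by lra.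
 by nra.
have [s3|s3]:=leP s (3/4).
 rewrite (@pos_ge0 (s-1/4)); last lra.
 rewrite pos_le0; last lra.
 rewrite ler_norml; split; last by lra.
 have q1 : 0<=(s-1/4)*(3/4-s) by pos.
 have q2 : 0<=(s-1/2)^+2 by pos.
 by lra.
rewrite !pos_ge0; [|lra|lra]; rewrite ler_norml; split; last by lra.
by nra.
Qed.

Lemma dth_ge1 s : 1/4<=s<=3/4 -> 1<=dth s.
Proof.
move=> /andP[s0 s1]; rewrite /dth (@pos_ge0 s); last lra.
rewrite (@pos_ge0 (s-1/4)); last lra.
rewrite !pos_le0; [|lra|lra]; nra.
Qed.

Lemma th_mono s t : s<=t -> th s<=th t.
Proof.
move=> st; have [|c _ E]:=@mean_value R th dth s t st; first by move=> x _; exact: is_derive_th.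
rewrite -subr_ge0 E mulr_ge0 ?subr_ge0//.
by have [/andP[]]:=dth_bounds c.
Qed.

Lemma th_01 s : 0<=th s<=1.
Proof.
apply/andP; split.
 have [s0|s0]:=leP s 0; first by have [->]:=th_le0 s0.
 by have [<- _ _]:=th_le0 (lexx (0 : R)); apply: th_mono; exact: ltW.
have [s0|s0]:=leP 1 s; first by have [->]:=th_ge1 s0.
by have [<- _ _]:=th_ge1 (lexx (1 : R)); apply: th_mono; exact: ltW.
Qed.

(** For [a + sg <= b], [trap sg a b] is the trapezoid that rises on [[a, a+sg]], is 1 up to [b] and
    falls on [[b, b+sg]], and [trapI] is its primitive, running from 0 to [b-a]. Composed with [u],
    [trapI] is the test function of a layer of level sets. *)
Definition ramp (sg s : R):=(pos s^+2-pos (s-sg)^+2)/(2*sg).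
Definition dramp (sg s : R):=(pos s-pos (s-sg))/sg.
Definition trapI (sg a b s : R):=ramp sg (s-a)-ramp sg (s-b).
Definition trap (sg a b s : R):=dramp sg (s-a)-dramp sg (s-b).

Lemma is_derive_ramp sg k s : 0<sg -> is_derive s 1 (fun s => ramp sg (s-k)) (dramp sg (s-k)).
Proof.
move=> sg0; have h1:=is_derive_pos_shift 0 k s; have h2:=is_derive_pos_shift 0 (k+sg) s.
have -> : (fun s => ramp sg (s-k)) = (fun s => (pos (s-k)^+2-pos (s-(k+sg))^+2)*(2*sg)^-1).
 by apply/funext => t; rewrite /ramp opprD addrA.
apply: is_derive_eq; rewrite /GRing.scale/= /dramp !expr1 opprD addrA; field.
by lra.
Qed.

Lemma is_derive_trapI sg a b s : 0<sg -> is_derive s 1 (trapI sg a b) (trap sg a b s).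
Proof. by move=> sg0; exact: (is_deriveB (is_derive_ramp a s sg0) (is_derive_ramp b s sg0)). Qed.

Lemma trap_continuous sg a b s : cts (trap sg a b) s.
Proof.
have ps k : cts (fun s => pos (s-k)) s.
 apply: cont_comp; first exact: pos_continuous.
 by apply: cont_sub; [exact: cvg_id|exact: cont_cst].
have pd k : cts (fun s => dramp sg (s-k)) s.
 apply: cont_mul; last exact: cont_cst.
 apply: cont_sub; first exact: ps.
 have -> : (fun y => pos (y-k-sg)) = (fun y => pos (y-(k+sg))) by apply/funext => y; rewrite opprD addrA.
 exact: ps.
by apply: cont_sub; exact: pd.
Qed.

Lemma ramp_le0 sg s : 0<sg -> s<=0 -> ramp sg s = 0 /\ dramp sg s = 0.
Proof. by move=> sg0 s0; rewrite /ramp /dramp !pos_le0; try lra; rewrite expr0n /= !subrr !mul0r. Qed.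

Lemma ramp_ge sg s : 0<sg -> sg<=s -> ramp sg s = s-sg/2 /\ dramp sg s = 1.
Proof.
move=> sg0 s0; rewrite /ramp /dramp !pos_ge0; try lra.
by split; field; rewrite gt_eqF.
Qed.

Lemma dramp_mono sg s t : 0<sg -> s<=t -> dramp sg s<=dramp sg t.
Proof.
move=> sg0 st; rewrite /dramp ler_pM2r ?invr_gt0//.
have [s0|s0]:=leP s 0.
 rewrite !(pos_le0 (s:=s)) ?(pos_le0 (s:=s-sg)); [|lra|lra].
 have [t0|t0]:=leP t 0; first by rewrite !pos_le0; lra.
 have [t1|t1]:=leP t sg; first by rewrite (pos_ge0 (ltW t0)) pos_le0; lra.
 by rewrite !pos_ge0; lra.
rewrite (pos_ge0 (ltW s0)) (@pos_ge0 t); last lra.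
have [t1|t1]:=leP t sg; first by rewrite !pos_le0; lra.
rewrite (@pos_ge0 (t-sg)); last lra.
have [s1|s1]:=leP s sg; first by rewrite pos_le0; lra.
by rewrite pos_ge0; lra.
Qed.

Lemma dramp_01 sg s : 0<sg -> 0<=dramp sg s<=1.
Proof.
move=> sg0; apply/andP; split.
 have [s0|s0]:=leP s 0; first by have [_ ->]:=ramp_le0 sg0 s0.
 by have [_ <-]:=ramp_le0 sg0 (lexx 0); apply: dramp_mono => //; exact: ltW.
have [s0|s0]:=leP sg s; first by have [_ ->]:=ramp_ge sg0 s0.
by have [_ <-]:=ramp_ge sg0 (lexx sg); apply: dramp_mono => //; exact: ltW.
Qed.

Lemma trap_01 sg a b s : 0<sg -> a<=b -> 0<=trap sg a b s<=1.
Proof.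
move=> sg0 ab; have m:=@dramp_mono sg (s-b) (s-a) sg0.
have /andP[h1 h2]:=dramp_01 (s-a) sg0; have /andP[h3 h4]:=dramp_01 (s-b) sg0.
by rewrite /trap; apply/andP; split; [rewrite subr_ge0 m// lerB|lra].
Qed.

Lemma trap_le sg a b s : 0<sg -> a<=b -> s<=a -> trapI sg a b s = 0 /\ trap sg a b s = 0.
Proof.
move=> sg0 ab sa; rewrite /trapI /trap.
have [-> ->]:=@ramp_le0 sg (s-a) sg0 ltac:(lra).
by have [-> ->]:=@ramp_le0 sg (s-b) sg0 ltac:(lra); rewrite !subrr.
Qed.

Lemma trap_ge sg a b s : 0<sg -> a<=b -> b+sg<=s -> trapI sg a b s = b-a /\ trap sg a b s = 0.
Proof.
move=> sg0 ab sa; rewrite /trapI /trap.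
have [-> ->]:=@ramp_ge sg (s-a) sg0 ltac:(lra).
have [-> ->]:=@ramp_ge sg (s-b) sg0 ltac:(lra).
by lra.
Qed.

Lemma trap_mid sg a b s : 0<sg -> a+sg<=s -> s<=b -> trap sg a b s = 1.
Proof.
move=> sg0 sa sb; rewrite /trap.
have [_ ->]:=@ramp_ge sg (s-a) sg0 ltac:(lra).
by have [_ ->]:=@ramp_le0 sg (s-b) sg0 ltac:(lra); rewrite subr0.
Qed.

Lemma trapI_mono sg a b s t : 0<sg -> a<=b -> s<=t -> trapI sg a b s<=trapI sg a b t.
Proof.
move=> sg0 ab st; have [|c _ E]:=@mean_value R (trapI sg a b) (trap sg a b) s t st.
 by move=> x _; exact: is_derive_trapI.
have /andP[t0 _]:=trap_01 c sg0 ab.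
by nra.
Qed.

Lemma trapI_ge sg a b s : 0<sg -> a+sg<=b -> b<=s -> b-a-sg/2<=trapI sg a b s.
Proof.
move=> sg0 ab bs; have ab' : a<=b by lra.
apply: le_trans (trapI_mono sg0 ab' bs).
rewrite /trapI subrr; have [-> _]:=@ramp_ge sg (b-a) sg0 ltac:(lra).
by have [-> _]:=@ramp_le0 sg 0 sg0 (lexx _); rewrite subr0.
Qed.

Lemma trapI_bounds sg a b s : 0<sg -> a<=b -> 0<=trapI sg a b s<=b-a.
Proof.
move=> sg0 ab; apply/andP; split.
 have [sa|sa]:=leP s a; first by have [->]:=trap_le sg0 ab sa.
 by have [<- _]:=trap_le sg0 ab (lexx a); apply: trapI_mono => //; exact: ltW.
have [sa|sa]:=leP (b+sg) s; first by have [->]:=trap_ge sg0 ab sa.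
by have [<- _]:=trap_ge sg0 ab (lexx (b+sg)); apply: trapI_mono => //; exact: ltW.
Qed.

End Spline.

Section Comp1.
Context {R : realType} {n : nat}.
Local Notation E:='rV[R]_n.
Local Notation e_ i:=(delta_mx 0 i : E).

Lemma partial_comp1 (g : E -> R) (phi : R -> R) (dphi : R) x i :
 is_derive (g x) 1 phi dphi -> is_derive x (e_ i) g (partial i g x) ->
 partial i (fun x => phi (g x)) x = dphi * partial i g x.
Proof. by move=> h1 h2; have [_]:=is_derive_comp1 h1 h2. Qed.

Lemma is_Ck1_comp1 (U : set E) (g : E -> R) (phi dphi : R -> R) : open U ->
 (forall s : R, is_derive s 1 phi (dphi s)) -> (forall s, cts dphi s) ->
 is_Ck 1 U g -> is_Ck 1 U (fun x => phi (g x)).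
Proof.
move=> oU h1 c1 cg; apply: (@is_CkS_intro _ _ 0 U _ (fun i x => dphi (g x) * partial i g x)) => //.
- move=> x Ux; apply: cont_comp; first by have [d _]:=h1 (g x); apply: differentiable_continuous; apply/derivable1_diffP.
 exact: is_Ck_cont cg Ux.
- by move=> i x Ux; exact: (is_derive_comp1 (h1 _) (is_Ck_derivable i cg Ux)).
- move=> i; split => // x Ux; apply: cont_mul.
  by apply: cont_comp; [exact: c1|exact: is_Ck_cont cg Ux].
 by have:=is_Ck_partial i cg => /is_Ck_cont; exact.
Qed.

End Comp1.

(** * Radial functions and the constant kappa *)

Section Radial.
Context {R : realType}.
Local Notation E:='rV[R]_4.
Local Notation e_ i:=(delta_mx 0 i : E).
Implicit Types (c x : E) (i j : 'I_4).

Definition zc c i x : R:=x 0 i-c 0 i.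
Definition rho c x : R:=\sum_i zc c i x^+2.
(** [log|x-c|], with the default value 0 at the centre. *)
Definition Lr c x : R:=ln (rho c x)/2.
Definition punct c : set E:=[set x | x != c].

Lemma rho_ge0 c x : 0<=rho c x.
Proof. by apply: sumr_ge0 => i _; rewrite sqr_ge0. Qed.

Lemma rhoE c x : rho c x = dot (x-c) (x-c).
Proof. by apply: eq_bigr => i _; rewrite !mxE -expr2. Qed.

Lemma rho_gt0 c x : x != c -> 0<rho c x.
Proof.
move=> xc; rewrite lt_neqAle rho_ge0 andbT eq_sym rhoE; apply/eqP => /dot_eq0/eqP.
by rewrite subr_eq0 (negbTE xc).
Qed.

Lemma rho_cc c : rho c c = 0.
Proof. by rewrite /rho big1// => i; rewrite /zc subrr expr0n. Qed.

Lemma open_punct c : open (punct c).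
Proof.
rewrite (_ : punct c = ~` [set c]); first exact/closed_openC/accessible_closed_set1/hausdorff_accessible/norm_hausdorff.
by apply/seteqP; split => x /= /eqP.
Qed.
Arguments open_punct : clear implicits.

Lemma is_derive_zc c i x j : is_derive x (e_ j) (zc c i) ((i == j)%:R).
Proof.
have h:=is_derive_coord x (e_ j) i.
apply: (is_derive_eq (is_deriveB h (is_derive_cst (c 0 i) _ _))).
by rewrite !mxE subr0.
Qed.

Lemma is_Ck_zc k c i U : open U -> is_Ck k U (zc c i).
Proof. by move=> oU; apply: is_Ck_sub_fun => //; [exact: is_Ck_coord|exact: is_Ck_cst]. Qed.

Lemma is_Ck_rho k c U : open U -> is_Ck k U (rho c).
Proof. by move=> oU; apply: is_Ck_sum => // i; apply: is_Ck_exp => //; exact: is_Ck_zc. Qed.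

Lemma partial_rho c i x : is_derive x (e_ i) (rho c) (2*zc c i x).
Proof.
have h j : is_derive x (e_ i) (fun x => zc c j x^+2) (2*zc c j x*(j == i)%:R).
 have hd:=is_derive_zc c j x i.
 by have:=is_derive_comp1 (is_derive_expn 1 (zc c j x)) hd; rewrite expr1.
have -> : rho c = \sum_j (fun x => zc c j x^+2) by apply/funext => y; rewrite fct_sumE.
have:=is_derive_sum (fun j => h j); move=> H; apply: (is_derive_eq H).
rewrite (bigD1 i)//= eqxx mulr1 big1 ?addr0// => j /negbTE ->.
by rewrite mulr0.
Qed.

Lemma is_Ck_Lr k c : is_Ck k (punct c) (Lr c).
Proof.
have oU:=open_punct c; apply: is_Ck_mul => //; last exact: is_Ck_cst.
by apply: is_Ck_ln => //; [exact: rho_gt0|exact: is_Ck_rho].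
Qed.

Lemma is_derive_Lr c i x : x != c -> is_derive x (e_ i) (Lr c) (zc c i x/rho c x).
Proof.
move=> xc; have r0:=rho_gt0 xc.
have h1:=is_derive_comp1 (is_derive1_ln r0) (partial_rho c i x).
have h2 : is_derive x (e_ i) (fun _ : E => 2^-1 : R) 0 by exact: is_derive_cst.
apply: (is_derive_eq (is_deriveM h1 h2)).
by rewrite /GRing.scale/=; field; rewrite gt_eqF.
Qed.

Lemma partial_Lr c i x : x != c -> partial i (Lr c) x = zc c i x/rho c x.
Proof. by move=> xc; have [_]:=is_derive_Lr i xc. Qed.

Lemma is_derive_zc_rhoV c i j m x : x != c -> is_derive x (e_ j) (fun x => zc c i x*(rho c x) ^- m.+1)
 ((i == j)%:R*rho c x ^- m.+1-2 * m.+1%:R*zc c i x*zc c j x*rho c x ^- m.+2).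
Proof.
move=> xc; have r0:=rho_gt0 xc; have r1:=lt0r_neq0 r0.
have h0:=is_derive_expn m (rho c x).
have rm : rho c x^+m.+1 != 0 by pos.
have hV : is_derive (rho c x) 1 (fun y : R => (y^+m.+1)^-1) (- (rho c x^+m.+1) ^- 2 *: (m.+1%:R*rho c x^+m)).
 exact: is_deriveV.
have h1:=is_derive_comp1 hV (partial_rho c j x).
apply: (is_derive_eq (is_deriveM (is_derive_zc c i x j) h1)).
rewrite /GRing.scale/= !exprS expr0 mulr1.
move: r1; move: (rho c x) => r r1; have rm' : r^+m != 0 by rewrite expf_neq0.
field; rewrite rm' /=; exact: r1.
Qed.

Lemma expR_Lr c x : x != c -> expR (2*Lr c x) = rho c x.
Proof. by move=> xc; rewrite /Lr mulrC divfK// lnK// posrE rho_gt0. Qed.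

Lemma Lr_near c (s : R) : \forall x \near c, x != c -> Lr c x<s.
Proof.
have op : open [set x : E | rho c x<expR (2*s)].
 by apply: open_preimage_lt => x; have:=@is_Ck_rho 0 c setT openT => /is_Ck_cont; exact.
have : \forall x \near c, rho c x<expR (2*s).
 by apply: open_nbhs_nbhs; split => //=; rewrite rho_cc expR_gt0.
by apply: filterS => x h xc; move: h; rewrite -(expR_Lr xc) ltr_expR ltr_pM2l.
Qed.

Lemma Lr_far c (s : R) x : `|c| + expR s < `|x| -> x != c /\ s<Lr c x.
Proof.
move=> h; have t0:=expR_gt0 s.
have xc : x != c.
 by apply/eqP => e; move: h; rewrite e ltNge => /negP; apply; rewrite lerDl ltW.
split => //; rewrite ltNge; apply/negP => Ls.
have r1 : dot (x-c) (x-c)<=expR s^+2.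
 by rewrite -rhoE -(expR_Lr xc) -expRM_natl ler_expR ler_pM2l.
have : `|x-c| <= expR s by apply: norm_row_bound (ltW t0) (fun i => dot_coord i (ltW t0) r1).
by have:=ler_normD (x-c) c; rewrite subrK => h1 h2; lra.
Qed.

(** As [Lr] takes a default value at the centre, the limit [A] of [phi] at minus infinity is
    prescribed there. *)
Definition cutf c (phi : R -> R) (A : R) x:=if x == c then A else phi (Lr c x).

(** A function of the logarithmic radius that is constant near both ends, so that it extends
    smoothly across the centre. *)
Record profile (phi dphi : R -> R) (A B s1 s2 : R) : Prop:=Profile {
 prof_der : forall s : R, is_derive s 1 phi (dphi s);
 prof_cont : forall s, cts dphi s;
 prof_lo : forall s, s<=s1 -> phi s = A /\ dphi s = 0;
 prof_hi : forall s, s2<=s -> phi s = B /\ dphi s = 0 }.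

Lemma C1at_near_cst (f : E -> R) (a : R) x : (\forall y \near x, f y = a) -> C1at f x.
Proof.
move=> /nbhs_interior h; have cst : C1at (fun _ : E => a) x.
 by apply: (is_Ck_C1at openT) => //; apply: is_Ck_cst; exact: openT.
apply: filterS2 cst (nbhs_interior h) => y H fa i; have [d ct]:=H i.
have fy : \forall z \near y, a = f z.
 by have:=nbhs_singleton fa; apply: filterS => z ->.
split; first by have []:=near_is_derive fy (derivable_is_derive d).
apply: cont_near_eq ct; have:=nbhs_interior (nbhs_interior fa); apply: filterS => z fz.
have fz' : \forall w \near z, a = f w by have:=nbhs_singleton fz; apply: filterS => w /nbhs_singleton ->.
exact: near_partial.
Qed.

Section Profile.
Variables (c : E) (phi dphi : R -> R) (A B s1 s2 : R).
Hypothesis P : profile phi dphi A B s1 s2.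

Lemma cutf_E x : x != c -> cutf c phi A x = phi (Lr c x).
Proof. by rewrite /cutf => /negbTE ->. Qed.

Lemma cutf_near : \forall x \near c, cutf c phi A x = A.
Proof.
have:=Lr_near c s1; apply: filterS => x h; rewrite /cutf.
by case: eqP => // /eqP/h/ltW/(prof_lo P)[].
Qed.

Lemma cutf_far x : `|c| + expR s2 < `|x| -> cutf c phi A x = B.
Proof. by move=> /Lr_far[xc h]; rewrite cutf_E//; have []:=prof_hi P (ltW h). Qed.

Lemma cutf_nearE x : x != c -> \forall y \near x, phi (Lr c y) = cutf c phi A y.
Proof.
move=> xc; have:=open_nbhs_nbhs (conj (open_punct c) xc).
by apply: filterS => y yc; rewrite cutf_E.
Qed.

Lemma is_Ck1_cutf_punct : is_Ck 1 (punct c) (cutf c phi A).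
Proof.
have oU:=open_punct c; apply: (@is_Ck_eq _ _ 1 (punct c) (fun x => phi (Lr c x))) => //.
 by move=> x xc; rewrite cutf_E.
by apply: is_Ck1_comp1 => //; [exact: prof_der P|exact: prof_cont P|exact: is_Ck_Lr].
Qed.

Lemma C1at_cutf x : C1at (cutf c phi A) x.
Proof.
have [->|xc]:=eqVneq x c; first exact: C1at_near_cst cutf_near.
exact: (is_Ck_C1at (open_punct c) is_Ck1_cutf_punct xc).
Qed.

Lemma partial_cutf i x : partial i (cutf c phi A) x = dphi (Lr c x)*(zc c i x/rho c x).
Proof.
have [->|xc]:=eqVneq x c.
 rewrite rho_cc invr0 !mulr0.
 have -> : partial i (cutf c phi A) c = partial i (fun=> A) c by apply: near_partial; exact: cutf_near.
 by rewrite /partial derive_cst.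
have d1 : is_derive x (e_ i) (Lr c) (partial i (Lr c) x) by rewrite partial_Lr//; exact: is_derive_Lr.
rewrite -partial_Lr// -(partial_comp1 (prof_der P (Lr c x)) d1).
by apply/esym/near_partial; exact: cutf_nearE.
Qed.

Lemma Cc_radial : Cc (fun x => dphi (Lr c x)*rho c x ^- 2).
Proof.
apply: (@Cc_intro _ _ (`|c| + expR s2)) => [x /Lr_far[_ h]|x].
 by have [_ ->]:=prof_hi P (ltW h); rewrite mul0r.
have [->|xc]:=eqVneq x c.
 right; have:=Lr_near c s1; apply: filterS => y h.
 have [->|/h/ltW/(prof_lo P)[_ ->]]:=eqVneq y c; last by lra.
 by rewrite rho_cc expr0n invr0 mulr0.
left; apply: cont_mul.
 by apply: cont_comp; [exact: prof_cont P _|exact: is_Ck_cont (is_Ck_Lr 0 c) xc].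
apply: cont_inv; first by rewrite expf_neq0// gt_eqF// rho_gt0.
by apply: cont_exp; exact: (is_Ck_cont (is_Ck_rho 0 c openT)).
Qed.

End Profile.

Lemma profile_th : profile (@th R) dth 0 1 0 1.
Proof.
split; [exact: is_derive_th|exact: dth_continuous| |].
- by move=> s /th_le0[].
- by move=> s /th_ge1[].
Qed.

(** The area of the unit 3-sphere: in the variable [s = log|x-c|] the measure [|x-c|^-4 dx] is this
    area times [ds], and [dth] has integral 1. *)
Definition kap c : R:=Int (fun x => dth (Lr c x)*rho c x ^- 2).

(** Up to a factor, [(x-c)/|x-c|^4] is the gradient of the fundamental solution of the Laplacian on
    R^4. *)
Lemma radial_div0 c x : x != c -> \sum_i partial i (fun x => zc c i x*rho c x ^- 2) x = 0.
Proof.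
move=> xc; have r1:=lt0r_neq0 (rho_gt0 xc).
have -> : \sum_i partial i (fun x => zc c i x*rho c x ^- 2) x =
 \sum_(i<4) (rho c x ^- 2-4*rho c x ^- 3*zc c i x^+2).
 apply: eq_bigr => i _; have [_]:=is_derive_zc_rhoV i i 1 xc; rewrite /partial => ->.
 by rewrite eqxx mul1r; congr (_-_); rewrite expr2; ring.
rewrite sumrB -mulr_sumr -/(rho c x) sumr_const card_ord -mulr_natr; field.
exact: r1.
Qed.

Lemma radial_sum c x (a : R) : \sum_i (a*(zc c i x/rho c x))*(zc c i x*rho c x ^- 2) = a*rho c x ^- 2.
Proof.
have [->|xc]:=eqVneq x c.
 by rewrite rho_cc expr0n invr0 mulr0 big1// => i; rewrite !mulr0.
have r1:=lt0r_neq0 (rho_gt0 xc).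
have -> : \sum_i (a*(zc c i x/rho c x))*(zc c i x*rho c x ^- 2) = a*rho c x ^- 3 * \sum_i zc c i x^+2.
 by rewrite mulr_sumr; apply: eq_bigr => i _; field; exact: r1.
by rewrite -/(rho c x); field; exact: r1.
Qed.

Lemma is_Ck_radial_field k c i : is_Ck k (punct c) (fun x => zc c i x*rho c x ^- 2).
Proof.
have oU:=open_punct c; apply: is_Ck_mul => //; first exact: is_Ck_zc.
apply: is_Ck_inv => // [x xc|]; first by rewrite expf_neq0// gt_eqF// rho_gt0.
by apply: is_Ck_exp => //; exact: is_Ck_rho.
Qed.

Lemma radial_integral0 c phi dphi s1 s2 : profile phi dphi 0 0 s1 s2 ->
 Int (fun x => dphi (Lr c x)*rho c x ^- 2) = 0.
Proof.
move=> P.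
have [||_ _ e]:=@divergence_thm R (cutf c phi 0) (fun i x => zc c i x*rho c x ^- 2) (`|c| + expR s2).
- by move=> x; exact: (cutf_far P).
- move=> x; have [->|xc]:=eqVneq x c; first by right; exact: (cutf_near c P).
 left; split; first exact: (C1at_cutf c P).
 by move=> i; exact: is_Ck_C1at (open_punct c) (is_Ck_radial_field 1 c i) xc.
transitivity (Int (fun x => \sum_i partial i (cutf c phi 0) x*(zc c i x*rho c x ^- 2))).
 by apply: Int_eq => x; rewrite -radial_sum; apply: eq_bigr => i _; rewrite (partial_cutf c P).
rewrite e; apply/eqP; rewrite oppr_eq0; apply/eqP; transitivity (Int (fun _ : E => 0 : R)); last exact: Int0.
apply: Int_eq => x.
have [->|xc]:=eqVneq x c; last by rewrite radial_div0// mulr0.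
by rewrite (nbhs_singleton (cutf_near c P)) mul0r.
Qed.

(** Subtracting [A + (B-A) th] leaves a profile that vanishes near both ends. Its integral is that
    of a compactly supported function's gradient paired with a divergence-free field, hence 0. *)
Lemma radial_integral c phi dphi A B s1 s2 : profile phi dphi A B s1 s2 ->
 Int (fun x => dphi (Lr c x)*rho c x ^- 2) = kap c*(B-A).
Proof.
move=> P.
pose psi s:=phi s-(B-A)*th s-A.
have P' : profile psi (fun s => dphi s-(B-A)*dth s) 0 0 (Num.min s1 0) (Num.max s2 1).
 split.
 - move=> s; have h1:=prof_der P s; have h2:=is_derive_th s.
  by apply: is_derive_eq; rewrite /GRing.scale/=; ring.
 - move=> s; apply: cont_sub; first exact: prof_cont P s.
  by apply: cont_mul; [exact: cont_cst|exact: dth_continuous].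
 - move=> s; rewrite le_min => /andP[h1 h2]; rewrite /psi.
  have [-> ->]:=prof_lo P h1; have [-> -> _]:=th_le0 h2.
  by lra.
 - move=> s; rewrite ge_max => /andP[h1 h2]; rewrite /psi.
  have [-> ->]:=prof_hi P h1; have [-> -> _]:=th_ge1 h2.
  by lra.
have:=radial_integral0 c P'.
have i1:=itg_Cc (Cc_radial c P); have i2:=itg_scale (B-A) (itg_Cc (Cc_radial c profile_th)).
rewrite (@Int_eq _ _ (fun x => dphi (Lr c x)*rho c x ^- 2-(B-A)*(dth (Lr c x)*rho c x ^- 2))); last first.
 by move=> x; ring.
rewrite Int_sub// Int_scale; last exact: itg_Cc (Cc_radial c profile_th).
by rewrite -/(kap c) => /eqP; rewrite subr_eq0 mulrC => /eqP.
Qed.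

Definition kappa : R:=kap 0.

Lemma kapE c : kap c = kappa.
Proof.
have shf x : dth (Lr c (x+c))*rho c (x+c) ^- 2 = dth (Lr 0 x)*rho 0 x ^- 2.
 suff e : rho c (x+c) = rho 0 x by rewrite /Lr e.
 by apply: eq_bigr => i _; rewrite /zc !mxE addrK subr0.
have i1:=itg_Cc (Cc_radial c profile_th); have i2:=itg_Cc (Cc_radial 0 profile_th).
rewrite /kappa /kap -(@Int_translate _ _ c (itg_mble i1) i1).
 by apply: Int_eq.
by apply: itg_eq i2 => x; rewrite shf.
Qed.

Lemma profile_quartic (sg : R) : 0<sg -> sg<1/4 ->
 profile (fun s => trapI sg sg (1-sg) (expR (4*s))) (fun s => 4*expR (4*s)*trap sg sg (1-sg) (expR (4*s)))
  0 (1-2*sg) (ln sg/4) 0.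
Proof.
move=> s0 s1; have ab : sg<=1-sg by lra.
split.
- move=> s; have h1 : is_derive s 1 (fun s : R => expR (4*s)) (4*expR (4*s)).
  by apply: is_derive_eq; rewrite /GRing.scale/=; ring.
 have:=@is_derive_comp1 R R (trapI sg sg (1-sg)) (fun s : R => expR (4*s)) s 1 _ _ (is_derive_trapI sg (1-sg) (expR (4*s)) s0) h1.
 by rewrite mulrC.
- move=> s; have ce : cts (fun s : R => expR (4*s)) s.
  apply: cont_comp; first exact: continuous_expR.
  by apply: cont_mul; [exact: cont_cst|exact: cvg_id].
 apply: cont_mul; first by apply: cont_mul; [exact: cont_cst|exact: ce].
 by apply: cont_comp; [exact: trap_continuous|exact: ce].
- move=> s h; have he : expR (4*s)<=sg.
  by rewrite -[leRHS](lnK s0) ler_expR mulrC -ler_pdivlMr.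
 by have [-> ->]:=trap_le s0 ab he; rewrite mulr0.
- move=> s h; have he : 1-sg+sg<=expR (4*s).
  by rewrite subrK -expR0 ler_expR mulr_ge0.
 by have [-> ->]:=trap_ge s0 ab he; rewrite mulr0; split => //; ring.
Qed.

(** For a profile that is a function of [e^(4s) = |x|^4], the density becomes 4 times a trapezoid in
    [|x|^4]. As [sg] shrinks, this compares [kappa] with 4 times the volume of the unit ball. *)
Lemma kappa_quartic (sg : R) : 0<sg -> sg<1/4 ->
 itg (fun x => trap sg sg (1-sg) (rho 0 x^+2)) /\
 kappa*(1-2*sg) = 4*Int (fun x => trap sg sg (1-sg) (rho 0 x^+2)).
Proof.
move=> s0 s1; have P:=profile_quartic s0 s1; have ab : sg<=1-sg by lra.
have e x : 4*expR (4*Lr 0 x)*trap sg sg (1-sg) (expR (4*Lr 0 x))*rho 0 x ^- 2 =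
 4*trap sg sg (1-sg) (rho 0 x^+2).
 have [->|x0]:=eqVneq x 0.
  rewrite rho_cc expr0n /= invr0 mulr0.
  by have [_ ->]:=trap_le s0 ab (ltW s0); rewrite mulr0.
 have -> : expR (4*Lr 0 x) = rho 0 x^+2.
  by rewrite -(expR_Lr x0) -expRM_natl; congr expR; ring.
 by field; rewrite gt_eqF// rho_gt0.
have i1:=itg_Cc (Cc_radial 0 P).
have i2 : itg (fun x => 4^-1*(4*expR (4*Lr 0 x)*trap sg sg (1-sg) (expR (4*Lr 0 x))*rho 0 x ^- 2)).
 by apply: itg_scale.
have i3 : itg (fun x => trap sg sg (1-sg) (rho 0 x^+2)).
 by apply: itg_eq i2 => x; rewrite e mulrA mulVf ?mul1r// pnatr_eq0.
split => //; rewrite -Int_scale// -[1-_]subr0 -(radial_integral 0 P).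
by apply: Int_eq => x; rewrite e.
Qed.

Lemma ball4_rho (r : R) x : ball4 r x = (rho 0 x<r^+2) :> Prop.
Proof. by rewrite rhoE subr0. Qed.

Lemma itg_ball4 (r : R) : 0<=r -> itg (\1_(ball4 r)).
Proof.
move=> r0; apply: (itg_indic (r:=r)); first exact: measurable_ball4.
by move=> x bx; rewrite /cube/=; apply: norm_row_bound r0 (ball4_bounded r0 bx).
Qed.

Lemma kappa_le : kappa<=4*omega.
Proof.
have main (sg : R) : 0<sg -> sg<1/4 -> kappa*(1-2*sg)<=4*omega.
 move=> s0 s1; have [i ->]:=kappa_quartic s0 s1; have ab : sg<=1-sg by lra.
 rewrite ler_pM2l// /omega -Int_indic; last exact: measurable_ball4.
 apply: Int_le => //; first exact: itg_ball4.
 move=> x; rewrite indicE; have [b1|b1]:=ltP (rho 0 x) 1.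
  rewrite mem_set; last by rewrite ball4_rho expr1n.
  by have /andP[]:=trap_01 (rho 0 x^+2) s0 ab.
 have [|_ ->]:=@trap_ge _ sg sg (1-sg) (rho 0 x^+2) s0 ab; last by [].
 by nra.
have [k0|k0]:=leP kappa 0; first by apply: le_trans k0 _; rewrite mulr_ge0// omega_ge0.
apply/ler_addgt0Pr => e e0.
pose sg:=Num.min (1/8) (e/(2*kappa)).
have s0 : 0<sg by rewrite lt_min divr_gt0//= divr_gt0// mulr_gt0.
have s1 : sg<1/4 by rewrite gt_min; apply/orP; left; lra.
have s2 : sg<=e/(2*kappa) by rewrite ge_min lexx orbT.
have:=main _ s0 s1; rewrite ler_pdivlMr ?mulr_gt0// in s2.
by lra.
Qed.

(** The trapezoid with [sg = 1/64] equals 1 on the shell between the radii 1/2 and 3/4, which has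
    positive volume. *)
Lemma kappa_gt0 : 0<kappa.
Proof.
have s0 : 0<(1/64 : R) by lra.
have s1 : (1/64 : R)<1/4 by lra.
have [i e]:=kappa_quartic s0 s1.
have b1:=@itg_ball4 (3/4) ltac:(lra); have b2:=@itg_ball4 (1/2) ltac:(lra).
have : Int (\1_(ball4 (3/4)))<=Int (fun x => trap (1/64) (1/64) (1-1/64) (rho 0 x^+2) + \1_(ball4 (1/2)) x).
 apply: Int_le => //; first exact: itg_add.
 move=> x; have ab : (1/64 : R)<=1-1/64 by lra.
 have /andP[t0 _]:=trap_01 (rho 0 x^+2) s0 ab.
 rewrite !indicE; case: (boolP (x \in ball4 (3/4))) => [/set_mem/=|_]; last by pos.
 rewrite ball4_rho => h1; case: (boolP (x \in ball4 (1/2))) => [_|h2]; first by rewrite lerDr.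
 have {}h2 : (1/2)^+2<=rho 0 x by rewrite leNgt; apply: contra h2 => h; rewrite mem_set//= ball4_rho.
 rewrite addr0 trap_mid//.
  by nra.
 by nra.
rewrite Int_add// !Int_indic; [|exact: measurable_ball4|exact: measurable_ball4].
rewrite !Vol_ball4; [|lra|lra].
have:=@omega_gt0 R; move: e; move: kappa (Int _) (@omega R) => k I om; nra.
Qed.

End Radial.

(** * Divergence structure of the curvature densities *)

Section DeriveRules.
Context {R : realType} {n : nat}.
Local Notation E:='rV[R]_n.
Implicit Types (f g : E -> R) (x v : E).

Lemma isd_add f g x v (a b : R) : is_derive x v f a -> is_derive x v g b ->
 is_derive x v (fun y => f y+g y) (a+b).
Proof. by move=> h1 h2; exact: is_deriveD. Qed.

Lemma isd_sub f g x v (a b : R) : is_derive x v f a -> is_derive x v g b ->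
 is_derive x v (fun y => f y-g y) (a-b).
Proof. by move=> h1 h2; exact: is_deriveB. Qed.

Lemma isd_mul f g x v (a b : R) : is_derive x v f a -> is_derive x v g b ->
 is_derive x v (fun y => f y*g y) (a*g x+f x*b).
Proof.
move=> h1 h2; apply: (is_derive_eq (is_deriveM h1 h2)).
by rewrite /GRing.scale/= addrC (mulrC (g x)).
Qed.

Lemma isd_cmul f x v (c a : R) : is_derive x v f a -> is_derive x v (fun y => c*f y) (c*a).
Proof.
move=> h; have h0 : is_derive x v (fun _ : E => c) 0 by exact: is_derive_cst.
by apply: (is_derive_eq (isd_mul h0 h)); rewrite mul0r add0r.
Qed.

Lemma isd_sum m (F : 'I_m -> E -> R) x v (a : 'I_m -> R) : (forall i, is_derive x v (F i) (a i)) ->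
 is_derive x v (fun y => \sum_i F i y) (\sum_i a i).
Proof.
move=> h; have -> : (fun y => \sum_i F i y) = \sum_i F i by apply/funext => y; rewrite fct_sumE.
exact: is_derive_sum.
Qed.

End DeriveRules.

Lemma sum_div_sig2 {R : realType} (h : 'I_4 -> 'I_4 -> R) (p a : 'I_4 -> R) : \sum_i a i = 0 ->
 \sum_i (2^-1*a i+2^-1*(trc h*h i i - \sum_j h i j^+2)
  + 2^-1*(2*(p i*hvec h p i)+nrm2 p*h i i)) = sig2 h p.
Proof.
move=> a0; rewrite !big_split /= -!mulr_sumr a0 sumrB big_split /= -!mulr_sumr.
by rewrite -/(hs2 h) -/(trc h) -/(hpp h p) /sig2; field.
Qed.

Section Fields.
Context {R : realType}.
Local Notation E:='rV[R]_4.
Local Notation e_ i:=(delta_mx 0 i : E).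
Variables (Om : set E) (u : E -> R).
Hypothesis oOm : open Om.
Hypothesis cu : is_Ck 3 Om u.
Implicit Types (x : E) (i j k : 'I_4).

Definition gr x i : R:=partial i u x.
Definition hs x i j : R:=partial j (partial i u) x.
Definition Nf x : R:=nrm2 (gr x).
(** The field of the 4-Laplacian of [u]. *)
Definition Xa i x : R:=Nf x*gr x i.
(** A field with divergence [sig2]. Unlike [Xa] it contains second derivatives of [u]. *)
Definition Vf i x : R:=2^-1*(trc (hs x)*gr x i-hvec (hs x) (gr x) i)+2^-1*(Nf x*gr x i).

Lemma hs_sym x : Om x -> forall i j, hs x i j = hs x j i.
Proof. by move=> Ox i j; apply: is_Ck_schwarz oOm (is_CkW cu) Ox. Qed.

Lemma is_Ck_gr i : is_Ck 2 Om (fun x => gr x i).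
Proof. exact: is_Ck_partial cu. Qed.

Lemma is_Ck_hs i j : is_Ck 1 Om (fun x => hs x i j).
Proof. exact: is_Ck_partial (is_Ck_gr i). Qed.

Lemma is_Ck_Nf : is_Ck 2 Om Nf.
Proof. by apply: is_Ck_sum => // i; apply: is_Ck_exp => //; exact: is_Ck_gr. Qed.

Lemma is_Ck_Xa i : is_Ck 2 Om (Xa i).
Proof. by apply: is_Ck_mul => //; [exact: is_Ck_Nf|exact: is_Ck_gr]. Qed.

Lemma is_Ck_trc : is_Ck 1 Om (fun x => trc (hs x)).
Proof. by apply: is_Ck_sum => // i; exact: is_Ck_hs. Qed.

Lemma is_Ck_hvec i : is_Ck 1 Om (fun x => hvec (hs x) (gr x) i).
Proof.
apply: is_Ck_sum => // j; apply: is_Ck_mul => //; first exact: is_Ck_hs.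
by apply: is_CkW; exact: is_Ck_gr.
Qed.

Lemma is_Ck_hpp : is_Ck 1 Om (fun x => hpp (hs x) (gr x)).
Proof.
apply: is_Ck_sum => // j; apply: is_Ck_mul => //; last exact: is_Ck_hvec.
by apply: is_CkW; exact: is_Ck_gr.
Qed.

Lemma is_Ck_fden : is_Ck 1 Om (fun x => fden (hs x) (gr x)).
Proof.
apply: is_Ck_opp => //; apply: is_Ck_add => //.
 by apply: is_Ck_mul => //; [exact: is_CkW is_Ck_Nf|exact: is_Ck_trc].
by apply: is_Ck_scale => //; exact: is_Ck_hpp.
Qed.

Lemma is_Ck_tden : is_Ck 1 Om (fun x => tden (hs x) (gr x)).
Proof.
apply: is_Ck_sub_fun => //; last first.
 by apply: is_Ck_scale => //; apply: is_Ck_exp => //; exact: is_CkW is_Ck_Nf.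
apply: is_Ck_sub_fun => //; first exact: is_Ck_hpp.
by apply: is_Ck_mul => //; [exact: is_CkW is_Ck_Nf|exact: is_Ck_trc].
Qed.

Lemma is_Ck_Vf i : is_Ck 1 Om (Vf i).
Proof.
apply: is_Ck_add => //; apply: is_Ck_scale => //; last exact: is_CkW (is_Ck_Xa i).
apply: is_Ck_sub_fun => //; last exact: is_Ck_hvec.
by apply: is_Ck_mul => //; [exact: is_Ck_trc|exact: is_CkW (is_Ck_gr i)].
Qed.

Lemma d_gr x i j : Om x -> is_derive x (e_ j) (fun x => gr x i) (hs x i j).
Proof. exact: is_Ck_derivable (is_Ck_gr i). Qed.

Lemma d_hs x i j k : Om x -> is_derive x (e_ k) (fun x => hs x i j) (partial k (fun x => hs x i j) x).
Proof. exact: is_Ck_derivable (is_Ck_hs i j). Qed.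

Lemma d_Nf x j : Om x -> is_derive x (e_ j) Nf (2*hvec (hs x) (gr x) j).
Proof.
move=> Ox; have h i : is_derive x (e_ j) (fun x => gr x i^+2) (2*(hs x i j*gr x i)).
 have -> : (fun x => gr x i^+2) = (fun x => gr x i*gr x i) by [].
 by apply: (is_derive_eq (isd_mul (d_gr i j Ox) (d_gr i j Ox))); ring.
apply: (is_derive_eq (isd_sum h)); rewrite /hvec mulr_sumr.
by apply: eq_bigr => i _; rewrite (hs_sym Ox).
Qed.

Lemma div_Xa x : Om x -> \sum_i partial i (Xa i) x = - fden (hs x) (gr x).
Proof.
move=> Ox; have e i : partial i (Xa i) x = 2*(gr x i*hvec (hs x) (gr x) i)+Nf x*hs x i i.
 by have [_]:=isd_mul (d_Nf i Ox) (d_gr i i Ox); rewrite /partial => ->; ring.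
rewrite (eq_bigr _ (fun i _ => e i)) big_split /= -!mulr_sumr /fden opprK addrC.
by [].
Qed.

Lemma third_sym x i j k : Om x -> partial k (fun x => hs x i j) x = partial j (fun x => hs x i k) x.
Proof. by move=> Ox; apply: is_Ck_schwarz oOm (is_Ck_gr i) Ox. Qed.

Lemma div_Vf x : Om x -> \sum_i partial i (Vf i) x = sig2 (hs x) (gr x).
Proof.
move=> Ox.
have dt i : is_derive x (e_ i) (fun x => trc (hs x)) (\sum_j partial i (fun x => hs x j j) x).
 by apply: isd_sum => j; exact: d_hs.
have dv i : is_derive x (e_ i) (fun x => hvec (hs x) (gr x) i)
  (\sum_j (partial i (fun x => hs x i j) x*gr x j+hs x i j^+2)).
 apply: isd_sum => j.
 apply: (is_derive_eq (isd_mul (d_hs i j i Ox) (d_gr j i Ox))).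
 exact: (congr1 (fun z => _+hs x i j*z) (hs_sym Ox j i)).
have dX i:=isd_mul (d_Nf i Ox) (d_gr i i Ox).
have e i : partial i (Vf i) x = 2^-1*((\sum_j partial i (fun x => hs x j j) x)*gr x i
  - \sum_j partial i (fun x => hs x i j) x*gr x j)
  + 2^-1*(trc (hs x)*hs x i i - \sum_j hs x i j^+2)
  + 2^-1*(2*(gr x i*hvec (hs x) (gr x) i)+Nf x*hs x i i).
 have [_]:=isd_add (isd_cmul 2^-1 (isd_sub (isd_mul (dt i) (d_gr i i Ox)) (dv i))) (isd_cmul 2^-1 (dX i)).
 rewrite /partial => ->; rewrite big_split /=; ring.
rewrite (eq_bigr _ (fun i _ => e i)); apply: sum_div_sig2.
(* What is left are the terms with third derivatives; they cancel by symmetry. *)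
rewrite sumrB; apply/eqP; rewrite subr_eq0; apply/eqP.
rewrite [RHS]exchange_big; apply: eq_bigr => i _; rewrite mulr_suml; apply: eq_bigr => j _.
exact: (congr1 (fun z => z*gr x i) (third_sym j j i Ox)).
Qed.

(** A tensor in first derivatives only, whose divergence is twice the second-order part of [Vf]. *)
Definition Tf i j x : R:=gr x i*gr x j-Nf x*(i == j)%:R.

Lemma is_Ck_Tf i j : is_Ck 2 Om (Tf i j).
Proof.
apply: is_Ck_sub_fun => //; first by apply: is_Ck_mul => //; exact: is_Ck_gr.
by apply: is_Ck_mul => //; [exact: is_Ck_Nf|exact: is_Ck_cst].
Qed.

Lemma div_Tf x i : Om x -> \sum_j partial j (Tf i j) x = trc (hs x)*gr x i-hvec (hs x) (gr x) i.
Proof.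
move=> Ox; have e j : partial j (Tf i j) x = (hs x i j*gr x j+gr x i*hs x j j)-2*hvec (hs x) (gr x) j*(i == j)%:R.
 have d0 : is_derive x (e_ j) (fun _ : E => (i == j)%:R : R) 0 by exact: is_derive_cst.
 have [_]:=isd_sub (isd_mul (d_gr i j Ox) (d_gr j j Ox)) (isd_mul (d_Nf j Ox) d0).
 by rewrite /partial => ->; rewrite mulr0 addr0.
rewrite (eq_bigr _ (fun j _ => e j)) sumrB big_split /= -mulr_sumr.
have -> : \sum_j 2*hvec (hs x) (gr x) j*(i == j)%:R = 2*hvec (hs x) (gr x) i.
 move: (hvec _ _) => w; rewrite (bigD1 i) //= eqxx mulr1 big1 ?addr0 // => j ji.
 by rewrite eq_sym (negbTE ji) mulr0.
rewrite -/(trc (hs x)) -/(hvec (hs x) (gr x) i).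
by lra.
Qed.

(** A second integration by parts moves the remaining derivative from [u] to the test field [g], so
    that only first derivatives of [u] occur. Near a conic end these are all that the energy
    estimate controls. *)
Lemma Vf_flux (g : 'I_4 -> E -> R) r : (forall i x, r < `|x| -> g i x = 0) ->
 (forall i x, (C1at (g i) x /\ Om x) \/ (\forall y \near x, g i y = 0)) ->
 [/\ Cc (fun x => \sum_i g i x*Vf i x), Cc (fun x => \sum_i g i x*Xa i x),
   Cc (fun x => \sum_i \sum_j partial j (g i) x*Tf i j x) &
 Int (fun x => \sum_i g i x*Vf i x) = - 2^-1*Int (fun x => \sum_i \sum_j partial j (g i) x*Tf i j x)
  + 2^-1*Int (fun x => \sum_i g i x*Xa i x)].
Proof.
move=> gr0 H.
have ccg (Y : 'I_4 -> E -> R) : (forall i, is_Ck 1 Om (Y i)) -> Cc (fun x => \sum_i g i x*Y i x).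
 move=> cY; apply: (@Cc_intro _ _ r) => [x xr|x]; first by rewrite big1// => i; rewrite gr0 ?mul0r.
 left; apply: cont_sum => i; have [[c1 Ox]|h]:=H i x.
  by apply: cont_mul; [exact: (C1at_cont c1)|exact: is_Ck_cont (cY i) Ox].
 apply: (@cont_near_eq _ _ (fun=> 0)); last exact: cont_cst.
 by apply: filterS h => y ->; rewrite mul0r.
have ccV:=ccg Vf is_Ck_Vf; have ccX:=ccg Xa (fun i => is_CkW (is_Ck_Xa i)).
have D i : [/\ Cc (fun x => \sum_j partial j (g i) x*Tf i j x), Cc (fun x => g i x * \sum_j partial j (Tf i j) x) &
  Int (fun x => \sum_j partial j (g i) x*Tf i j x) = - Int (fun x => g i x * \sum_j partial j (Tf i j) x)].
 apply: (@divergence_thm _ _ _ r); first exact: gr0.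
 move=> x; have [[c1 Ox]|h]:=H i x; [left|by right]; split; first exact: c1.
 by move=> j; exact: is_Ck_C1at oOm (is_CkW (is_Ck_Tf i j)) Ox.
have ccT : Cc (fun x => \sum_i \sum_j partial j (g i) x*Tf i j x).
 split; last by exists r => x xr; rewrite big1// => i _; rewrite big1// => j _; rewrite (partial_far j (gr0 i)) ?mul0r.
 by move=> x; apply: cont_sum => i; have [[c _] _ _]:=D i; exact: c.
split => //.
have iT i : itg (fun x => \sum_j partial j (g i) x*Tf i j x) by have [c _ _]:=D i; exact: itg_Cc.
have iW i : itg (fun x => g i x * \sum_j partial j (Tf i j) x) by have [_ c _]:=D i; exact: itg_Cc.
rewrite (Int_sum _ _ iT) (eq_bigr (fun i => - Int (fun x => g i x * \sum_j partial j (Tf i j) x))); last by move=> i _; have [_ _ ->]:=D i.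
rewrite sumrN mulrNN -(Int_sum _ _ iW) -(Int_scale _ (itg_sum _ _ iW)) -(Int_scale _ (itg_Cc ccX)).
rewrite -Int_add; [|exact: itg_scale (itg_sum _ _ iW)|exact: itg_scale (itg_Cc ccX)].
apply: Int_eq => x; rewrite !mulr_sumr -big_split /=; apply: eq_bigr => i _.
have [[c1 Ox]|h]:=H i x; last by rewrite (nbhs_singleton h) !mul0r !mulr0 addr0.
by rewrite div_Tf// /Vf /Xa; ring.
Qed.

End Fields.

(** * Energy estimate and masses at a conic end *)

Section EndScalars.
Context {R : realType}.
Implicit Types (q al D y v t k b : R).

(** The gradient [a] is split into its model part [q e], where [e] is the radial unit vector, and
    the deviation [d], whose radial component is [al]. *)
Lemma split_sums (a e : 'I_4 -> R) q : nrm2 e = 1 ->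
 let d:=fun i => a i-q*e i in let al:=\sum_i d i*e i in
 [/\ \sum_i a i*e i = q+al, nrm2 a = q^+2+2*q*al+nrm2 d,
   \sum_i a i*d i = q*al+nrm2 d & al^+2<=nrm2 d].
Proof.
move=> e1 d al.
have aE i : a i = q*e i+d i by rewrite /d; ring.
have e1' : \sum_i e i^+2 = 1 by [].
split.
- have -> : q+al = q * \sum_i e i^+2+al by rewrite e1' mulr1.
 rewrite mulr_sumr /al -big_split; apply: eq_bigr => i _ /=.
 by rewrite [a i]aE; ring.
- have -> : q^+2+2*q*al+nrm2 d = q^+2 * \sum_i e i^+2+2*q*al+nrm2 d by rewrite e1' mulr1.
 rewrite /al /nrm2 !mulr_sumr -!big_split; apply: eq_bigr => i _ /=.
 by rewrite [a i]aE; ring.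
- rewrite /al /nrm2 mulr_sumr -big_split; apply: eq_bigr => i _ /=.
 by rewrite [a i]aE; ring.
- have : 0<=nrm2 (fun i => d i-al*e i) by exact: nrm2_ge0.
 have -> : nrm2 (fun i => d i-al*e i) = nrm2 d-2*al*(\sum_i d i*e i)+al^+2 * \sum_i e i^+2.
  have [a0 a0E] : exists a0, a0 = al by exists al.
  rewrite -a0E /nrm2 !mulr_sumr -sumrN -!big_split /=; apply: eq_bigr => i _; ring.
 by rewrite e1' -/al => h; rewrite -subr_ge0; move: h; congr (0<=_); ring.
Qed.

(** Strong monotonicity of the field [|a|^2 a]: its increment from [q e], paired with the deviation,
    is at least a quarter of the fourth power of the deviation. *)
Lemma coercive_scalar q al D : al^+2<=D ->
 D^+2/4<=(q^+2+2*q*al+D)*(q*al+D)-q^+3*al.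
Proof.
move=> h; rewrite -subr_ge0.
have -> : (q^+2+2*q*al+D)*(q*al+D)-q^+3*al-D^+2/4 =
 3/4*(D+2*q*al)^+2+q^+2*(D-al^+2) by lra.
by pos.
Qed.

(** The radial component of [|a|^2 a - q^3 e] in the notation of [split_sums]. *)
Definition errf q al D:=(q^+2+2*q*al+D)*(q+al)-q^+3.

Lemma sqrt_bound al D : al^+2<=D -> `|al| <= Num.sqrt D /\ Num.sqrt D^+2 = D.
Proof.
move=> h; have D0 : 0<=D by apply: le_trans h; exact: sqr_ge0.
by rewrite sqr_sqrtr// -sqrtr_sqr ler_wsqrtr.
Qed.

Lemma errf_bound b y al D d : 0<=y -> al^+2<=D -> d = Num.sqrt D ->
 `|y*errf (b*y) al D| <= (3*b^+2+3 * `|b| + 1)*(y^+3*d+y^+2*d^+2+y*d^+3).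
Proof.
move=> y0 h dE; have [ad dD] : `|al| <= d /\ d^+2 = D by rewrite dE; exact: sqrt_bound h.
have d0 : 0<=d by rewrite dE.
have -> : y*errf (b*y) al D = 3*b^+2*(y^+3*al)+(2*b*(y^+2*al^+2)+b*(y^+2*D))+y*(al*D).
 by rewrite /errf; ring.
have b2:=sqr_ge0 b; have bn:=normr_ge0 b.
have t1 : `|3*b^+2*(y^+3*al)| <= 3*b^+2*(y^+3*d).
 have b3 : 0<=3*b^+2 by lra.
 rewrite (normrM (3*b^+2)) (normrM (y^+3)) (ger0_norm b3) (ger0_norm (exprn_ge0 3 y0)).
 apply: ler_wpM2l => //.
 by apply: ler_wpM2l => //; exact: exprn_ge0.
have t2 : `|2*b*(y^+2*al^+2)+b*(y^+2*D)| <= 3 * `|b| * (y^+2*d^+2).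
 rewrite dD; have -> : 2*b*(y^+2*al^+2)+b*(y^+2*D) = b*(y^+2*(2*al^+2+D)) by ring.
 have a0:=sqr_ge0 al; have D0 : 0<=D by lra.
 rewrite (normrM b) (normrM (y^+2)) (ger0_norm (exprn_ge0 2 y0)) (ger0_norm (_ : 0<=2*al^+2+D)); last by lra.
 have -> : 3 * `|b| * (y^+2*D) = `|b| * (y^+2*(3*D)) by ring.
 apply: ler_wpM2l => //; apply: ler_wpM2l; first exact: sqr_ge0.
 by lra.
have t3 : `|y*(al*D)| <= y*d^+3.
 rewrite (normrM y) (normrM al) (ger0_norm y0) -dD (ger0_norm (sqr_ge0 d)) [d^+3]exprS.
 by apply: ler_wpM2l => //; apply: ler_wpM2r => //; exact: sqr_ge0.
apply: le_trans (ler_normD _ _) _; apply: (le_trans (lerD (ler_normD _ _) (lexx _))).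
have p1 : 0<=y^+3*d by pos.
have p2 : 0<=y^+2*d^+2 by pos.
have p3 : 0<=y*d^+3 by rewrite mulr_ge0// exprn_ge0.
by nra.
Qed.

Lemma quartic p q : q^+3 * p+q^+2 * p^+2+q * p^+3<=3*(p^+4+q^+4).
Proof.
have:=sqr_ge0 (q^+2-q * p); have:=sqr_ge0 (p^+2-q * p); have:=sqr_ge0 (q^+2-p^+2).
by nra.
Qed.

Lemma young_scalar (k : R) : 0<=k -> exists2 C, 0<=C & forall v y t, 0<=v -> 0<=y -> 0<=t<=4 ->
 k*t*(y^+3*v+y^+2*v^+2+y*v^+3)<=v^+4/8+C*(t*y^+4).
Proof.
(* The substitution [v = L w] makes the quartic term in [v] large; [L >= 96k] is what [12k <= L/8]
   requires for it to absorb the mixed terms. *)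
move=> k0; have [L LE] : exists L, L = 96*k+1 by eexists.
have L1 : 1<=L by lra.
exists (3*k*L^+3); first by pos.
move=> v y t v0 y0 /andP[t0 t4]; pose w:=v/L; have w0 : 0<=w by rewrite divr_ge0//; lra.
have -> : v = L*w by rewrite mulrC divfK//; lra.
have P1 : 0<=y^+3*w by pos.
have P2 : 0<=y^+2*w^+2 by pos.
have h1 : y^+3*(L*w)+y^+2*(L*w)^+2+y*(L*w)^+3<=L^+3*(3*(w^+4+y^+4)).
 apply: le_trans (ler_wpM2l _ (quartic w y)); last by pos.
 have L2 : L<=L^+2 by rewrite ler_eXnr.
 have L3 : L^+2<=L^+3 by rewrite ler_weXn2l.
 by nra.
have kt : 0<=k*t by pos.
apply: le_trans (ler_wpM2l kt h1) _.
have : 12*k*(L^+3*w^+4)<=L/8*(L^+3*w^+4) by apply: ler_wpM2r; [pos|lra].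
by nra.
Qed.

End EndScalars.

Section Profiles.
Context {R : realType}.
Implicit Types (phi dphi : R -> R).

Lemma profile_neg phi dphi (A B s1 s2 : R) : profile phi dphi A B s1 s2 ->
 profile (fun s => phi (- s)) (fun s => - dphi (- s)) B A (- s2) (- s1).
Proof.
move=> P; split.
- move=> s; have h : is_derive s 1 (fun s : R => - s) (-1) by apply: is_derive_eq.
 by have:=@is_derive_comp1 R R phi (fun s : R => - s) s 1 _ _ (prof_der P (- s)) h; rewrite mulrN1.
- move=> s; apply: cont_opp; apply: cont_comp; first exact: prof_cont P _.
 by apply: cont_opp; exact: cvg_id.
- by move=> s h; have [|-> ->]:=prof_hi P (s:=- s); [lra|rewrite oppr0].
- by move=> s h; have [|-> ->]:=prof_lo P (s:=- s); [lra|rewrite oppr0].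
Qed.

Lemma profile_scale phi dphi (A B s1 s2 k m : R) : 0<m -> profile phi dphi A B s1 s2 ->
 profile (fun s => phi ((s-k)/m)) (fun s => dphi ((s-k)/m)/m) A B (m*s1+k) (m*s2+k).
Proof.
move=> m0 P; split.
- move=> s; have h : is_derive s 1 (fun s : R => (s-k)/m) m^-1.
  by apply: is_derive_eq; rewrite /GRing.scale/=; ring.
 exact: (@is_derive_comp1 R R phi (fun s : R => (s-k)/m) s 1 _ _ (prof_der P _) h).
- move=> s; apply: cont_mul; last exact: cont_cst.
 apply: cont_comp; first exact: prof_cont P _.
 apply: cont_mul; last exact: cont_cst.
 by apply: cont_sub; [exact: cvg_id|exact: cont_cst].
- move=> s h; have [|-> ->]:=prof_lo P (s:=(s-k)/m); last by lra.
 by rewrite ler_pdivrMr//; lra.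
- move=> s h; have [|-> ->]:=prof_hi P (s:=(s-k)/m); last by lra.
 by rewrite ler_pdivlMr//; lra.
Qed.

Lemma profile_shift phi dphi (A B s1 s2 k : R) : profile phi dphi A B s1 s2 ->
 profile (fun s => phi (s-k)) (fun s => dphi (s-k)) A B (s1+k) (s2+k).
Proof.
move=> P; have:=profile_scale k ltr01 P; rewrite !mul1r.
have -> : (fun s => phi ((s-k)/1)) = (fun s => phi (s-k)) by apply/funext => s; rewrite divr1.
by have -> : (fun s => dphi ((s-k)/1)/1) = (fun s => dphi (s-k)) by apply/funext => s; rewrite !divr1.
Qed.

Lemma profile_sub f df g dg (A B A' B' s1 s2 s1' s2' : R) : profile f df A B s1 s2 -> profile g dg A' B' s1' s2' ->
 profile (fun s => f s-g s) (fun s => df s-dg s) (A-A') (B-B') (Num.min s1 s1') (Num.max s2 s2').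
Proof.
move=> P Q; split.
- by move=> s; exact: (is_deriveB (prof_der P s) (prof_der Q s)).
- by move=> s; apply: cont_sub; [exact: prof_cont P s|exact: prof_cont Q s].
- by move=> s; rewrite le_min => /andP[/(prof_lo P)[-> ->] /(prof_lo Q)[-> ->]]; rewrite subr0.
- by move=> s; rewrite ge_max => /andP[/(prof_hi P)[-> ->] /(prof_hi Q)[-> ->]]; rewrite subr0.
Qed.

Lemma radial_end (c : 'rV[R]_4) (sg : R) phi dphi (A B s1 s2 : R) : sg = 1 \/ sg = -1 ->
 profile phi dphi A B s1 s2 ->
 Cc (fun x => dphi (sg*Lr c x)*rho c x ^- 2) /\
 Int (fun x => dphi (sg*Lr c x)*rho c x ^- 2) = kappa*(B-A).
Proof.
move=> sE P; case: sE => ->.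
 have e : (fun x => dphi (1*Lr c x)*rho c x ^- 2) = (fun x => dphi (Lr c x)*rho c x ^- 2).
  by apply/funext => x; rewrite mul1r.
 by rewrite e (radial_integral c P) kapE; split => //; exact: Cc_radial P.
have Q:=profile_neg P; have cc:=Cc_radial c Q; have ii:=radial_integral c Q.
have e : (fun x => dphi (-1*Lr c x)*rho c x ^- 2) = (fun x => -1*(- dphi (- Lr c x)*rho c x ^- 2)).
 by apply/funext => x; rewrite mulN1r; ring.
split; last by rewrite e Int_scale ?ii ?kapE; [ring|exact: itg_Cc].
rewrite e; have [c1 [r cr]]:=cc; split; last by exists r => x /cr ->; rewrite mulr0.
by move=> x; apply: cont_mul; [exact: cont_cst|exact: c1].
Qed.

End Profiles.

Lemma energy_arith (R : realType) (A B k C1 : R) : A<=0 -> 8^-1*B<=A+C1*(2*k) -> B<=16*C1*k.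
Proof. by move=> *; lra. Qed.

Notation pairing G X:=(fun x => \sum_j G j x*X j x).
Notation dpairing z X:=(fun x => \sum_j partial j z x*X j x).

Definition mass_bound {R : realType} (G X : 'I_4 -> 'rV[R]_4 -> R) (C v : R) :=
 Cc (pairing G X) /\ `|Int (pairing G X)-v| <= C.

Section End.
Context {R : realType}.
Local Notation E:='rV[R]_4.
Local Notation e_ i:=(delta_mx 0 i : E).
Variables (Om : set E) (u : E -> R) (c : E) (b sg s0 M : R).
Hypothesis oOm : open Om.
Hypothesis cu : is_Ck 3 Om u.
Hypothesis sgE : sg = 1 \/ sg = -1.
Hypothesis s0_ge0 : 0<=s0.
Hypothesis fd0 : forall x, Om x -> 0<=fden (hs u x) (gr u x).
Hypothesis HE : forall x, x != c -> s0<sg*Lr c x -> Om x /\ `|u x-b*Lr c x| <= M.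
Implicit Types (x : E) (i j : 'I_4).

(** Large towards the end in both cases: [sg] is -1 at a finite point and 1 at infinity. *)
Definition ell x:=sg*Lr c x.
Definition endset : set E:=[set x | x != c /\ s0<ell x].
Definition yy x : R:=Num.sqrt (rho c x)^-1.
Definition ev x i : R:=zc c i x*yy x.
Definition dd x i : R:=gr u x i-b*yy x*ev x i.
Definition al x : R:=\sum_i dd x i*ev x i.
Definition D2 x : R:=nrm2 (dd x).
(** Shifted by [M] so as to be nonpositive on the end: paired with [fden >= 0], it contributes to
    the energy estimate with a favourable sign. *)
Definition ww x : R:=u x-b*Lr c x-M.

Lemma M_ge0 x : endset x -> 0<=M.
Proof. by move=> [xc h]; have [_]:=HE xc h; apply: le_trans. Qed.

Lemma sg2 : sg^+2 = 1.
Proof. by case: sgE => ->; rewrite ?sqrrN expr1n. Qed.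

Lemma sg_norm : `|sg| = 1.
Proof. by case: sgE => ->; rewrite ?normrN normr1. Qed.

Lemma yy_ge0 x : 0<=yy x.
Proof. exact: sqrtr_ge0. Qed.

Lemma yy2 x : yy x^+2 = (rho c x)^-1.
Proof. by rewrite sqr_sqrtr// invr_ge0 rho_ge0. Qed.

Lemma yy4 x : rho c x ^- 2 = yy x^+4.
Proof. by rewrite -[4%N]/(2*2)%N exprM yy2 exprVn. Qed.

Lemma zc_rho i x : zc c i x/rho c x = yy x*ev x i.
Proof. by rewrite -yy2 /ev; ring. Qed.

Lemma ev1 x : x != c -> nrm2 (ev x) = 1.
Proof.
move=> xc; have r1:=lt0r_neq0 (rho_gt0 xc).
rewrite /nrm2 /ev (eq_bigr (fun i => yy x^+2*zc c i x^+2)); last by move=> i _; ring.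
by rewrite -mulr_sumr yy2 mulVf.
Qed.

Lemma dd_split x : x != c ->
 [/\ \sum_i gr u x i*ev x i = b*yy x+al x, Nf u x = (b*yy x)^+2+2*(b*yy x)*al x+D2 x,
   \sum_i gr u x i*dd x i = b*yy x*al x+D2 x & al x^+2<=D2 x].
Proof. by move=> xc; have:=split_sums (gr u x) (b*yy x) (ev1 xc). Qed.

Lemma ell_cont x : x != c -> cts ell x.
Proof. by move=> xc; apply: cont_mul; [exact: cont_cst|exact: is_Ck_cont (is_Ck_Lr 0 c) xc]. Qed.

Lemma near_ell_lt (s : R) x : x != c -> ell x<s -> \forall y \near x, ell y<s.
Proof.
move=> xc h; have:=@cvgr_lt _ _ _ _ _ _ (ell_cont xc) s h.
exact.
Qed.

Lemma near_ell_gt (s : R) x : x != c -> s<ell x -> \forall y \near x, s<ell y.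
Proof.
move=> xc h; have:=@cvgr_gt _ _ _ _ _ _ (ell_cont xc) s h.
exact.
Qed.

Lemma open_endset : open endset.
Proof.
rewrite openE => x [xc h]; have n1:=near_ell_gt xc h.
have n2 : nbhs x (punct c):=open_nbhs_nbhs (conj (@open_punct R c) xc).
by apply: filterS2 n2 n1 => y yc hy; split.
Qed.

Lemma endset_Om x : endset x -> Om x.
Proof. by move=> [xc h]; have []:=HE xc h. Qed.

Lemma ell_c : ell c = 0.
Proof. by rewrite /ell /Lr rho_cc ln0// mul0r mulr0. Qed.

Lemma near_center (s1 s2 : R) : 0<s1 -> \forall x \near c, x = c \/ ell x<s1 \/ s2<ell x.
Proof.
move=> s10; case: sgE => sE.
 have:=Lr_near c s1; apply: filterS => x h; have [->|xc]:=eqVneq x c; first by left.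
 by right; left; rewrite /ell sE mul1r; exact: h.
have:=Lr_near c (- s2); apply: filterS => x h; have [->|xc]:=eqVneq x c; first by left.
by right; right; rewrite /ell sE mulN1r ltrNr; exact: h.
Qed.

Lemma ell_far (s1 s2 : R) : exists r : R, forall x, r < `|x| -> ell x<=s1 \/ s2<=ell x.
Proof.
case: sgE => sE.
 by exists (`|c| + expR s2) => x /Lr_far[_ h]; right; rewrite /ell sE mul1r ltW.
by exists (`|c| + expR (- s1)) => x /Lr_far[_ h]; left; rewrite /ell sE mulN1r lerNl ltW.
Qed.

Section CompactProfile.
Variables (phi dphi : R -> R) (s1 s2 : R).
Hypothesis P : profile phi dphi 0 0 s1 s2.
Hypothesis s10 : s0<s1.

Lemma phi_ell_near0 x : ~ endset x -> \forall y \near x, phi (ell y) = 0 /\ dphi (ell y) = 0.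
Proof.
move=> nD; have s1p : 0<s1 by exact: le_lt_trans s10.
have lo y : ell y<=s1 -> phi (ell y) = 0 /\ dphi (ell y) = 0 by move=> h; exact: (prof_lo P h).
have hi y : s2<=ell y -> phi (ell y) = 0 /\ dphi (ell y) = 0 by move=> h; exact: (prof_hi P h).
have [->|xc]:=eqVneq x c.
 have:=near_center s2 s1p; apply: filterS => y [->|[h|h]].
 - by apply: lo; rewrite ell_c ltW.
 - by apply: lo; exact: ltW.
 - by apply: hi; exact: ltW.
have h : ell x<=s0 by rewrite leNgt; apply/negP => h; apply: nD.
have:=near_ell_lt xc (le_lt_trans h s10); apply: filterS => y hy.
by apply: lo; exact: ltW.
Qed.

Lemma phi_ell_far : exists r : R, forall x, r < `|x| -> phi (ell x) = 0 /\ dphi (ell x) = 0.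
Proof.
by have [r H]:=ell_far s1 s2; exists r => x /H[/(prof_lo P)|/(prof_hi P)].
Qed.

Lemma is_Ck_phi_ell : is_Ck 1 endset (fun x => phi (ell x)).
Proof.
have oD:=open_endset; apply: is_Ck1_comp1 => //; [exact: prof_der P|exact: prof_cont P|].
apply: is_Ck_scale => //; apply: (is_Ck_sub _ (is_Ck_Lr 1 c)) => x; by case.
Qed.

Lemma d_phi_ell x i : x != c -> is_derive x (e_ i) (fun x => phi (ell x)) (dphi (ell x)*(sg*(yy x*ev x i))).
Proof.
move=> xc; have h:=is_derive_Lr i xc; rewrite zc_rho in h.
exact: (is_derive_comp1 (prof_der P (ell x)) (isd_cmul sg h)).
Qed.

End CompactProfile.

Section Energy.
Variable S : R.
Hypothesis S1 : s0<S-1.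

(** Equal to 1 on [[S, 2S]] and supported in [[S-1, 2S+1]]. The two transition layers have width 1
    in [log r], so the bound [DZf] of the derivative has integral [2 kappa] for every [S]. *)
Definition Zf (s : R):=th (s-(S-1))-th (s-2*S).
Definition dZf (s : R):=dth (s-(S-1))-dth (s-2*S).
Definition DZf (s : R):=dth (s-(S-1))+dth (s-2*S).

Lemma profile_Z : profile Zf dZf 0 0 (S-1) (2*S+1).
Proof.
have SS : S-1<=2*S by have:=s0_ge0; move: S1; lra.
have P:=profile_sub (profile_shift (S-1) (@profile_th R)) (profile_shift (2*S) (@profile_th R)).
split; [exact: prof_der P|exact: prof_cont P| |].
- move=> s h; have hs : s<=Num.min (0+(S-1)) (0+2*S) by rewrite le_min !add0r h (le_trans h).
 by have [e1 e2]:=prof_lo P hs; rewrite subrr in e1.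
- move=> s h; have hs : Num.max (1+(S-1)) (1+2*S)<=s by rewrite ge_max; apply/andP; split; lra.
 by have [e1 e2]:=prof_hi P hs; rewrite subrr in e1.
Qed.

Lemma Zf_01 s : 0<=Zf s<=1.
Proof.
have SS : S-1<=2*S by have:=s0_ge0; move: S1; lra.
have /andP[a1 a2]:=th_01 (s-(S-1)); have /andP[b1 b2]:=th_01 (s-2*S).
have m:=@th_mono R (s-2*S) (s-(S-1)) ltac:(lra).
by rewrite /Zf; apply/andP; split; lra.
Qed.

Lemma Zf_1 s : S<=s<=2*S -> Zf s = 1.
Proof.
move=> /andP[h1 h2]; rewrite /Zf; have [-> _ _]:=@th_ge1 R (s-(S-1)) ltac:(lra).
by have [-> _ _]:=@th_le0 R (s-2*S) ltac:(lra); rewrite subr0.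
Qed.

Lemma dZf_bound s : `|dZf s| <= DZf s /\ 0<=DZf s<=4.
Proof.
have [/andP[a1 a2] _]:=dth_bounds (s-(S-1)); have [/andP[b1 b2] _]:=dth_bounds (s-2*S).
by rewrite /dZf /DZf ler_norml; split; apply/andP; split; lra.
Qed.

Lemma Int_DZ : Cc (fun x => DZf (ell x)*rho c x ^- 2) /\ Int (fun x => DZf (ell x)*rho c x ^- 2) = 2*kappa.
Proof.
have [c1 i1]:=radial_end c sgE (profile_shift (S-1) (@profile_th R)).
have [c2 i2]:=radial_end c sgE (profile_shift (2*S) (@profile_th R)).
have e x : DZf (ell x)*rho c x ^- 2 = dth (sg*Lr c x-(S-1))*rho c x ^- 2+dth (sg*Lr c x-2*S)*rho c x ^- 2.
 by rewrite /DZf mulrDl.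
split.
 have [k1 [r1 h1]]:=c1; have [k2 [r2 h2]]:=c2.
 apply: (@Cc_intro _ _ (Num.max r1 r2)) => [x|x].
  by rewrite gt_max => /andP[q1 q2]; rewrite e h1// h2// addr0.
 by left; rewrite (_ : (fun x => _) = (fun x => dth (sg*Lr c x-(S-1))*rho c x ^- 2+dth (sg*Lr c x-2*S)*rho c x ^- 2)); [apply: cont_add; [exact: k1|exact: k2]|apply/funext => y; exact: e].
rewrite (Int_eq e) Int_add; [|exact: itg_Cc|exact: itg_Cc].
by rewrite i1 i2; ring.
Qed.

(** The fourth power leaves a factor [Z^3] next to the gradient of the cut-off, enough for Young's
    inequality to absorb mixed terms of degree at most 3 in the deviation. *)
Definition etaS x:=Zf (ell x)^+4*ww x.

Lemma is_Ck_ww : is_Ck 1 endset ww.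
Proof.
have oD:=open_endset; apply: is_Ck_sub_fun => //; last exact: is_Ck_cst.
apply: is_Ck_sub_fun => //.
 exact: is_Ck_sub endset_Om (is_CkW (is_CkW cu)).
by apply: is_Ck_scale => //; apply: (is_Ck_sub _ (is_Ck_Lr 1 c)) => x; case.
Qed.

Lemma etaS_cases x : (endset x /\ C1at etaS x) \/ (\forall y \near x, etaS y = 0).
Proof.
have oD:=open_endset; have [Dx|nD]:=pselect (endset x).
 have c4 : is_Ck 1 endset etaS.
  apply: (is_Ck_mul oD _ is_Ck_ww).
  exact: (is_Ck_exp 4 oD (is_Ck_phi_ell profile_Z)).
 by left; split => //; exact: (is_Ck_C1at oD c4 Dx).
right; have:=phi_ell_near0 profile_Z S1 nD; apply: filterS => y [h _].
by rewrite /etaS h expr0n mul0r.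
Qed.

Lemma partial_etaS x i : endset x ->
 partial i etaS x = 4*Zf (ell x)^+3*dZf (ell x)*sg*ww x*yy x*ev x i+Zf (ell x)^+4*dd x i.
Proof.
move=> Dx; have [xc _]:=Dx.
have h1:=d_phi_ell profile_Z i xc.
have h4:=@is_derive_comp1 R _ (fun y : R => y^+4) (fun x => Zf (ell x)) x (e_ i) _ _ (is_derive_expn 3 (Zf (ell x))) h1.
have hw : is_derive x (e_ i) ww (dd x i).
 have hL:=is_derive_Lr i xc; rewrite zc_rho in hL.
 have hu : is_derive x (e_ i) u (gr u x i) by exact: is_Ck_derivable cu (endset_Om Dx).
 have hM : is_derive x (e_ i) (fun _ : E => M) 0 by exact: is_derive_cst.
 by apply: (is_derive_eq (isd_sub (isd_sub hu (isd_cmul b hL)) hM)); rewrite subr0 mulrA.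
have [_]:=isd_mul h4 hw; rewrite -/(partial i _ x) => ->.
by move: (Zf _) (dZf _) (ww x) (yy x) (ev x i) (dd x i) => z dz w y e d; ring.
Qed.

Lemma radial_field_E x i : zc c i x*rho c x ^- 2 = yy x^+3*ev x i.
Proof. by rewrite yy4 /ev; ring. Qed.

End Energy.

Local Notation ZD S:=(fun x => Zf S (ell x)^+4*D2 x^+2).

Local Notation mix y d:=(y^+3*d+y^+2*d^+2+y*d^+3).

(** Where the gradient falls on [ww], strong monotonicity yields a quarter of [D2^2]. Where it falls
    on the cut-off, the mixed terms cost half of that and a multiple of [r^-4] on the transition
    layers. *)
Lemma energy_pointwise : exists2 C1 : R, 0<=C1 & forall S x, s0<S-1 ->
 Zf S (ell x)^+4*D2 x^+2/8 <=
 \sum_i partial i (etaS S) x*(Xa u i x-b^+3*(zc c i x*rho c x ^- 2))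
 + C1*(DZf S (ell x)*rho c x ^- 2).
Proof.
have Mc : 0<=Num.max M 0 by rewrite le_max lexx orbT.
have k0 : 0<=8*Num.max M 0*(3*b^+2+3 * `|b| + 1).
 by rewrite mulr_ge0 ?mulr_ge0// !addr_ge0// mulr_ge0// sqr_ge0.
have [C1 C10 Y]:=young_scalar k0; exists C1 => // S x S1.
have [dZ1 /andP[DZ0 DZ4]]:=dZf_bound S (ell x).
have [Dx|nD]:=pselect (endset x); last first.
 have h:=phi_ell_near0 (profile_Z S1) S1 nD.
 have [z0 _]:=nbhs_singleton h.
 rewrite z0 expr0n !mul0r big1 ?add0r; first by rewrite !mulr_ge0// invr_ge0 exprn_ge0// rho_ge0.
 move=> i _; have e0 : \forall y \near x, etaS S y = 0 by apply: filterS h => y [h' _]; rewrite /etaS h' expr0n mul0r.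
 by rewrite (nbhs_singleton (near0_partial i e0)) mul0r.
have [xc _]:=Dx; have [s1 s2 s3 s4]:=dd_split xc.
have Mx:=M_ge0 Dx.
have wb : `|ww x| <= 2*M.
 have [_]:=HE xc (proj2 Dx); rewrite /ww; move: (u x-_) => q; rewrite !ler_norml => /andP[? ?].
 by apply/andP; split; lra.
(* The two summands collect the gradient of the cut-off and the gradient of [ww], the latter being
   the coercive part. *)
have -> : \sum_i partial i (etaS S) x*(Xa u i x-b^+3*(zc c i x*rho c x ^- 2)) =
 4*Zf S (ell x)^+3*dZf S (ell x)*sg*ww x*(yy x*errf (b*yy x) (al x) (D2 x))
 + Zf S (ell x)^+4*(Nf u x * \sum_i gr u x i*dd x i-(b*yy x)^+3*al x).
 rewrite /errf -s2 -s1 /al.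
 have [q3 qE] : exists q3, q3 = (b*yy x)^+3 by eexists.
 rewrite -qE; have -> : Nf u x*(\sum_i gr u x i*ev x i)-q3 = \sum_i (Nf u x*(gr u x i*ev x i)-q3*ev x i^+2).
  by rewrite sumrB -!mulr_sumr -/(nrm2 (ev x)) ev1// mulr1.
 rewrite !mulr_sumr -!sumrB !mulr_sumr -big_split /=; apply: eq_bigr => i _.
 rewrite (partial_etaS S1)// radial_field_E /Xa qE.
 move: (Zf _ _) (dZf _ _) (ww x) (yy x) (ev x i) (dd x i) (Nf u x) (gr u x i) => z dz w y e d N g; ring.
rewrite s3 s2 yy4.
have co:=coercive_scalar (b*yy x) s4.
have [d dE] : exists d, d = Num.sqrt (D2 x) by eexists.
have eb:=errf_bound b (yy_ge0 x) s4 dE.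
have [_ d2]:=sqrt_bound s4; rewrite -dE in d2.
have d0 : 0<=d by rewrite dE sqrtr_ge0.
have /andP[z0 z1]:=Zf_01 S1 (ell x).
have y0:=yy_ge0 x.
have:=Y (Zf S (ell x)*d) (yy x) (DZf S (ell x)) (mulr_ge0 z0 d0) y0.
rewrite DZ0 DZ4 => /(_ isT).
have MM : Num.max M 0 = M by apply/max_idPl.
rewrite MM in k0 *.
have sgn:=sg_norm.
move: co eb dZ1 DZ0 DZ4 wb; rewrite -d2.
move: (Zf S (ell x)) (dZf S (ell x)) (DZf S (ell x)) (ww x) (yy x) (al x) z0 z1 y0 => z dz t w y a z0 z1 y0.
move: (errf _ _ _) => er.
set B:=3*b^+2+3 * `|b| + 1 in k0 *; set F:=(_+_)*(_+_)-_; clearbody F B.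
move=> co eb dZ1 DZ0 DZ4 wb Yv.
have z4 : 0<=z^+4 by exact: exprn_ge0.
have t1 : z^+4*((d^+2)^+2/4)<=z^+4*F by apply: ler_wpM2l.
have B0 : 0<=B*(mix y d) by apply: le_trans eb.
have t2 : `|4*z^+3*dz*sg*w*(y*er)| <= 8*M*t*(z^+3*(B*(mix y d))).
 have -> : 4*z^+3*dz*sg*w*(y*er) = 4*z^+3*sg*(dz*(w*(y*er))) by ring.
 have -> : 8*M*t*(z^+3*(B*(mix y d))) = 4*z^+3*1*(t*(2*M*(B*(mix y d)))) by ring.
 have z3 : 0<=4*z^+3 by rewrite mulr_ge0// exprn_ge0.
 rewrite (normrM (4*z^+3*sg)) (normrM (4*z^+3)) (ger0_norm z3) sgn.
 apply: ler_wpM2l; first by rewrite mulr1.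
 rewrite (normrM dz) (normrM w).
 by apply: ler_pM => //; apply: ler_pM.
(* As [0 <= z <= 1], the factor [z^3] is at most [z] and [z^2]; each power of [d] can then be given
   the same power of [z]. *)
have t3 : 8*M*t*(z^+3*(B*(mix y d))) <=
  8*M*B*t*(y^+3*(z*d)+y^+2*(z*d)^+2+y*(z*d)^+3).
 have -> : 8*M*t*(z^+3*(B*(mix y d))) =
  8*M*B*t*(z^+3*y^+3*d+z^+3*y^+2*d^+2+z^+3*y*d^+3) by ring.
 apply: ler_wpM2l; first exact: mulr_ge0.
 have z2 : 0<=z^+2-z^+3 by rewrite subr_ge0 exprS ler_piMl// exprn_ge0.
 have z3 : 0<=z-z^+2 by rewrite subr_ge0 expr2 ler_piMl.
 have P1 : 0<=y^+3*d by pos.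
 have P2 : 0<=y^+2*d^+2 by pos.
 have:=mulr_ge0 (addr_ge0 z3 z2) P1; have:=mulr_ge0 z2 P2; lra.
have t4 : - `|4*z^+3*dz*sg*w*(y*er)| <= 4*z^+3*dz*sg*w*(y*er).
 by rewrite lerNl -normrN ler_norm.
have e1 : (z*d)^+4 = z^+4*(d^+2)^+2 by ring.
rewrite e1 in Yv.
move: t1 t2 t3 t4 Yv; move: (4*z^+3*dz*sg*w*(y*er)) (8*M*t*_) (8*M*B*t*_) (C1*_) => q1 q2 q3 q4.
have -> : z^+4*((d^+2)^+2/4) = z^+4*(d^+2)^+2/4 by ring.
move: (z^+4*(d^+2)^+2) (z^+4*F) `|q1| => q5 q6 q7 *; lra.
Qed.

(** Tested against [etaS], the field [Xa] gives a nonpositive term because [fden >= 0 >= ww], and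
    the divergence-free model field gives 0. What remains is the error on the transition layers,
    whose size does not depend on [S]. *)
Lemma energy_bound : exists2 C0 : R, 0<=C0 & forall S, s0<S-1 ->
 Cc (ZD S) /\
 Int (ZD S)<=C0.
Proof.
have [C1 C10 pw]:=energy_pointwise.
exists (16*C1*kappa); first by rewrite !mulr_ge0// ltW// kappa_gt0.
move=> S S1; have oD:=open_endset.
have [r Hr]:=phi_ell_far (profile_Z S1).
have far0 x : r < `|x| -> etaS S x = 0 by move=> /Hr[h _]; rewrite /etaS h expr0n mul0r.
have ccD : Cc (ZD S).
 apply: (@Cc_intro _ _ r) => [x /Hr[h _]|x]; first by rewrite h expr0n mul0r.
 have [Dx|nD]:=pselect (endset x); last first.
  by right; have:=phi_ell_near0 (profile_Z S1) S1 nD; apply: filterS => y [h _]; rewrite h expr0n mul0r.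
 left; apply: cont_mul; first by apply: cont_exp; exact: is_Ck_cont (is_Ck_phi_ell (profile_Z S1)) Dx.
 apply: cont_exp; apply: cont_sum => i; apply: cont_exp.
 have [xc _]:=Dx; apply: cont_sub; first exact: is_Ck_cont (is_Ck_gr cu i) (endset_Om Dx).
 have -> : (fun y => b*yy y*ev y i) = (fun y => b*(zc c i y/rho c y)).
  by apply/funext => y; rewrite zc_rho mulrA.
 apply: cont_mul; first exact: cont_cst.
 apply: cont_mul; first exact: (is_Ck_cont (is_Ck_zc 0 c i openT)).
 by apply: cont_inv; [rewrite gt_eqF// rho_gt0|exact: (is_Ck_cont (is_Ck_rho 0 c openT))].
split => //.
have [||c1 c2 e1]:=@divergence_thm R (etaS S) (Xa u) r; first exact: far0.
 move=> x; have [[Dx h]|h]:=etaS_cases S1 x; [left|by right]; split; [exact: h|move=> i].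
 exact: is_Ck_C1at oOm (is_CkW (is_Ck_Xa oOm cu i)) (endset_Om Dx).
have [||c3 c4 e2]:=@divergence_thm R (etaS S) (fun i x => zc c i x*rho c x ^- 2) r; first exact: far0.
 move=> x; have [[Dx h]|h]:=etaS_cases S1 x; [left|by right]; split; [exact: h|move=> i].
 have [xc _]:=Dx; exact: (is_Ck_C1at (@open_punct R c) (is_Ck_radial_field 1 c i) xc).
have e2' : Int (fun x => \sum_i partial i (etaS S) x*(zc c i x*rho c x ^- 2)) = 0.
 rewrite e2; apply/eqP; rewrite oppr_eq0; apply/eqP; transitivity (Int (fun _ : E => 0 : R)); last exact: Int0.
 apply: Int_eq => x; have [[[xc _] _]|h]:=etaS_cases S1 x; first by rewrite radial_div0// mulr0.
 by rewrite (nbhs_singleton h) mul0r.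
have e1' : Int (fun x => \sum_i partial i (etaS S) x*Xa u i x)<=0.
 rewrite e1 oppr_le0; apply: Int_ge0 => x.
 have [[Dx _]|h]:=etaS_cases S1 x; last by rewrite (nbhs_singleton h) mul0r.
 rewrite (div_Xa oOm cu (endset_Om Dx)) mulrN -mulNr; apply: mulr_ge0; last exact: fd0 (endset_Om Dx).
 rewrite /etaS -mulrN; apply: mulr_ge0; first by rewrite exprn_ge0//; have /andP[]:=Zf_01 S1 (ell x).
 rewrite /ww oppr_ge0 subr_le0; have [xc hx]:=Dx; have [_]:=HE xc hx.
 by apply: le_trans; exact: ler_norm.
have [c5 e5]:=Int_DZ S.
have i1:=itg_Cc c1; have i3:=itg_Cc c3; have i5:=itg_Cc c5; have iD:=itg_Cc ccD.
have : Int (fun x => 8^-1*(Zf S (ell x)^+4*D2 x^+2)) <=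
 Int (fun x => (\sum_i partial i (etaS S) x*Xa u i x-b^+3 * \sum_i partial i (etaS S) x*(zc c i x*rho c x ^- 2))
  + C1*(DZf S (ell x)*rho c x ^- 2)).
 apply: Int_le.
 - exact: itg_scale.
 - by apply: itg_add; [apply: itg_sub => //; exact: itg_scale|exact: itg_scale].
 move=> x; rewrite mulrC; apply: le_trans (pw S x S1) _.
 rewrite lerD2r mulr_sumr -sumrB; apply: ler_sum => i _.
 by rewrite le_eqVlt; apply/orP; left; apply/eqP; ring.
rewrite Int_scale// Int_add; [|by apply: itg_sub => //; exact: itg_scale|exact: itg_scale].
rewrite Int_sub//; last exact: itg_scale.
rewrite !Int_scale// e2' e5 mulr0 subr0.
have [A AE] : exists A, A = Int (fun x => \sum_i partial i (etaS S) x*Xa u i x) by eexists.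
by rewrite -AE in e1' *; exact: energy_arith.
Qed.

Section Mass.
Variable k : nat.
Let K : R:=k.+1%:R.
(** The exponent balances two errors. With [d = p K] and [y = q K^4], each mixed term of degree four
    in [y] and [d], divided by [K^15], is at most the same term in [q] and [p]; and [y^4/K^16]
    integrates over the shell, of logarithmic length of order [S], to order [S/K^16 = 1/K]. *)
Let S : R:=K^+15.
Hypothesis S1 : s0<S-1.

Let K1 : 1<=K. Proof. by rewrite /K ler1n. Qed.
Let Kp : 0<K. Proof. by rewrite /K ltr0n. Qed.
Let Sp : 0<S. Proof. by rewrite /S exprn_gt0. Qed.
Let S_ge1 : 1<=S. Proof. by rewrite /S exprn_ege1. Qed.
Definition hK s:=dth ((s-S)/S)/S.
Definition h2K s:=ddth ((s-S)/S)/S^+2.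

Lemma profile_chi : profile (fun s => th ((s-S)/S)) hK 0 1 (S*0+S) (S*1+S).
Proof. exact: profile_scale S Sp (@profile_th R). Qed.

Lemma profile_hK : profile hK h2K 0 0 S (2*S).
Proof.
split.
- move=> s; have h : is_derive s 1 (fun s : R => (s-S)/S) S^-1.
  by apply: is_derive_eq; rewrite /GRing.scale/=; ring.
 have:=@is_derive_comp1 R R dth (fun s : R => (s-S)/S) s 1 _ _ (is_derive_dth _) h.
 move=> H; have h0 : is_derive s 1 (fun _ : R => S^-1) 0 by exact: is_derive_cst.
 apply: (is_derive_eq (is_deriveM H h0)); rewrite /GRing.scale/= mulr0 add0r /h2K.
 by field; rewrite gt_eqF.
- move=> s; apply: cont_mul; last exact: cont_cst.
 apply: cont_comp; first exact: ddth_continuous.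
 apply: cont_mul; last exact: cont_cst.
 by apply: cont_sub; [exact: cvg_id|exact: cont_cst].
- move=> s h; rewrite /hK /h2K; have [|_ -> ->]:=@th_le0 R ((s-S)/S); last by rewrite !mul0r.
 by rewrite ler_pdivrMr//; lra.
- move=> s h; rewrite /hK /h2K; have [|_ -> ->]:=@th_ge1 R ((s-S)/S); last by rewrite !mul0r.
 by rewrite ler_pdivlMr//; lra.
Qed.

(** The gradient of the cut-off [th ((ell - S)/S)]. *)
Definition gS i x:=sg*hK (ell x)*(zc c i x/rho c x).

Let S0 : s0<S. Proof. by move: S1; lra. Qed.

Lemma gS_near0 x : ~ endset x -> \forall y \near x, forall i, gS i y = 0.
Proof.
move=> nD; have:=phi_ell_near0 profile_hK S0 nD; apply: filterS => y [h _] i.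
by rewrite /gS h mulr0 mul0r.
Qed.

Lemma gS_cases i x : (endset x /\ C1at (gS i) x) \/ (\forall y \near x, gS i y = 0).
Proof.
have oD:=open_endset; have [Dx|nD]:=pselect (endset x); last first.
 by right; apply: filterS (gS_near0 nD) => y; exact.
left; split => //; suff c4 : is_Ck 1 endset (gS i) by exact: (is_Ck_C1at oD c4 Dx).
apply: (is_Ck_mul oD).
 by apply: (is_Ck_scale sg oD); exact: (is_Ck_phi_ell profile_hK).
apply: (is_Ck_mul oD); first exact: is_Ck_zc.
by apply: (is_Ck_inv oD); [move=> y [yc _]; rewrite gt_eqF// rho_gt0|exact: is_Ck_rho].
Qed.

Lemma partial_gS i j x : endset x -> partial j (gS i) x =
 yy x^+2*((h2K (ell x)-2*sg*hK (ell x))*(ev x i*ev x j)+sg*hK (ell x)*(i == j)%:R).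
Proof.
move=> Dx; have [xc _]:=Dx.
have h1:=isd_cmul sg (d_phi_ell profile_hK j xc).
have h2:=is_derive_zc_rhoV i j 0 xc.
have [_]:=isd_mul h1 h2.
have -> : (fun y => sg*hK (ell y)*(zc c i y*rho c y ^- 1)) = gS i by apply/funext => y; rewrite expr1.
rewrite -/(partial j _ x) => ->; rewrite expr1 mulr1 yy4 zc_rho -yy2.
have zE m : zc c m x*yy x^+2 = yy x*ev x m by rewrite /ev; ring.
have -> : 2*zc c i x*zc c j x*yy x^+4 = 2*(zc c i x*yy x^+2)*(zc c j x*yy x^+2) by ring.
rewrite !zE; have e2:=sg2.
move: (h2K _) (hK _) (yy x) (ev x i) (ev x j) ((i == j)%:R) => a d y p q dl.
have -> : sg*(a*(sg*(y*q))) = sg^+2*(a*(y*q)) by ring.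
by rewrite e2; ring.
Qed.

Lemma contraction_sum (p e : 'I_4 -> R) (A B N Y : R) :
 \sum_i \sum_j Y*(A*(e i*e j)+B*(i == j)%:R)*(p i * p j-N*(i == j)%:R) =
 Y*(A*(\sum_i p i*e i)^+2-A*N*nrm2 e+B*nrm2 p-B*N * \sum_(i<4) 1).
Proof.
have [s sE] : exists s, s = \sum_i p i*e i by eexists.
rewrite (eq_bigr (fun i => Y*A*s*(p i*e i)-Y*A*N*e i^+2+Y*B * p i^+2-Y*B*N*1)); last first.
 move=> i _.
 transitivity (\sum_j (Y*A*(p i*e i)*(p j*e j)+(i == j)%:R*(Y*(- A*N*(e i*e j)+B*(p i * p j)-B*N*(i == j)%:R)))).
  by apply: eq_bigr => j _; ring.
 have ii : (i == i)%:R = 1 :> R by rewrite eqxx.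
 rewrite big_split /= -mulr_sumr -sE (bigD1 i)//= ii big1; first by ring.
 by move=> j ji; rewrite eq_sym (negbTE ji) mul0r.
by rewrite !big_split /= !sumrN -!mulr_sumr -sE /nrm2; ring.
Qed.

(** For the model [u = b log r] both [al] and [D2] vanish, and only the term in [b^2 y^4]
    survives. *)
Lemma gS_T x : endset x -> \sum_i \sum_j partial j (gS i) x*Tf u i j x =
 yy x^+2*((h2K (ell x)-2*sg*hK (ell x))*(al x^+2-D2 x)
  - 3*sg*hK (ell x)*((b*yy x)^+2+2*(b*yy x)*al x+D2 x)).
Proof.
move=> Dx; have [xc _]:=Dx; have [s1 s2 _ _]:=dd_split xc.
have [A AE] : exists A, A = h2K (ell x)-2*sg*hK (ell x) by eexists.
have [B BE] : exists B, B = sg*hK (ell x) by eexists.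
have -> : \sum_i \sum_j partial j (gS i) x*Tf u i j x =
 yy x^+2*(A*(\sum_i gr u x i*ev x i)^+2-A*Nf u x*nrm2 (ev x)+B*nrm2 (gr u x)-B*Nf u x * \sum_(i<4) 1).
 rewrite (eq_bigr (fun i => \sum_j yy x^+2*(A*(ev x i*ev x j)+B*(i == j)%:R)*(gr u x i*gr u x j-Nf u x*(i == j)%:R))); last first.
  by move=> i _; apply: eq_bigr => j _; rewrite partial_gS// -AE -BE.
 exact: contraction_sum.
rewrite sumr_const card_ord ev1// s1 -/(Nf u x) s2 AE BE; move: sg2.
move: (h2K _) (hK _) (yy x) (al x) (D2 x) => a d y p q _; ring.
Qed.

Lemma gS_X x : endset x -> \sum_i gS i x*Xa u i x = sg*hK (ell x)*(b^+3*yy x^+4+yy x*errf (b*yy x) (al x) (D2 x)).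
Proof.
move=> Dx; have [xc _]:=Dx; have [s1 s2 _ _]:=dd_split xc.
have -> : \sum_i gS i x*Xa u i x = sg*hK (ell x)*(yy x*(Nf u x * \sum_i gr u x i*ev x i)).
 by rewrite !mulr_sumr; apply: eq_bigr => i _; rewrite /gS zc_rho /Xa; ring.
by rewrite s1 s2 /errf; ring.
Qed.

(** A majorant of the indicator of the shell [S <= ell <= 2S] with an explicit radial integral:
    there [ell/(3S)] lies in [[1/3, 2/3]], where [dth >= 1]. *)
Definition GS x:=dth ((ell x-0)/(3*S)).

Lemma shell_terms y d : 0<=y -> 0<=d -> S^-1*(y^+3*d+y^+2*d^+2+y*d^+3)<=3*(d^+4/K^+4+y^+4/K^+16).
Proof.
move=> y0 d0; pose p:=d/K; pose q:=y/K^+4.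
have p0 : 0<=p by rewrite divr_ge0// ltW.
have q0 : 0<=q by rewrite divr_ge0// exprn_ge0// ltW.
have Kn0 : K != 0 by rewrite gt_eqF.
have -> : d^+4/K^+4 = p^+4 by rewrite /p expr_div_n.
have -> : y^+4/K^+16 = q^+4 by rewrite /q expr_div_n -exprM.
have yE : y = q*K^+4 by rewrite /q divfK// expf_neq0.
have dE : d = p*K by rewrite /p divfK.
have -> : S^-1*(y^+3*d+y^+2*d^+2+y*d^+3) = q^+3 * p/K^+2+q^+2 * p^+2/K^+5+q * p^+3/K^+8.
 by rewrite yE dE /S; field.
clearbody p q; have kk m : (K^+m)^-1<=1 by rewrite invf_le1 ?exprn_ege1 ?exprn_gt0.
have a1 : q^+3 * p/K^+2<=q^+3 * p by rewrite ler_piMr// mulr_ge0// exprn_ge0.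
have a2 : q^+2 * p^+2/K^+5<=q^+2 * p^+2 by rewrite ler_piMr// mulr_ge0// exprn_ge0.
have a3 : q * p^+3/K^+8<=q * p^+3 by rewrite ler_piMr// mulr_ge0// exprn_ge0.
by apply: le_trans (quartic p q); do 2 apply: lerD => //.
Qed.

Lemma shell_cases x : endset x -> (hK (ell x) = 0 /\ h2K (ell x) = 0) \/
 [/\ Zf S (ell x) = 1, 1<=GS x, 0<=hK (ell x)<=2/S & `|h2K (ell x)| <= 8/S].
Proof.
move=> Dx; have [h1|h1]:=leP (ell x) S; first by left; exact: (prof_lo profile_hK h1).
have [h2|h2]:=leP (2*S) (ell x); first by left; exact: (prof_hi profile_hK h2).
right; have [/andP[a1 a2] a3]:=dth_bounds ((ell x-S)/S); split.
- by apply: Zf_1; rewrite !ltW.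
- apply: dth_ge1; rewrite subr0 ler_pdivlMr ?mulr_gt0// ler_pdivrMr ?mulr_gt0//.
 by apply/andP; split; lra.
- by rewrite /hK divr_ge0 ?(ltW Sp)//= ler_pM2r ?invr_gt0.
- rewrite /h2K normrM normfV (ger0_norm (exprn_ge0 2 (ltW Sp))).
 have i0 : 0<=(S^+2)^-1 by rewrite invr_ge0 exprn_ge0// ltW.
 have i1 : (S^+2)^-1<=S^-1 by rewrite lef_pV2 ?posrE ?exprn_gt0// expr2 ler_peMl// ltW.
 exact: ler_pM.
Qed.

Local Notation errK x:=(Zf S (ell x)^+4*D2 x^+2/K^+4+GS x*rho c x ^- 2/K^+16).

Local Notation Cb:=(3*b^+2+3 * `|b| + 1).

Local Notation hr x:=(hK (ell x)*rho c x ^- 2).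

(** The cut-off varies over a logarithmic length [S], so every deviation from the model is a mixed
    term with a factor [1/S], to which [shell_terms] applies. *)
Lemma mass_pointwise x :
 `|\sum_i gS i x*Xa u i x-sg*b^+3*(hr x)| <=
   100*Cb*(errK x) /\
 `|\sum_i \sum_j partial j (gS i) x*Tf u i j x+3*sg*b^+2*(hr x)| <=
   100*Cb*(errK x).
Proof.
have [B BE] : exists B, B = 3*b^+2+3 * `|b| + 1 by exists Cb.
have bb : 0 <= `|b| by [].
have B1 : 1<=B by rewrite BE lerDr addr_ge0// mulr_ge0// sqr_ge0.
have B2 : `|b| <= B by rewrite BE; have:=sqr_ge0 b; move: bb; move: `|b| (b^+2) => p q *; lra.
rewrite -BE; have GS0 : 0<=GS x by rewrite /GS; have [/andP[]]:=dth_bounds ((ell x-0)/(3*S)).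
have rhs0 : 0<=100*B*(errK x).
 have z0 : 0<=Zf S (ell x) by have /andP[]:=Zf_01 S1 (ell x).
 apply: mulr_ge0; first by apply: mulr_ge0 => //; exact: le_trans ler01 B1.
 have p1 : 0<=Zf S (ell x)^+4*D2 x^+2 by apply: mulr_ge0; [exact: exprn_ge0|exact: sqr_ge0].
 have p2 : 0<=GS x*rho c x ^- 2 by apply: mulr_ge0 => //; rewrite invr_ge0 sqr_ge0.
 by apply: addr_ge0; apply: divr_ge0 => //; apply: exprn_ge0; exact: ltW.
have zero : hK (ell x) = 0 -> h2K (ell x) = 0 -> (endset x -> False) \/ endset x ->
  \sum_i gS i x*Xa u i x-sg*b^+3*(hr x) = 0 /\
  \sum_i \sum_j partial j (gS i) x*Tf u i j x+3*sg*b^+2*(hr x) = 0.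
 move=> z1 z2 [nD|Dx].
  have n0:=gS_near0 nD; rewrite z1 !mul0r !mulr0 subr0 addr0; split; apply: big1 => i _.
   by rewrite (nbhs_singleton n0 i) mul0r.
  apply: big1 => j _; have n1 : \forall y \near x, gS i y = 0 by apply: filterS n0 => y; exact.
  by rewrite (nbhs_singleton (near0_partial j n1)) mul0r.
 by rewrite gS_X// gS_T// z1 z2 !(mulr0, mul0r, subr0, addr0).
have [Dx|nD]:=pselect (endset x); last first.
 have [z1 z2]:=nbhs_singleton (phi_ell_near0 profile_hK S0 nD).
 by have [-> ->]:=zero z1 z2 (or_introl nD); rewrite normr0.
have [[z1 z2]|[Z1 G1 /andP[h0 h1] h2]]:=shell_cases Dx.
 by have [-> ->]:=zero z1 z2 (or_intror Dx); rewrite normr0.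
clear zero rhs0; rewrite gS_X// gS_T// yy4 Z1 expr1n mul1r.
have [xc _]:=Dx; have [_ _ _ s4]:=dd_split xc.
have [d dE] : exists d, d = Num.sqrt (D2 x) by eexists.
have eb:=errf_bound b (yy_ge0 x) s4 dE; rewrite -BE in eb.
have [ad d2]:=sqrt_bound s4; rewrite -dE in ad d2.
have d0 : 0<=d by rewrite dE sqrtr_ge0.
have st:=shell_terms (yy_ge0 x) d0.
have tgt : 3*(d^+4/K^+4+yy x^+4/K^+16)<=3*(D2 x^+2/K^+4+GS x*yy x^+4/K^+16).
 apply: ler_wpM2l => //; rewrite -d2 -exprM lerD2l; apply: ler_wpM2r; first by rewrite invr_ge0 exprn_ge0// ltW.
 by rewrite ler_peMl// exprn_ge0// yy_ge0.
have {}st:=le_trans st tgt.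
have y0:=yy_ge0 x; have sn:=sg_norm; have sg2':=sg2.
move: eb st ad s4 h0 h1 h2; rewrite -d2.
move: ((d^+2)^+2/K^+4+_) => RHS.
move: (hK (ell x)) (h2K (ell x)) (yy x) (al x) y0 => h hh y a y0.
move: (errf _ _ _) => er eb st ad s4 h0 h1 h2.
have Sv : 0<S^-1 by rewrite invr_gt0.
set T1:=y^+3*d in eb st *; set T2:=y^+2*d^+2 in eb st *; set T3:=y*d^+3 in eb st *.
have T10 : 0<=T1 by rewrite mulr_ge0// exprn_ge0.
have T20 : 0<=T2 by rewrite mulr_ge0// exprn_ge0.
have T30 : 0<=T3 by rewrite mulr_ge0// exprn_ge0.
split.
 have -> : sg*h*(b^+3*y^+4+y*er)-sg*b^+3*(h*y^+4) = sg*(h*(y*er)) by ring.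
 rewrite (normrM sg) (normrM h) sn mul1r (ger0_norm h0).
 apply: (@le_trans _ _ (2/S*(B*(T1+T2+T3)))); first exact: ler_pM.
 have -> : 2/S*(B*(T1+T2+T3)) = 2*B*(S^-1*(T1+T2+T3)) by ring.
 apply: (@le_trans _ _ (2*B*(3*RHS))); first by apply: ler_wpM2l => //; rewrite mulr_ge0//; lra.
 have R0 : 0<=RHS.
  by rewrite -(pmulr_rge0 _ (ltr0n R 3)); apply: le_trans st; rewrite mulr_ge0 ?(ltW Sv)// !addr_ge0.
 have -> : 2*B*(3*RHS) = 6*(B*RHS) by ring.
 have -> : 100*B*RHS = 100*(B*RHS) by ring.
 by apply: ler_wpM2r; [rewrite mulr_ge0//; lra|lra].
have -> : y^+2*((hh-2*sg*h)*(a^+2-d^+2)-3*sg*h*((b*y)^+2+2*(b*y)*a+d^+2))+3*sg*b^+2*(h*y^+4) =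
 (hh-2*sg*h)*(y^+2*(a^+2-d^+2))-sg*h*(6*b*(y^+3*a)+3*(y^+2*d^+2)) by ring.
apply: le_trans (ler_normB _ _) _; rewrite (normrM (hh-_)) (normrM (sg*h)) (normrM sg) sn mul1r (ger0_norm h0).
have t1 : `|hh-2*sg*h| <= 12/S.
 apply: le_trans (ler_normB _ _) _; rewrite (normrM (2*sg)) (normrM 2) sn (ger0_norm h0) mulr1 (ger0_norm (ler0n R 2)).
 have -> : 12/S = 8/S+2*(2/S) by ring.
 by apply: lerD => //; apply: ler_wpM2l.
have t2 : `|y^+2*(a^+2-d^+2)| <= T2.
 rewrite (normrM (y^+2)) (ger0_norm (sqr_ge0 y)); apply: ler_wpM2l; first exact: sqr_ge0.
 rewrite ler_norml lerBlDr; have a0:=sqr_ge0 a; have dd0:=sqr_ge0 d.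
 by apply/andP; split; [rewrite lerBrDr addNr|apply: le_trans s4 _; rewrite lerDl].
have t3 : `|6*b*(y^+3*a)+3*(y^+2*d^+2)| <= 6*B*T1+3*T2.
 apply: le_trans (ler_normD _ _) _; rewrite (normrM 3) (ger0_norm T20) (ger0_norm (ler0n R 3)) lerD2r.
 rewrite (normrM (6*b)) (normrM 6) (normrM (y^+3)) (ger0_norm (exprn_ge0 3 y0)) (ger0_norm (ler0n R 6)).
 apply: ler_pM; [exact: mulr_ge0| |exact: ler_wpM2l|].
  by apply: mulr_ge0 => //; exact: exprn_ge0.
 by apply: ler_wpM2l => //; exact: exprn_ge0.
apply: (@le_trans _ _ (12/S*T2+2/S*(6*B*T1+3*T2))).
 by apply: lerD; apply: ler_pM.
have -> : 12/S*T2+2/S*(6*B*T1+3*T2) = S^-1*(18*T2+12*B*T1) by ring.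
apply: (@le_trans _ _ (S^-1*(30*B*(T1+T2+T3)))).
 apply: ler_wpM2l; first exact: ltW.
 have m1 : T2<=B*T2 by rewrite ler_peMl.
 have m2 : 0<=B*T1 by rewrite mulr_ge0//; lra.
 have m3 : 0<=B*T3 by rewrite mulr_ge0//; lra.
 have -> : 30*B*(T1+T2+T3) = 30*(B*T1)+30*(B*T2)+30*(B*T3) by ring.
 have -> : 12*B*T1 = 12*(B*T1) by ring.
 lra.
have -> : S^-1*(30*B*(T1+T2+T3)) = 30*B*(S^-1*(T1+T2+T3)) by ring.
have -> : 100*B*RHS = 30*B*(3*RHS)+10*(B*RHS) by ring.
have R0 : 0<=RHS.
 by rewrite -(pmulr_rge0 _ (ltr0n R 3)); apply: le_trans st; rewrite mulr_ge0 ?(ltW Sv)// !addr_ge0.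
apply: ler_wpDr; first by rewrite !mulr_ge0//; lra.
by apply: ler_wpM2l => //; rewrite mulr_ge0//; lra.
Qed.

Lemma Int_hK : Cc (fun x => hK (ell x)*rho c x ^- 2) /\ Int (fun x => hK (ell x)*rho c x ^- 2) = kappa.
Proof. by have [h1 h2]:=radial_end c sgE profile_chi; split => //; rewrite [LHS]h2 subr0 mulr1. Qed.

Lemma Int_GS : itg (fun x => GS x*rho c x ^- 2) /\ Int (fun x => GS x*rho c x ^- 2) = 3*S*kappa.
Proof.
have S3 : 0<3*S by rewrite mulr_gt0.
have [h1 h2]:=radial_end c sgE (profile_scale 0 S3 (@profile_th R)).
have e x : GS x*rho c x ^- 2 = 3*S*(dth ((sg*Lr c x-0)/(3*S))/(3*S)*rho c x ^- 2).
 by rewrite /GS /ell mulrA [_*(dth _/_)]mulrC divfK// gt_eqF.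
split; first by apply: (itg_eq (f:=fun x => 3*S*(dth ((sg*Lr c x-0)/(3*S))/(3*S)*rho c x ^- 2))) => [x|]; [rewrite e|exact: itg_scale (itg_Cc h1)].
rewrite (Int_eq e) Int_scale; last exact: itg_Cc.
by rewrite h2 subr0 mulr1.
Qed.

Lemma gS_far : exists r : R, forall i x, r < `|x| -> gS i x = 0.
Proof.
have [r Hr]:=phi_ell_far profile_hK; exists r => i x /Hr[h _].
by rewrite /gS h mulr0 mul0r.
Qed.

(** The limits are the values for the model [u = b log r]: [b^3] for [Xa], and for [Vf] the sum of
    [3b^2/2] from [Tf] and [b^3/2] from [Xa]. *)
Lemma mass_estimate (C0 : R) : itg (ZD S) -> Int (ZD S)<=C0 ->
 let C:=100*Cb*(C0+3*kappa) in
 mass_bound gS (Xa u) (C/K) (sg*b^+3*kappa) /\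
 mass_bound gS (Vf u) (C/K) (sg*(3*b^+2+b^+3)/2*kappa).
Proof.
move=> iZ Z0 C; have [r Hr]:=gS_far.
have [||cV cX cT EV]:=@Vf_flux R Om u oOm cu gS r; first exact: Hr.
 by move=> i x; have [[Dx h]|h]:=gS_cases i x; [left; split; [exact: h|exact: endset_Om]|right].
have [ch eh]:=Int_hK; have [iG eG]:=Int_GS.
have [B BE] : exists B, B = 100*Cb by eexists.
have B0 : 0<=B by rewrite BE mulr_ge0// !addr_ge0// mulr_ge0// sqr_ge0.
have ih:=itg_Cc ch; have iX:=itg_Cc cX; have iT:=itg_Cc cT.
pose err x:=B*(K ^- 4*(Zf S (ell x)^+4*D2 x^+2)+K ^- 16*(GS x*rho c x ^- 2)).
have ie1:=itg_scale (K ^- 4) iZ; have ie2:=itg_scale (K ^- 16) iG.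
have ie : itg err by apply: itg_scale; exact: itg_add.
have C00 : 0<=C0 by apply: le_trans Z0; apply: Int_ge0 => x; rewrite mulr_ge0 ?sqr_ge0// exprn_ge0//; have /andP[]:=Zf_01 S1 (ell x).
have errI : Int err<=C/K.
 rewrite /err Int_scale; last exact: itg_add.
 rewrite Int_add// !Int_scale// eG /C -BE -[leRHS]mulrA; apply: ler_wpM2l => //.
 have -> : K ^- 16*(3*S*kappa) = 3*kappa/K.
  by rewrite /S; field; rewrite gt_eqF.
 rewrite [leRHS]mulrDl lerD2r [leLHS]mulrC; apply: ler_pM => //.
 - by apply: Int_ge0 => x; rewrite mulr_ge0 ?sqr_ge0// exprn_ge0//; have /andP[]:=Zf_01 S1 (ell x).
 - by rewrite invr_ge0 exprn_ge0// ltW.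
 - by rewrite lef_pV2 ?posrE ?exprn_gt0// -{1}[K]expr1 ler_weXn2l.
have abs (f : E -> R) : itg f -> (forall x, `|f x| <= err x) -> `|Int f| <= C/K.
 move=> jf fe; rewrite ler_norml; apply/andP; split.
  rewrite -[X in _<=X]opprK lerN2; apply: le_trans errI.
  have e1 : - Int f = Int (fun x => -1*f x) by rewrite Int_scale// mulN1r.
  rewrite e1; apply: Int_le => //; first exact: itg_scale.
  by move=> x; apply: le_trans (fe x); rewrite mulN1r -normrN ler_norm.
 by apply: le_trans errI; apply: Int_le => // x; apply: le_trans (fe x); exact: ler_norm.
have bX : `|Int (fun x => \sum_i gS i x*Xa u i x)-sg*b^+3*kappa| <= C/K.
 rewrite -eh -Int_scale// -Int_sub//; last exact: itg_scale.
 apply: abs; first by apply: itg_sub => //; exact: itg_scale.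
 move=> x; have [h _]:=mass_pointwise x; apply: le_trans h _.
 by rewrite -BE /err ![_/K^+_]mulrC.
have bT : `|Int (fun x => \sum_i \sum_j partial j (gS i) x*Tf u i j x)+3*sg*b^+2*kappa| <= C/K.
 rewrite -eh -Int_scale// -Int_add//; last exact: itg_scale.
 apply: abs; first by apply: itg_add => //; exact: itg_scale.
 move=> x; have [_ h]:=mass_pointwise x; apply: le_trans h _.
 by rewrite -BE /err ![_/K^+_]mulrC.
split; split => //; rewrite EV.
move: bX bT; rewrite !ler_norml; move: (Int _) (Int _) (C/K) (@kappa R) => I2 I1 c' kp.
move=> /andP[a1 a2] /andP[a3 a4].
have -> : - 2^-1*I2+2^-1*I1-sg*(3*b^+2+b^+3)/2*kp =
 - 2^-1*(I2+3*sg*b^+2*kp)+2^-1*(I1-sg*b^+3*kp) by field.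
by apply/andP; split; lra.
Qed.

End Mass.

Definition end_masses (C : R):=forall k : nat, s0<k.+1%:R^+15-1 ->
 mass_bound (gS k) (Xa u) (C/k.+1%:R) (sg*b^+3*kappa) /\
 mass_bound (gS k) (Vf u) (C/k.+1%:R) (sg*(3*b^+2+b^+3)/2*kappa).

Lemma end_masses_le C C' : C<=C' -> end_masses C -> end_masses C'.
Proof.
move=> CC h k hk; have CK : C/k.+1%:R<=C'/k.+1%:R by apply: ler_wpM2r.
by have [[h1 h2] [h3 h4]]:=h k hk; do 2 split => //; apply: le_trans CK.
Qed.

Theorem end_mass : exists2 C : R, 0<=C & end_masses C.
Proof.
have [C0 C00 HC]:=energy_bound.
exists (100*(3*b^+2+3 * `|b| + 1)*(C0+3*kappa)).
 have kp:=ltW (@kappa_gt0 R); have bb:=sqr_ge0 b; have nb:=normr_ge0 b.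
 by rewrite mulr_ge0// ?addr_ge0// mulr_ge0// !addr_ge0// mulr_ge0.
move=> k S1; have [cZ Z0]:=HC _ S1.
exact: (mass_estimate S1 (itg_Cc cZ) Z0).
Qed.

End End.

(** * Monotonicity from one-sided increments *)

Section RightMono.
Context {R : realType}.

(** A function that may jump is nondecreasing if its increments to the right are bounded below by
    small multiples of those of a nondecreasing [mu], and if it does not drop in the limit from the
    left. The second condition makes the supremum of the good points good, the first lets one pass
    beyond it. *)
Lemma right_mono (F mu : R -> R) (T0 T1 : R) : T0<=T1 ->
 (forall s t, s<=t -> mu s<=mu t) ->
 (forall t e, T0<=t<T1 -> 0<e -> exists2 d, 0<d & forall t', t<t'<t+d -> t'<=T1 -> - e*(mu t'-mu t)<=F t'-F t) ->
 (forall t e, T0<t<=T1 -> 0<e -> exists2 d, 0<d & forall s, t-d<s<t -> T0<=s -> F s-e<=F t) ->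
 F T0<=F T1.
Proof.
move=> T01 mm hr hl; apply/ler_addgt0Pr => e0 e00.
(* Normalised so that the total loss on [[T0, T1]] is at most [e0]. *)
pose e:=e0/(mu T1-mu T0+1); have d0 : 0<mu T1-mu T0+1 by have:=mm _ _ T01; lra.
have ep : 0<e by exact: divr_gt0.
pose good t:=F T0-e*(mu t-mu T0)<=F t.
have g0 : good T0 by rewrite /good subrr mulr0 subr0.
pose S:=[set t | T0<=t<=T1 /\ good t].
have S0 : S T0 by split => //; rewrite lexx.
have Sub : ubound S T1 by move=> t [/andP[]].
have hsS : has_sup S by split; [exists T0|exists T1].
pose c:=sup S.
have cT1 : c<=T1 by apply: ge_sup => //; exists T0.
have T0c : T0<=c by apply: ub_le_sup => //; exists T1.
have gc : good c.
 have [->//|/eqP cn]:=pselect (c = T0).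
 have T0c' : T0<c by lra.
 rewrite /good; apply/ler_addgt0Pr => e1 e10.
 have [d dp hd]:=hl c e1 ltac:(by rewrite T0c' cT1) e10.
 have [s [/andP[s0 s1] gs] cs]:=sup_adherent dp hsS.
 have sc : s<=c by apply: ub_le_sup; [exists T1|split => //; rewrite s0].
 have [->|/eqP sn]:=pselect (c = s); first by apply: le_trans gs _; rewrite lerDl ltW.
 have:=hd s ltac:(by rewrite cs lt_neqAle eq_sym sn sc) s0.
 move: gs; rewrite /good => g1 g2; have m1:=mm _ _ sc.
 by nra.
have [e1|/eqP cn]:=pselect (c = T1).
 move: gc; rewrite /good e1 => g; apply: le_trans (_ : F T0<=F T1+e*(mu T1-mu T0)) _; first lra.
 rewrite lerD2l /e mulrAC ler_pdivrMr// ler_pM2l//; lra.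
have cT : c<T1 by lra.
have [d dp hd]:=hr c e ltac:(by rewrite T0c cT) ep.
pose t:=Num.min T1 (c+d/2).
have ct : c<t by rewrite lt_min cT ltrDl divr_gt0.
have tT : t<=T1 by rewrite ge_min lexx.
have td : t<c+d by rewrite gt_min; apply/orP; right; lra.
have h:=hd t ltac:(by rewrite ct td) tT.
have : S t.
 split; first by lra.
 by move: gc h; rewrite /good; lra.
move=> St; have : t<=c by apply: ub_le_sup => //; exists T1.
by lra.
Qed.

Lemma expR_step (d : R) : 0<=d -> d<=1/8 -> expR (4*d)-1<=4*d+32*d^+2.
Proof.
move=> d0 d1; have h:=expR_ge1Dx (- (4*d)); rewrite expRN in h.
have p:=expR_gt0 (4*d); have p4 : 0<1-4*d by lra.
have h2 : expR (4*d)*(1-4*d)<=1.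
 by have:=ler_wpM2l (ltW p) h; rewrite mulfV// gt_eqF.
by nra.
Qed.

Lemma cube_root_convex (y z : R) : 0<=y -> 0<=z -> 0<=3*z^+4-4*y*z^+3+y^+4.
Proof.
move=> y0 z0; have -> : 3*z^+4-4*y*z^+3+y^+4 = (y-z)^+2*(2*z^+2+(y+z)^+2) by ring.
by pos.
Qed.

Lemma cube_root_tangent (y z : R) : 0<=y -> 0<=z -> y^+3-z^+3<=3*y^+2*(y-z).
Proof.
move=> y0 z0; rewrite -subr_ge0.
have -> : 3*y^+2*(y-z)-(y^+3-z^+3) = (y-z)^+2*(2*y+z) by ring.
by pos.
Qed.

(** The increment form of differentiating [kap y^4/8 - 2yE] with [a = kap y^3]: convexity of [y^4]
    as a function of [y^3] and a tangent bound for the cube replace the derivatives. *)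
Lemma step_arith (kap y z E E' : R) : 0<kap -> 0<y -> 0<=z -> 0<=E ->
 (2*E-kap*y^+3/2)/(3*kap*y^+2)*(kap*y^+3-kap*z^+3)+2*z*(E-E') <=
 (kap*z^+4/8-2*z*E')-(kap*y^+4/8-2*y*E).
Proof.
move=> k0 y0 z0 E0.
have -> : (2*E-kap*y^+3/2)/(3*kap*y^+2)*(kap*y^+3-kap*z^+3) =
 2*E*((y^+3-z^+3)/(3*y^+2))-kap*(y*(y^+3-z^+3)/6).
 by field; rewrite !lt0r_neq0.
have h1 : (y^+3-z^+3)/(3*y^+2)<=y-z.
 by rewrite ler_pdivrMr ?mulr_gt0 ?exprn_gt0// mulrC; apply: cube_root_tangent => //; exact: ltW.
have h2:=ler_wpM2l (mulr_ge0 (ler0n R 2) E0) h1.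
have h3 : 0<=kap*(3*z^+4-4*y*z^+3+y^+4) by apply: mulr_ge0; [exact: ltW|exact: cube_root_convex (ltW y0) z0].
by lra.
Qed.

End RightMono.

Section Mono.
Context {R : realType}.
Variables (a E B lam : R -> R) (K kap s T0 T1 : R).
Hypotheses (K0 : 0<K) (kap0 : 0<kap) (s0 : 0<=s) (T01 : T0<=T1).
Hypothesis a_mono : forall t t', t<=t' -> a t'<=a t.
Hypothesis B_mono : forall t t', t<=t' -> B t'<=B t.
Hypothesis a_ge0 : forall t, 0<=a t.
Hypothesis B_ge0 : forall t, 0<=B t.
Hypothesis E_ge0 : forall t, 0<=E t.
Hypothesis E_diff : forall t t', t<=t' ->
 K*expR (4*t)*(B t-B t')<=E t-E t'<=K*expR (4*t')*(B t-B t').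
Hypothesis a_right : forall t e, 0<e -> exists2 d, 0<d & forall t', t<=t'<t+d -> a t-a t'<=e.
Hypothesis B_right : forall t e, 0<e -> exists2 d, 0<d & forall t', t<=t'<t+d -> B t-B t'<=e.
Hypothesis lam_diff : forall t t', t<=t' -> 0<=lam t-lam t'<=B t-B t'.
Hypothesis B_eq0 : forall t, B t = 0 -> forall t', t<=t' -> a t' = a t.
Hypothesis a_gt0 : forall t, 0<B t -> 0<a t.
Hypothesis Q_ge0 : forall t, 0<=2*E t-a t/2.

Definition yr t:=(a t/kap) `^ 3^-1.

(** The level-set inequality for the layer between [t] and [t'], with the AM-GM weights already
    inserted. As [Q] may vanish it is replaced by [Q + e] in the weights; [s] and [lam] carry the
    gain from a set where the pointwise inequality is strict. *)
Hypothesis layer : forall t t' e, T0<=t -> t<t' -> t'<=T1 -> 0<B t -> 0<e ->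
 let Q:=2*E t-a t/2 in let P:=K*expR (4*t) in
 16*P*(t'-t)*B t'+s*(lam t-lam t') <=
 (Q+e)/(3*kap*yr t^+2)*(a t-a t')+2*yr t*P*(B t-B t')
 + 4*P*B t/(Q+e)*((t'-t)*(Q+2^-1*(a t-a t'))).
Hypothesis s_small : s<=2*yr T1*(K*expR (4*T0)).

Definition MM t:=kap*yr t^+4/8+(3-2*yr t)*E t-3*K*expR (4*t)*B t.

Lemma yr_ge0 t : 0<=yr t.
Proof. exact: powR_ge0. Qed.

Lemma yr_cube t : kap*yr t^+3 = a t.
Proof.
rewrite /yr -powR_mulrn ?powR_ge0// -powRrM mulVf// powRr1.
 by rewrite mulrC divfK// gt_eqF.
by rewrite divr_ge0// ltW.
Qed.

Lemma yr_mono t t' : t<=t' -> yr t'<=yr t.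
Proof.
move=> tt; rewrite /yr; apply: ge0_ler_powR; rewrite ?nnegrE ?divr_ge0// ?(ltW kap0)//.
by rewrite ler_pM2r ?invr_gt0//; exact: a_mono.
Qed.

Lemma yr_gt0 t : 0<B t -> 0<yr t.
Proof. by move=> h; rewrite /yr powR_gt0// divr_gt0//; exact: a_gt0. Qed.

Lemma B_zero t t' : t<=t' -> B t = 0 -> MM t' = MM t /\ lam t' = lam t.
Proof.
move=> tt b0; have b1 : B t' = 0 by apply/eqP; rewrite eq_le B_ge0 -b0 B_mono.
have [e1 l1] : E t' = E t /\ lam t' = lam t.
 have /andP[h1 h2]:=E_diff tt; have /andP[h3 h4]:=lam_diff tt.
 by nra.
by split => //; rewrite /MM /yr (B_eq0 b0 tt) b0 b1 e1 !mulr0.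
Qed.

Lemma MM_step t t' : t<=t' -> 0<B t ->
 (2*E t-a t/2)/(3*kap*yr t^+2)*(a t-a t')+2*yr t'*(K*expR (4*t))*(B t-B t')
  - 3*K*(expR (4*t')-expR (4*t))*B t<=MM t'-MM t.
Proof.
move=> tt b0; have:=step_arith (E t') kap0 (yr_gt0 b0) (yr_ge0 t') (E_ge0 t).
rewrite !yr_cube /MM; have /andP[h1 h2]:=E_diff tt.
have y2 : 0<=2*yr t' by pos.
by nra.
Qed.

(** The only loss comes through the factor [e^(4t)], which is continuous, so there is no downward
    jump from the left. *)
Lemma MM_left t t' : T0<=t -> t<=t' -> t'<=T1 ->
 s*(lam t-lam t')-3*K*(expR (4*t')-expR (4*t))*B T0<=MM t'-MM t.
Proof.
move=> Tt tt tT; have ee : 0<=expR (4*t')-expR (4*t) by rewrite subr_ge0 ler_expR ler_pM2l.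
have [b0|/eqP b0]:=pselect (B t = 0).
 have [-> ->]:=B_zero tt b0; rewrite !subrr mulr0 sub0r oppr_le0.
 by pos.
have bp : 0<B t by rewrite lt_neqAle eq_sym b0 B_ge0.
apply: le_trans (MM_step tt bp); apply: lerD.
 have /andP[l0 l1]:=lam_diff tt.
 have h1 : s*(lam t-lam t')<=2*yr t'*(K*expR (4*t))*(B t-B t').
  apply: ler_pM => //; apply: le_trans s_small _; apply: ler_pM.
  - by pos.
  - by pos.
  - by rewrite ler_pM2l//; exact: yr_mono.
  - by rewrite ler_pM2l// ler_expR ler_pM2l.
 apply: le_trans h1 _; rewrite lerDr mulr_ge0//; last by rewrite subr_ge0 a_mono.
 by rewrite divr_ge0 ?Q_ge0// mulr_ge0 ?sqr_ge0// mulr_ge0// ltW.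
rewrite lerN2; apply: ler_wpM2l; last exact: B_mono.
by pos.
Qed.

(** The error budget of one step: raising [Q] to [Q + e1] costs [e D], replacing [y] by [z] costs
    [e DB], and replacing [b] by [b'] and the quadratic part of the exponential cost half of [e Dl]
    each. *)
Lemma local_arith (Q e1 k y z P D DB DL Dl b b' e x m m' KE : R) :
 0<Q+e1 -> 0<=Q -> 0<k -> 0<y -> 0<=z -> z<=y -> 0<P -> 0<=D -> 0<=DB -> 0<Dl -> 0<=b -> 0<e ->
 DB = b-b' ->
 x = e*(3*k*y^+2) -> e1 = x ->
 D = k*y^+3-k*z^+3 ->
 2^-1*D<=e1 -> 2*P*D<=e*(k*y^+2) -> 16*P*DB<=e/2 -> 96*P*b*Dl<=e/2 ->
 KE<=4*Dl+32*Dl^+2 ->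
 16*P*Dl*b'+DL<=(Q+e1)/(3*k*y^+2)*D+2*y*P*DB+4*P*b/(Q+e1)*(Dl*(Q+2^-1*D)) ->
 Q/(3*k*y^+2)*D+2*z*P*DB-3*P*KE*b<=m'-m ->
 DL-e*(Dl+D+DB)<=m'-m.
Proof.
move=> q1 q0 k0 y0 z0 zy P0 D0 DB0 Dl0 b0 e0 eDB ex e1x eD h1 h2 h3 h4 h5 h6 h7.
have ky : 0<k*y^+2 by rewrite mulr_gt0// exprn_gt0.
have f1 : (Q+e1)/(3*k*y^+2)*D = Q/(3*k*y^+2)*D+e*D.
 by rewrite e1x ex; field; rewrite !lt0r_neq0.
have f2 : 4*P*b/(Q+e1)*(Dl*(Q+2^-1*D))<=4*P*b*Dl.
 rewrite mulrAC ler_pdivrMr// -!mulrA; do 4! (apply: ler_wpM2l; first by [|exact: ltW]).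
 by lra.
have f3 : 2*(y-z)*P*DB<=e*DB.
 apply: ler_wpM2r => //; rewrite -(ler_pM2r ky).
 apply: le_trans h2.
 have -> : 2*(y-z)*P*(k*y^+2) = 2*P*(k*(y^+2*(y-z))) by ring.
 apply: ler_wpM2l; first by lra.
 rewrite eD -mulrBr ler_pM2l// -subr_ge0.
 have -> : y^+3-z^+3-y^+2*(y-z) = z*(y-z)*(y+z) by ring.
 by rewrite !mulr_ge0 ?subr_ge0// addr_ge0// ltW.
have f4 : 3*P*KE*b<=12*P*b*Dl+96*P*b*Dl*Dl.
 have -> : 12*P*b*Dl+96*P*b*Dl*Dl = 3*P*(4*Dl+32*Dl^+2)*b by ring.
 by apply: ler_wpM2r => //; rewrite ler_pM2l// mulr_gt0.
have f5:=ler_wpM2r (ltW Dl0) h4.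
have f6:=ler_wpM2r (ltW Dl0) h3.
move: f1 f2 f3 f4 f5 f6 h6 h7; rewrite eDB.
by lra.
Qed.

Lemma MM_local t e : T0<=t<T1 -> 0<e -> exists2 d, 0<d & forall t', t<t'<t+d -> t'<=T1 ->
 - e*((t'-a t'-B t')-(t-a t-B t))<=(MM t'+s * lam t')-(MM t+s * lam t).
Proof.
move=> /andP[Tt tT] e0.
have [b0|/eqP b0]:=pselect (B t = 0).
 exists 1 => // t' /andP[tt _] _; have [-> ->]:=B_zero (ltW tt) b0; rewrite subrr mulNr oppr_le0.
 rewrite mulr_ge0 ?(ltW e0)//; have:=a_mono (ltW tt); have:=B_mono (ltW tt); lra.
have bp : 0<B t by rewrite lt_neqAle eq_sym b0 B_ge0.
have yp:=yr_gt0 bp; pose P:=K*expR (4*t); have P0 : 0<P by pos.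
(* Adding [e1] to [Q] raises the coefficient of [a t - a t'] by exactly [e]. *)
pose e1:=e*(3*kap*yr t^+2).
have ky : 0<kap*yr t^+2 by pos.
have e10 : 0<e1 by pos.
have P2 : 0<2*P by lra.
have [d1 d10 hd1]:=@a_right t (Num.min (2*e1) (e*(kap*yr t^+2)/(2*P))) ltac:(by rewrite lt_min mulr_gt0//= divr_gt0// mulr_gt0).
have [d2 d20 hd2]:=@B_right t (e/2/(16*P)) ltac:(by rewrite !divr_gt0// mulr_gt0).
have q0 : 0<96*P*B t by apply: mulr_gt0 => //; exact: mulr_gt0.
pose d3:=e/2/(96*P*B t); have d30 : 0<d3 by apply: divr_gt0 => //; exact: divr_gt0.
exists (Num.min (Num.min d1 d2) (Num.min d3 (1/8))).
 by rewrite !lt_min d10 d20 d30 divr_gt0.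
move=> t' /andP[tt]; rewrite -ltrBlDl !lt_min => /andP[/andP[t1 t2] /andP[t3 t4]] tT'.
have k1:=hd1 t' ltac:(by rewrite (ltW tt) -ltrBlDl).
have k2:=hd2 t' ltac:(by rewrite (ltW tt) -ltrBlDl).
move: k1; rewrite le_min ler_pdivlMr// => /andP[k1 k1'].
have P16 : 0<16*P by lra.
move: k2; rewrite (ler_pdivlMr _ _ P16) => k2.
move: t3; rewrite (ltr_pdivlMr _ _ q0) => t3.
have Dl0 : 0<t'-t by rewrite subr_gt0.
have KE:=expR_step (ltW Dl0) (ltW t4).
have L:=layer Tt tt tT' bp e10.
have ST:=MM_step (ltW tt) bp.
have main : s*(lam t-lam t')-e*((t'-t)+(a t-a t')+(B t-B t'))<=MM t'-MM t.
 apply: (@local_arith (2*E t-a t/2) e1 kap (yr t) (yr t') P (a t-a t') (B t-B t') _ (t'-t) (B t) (B t') e e1 _ _ (expR (4*(t'-t))-1)) => //.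
 - by rewrite ltr_wpDl.
 - exact: yr_ge0.
 - exact: yr_mono (ltW tt).
 - by rewrite subr_ge0 a_mono// ltW.
 - by rewrite subr_ge0 B_mono// ltW.
 - by rewrite !yr_cube.
 - by rewrite mulrC ler_pdivrMr// mulrC.
 - by rewrite mulrC.
 - by rewrite mulrC.
 - by rewrite mulrC ltW.
 - rewrite (_ : 3*P*(expR (4*(t'-t))-1)*B t = 3*K*(expR (4*t')-expR (4*t))*B t) //.
  have -> : expR (4*t') = expR (4*t)*expR (4*(t'-t)) by rewrite -expRD; congr expR; ring.
  by rewrite /P; ring.
move: main; move: (MM t') (MM t) (a t) (a t') (B t) (B t') (lam t) (lam t') => *; lra.
Qed.

Theorem MM_mono : MM T0+s * lam T0<=MM T1+s * lam T1.
Proof.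
(* The increments of [t - a t - B t] are the sum of the three quantities that measure the errors in
   [local_arith]. *)
apply: (@right_mono _ (fun t => MM t+s * lam t) (fun t => t-a t-B t)) => //.
- move=> x y xy; have:=a_mono xy; have:=B_mono xy; lra.
- by move=> t e tt e0; exact: MM_local.
move=> t e /andP[Tt tT] e0.
pose c:=3*K*B T0+1; have c0 : 0<c by rewrite ltr_wpDl// mulr_ge0// mulr_ge0// ltW.
have ce : cts (fun s : R => expR (4*s)) t.
 apply: (@continuous_comp _ _ _ (fun s : R => 4*s) expR); last exact: continuous_expR.
 by apply: cvgM; [exact: cvg_cst|exact: cvg_id].
have /cvgrPdist_le/(_ (e/c) (divr_gt0 e0 c0)):=ce.
move=> /nbhs_ballP[d /= dp hd]; exists d => // x /andP[x1 x2] Tx.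
have:=hd x; rewrite /ball /= ger0_norm ?subr_ge0 ?(ltW x2)// => /(_ ltac:(lra)) h.
have xe : 0<=expR (4*t)-expR (4*x) by rewrite subr_ge0 ler_expR ler_pM2l// ltW.
rewrite ger0_norm// ler_pdivlMr// in h.
have:=MM_left Tx (ltW x2) tT.
have : 3*K*(expR (4*t)-expR (4*x))*B T0<=e.
 apply: le_trans h; move: xe; move: (expR _-expR _) => z z0.
 have -> : z*c = 3*K*z*B T0+z by rewrite /c; ring.
 by lra.
by lra.
Qed.

End Mono.

(** * Superlevel sets and the monotone quantity *)

Lemma indicT {R : realType} {T : Type} (A : set T) x : A x -> \1_A x = 1 :> R.
Proof. by move=> h; rewrite indicE mem_set. Qed.

Lemma indicF {R : realType} {T : Type} (A : set T) x : ~ A x -> \1_A x = 0 :> R.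
Proof. by move=> h; rewrite indicE memNset. Qed.

Lemma indic_01 {R : realType} {T : Type} (A : set T) x : 0<=(\1_A x : R)<=1.
Proof. by rewrite indicE; case: (_ \in _); rewrite lexx ler01. Qed.

Lemma trap_height_gt0 {R : realType} (a b s : R) : 0<s -> a+s<=b -> 0<b-a-s/2.
Proof. by lra. Qed.

Lemma flux_arith {R : realType} (d K A0 E0 Ja : R) (I1 I2 Jv Jf : R) : 0<=K ->
 I1<=d*Jv -> d*Jf<=I2 ->
 2*(K*I1+d*E0)-2^-1*(I2+d*A0) <=
 d*(2*(E0+K*Jv)-(A0+Ja)/2+2^-1*(A0+Ja-(A0+Jf))).
Proof.
by move=> *; nra. Qed.

Lemma trap_arith {R : realType} (al bt de k s f T p n w : R) : 0<=al -> 0<=f -> 0<=w -> w<=1 -> 0<=n -> n<=1 ->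
 0<=s<=de -> k * p+s*n<=al*f+bt*T+de ->
 k*(w * p)+s*n<=al*f+de+bt*(w*T).
Proof.
move=> a0 f0 w0 w1 n0 n1 /andP[s0 sd] H; have h:=ler_wpM2l w0 H.
have h2 : s*n<=de by apply: le_trans sd; rewrite ler_piMr.
have af : 0<=al*f by pos.
have w1' : 0<=1-w by lra.
have h3 : (1-w)*(s*n)<=(1-w)*(de+al*f) by apply: ler_wpM2l => //; lra.
have -> : k*(w * p)+s*n = w*(k * p+s*n)+(1-w)*(s*n) by ring.
have -> : al*f+de+bt*(w*T) = w*(al*f+bt*T+de)+(1-w)*(de+al*f) by ring.
exact: lerD.
Qed.

Lemma layer_arith {R : realType} (k d d0 Z S Ra bt Y e sg : R) : 0<=bt -> 0<=sg -> 0<=k*Z ->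
 k*(4*(d-sg-d0-sg/2)*Z)+S<=Ra+bt*((d-sg-d0)*Y) ->
 sg*(6*(k*Z)+bt * `|Y| + 1)<=e ->
 4*k*(d-d0)*Z+S<=Ra+bt*((d-d0)*Y)+e.
Proof.
move=> b0 s0 kZ H He.
have h1 : - (bt*Y)<=bt * `|Y| by rewrite -mulrN; apply: ler_wpM2l => //; rewrite lerNl; exact: lerNnormlW.
have h2:=ler_wpM2l s0 h1.
have -> : 4*k*(d-d0)*Z+S = k*(4*(d-sg-d0-sg/2)*Z)+S+sg*(6*(k*Z)) by lra.
apply: le_trans (lerD H (lexx _)) _.
have -> : bt*((d-sg-d0)*Y) = bt*((d-d0)*Y)+sg*(- (bt*Y)) by ring.
by lra.
Qed.

Lemma layer_mono {R : realType} (k c Z Z' S W : R) : 0<=k -> 0<=c -> Z<=Z' ->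
 k*(4*c*Z')+S<=W -> k*(4*c*Z)+S<=W.
Proof.
move=> k0 c0 zz; apply: le_trans; rewrite lerD2r; apply: ler_wpM2l => //.
by apply: ler_wpM2l => //; rewrite mulr_ge0.
Qed.

Lemma Vol_gt0 {R : realType} (A : set 'rV[R]_4) (x : 'rV[R]_4) r : measurable (A : set (@E4 R)) ->
 A `<=` cube r -> (\forall y \near x, A y) -> 0<Vol A.
Proof.
move=> mA Ar /nbhs_ballP[d /= d0 hd].
pose e:=d/2; have e0 : 0<e by pos.
have bx y : ball4 e (y-x) -> A y.
 move=> b; apply: hd; split => // i j; rewrite ord1 /ball /= distrC.
 have:=ball4_bounded (ltW e0) b j; rewrite !mxE => h; apply: le_lt_trans h _.
 by rewrite /e; lra.
have ib : itg (\1_(ball4 e) : 'rV[R]_4 -> R).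
 apply: (@itg_indic _ _ e); first exact: measurable_ball4.
 by rewrite (cubeE (ltW e0)) => y b; exact: ball4_bounded (ltW e0) b.
have it : itg (fun y => \1_(ball4 e) (y + - x) : R).
 apply: (itg_dom _ _ (itg_indic mA Ar)).
  have:=@measurable_affine R 1 (- x) _ (@measurable_ball4 R e) => m.
  have -> : (fun y : 'rV[R]_4 => \1_(ball4 e) (y + - x) : R) = \1_((fun y : 'rV[R]_4 => 1 *: y + - x) @^-1` ball4 e).
   apply/funext => y; have [h|h]:=pselect (ball4 e (y + - x)); last by rewrite !indicF //= scale1r.
   by rewrite !indicT //= scale1r.
  exact: measurable_indic.
 move=> y; rewrite ger0_norm; last by [].
 have [h|h]:=pselect (A y); first by rewrite (indicT h); have /andP[]:=@indic_01 R _ (ball4 e) (y + - x).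
 by rewrite indicF// => /bx.
have:=Int_translate (itg_mble ib) ib it; rewrite (Int_indic (@measurable_ball4 R e)) Vol_ball4// => I1.
have : e^+4*omega<=Vol A.
 rewrite -I1 -(Int_indic mA); apply: Int_le => //; first exact: itg_indic Ar.
 move=> y; have [h|h]:=pselect (A y); first by rewrite (indicT h); have /andP[]:=@indic_01 R _ (ball4 e) (y + - x).
 by rewrite indicF// => /bx.
by apply: lt_le_trans; rewrite mulr_gt0 ?exprn_gt0// omega_gt0.
Qed.

Lemma powR_expK {R : realType} (x : R) n : 0<=x -> (0<n)%N -> (x `^ n%:R^-1)^+n = x.
Proof.
move=> x0 n0; rewrite -powR_mulrn ?powR_ge0// -powRrM mulVf ?powRr1//.
by rewrite pnatr_eq0 -lt0n.
Qed.

Lemma powR_quarter {R : realType} (b b' w : R) : 0<=b' -> b'<=b -> 0<w ->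
 b'<=(b/w) `^ 4^-1*(b' `^ (3/4)*w `^ 4^-1).
Proof.
move=> b0 bb w0; have b1 : 0<=b by lra.
have -> : (b/w) `^ 4^-1*(b' `^ (3/4)*w `^ 4^-1) = b `^ 4^-1*b' `^ (3/4).
 rewrite mulrCA -powRM ?divr_ge0// ?(ltW w0)// divfK ?gt_eqF//; exact: mulrC.
have h : b' `^ 4^-1<=b `^ 4^-1 by apply: ge0_ler_powR.
apply: le_trans (ler_wpM2r (powR_ge0 _ _) h).
have [->|bn]:=eqVneq b' 0; first by [].
rewrite -powRD; last by lra.
have -> : 4^-1+3/4 = 1 :> R by lra.
by rewrite powRr1.
Qed.

(** The weights are such that [Q + e] and [y] cancel in the product: the condition for AM-GM then
    involves only [P], [B] and [f T]. *)
Lemma weights_arith {R : realType} (Q e k y P B f T : R) : 0<Q+e -> 0<k -> 0<y ->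
 64*((Q+e)/(3*k*y^+2)*f)*(4*P*B/(Q+e)*T)*(2*y*P)^+2 =
 1024/(3*k)*P^+3*B*(f*T).
Proof. by move=> q k0 y0; field; rewrite !lt0r_neq0. Qed.

Lemma cube_root_cvg {R : realType} (a : nat -> R) (l : R) : (forall n, 0<=a n) -> 0<=l ->
 a n @[n --> \oo] --> l -> (a n) `^ 3^-1 @[n --> \oo] --> l `^ 3^-1.
Proof.
move=> a0 l0 c; apply/cvgrPdist_le => e e0.
have /cvgrPdist_le/(_ (e^+3) (exprn_gt0 _ e0)):=c.
apply: filterS => n h; set y:=l `^ _; set z:=a n `^ _.
have y0 : 0<=y by pos.
have z0 : 0<=z by pos.
have y3 : y^+3 = l by exact: (@powR_expK _ _ 3).
have z3 : z^+3 = a n by exact: (@powR_expK _ _ 3).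
move: h; rewrite -y3 -z3 => h.
rewrite -(@ler_pXn2r _ 3) ?nnegrE ?normr_ge0 ?(ltW e0)//.
apply: le_trans h; rewrite -normrX.
have [yz|yz]:=leP z y.
 rewrite !ger0_norm ?exprn_ge0 ?subr_ge0//; last by rewrite lerXn2r.
 rewrite -subr_ge0; have -> : y^+3-z^+3-(y-z)^+3 = 3*(y*z*(y-z)) by ring.
 by rewrite !mulr_ge0// subr_ge0.
have yz':=ltW yz; rewrite -[y^+3-_]opprB -[y-z]opprB !normrX !normrN -!normrX.
rewrite !ger0_norm ?exprn_ge0 ?subr_ge0//; last by rewrite lerXn2r.
rewrite -subr_ge0; have -> : z^+3-y^+3-(z-y)^+3 = 3*(y*z*(z-y)) by ring.
by rewrite !mulr_ge0// subr_ge0.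
Qed.

Lemma cvg_exp4 {R : realType} (a : nat -> R) (l : R) : a n @[n --> \oo] --> l -> a n^+4 @[n --> \oo] --> l^+4.
Proof.
move=> c; rewrite (_ : (fun n => _) = (fun n => a n*a n*(a n*a n))); last by apply/funext => n; ring.
by rewrite (_ : l^+4 = l * l*(l * l)); [apply: cvgM; apply: cvgM|ring].
Qed.

Lemma expR_cvg0 {R : realType} : expR (4*(- n%:R)) @[n --> \oo] --> (0 : R).
Proof.
apply: (@cvg_harmonic _ _ _ 1 0%N) => // n _; rewrite subr0 ger0_norm ?expR_ge0//.
rewrite mulrN expRN div1r lef_pV2 ?posrE ?expR_gt0 ?ltr0n//.
apply: le_trans (expR_ge1Dx _); rewrite -natr1 addrC lerD2l ler_peMl//.
by lra.
Qed.

Lemma coef_ge0 {R : realType} (K e B k : R) : 0<K -> 0<e -> 0<=B -> 0<k -> 0<=1024/(3*k)*(K*e)^+3*B.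
Proof.
move=> K0 e0 B0 k0; apply: mulr_ge0; last exact: B0.
apply: mulr_ge0; last by pos.
apply: divr_ge0; first exact: ler0n.
by lra.
Qed.

Lemma coef_gt0 {R : realType} (K e B k : R) : 0<K -> 0<e -> 0<B -> 0<k -> 0<1024/(3*k)*(K*e)^+3*B.
Proof.
move=> K0 e0 B0 k0; apply: mulr_gt0; last exact: B0.
apply: mulr_gt0; last by pos.
apply: divr_gt0; first exact: ltr0n.
by lra.
Qed.

Lemma coef_mono {R : realType} (K e e' B B' k : R) : 0<K -> 0<e -> e<=e' -> B<=B' -> 0<=B -> 0<k ->
 1024/(3*k)*(K*e)^+3*B<=1024/(3*k)*(K*e')^+3*B'.
Proof.
move=> K0 e0 ee BB B0 k0.
have c0 : 0<=1024/(3*k).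
 by apply: divr_ge0; [exact: ler0n|apply: mulr_ge0; [exact: ler0n|exact: ltW]].
have q0 : 0<=K*e by pos.
have qq : K*e<=K*e' by rewrite ler_pM2l.
have e3 : (K*e)^+3<=(K*e')^+3 by rewrite lerXn2r ?nnegrE//; exact: le_trans qq.
apply: ler_pM; [|exact: B0| |exact: BB].
 by apply: mulr_ge0; [exact: c0|exact: exprn_ge0].
by apply: ler_wpM2l; [exact: c0|exact: e3].
Qed.

(** The place where [kap <= 4 omega] enters, together with [e^(4t) <= e^(4u)] on the superlevel
    set. *)
Lemma slack_arith {R : realType} (K e e' B om k p q : R) : 0<K -> 0<e -> e<=e' -> 0<=B -> 0<om -> 0<k -> k<=4*om -> 0<=p ->
 q^+4 = B/om ->
 (4*(K*e)*q * p)^+4<=1024/(3*k)*(K*e)^+3*B*(3*K*e' * p^+4).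
Proof.
move=> K0 e0 ee B0 om0 k0 ko p0 q4.
have -> : (4*(K*e)*q * p)^+4 = 256/om*(K^+4*e^+3*B * p^+4*e).
 transitivity (256*(K*e)^+4*(q^+4) * p^+4); first by ring.
 by rewrite q4; field; rewrite lt0r_neq0.
have -> : 1024/(3*k)*(K*e)^+3*B*(3*K*e' * p^+4) = 1024/k*(K^+4*e^+3*B * p^+4*e') by lra.
have X0 : 0<=K^+4*e^+3*B * p^+4.
 by apply: mulr_ge0; [apply: mulr_ge0 => //; apply: mulr_ge0; apply: exprn_ge0; exact: ltW|exact: exprn_ge0].
apply: ler_pM; rewrite ?divr_ge0 ?(ltW om0)//; first by rewrite mulr_ge0// ltW.
 rewrite ler_pdivrMr// mulrAC ler_pdivlMr//; lra.
by apply: ler_wpM2l.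
Qed.

Section Superlevel.
Context {R : realType}.
Local Notation E:='rV[R]_4.
Local Notation e_ i:=(delta_mx 0 i : E).
Variables (Om : set E) (u f Th : E -> R) (K A0 E0 : R).
Hypothesis oOm : open Om.
Hypothesis cu : is_Ck 1 Om u.
Hypothesis cf : forall x, Om x -> cts f x.
Hypothesis cTh : forall x, Om x -> cts Th x.
Hypothesis f0 : forall x, Om x -> 0<=f x.
Hypothesis Th0 : forall x, Om x -> 0<=Th x.
Hypothesis far : forall T : R, exists r : R, forall x : E, r < `|x| -> Om x /\ u x<T.
Hypothesis nearS : forall (x : E) (T : R), ~ Om x -> \forall y \near x, Om y -> T<u y.
Hypothesis K0 : 0<K.
Hypothesis A00 : 0<=A0.
Hypothesis E00 : 0<=E0.

Definition fO x : R:=\1_Om x*f x.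
Definition vO x : R:=\1_Om x*expR (4*u x).
Hypothesis ifO : itg fO.
Hypothesis ivO : itg vO.

(** Extended across the singular points by its limit [b-a], since [u] tends to plus infinity
    there. *)
Definition eta (sg a b : R) (x : E) : R:=if `[< Om x >] then trapI sg a b (u x) else b-a.

(** A smoothed coarea formula: the weighted integral of [Th] over a layer is an average of
    [2E - a/2] over its levels. [A0] and [E0] are the masses at the singular points, where the test
    function is [b-a]. *)
Hypothesis flux : forall sg a b, 0<sg -> a<=b ->
 itg (fun x => \1_Om x*(trap sg a b (u x)*Th x)) /\
 Int (fun x => \1_Om x*(trap sg a b (u x)*Th x)) =
 2*(K*Int (fun x => eta sg a b x*vO x)+(b-a)*E0) -
 2^-1*(Int (fun x => eta sg a b x*fO x)+(b-a)*A0).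

Definition L (t : R) : set E:=[set x | Om x /\ t<u x].

Lemma u_cont x : Om x -> cts u x.
Proof. by move=> Ox; exact: (proj1 cu). Qed.

Lemma open_L t : open (L t).
Proof.
rewrite openE => x [Ox tx]; rewrite /interior.
have n1 : \forall y \near x, Om y by exact: open_nbhs_nbhs.
have n2 : \forall y \near x, t<u y by have:=@lt_nbhsr _ _ _ tx => nb; exact: (u_cont Ox nb).
by apply: filterS2 n1 n2.
Qed.

Lemma measurable_L t : measurable (L t : set (@E4 R)).
Proof.
have cc x : L t x -> cts (fun _ : E => 1 : R) x by move=> _; exact: cst_continuous.
have m1:=measurable_indicM (@open_L t) cc; have -> : L t = [set x : @E4 R | (0 : R)<(\1_(L t) x : R)*1].
 apply/seteqP; split => x /=; first by move=> h; rewrite indicT// mulr1.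
 by move=> h; apply: contrapT => n; move: h; rewrite indicF// mul0r ltxx.
exact: measurable_superlevelE.
Qed.

Lemma L_bounded t : exists r, L t `<=` cube r.
Proof.
have [r hr]:=far t; exists r => x [_ tx]; rewrite /cube /= leNgt.
by apply/negP => h; have [_ /(lt_trans tx)]:=hr x h; rewrite ltxx.
Qed.

Lemma L_mono s t : s<=t -> L t `<=` L s.
Proof. by move=> st x [Ox tx]; split => //; exact: le_lt_trans tx. Qed.

Lemma itg_L t : itg (\1_(L t) : E -> R).
Proof. by have [r hr]:=L_bounded t; apply: itg_indic hr; exact: measurable_L. Qed.

Definition J (G : E -> R) (t : R) : R:=Int (fun x => \1_(L t) x*G x).

Lemma itg_J G t : itg G -> itg (fun x => \1_(L t) x*G x).
Proof.
move=> iG; apply: (@itg_dom _ _ (fun x => `|G x|)).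
- by apply: measurable_funM; [exact: itg_mble (itg_L t)|exact: itg_mble].
- by move=> x; rewrite normrM ler_piMl// ger0_norm; have /andP[]:=@indic_01 R _ (L t) x.
- by have:=integrable_norm iG.
Qed.

Lemma fO_ge0 x : 0<=fO x.
Proof.
rewrite /fO; have [h|h]:=pselect (Om x); last by rewrite indicF// mul0r.
by rewrite indicT// mul1r f0.
Qed.

Lemma vO_ge0 x : 0<=vO x.
Proof.
by move=> *; pos. Qed.

Lemma J_mono G s t : itg G -> (forall x, 0<=G x) -> s<=t -> J G t<=J G s.
Proof.
move=> iG G0 st; apply: Int_le; [exact: itg_J|exact: itg_J|move=> x].
apply: ler_wpM2r; first exact: G0.
have [h|h]:=pselect (L t x); first by rewrite !indicT//; exact: L_mono st _ h.
by rewrite (indicF h); have /andP[]:=@indic_01 R _ (L s) x.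
Qed.

Lemma J_ge0 G t : (forall x, 0<=G x) -> 0<=J G t.
Proof.
by move=> G0; apply: Int_ge0 => x; rewrite mulr_ge0.
Qed.

Lemma J_cvg G (tn : nat -> R) (A : set E) : itg G -> (forall x, 0<=G x) ->
 (forall x, \1_(L (tn n)) x @[n --> \oo] --> (\1_A x : R)) ->
 itg (fun x => \1_A x*G x) ->
 J G (tn n) @[n --> \oo] --> Int (fun x => \1_A x*G x).
Proof.
move=> iG G0 hc iA; apply: (@Int_dominated _ _ _ G) => //.
- by move=> n; apply: itg_mble; exact: itg_J.
- by move=> x; apply: cvgM; [exact: hc|exact: cvg_cst].
- move=> n x; rewrite normrM (ger0_norm (G0 x)) ler_piMl//.
 by rewrite ger0_norm; have /andP[]:=@indic_01 R _ (L (tn n)) x.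
Qed.

Lemma cvg_near (s : nat -> R) (l : R) N : (forall n, (N<=n)%N -> s n = l) -> s n @[n --> \oo] --> l.
Proof. by move=> h; apply: cvg_near_cst; exists N => // n /= Nn; rewrite h. Qed.

(** Right-continuity is due to the strict inequality in [L]: the sets [L t'] increase to [L t] as
    [t'] decreases to [t]. *)
Lemma J_right G t e : itg G -> (forall x, 0<=G x) -> 0<e ->
 exists2 d : R, 0<d & forall t', t<=t'<t+d -> J G t-J G t'<=e.
Proof.
move=> iG G0 e0.
have /cvgrPdist_le/(_ e e0) [N _ hN] : J G (t+n.+1%:R^-1) @[n --> \oo] --> Int (fun x => \1_(L t) x*G x).
 apply: J_cvg => //; last exact: itg_J.
 move=> x; have [h|h]:=pselect (L t x); last first.
  rewrite indicF//; apply: (@cvg_near _ _ 0%N) => n _; rewrite indicF// => h'.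
  by apply: h; apply: L_mono h'; rewrite lerDl invr_ge0 ler0n.
 rewrite indicT//; have [Ox tx]:=h.
 apply: (@cvg_near _ _ (Num.trunc (u x-t)^-1).+1) => n Nn; rewrite indicT//; split => //.
 rewrite -ltrBrDl invf_plt ?posrE ?ltr0n ?subr_gt0//.
 by apply: lt_le_trans (truncnS_gt _) _; rewrite ler_nat; apply: leq_trans Nn _.
exists N.+1%:R^-1 => [|t' /andP[t1 t2]]; first by [].
have:=hN N (leqnn N); rewrite /J => h.
apply: le_trans (le_trans (ler_norm _) h); rewrite lerD2l lerN2.
by apply: J_mono => //; exact: ltW.
Qed.

Definition BL t : R:=Vol (L t).
Definition aL t : R:=A0+J fO t.
Definition EL t : R:=E0+K*J vO t.
Definition QL t : R:=2*EL t-aL t/2.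

Lemma BL_J s t : s<=t -> BL t = J (\1_(L s)) t.
Proof.
move=> st; rewrite /BL -Int_indic; last exact: measurable_L.
apply: Int_eq => x; have [h|h]:=pselect (L t x); last by rewrite !(indicF h) mul0r.
by rewrite !indicT ?mulr1//; exact: L_mono h.
Qed.

Lemma indic_ge0 s x : (0 : R) <= \1_(L s) x.
Proof.
by []. Qed.

Lemma BL_mono s t : s<=t -> BL t<=BL s.
Proof. by move=> st; rewrite (BL_J st) (BL_J (lexx s)); apply: J_mono st; [exact: itg_L|move=> x; exact: indic_ge0]. Qed.

Lemma BL_ge0 t : 0<=BL t.
Proof. exact: Vol_ge0. Qed.

Lemma aL_mono s t : s<=t -> aL t<=aL s.
Proof. by move=> st; rewrite lerD2l; apply: J_mono => //; exact: fO_ge0. Qed.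

Lemma aL_ge0 t : 0<=aL t.
Proof. by rewrite addr_ge0//; apply: J_ge0; exact: fO_ge0. Qed.

Lemma EL_ge0 t : 0<=EL t.
Proof. by apply: addr_ge0 => //; apply: mulr_ge0; [exact: ltW|apply: J_ge0; exact: vO_ge0]. Qed.

Lemma EL_diff s t : s<=t -> K*expR (4*s)*(BL s-BL t)<=EL s-EL t<=K*expR (4*t)*(BL s-BL t).
Proof.
move=> st.
have -> : EL s-EL t = K*(J vO s-J vO t) by rewrite /EL; ring.
have P x : expR (4*s)*(\1_(L s) x * \1_(L s) x - \1_(L t) x * \1_(L s) x) <= \1_(L s) x*vO x - \1_(L t) x*vO x <=
  expR (4*t)*(\1_(L s) x * \1_(L s) x - \1_(L t) x * \1_(L s) x).
 rewrite -!mulrBl; have [h|h]:=pselect (L s x); last first.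
  have h' : ~ L t x by move=> /(L_mono st).
  by rewrite (indicF h) (indicF h') subrr !mul0r !mulr0 lexx.
 have [Ox sx]:=h; have [h'|h']:=pselect (L t x); first by rewrite !indicT// subrr !mul0r !mulr0 lexx.
 rewrite /vO !(indicT h) (indicF h') (indicT Ox) subr0 !mul1r !mulr1 !ler_expR !ler_pM2l// (ltW sx) /=.
 by rewrite leNgt; apply/negP => tx; apply: h'.
have i1:=itg_sub (itg_J s (itg_L s)) (itg_J t (itg_L s)); have i2:=itg_sub (itg_J s ivO) (itg_J t ivO).
rewrite -!mulrA !ler_pM2l// (BL_J st) (BL_J (lexx s)) /J -!Int_sub; [|exact: itg_J|exact: itg_J|by apply: itg_J; exact: itg_L|by apply: itg_J; exact: itg_L].
rewrite -!Int_scale//; apply/andP; split; apply: Int_le => //; do ?exact: itg_scale; by move=> x; have /andP[]:=P x.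
Qed.

Lemma eta_out sg a b x : ~ Om x -> eta sg a b x = b-a.
Proof. by move=> h; rewrite /eta; case: asboolP. Qed.

Lemma eta_in sg a b x : Om x -> eta sg a b x = trapI sg a b (u x).
Proof. by move=> h; rewrite /eta; case: asboolP. Qed.

Section Trap.
Variables (sg a b : R).
Hypotheses (sg0 : 0<sg) (ab : a<=b).

Lemma eta_near x : ~ Om x -> \forall y \near x, eta sg a b y = b-a.
Proof.
move=> nx; apply: filterS (nearS (b+sg) nx) => y hy.
have [Oy|nO]:=pselect (Om y); last exact: eta_out.
by rewrite eta_in//; have []:=trap_ge sg0 ab (ltW (hy Oy)).
Qed.

Lemma is_Ck1_eta : is_Ck 1 Om (eta sg a b).
Proof.
have h : is_Ck 1 Om (fun x => trapI sg a b (u x)).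
 apply: is_Ck1_comp1 cu => // s; [exact: is_derive_trapI|exact: trap_continuous].
by apply: is_Ck_eq h => // x Ox; rewrite eta_in.
Qed.

Lemma C1at_eta x : C1at (eta sg a b) x.
Proof.
have [Ox|nO]:=pselect (Om x); first exact: is_Ck_C1at oOm is_Ck1_eta Ox.
exact: C1at_near_cst (eta_near nO).
Qed.

Lemma partial_eta_in i x : Om x -> partial i (eta sg a b) x = trap sg a b (u x) * partial i u x.
Proof.
move=> Ox; have h : is_derive x (e_ i) u (partial i u x) by exact: is_Ck_derivable cu Ox.
rewrite -(partial_comp1 (is_derive_trapI a b (u x) sg0) h) /partial.
apply: near_eq_derive; apply: filterS (open_nbhs_nbhs (conj oOm Ox)) => y Oy.
exact: eta_in.
Qed.

Lemma partial_eta_out i x : ~ Om x -> partial i (eta sg a b) x = 0.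
Proof.
move=> nO; rewrite /partial (near_eq_derive (g:=fun=> b-a)) ?derive_cst//.
exact: eta_near.
Qed.

Lemma eta_far : exists r : R, forall x, r < `|x| -> eta sg a b x = 0.
Proof.
have [r hr]:=far a; exists r => x /hr[Ox ux]; rewrite eta_in//.
by have []:=trap_le sg0 ab (ltW ux).
Qed.

Lemma eta_bounds x : 0<=eta sg a b x<=b-a.
Proof.
rewrite /eta; case: asboolP => _; first exact: trapI_bounds.
by rewrite subr_ge0 ab lexx.
Qed.

Lemma enorm_grad_eta x : enorm (grad (eta sg a b) x) = \1_Om x*(trap sg a b (u x)*enorm (grad u x)).
Proof.
have [Ox|nO]:=pselect (Om x).
 have t0 : 0<=trap sg a b (u x) by have /andP[]:=trap_01 (u x) sg0 ab.
 rewrite indicT// mul1r /enorm /dot.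
 under eq_bigr => i _ do rewrite !mxE partial_eta_in// -expr2 exprMn expr2.
 rewrite -(mulr_sumr _ _ _) sqrtrM ?mulr_ge0// -expr2 sqrtr_sqr ger0_norm//.
 by congr (_*Num.sqrt _); apply: eq_bigr => i _; rewrite !mxE expr2.
rewrite indicF// mul0r /enorm /dot.
under eq_bigr => i _ do rewrite !mxE partial_eta_out// mul0r.
by rewrite big1// sqrtr0.
Qed.

Lemma itg_grad : itg (fun x => \1_Om x*(trap sg a b (u x)*enorm (grad u x))).
Proof.
have [r hr]:=eta_far.
have c : Cc (fun x => enorm (grad (eta sg a b) x)).
 split; first by move=> x; apply: C1at_grad_cont; exact: C1at_eta.
 exists r => x rx; rewrite /enorm /dot big1 ?sqrtr0// => i _.
 by rewrite !mxE (partial_far _ hr) ?mul0r.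
by apply: itg_eq (itg_Cc c) => x; exact: enorm_grad_eta.
Qed.

(** On [L b] the test function is at least [b-a-sg/2], which is the height at which the
    isoperimetric inequality is applied. *)
Lemma isop_level : a+sg<=b ->
 4*(b-a-sg/2)*(BL b `^ (3/4)*omega `^ 4^-1) <=
 Int (fun x => \1_Om x*(trap sg a b (u x)*enorm (grad u x))).
Proof.
move=> asb; have H0 : 0<b-a-sg/2 by exact: trap_height_gt0.
have [r hr]:=eta_far.
have e0 x : 0<=eta sg a b x by have /andP[]:=eta_bounds x.
have:=isoperimetric e0 hr C1at_eta H0.
rewrite (Int_eq enorm_grad_eta); apply: le_trans; apply: ler_wpM2l; first by lra.
apply: ler_wpM2r; first exact: powR_ge0.
apply: ge0_ler_powR; rewrite ?nnegrE ?divr_ge0// ?Vol_ge0//.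
have ce : forall x, cts (eta sg a b) x by move=> x; exact: C1at_cont (C1at_eta x).
pose S:=[set x | b-a-sg/2<=eta sg a b x].
have mS : measurable (S : set (@E4 R)).
 have -> : S = ~` [set x : @E4 R | - (b-a-sg/2) < - eta sg a b x].
  apply/seteqP; split => x; rewrite /S /= ltrN2; first by lra.
  by lra.
 apply: measurableC; apply: measurable_superlevelE; apply: measurableT_comp => //.
 exact: continuous_mble.
apply: (@Vol_le _ _ _ (Num.max r 0)) => //; first exact: measurable_L.
- move=> x; rewrite /S /= => Sx; apply: cube_coord; rewrite /cube /= leNgt.
 by apply/negP; rewrite gt_max => /andP[/hr e _]; move: Sx; rewrite e; lra.
- by move=> x [Ox bx]; rewrite /= eta_in//; apply: trapI_ge => //; exact: ltW.
Qed.

(** The test function is at most [b-a] and vanishes on [Om] off [L a], which bounds the volume term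
    above; it equals [b-a] on [L (b+sg)], which bounds the [f] term below. *)
Lemma flux_bound : Int (fun x => \1_Om x*(trap sg a b (u x)*Th x)) <=
 (b-a)*(QL a+2^-1*(aL a-aL (b+sg))).
Proof.
have [_ ->]:=flux sg0 ab.
have me : mble (eta sg a b) by apply: continuous_mble => x; exact: C1at_cont (C1at_eta x).
have ie G : itg G -> itg (fun x => eta sg a b x*G x).
 move=> iG; apply: (@itg_dom _ _ (fun x => (b-a) * `|G x|)).
 - by apply: measurable_funM => //; exact: itg_mble.
 - move=> x; have /andP[h1 h2]:=eta_bounds x; rewrite normrM (ger0_norm h1).
  by apply: ler_wpM2r.
 - by apply: itg_scale; have:=integrable_norm iG.
have h1 : Int (fun x => eta sg a b x*vO x)<=(b-a)*J vO a.
 rewrite /J -Int_scale; last exact: itg_J.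
 apply: Int_le; [exact: ie|by apply: itg_scale; exact: itg_J|move=> x].
 have [Ox|nO]:=pselect (Om x); last by rewrite /vO (indicF nO) mul0r !mulr0.
 rewrite [leRHS]mulrA; apply: ler_wpM2r; first exact: vO_ge0.
 have [h|h]:=pselect (L a x); first by rewrite indicT// mulr1; have /andP[]:=eta_bounds x.
 rewrite indicF// mulr0 eta_in//; have []:=@trap_le _ sg a b (u x) sg0 ab _; last by lra.
 by rewrite leNgt; apply/negP => ax; apply: h.
have h2 : (b-a)*J fO (b+sg)<=Int (fun x => eta sg a b x*fO x).
 rewrite /J -Int_scale; last exact: itg_J.
 apply: Int_le; [by apply: itg_scale; exact: itg_J|exact: ie|move=> x].
 rewrite [leLHS]mulrA; apply: ler_wpM2r; first exact: fO_ge0.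
 have [h|h]:=pselect (L (b+sg) x); last by rewrite indicF// mulr0; have /andP[]:=eta_bounds x.
 have [Ox bx]:=h; rewrite indicT// mulr1 eta_in//.
 by have [-> _]:=trap_ge sg0 ab (ltW bx).
apply: le_trans (flux_arith A0 E0 (J fO a) (ltW K0) h1 h2) _.
by [].
Qed.

Lemma isop_trap (al bt de k s : R) (N : set E) : 0<=al -> 0<=bt -> 0<=k -> 0<=s<=de ->
 measurable (N : set (@E4 R)) ->
 (forall x, L a x -> k*enorm (grad u x)+s * \1_N x<=al*f x+bt*Th x+de) -> a+sg<=b ->
 k*(4*(b-a-sg/2)*(BL b `^ (3/4)*omega `^ 4^-1)) +
  s*(Int (fun x => \1_(L a) x * \1_N x)-Int (fun x => \1_(L (b+sg)) x * \1_N x)) <=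
 al*(aL a-aL (b+sg))+de*(BL a-BL (b+sg))+bt*((b-a)*(QL a+2^-1*(aL a-aL (b+sg)))).
Proof.
move=> al0 bt0 k0 sde mN H asb.
have st : a<=b+sg by apply: le_trans ab _; rewrite lerDl ltW.
have iN t : itg (fun x => \1_(L t) x * \1_N x : R).
 apply: (itg_dom _ _ (itg_L t)).
  by apply: measurable_funM; [exact: itg_mble (itg_L t)|exact: measurable_indic].
 move=> x; rewrite ger0_norm; last by [].
 by rewrite ler_piMr.
have iT : itg (fun x => \1_Om x*(trap sg a b (u x)*Th x)) by have []:=flux sg0 ab.
have i1:=itg_sub (itg_J a ifO) (itg_J (b+sg) ifO).
have i2:=itg_sub (itg_J a (itg_L a)) (itg_J (b+sg) (itg_L a)).
have i3:=itg_sub (iN a) (iN (b+sg)).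
have P : Int (fun x => k*(\1_Om x*(trap sg a b (u x)*enorm (grad u x)))+s*(\1_(L a) x * \1_N x - \1_(L (b+sg)) x * \1_N x)) <=
 Int (fun x => al*(\1_(L a) x*fO x - \1_(L (b+sg)) x*fO x)+de*(\1_(L a) x * \1_(L a) x - \1_(L (b+sg)) x * \1_(L a) x)+bt*(\1_Om x*(trap sg a b (u x)*Th x))).
 apply: Int_le.
 - by apply: itg_add; apply: itg_scale => //; exact: itg_grad.
 - by apply: itg_add; [apply: itg_add|]; apply: itg_scale.
 - move=> x; have [h|h]:=pselect (L a x); last first.
   have h' : ~ L (b+sg) x by move=> /(L_mono st).
   rewrite !(indicF h) !(indicF h') !mul0r !subr0 !mulr0 !add0r.
   have [Ox|nO]:=pselect (Om x); last by rewrite (indicF nO) !mul0r !mulr0.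
   have [_ ->] : trapI sg a b (u x) = 0 /\ trap sg a b (u x) = 0.
    by apply: trap_le => //; rewrite leNgt; apply/negP => ax; apply: h.
   by lra.
  have [Ox ax]:=h; rewrite /fO !(indicT h) !(indicT Ox).
  have [h'|h']:=pselect (L (b+sg) x).
   have [_ ->]:=trap_ge sg0 ab (ltW (proj2 h')).
   by rewrite !(indicT h') !subrr !mul0r !mulr0 !addr0.
  rewrite !(indicF h') !mul0r !subr0 !mul1r mulr1.
  have /andP[t1 t2]:=trap_01 (u x) sg0 ab; have /andP[n1 n2]:=@indic_01 R _ N x.
  exact: trap_arith al0 (f0 Ox) t1 t2 n1 n2 sde (H x h).
rewrite Int_add in P; [|by apply: itg_scale; exact: itg_grad|by apply: itg_scale].
rewrite !Int_scale// in P; last exact: itg_grad.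
rewrite Int_sub// in P.
rewrite Int_add in P; [|by apply: itg_add; apply: itg_scale|by apply: itg_scale].
rewrite Int_add in P; [|by apply: itg_scale|by apply: itg_scale].
rewrite !Int_scale// in P.
rewrite (Int_sub (itg_J a ifO) (itg_J (b+sg) ifO)) (Int_sub (itg_J a (itg_L a)) (itg_J (b+sg) (itg_L a))) in P.
rewrite (BL_J st) (BL_J (lexx a)).
apply: le_trans (le_trans P _).
 by rewrite lerD2r; apply: ler_wpM2l => //; exact: isop_level.
apply: lerD; last by apply: ler_wpM2l => //; exact: flux_bound.
by rewrite opprD addrACA subrr add0r.
Qed.

End Trap.

(** The trapezoid inequality [isop_trap] on [[t, t'-sg]], with the width [sg] of the slopes tending
    to 0. *)
Lemma layer_inequality (t t' al bt de k s : R) (N : set E) : t<t' -> 0<=al -> 0<=bt -> 0<=k -> 0<=s<=de ->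
 measurable (N : set (@E4 R)) ->
 (forall x, L t x -> k*enorm (grad u x)+s * \1_N x<=al*f x+bt*Th x+de) ->
 4*k*(t'-t)*(BL t' `^ (3/4)*omega `^ 4^-1) +
  s*(Int (fun x => \1_(L t) x * \1_N x)-Int (fun x => \1_(L t') x * \1_N x)) <=
 al*(aL t-aL t')+de*(BL t-BL t')+bt*((t'-t)*(QL t+2^-1*(aL t-aL t'))).
Proof.
move=> tt al0 bt0 k0 sde mN H.
pose Z:=BL t' `^ (3/4)*omega `^ 4^-1 : R; pose Y:=QL t+2^-1*(aL t-aL t').
have Z0 : 0<=Z by rewrite mulr_ge0// powR_ge0.
set S:=s*_; set Ra:=_+de*_.
have main sg : 0<sg -> t+sg+sg<=t' ->
 k*(4*(t'-sg-t-sg/2)*Z)+S<=Ra+bt*((t'-sg-t)*Y).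
 move=> sg0 h; have tb : t<=t'-sg by lra.
 have h2 : t+sg<=t'-sg by lra.
 have c0 : 0<=t'-sg-t-sg/2 by lra.
 have c1 : t'-sg<=t' by lra.
 have P:=isop_trap sg0 tb al0 bt0 k0 sde mN H h2; rewrite subrK in P.
 apply: (layer_mono k0 c0 _ P); apply: ler_wpM2r; first exact: powR_ge0.
 apply: ge0_ler_powR; rewrite ?nnegrE ?divr_ge0// ?Vol_ge0//.
 exact: BL_mono.
have kZ : 0<=k*Z by pos.
apply/ler_addgt0Pr => e e0.
pose W:=6*(k*Z)+bt * `|Y| + 1; have W0 : 0<W.
 by rewrite ltr_wpDl// addr_ge0// mulr_ge0.
pose sg:=Num.min ((t'-t)/2) (e/W).
have sg0 : 0<sg by rewrite lt_min !divr_gt0// subr_gt0.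
have s1 : sg<=(t'-t)/2 by rewrite ge_min lexx.
have s2 : sg*W<=e by rewrite -ler_pdivlMr// ge_min lexx orbT.
have h2 : t+sg+sg<=t' by lra.
have mm:=main sg sg0 h2.
exact: (layer_arith bt0 (ltW sg0) kZ mm s2).
Qed.

(** By [flux_bound], averages of the nonnegative [Th] over layers above [t] bound [QL t] below, up
    to an error that tends to 0 by right-continuity. *)
Lemma QL_ge0 t : 0<=QL t.
Proof.
have step t' : t<t' -> 0<=QL t+2^-1*(aL t-aL t').
 move=> tt; pose sg:=(t'-t)/2; have sg0 : 0<sg by pos.
 have h : t<=t-sg+sg+sg by lra.
 have tb : t<=t'-sg by rewrite /sg; lra.
 have fb:=flux_bound sg0 tb; rewrite subrK in fb.
 have i0 : 0<=Int (fun x => \1_Om x*(trap sg t (t'-sg) (u x)*Th x)).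
  apply: Int_ge0 => x; have [Ox|nO]:=pselect (Om x); last by rewrite indicF// mul0r.
  rewrite indicT// mul1r mulr_ge0//; last exact: Th0.
  by have /andP[]:=trap_01 (u x) sg0 tb.
 have d0 : 0<t'-sg-t by rewrite /sg; lra.
 by rewrite -(pmulr_rge0 _ d0); apply: le_trans i0 fb.
apply/ler_addgt0Pr => e e0.
have [d d0 hd]:=J_right t ifO fO_ge0 e0.
have:=step (t+d/2) ltac:(by rewrite ltrDl divr_gt0).
have h:=hd (t+d/2) ltac:(by rewrite lerDl divr_ge0 ?(ltW d0)//= ltrD2l; lra).
have -> : aL t-aL (t+d/2) = J fO t-J fO (t+d/2) by rewrite /aL; ring.
by lra.
Qed.

Hypothesis HAM : forall x, Om x -> 3*K*expR (4*u x)*enorm (grad u x)^+4<=f x*Th x.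
Hypothesis Hnd : forall t x, L t x -> exists y, L t y /\ 0<f y.
Variable kap : R.
Hypotheses (kap0 : 0<kap) (kap_le : kap<=4*omega).

Lemma Vol_L_gt0 t x : L t x -> 0<BL t.
Proof.
move=> h; have [r hr]:=L_bounded t.
apply: (@Vol_gt0 _ _ x r) => //; first exact: measurable_L.
exact: open_nbhs_nbhs (conj (@open_L t) h).
Qed.

Lemma BL_eq0 t : BL t = 0 -> forall t', t<=t' -> aL t' = aL t.
Proof.
move=> b0 t' tt; have nL s : t<=s -> forall x, ~ L s x.
 by move=> ts x /(L_mono ts)/Vol_L_gt0; rewrite b0 ltxx.
congr (_+_); apply: Int_eq => x.
by rewrite (indicF (nL _ tt x)) (indicF (nL _ (lexx t) x)).
Qed.

Lemma L_nonempty t : 0<BL t -> exists x, L t x.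
Proof.
move=> b; apply: contrapT => n; move: b.
have -> : BL t = 0; last by lra.
rewrite /BL -Int_indic; last exact: measurable_L.
rewrite -[RHS]Int0; apply: Int_eq => x; rewrite indicF// => h.
by apply: n; exists x.
Qed.

(** Keeps [y] positive as long as the superlevel set is nonempty, so that division by [y^2] in the
    weights is meaningful. *)
Lemma aL_gt0 t : 0<BL t -> 0<aL t.
Proof.
move=> /L_nonempty[x0 /Hnd[x [Lx fx]]].
pose V : set E:=[set y | L t y /\ f x/2<fO y].
have [r hr]:=L_bounded t.
have VL : V `<=` L t by move=> y [].
have mV : measurable (V : set (@E4 R)).
 have -> : V = L t `&` [set y | f x/2<fO y] by [].
 by apply: measurableI; [exact: measurable_L|apply: measurable_superlevelE; exact: itg_mble].
have nV : \forall y \near x, V y.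
 have n1 : \forall y \near x, L t y by exact: open_nbhs_nbhs (conj (@open_L t) Lx).
 have n2 : \forall y \near x, f x/2<f y.
  have fl : f x/2<f x by lra.
  by have:=@lt_nbhsr _ _ _ fl => nb; exact: (cf (proj1 Lx) nb).
 apply: filterS2 n1 n2 => y Ly fy; split => //; rewrite /fO indicT ?mul1r//; exact: (proj1 Ly).
have V0:=Vol_gt0 mV (subset_trans VL hr) nV.
apply: ltr_wpDl => //; apply: lt_le_trans (_ : f x/2*Vol V<=_).
 by rewrite mulr_gt0// divr_gt0.
rewrite -Int_indic// -Int_scale; last exact: itg_indic (subset_trans VL hr).
apply: Int_le; [by apply: itg_scale; exact: itg_indic (subset_trans VL hr)|exact: itg_J|move=> y].
have [h|h]:=pselect (V y); last by rewrite (indicF h) mulr0 mulr_ge0 ?fO_ge0.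
by rewrite (indicT h) (indicT (VL _ h)) mulr1 mul1r ltW//; case: h.
Qed.

Definition lamL (N : set E) t : R:=Int (fun x => \1_(L t) x * \1_N x).

Lemma itg_LN N t : measurable (N : set (@E4 R)) -> itg (fun x => \1_(L t) x * \1_N x : R).
Proof.
move=> mN; apply: (itg_dom _ _ (itg_L t)).
 by apply: measurable_funM; [exact: itg_mble (itg_L t)|exact: measurable_indic].
move=> x; have /andP[n1 n2]:=@indic_01 R _ N x.
by rewrite ger0_norm ?indic_ge0// ler_piMr//.
Qed.

Lemma lamL_diff N t t' : measurable (N : set (@E4 R)) -> t<=t' -> 0<=lamL N t-lamL N t'<=BL t-BL t'.
Proof.
move=> mN tt; have i1:=itg_LN t mN; have i2:=itg_LN t' mN.
have j1:=itg_J t (itg_L t); have j2:=itg_J t' (itg_L t).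
rewrite (BL_J tt) (BL_J (lexx t)) /lamL /J -!Int_sub//.
have d x : (0 : R) <= \1_(L t) x - \1_(L t') x.
 have [h|h]:=pselect (L t' x); first by rewrite (indicT (L_mono tt h)).
 by rewrite (indicF h).
apply/andP; split.
 apply: Int_ge0 => x; rewrite -mulrBl mulr_ge0//; by [].
apply: Int_le; [exact: itg_sub|exact: itg_sub|move=> x].
rewrite -!mulrBl; have [h|h]:=pselect (L t x).
 apply: ler_wpM2l; first exact: d.
 by rewrite (indicT h); have /andP[]:=@indic_01 R _ N x.
have h' : ~ L t' x by move=> /(L_mono tt).
by rewrite (indicF h) (indicF h') subrr !mul0r.
Qed.

(** The factor that turns the isoperimetric bound [4 omega^(1/4) B^(3/4)] into [16 P B]. *)
Definition kw t : R:=4*(K*expR (4*t))*(BL t/omega) `^ 4^-1.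

(** [s] on [N] is the amount by which the bound on the gradient can be strengthened. With [N] empty
    this is plain monotonicity; otherwise it measures a strict increase. *)
Theorem level_mono T0 T1 (N : set E) (s : R) : T0<=T1 -> measurable (N : set (@E4 R)) ->
 0<=s -> s<=2*yr aL kap T1*(K*expR (4*T0)) ->
 (forall t x, T0<=t -> t<T1 -> L t x ->
   (kw t*enorm (grad u x)+s * \1_N x)^+4<=1024/(3*kap)*(K*expR (4*t))^+3*BL t*(f x*Th x)) ->
 MM aL EL BL K kap T0+s * lamL N T0<=MM aL EL BL K kap T1+s * lamL N T1.
Proof.
move=> T01 mN s0 ss HN.
have rB t e : 0<e -> exists2 d : R, 0<d & forall t', t<=t'<t+d -> BL t-BL t'<=e.
 move=> e0; have [d d0 hd]:=J_right t (itg_L t) (fun x => indic_ge0 t x) e0.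
 exists d => // t' ht; rewrite (BL_J (lexx t)) (BL_J (_ : t<=t')); first exact: hd.
 by lra.
have ra t e : 0<e -> exists2 d : R, 0<d & forall t', t<=t'<t+d -> aL t-aL t'<=e.
 move=> e0; have [d d0 hd]:=J_right t ifO fO_ge0 e0; exists d => // t' ht.
 by rewrite opprD addrACA subrr add0r; exact: hd.
apply: MM_mono => //.
- exact: aL_mono.
- exact: BL_mono.
- exact: aL_ge0.
- exact: BL_ge0.
- exact: EL_ge0.
- exact: EL_diff.
- by move=> t t'; exact: lamL_diff.
- exact: BL_eq0.
- exact: aL_gt0.
- exact: QL_ge0.
move=> t t' e Tt tt tT bp e0 /=.
have y0 : 0<yr aL kap t by exact: (yr_gt0 kap0 aL_gt0 bp).
have P0 : 0<K*expR (4*t) by rewrite mulr_gt0// expR_gt0.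
have Qe : 0<QL t+e by apply: ltr_wpDl => //; exact: QL_ge0.
have sde : 0<=s<=2*yr aL kap t*(K*expR (4*t)).
 rewrite s0 /=; apply: le_trans ss _; apply: ler_pM.
 - by apply: mulr_ge0; [exact: ler0n|exact: yr_ge0].
 - by apply: mulr_ge0; [exact: ltW|exact: expR_ge0].
 - apply: ler_wpM2l; first exact: ler0n.
  by apply: yr_mono; [exact: kap0|exact: aL_mono|exact: aL_ge0|exact: le_trans (ltW tt) tT].
 - by rewrite ler_pM2l// ler_expR ler_pM2l.
have al0 : 0<=(QL t+e)/(3*kap*yr aL kap t^+2).
 by rewrite divr_ge0 ?(ltW Qe)// mulr_ge0 ?sqr_ge0// mulr_ge0// ltW.
have bt0 : 0<=4*(K*expR (4*t))*BL t/(QL t+e).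
 by rewrite divr_ge0 ?(ltW Qe)// mulr_ge0 ?(ltW bp)// mulr_ge0// ltW.
have k0 : 0<=kw t by rewrite mulr_ge0 ?powR_ge0// mulr_ge0// ltW.
have LI:=@layer_inequality t t' _ _ _ (kw t) s N tt al0 bt0 k0 sde mN.
apply: le_trans (LI _).
 rewrite lerD2r; apply: le_trans (_ : 16*(K*expR (4*t))*(t'-t)*((BL t/omega) `^ 4^-1*(BL t' `^ (3/4)*omega `^ 4^-1))<=_).
  apply: ler_wpM2l; first by rewrite mulr_ge0 ?subr_ge0 ?(ltW tt)// mulr_ge0// ltW.
  by apply: powR_quarter; [exact: BL_ge0|exact: BL_mono (ltW tt)|exact: omega_gt0].
 rewrite /kw le_eqVlt; apply/orP; left; apply/eqP.
 by move: (_ `^ _) (_*_ `^ _) => X Y; ring.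
move=> x Lx; have Ox:=proj1 Lx.
apply: amgm4.
- by rewrite mulr_ge0// f0.
- by rewrite mulr_ge0// Th0.
- by have /andP[/le_trans h1 /h1]:=sde.
- rewrite weights_arith//; apply: HN => //; exact: lt_le_trans tT.
Qed.

Lemma level_slack0 t x : L t x -> (kw t*enorm (grad u x))^+4<=1024/(3*kap)*(K*expR (4*t))^+3*BL t*(3*K*expR (4*u x)*enorm (grad u x)^+4).
Proof.
move=> [Ox tx].
have ee : expR (4*t)<=expR (4*u x) by rewrite ler_expR ler_pM2l// ltW.
have q4 : ((BL t/omega) `^ 4^-1)^+4 = BL t/omega by apply: (@powR_expK _ _ 4) => //; apply: divr_ge0; [exact: BL_ge0|exact: omega_ge0].
exact: (slack_arith K0 (expR_gt0 _) ee (BL_ge0 t) (@omega_gt0 R) kap0 kap_le (enorm_ge0 _) q4).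
Qed.

Corollary level_mono0 T0 T1 : T0<=T1 -> MM aL EL BL K kap T0<=MM aL EL BL K kap T1.
Proof.
move=> T01; have:=@level_mono T0 T1 set0 0 T01 measurable0 (lexx 0).
rewrite !mul0r !addr0; apply.
 by pos.
move=> t x _ _ Lx; rewrite mul0r addr0; apply: le_trans (level_slack0 Lx) _.
apply: ler_wpM2l; last by apply: HAM; exact: (proj1 Lx).
exact: coef_ge0 K0 (expR_gt0 _) (BL_ge0 t) kap0.
Qed.

Definition ylim (a : R) : R:=(a/kap) `^ 3^-1.
Definition Mlim (a e : R) : R:=kap*ylim a^+4/8+(3-2*ylim a)*e.

(** Dominated convergence: on [L t] one has [e^(4t) <= e^(4u)], and [e^(4u)] is integrable. *)
Lemma EC_cvg (tn : nat -> R) : (forall x, Om x -> \1_(L (tn n)) x*expR (4*tn n) @[n --> \oo] --> (0 : R)) ->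
 expR (4*tn n)*BL (tn n) @[n --> \oo] --> (0 : R).
Proof.
move=> hc; have c : Int (fun x => expR (4*tn n) * \1_(L (tn n)) x) @[n --> \oo] --> Int (fun=> 0 : R).
 apply: (@Int_dominated _ _ _ vO) => //.
 - by move=> n; apply: itg_mble; apply: itg_scale; exact: itg_L.
 - exact: itg0.
 - move=> x; have [Ox|nO]:=pselect (Om x).
   rewrite (_ : (fun n => _) = (fun n => \1_(L (tn n)) x*expR (4*tn n))); first exact: hc.
   by apply/funext => n; rewrite mulrC.
  apply: (@cvg_near _ _ 0%N) => n _; rewrite indicF ?mulr0// => -[].
  by [].
 - move=> n x; rewrite ger0_norm; last by [].
  have [h|h]:=pselect (L (tn n) x); last by rewrite (indicF h) mulr0 vO_ge0.
  have [Ox tx]:=h; rewrite (indicT h) mulr1 /vO (indicT Ox) mul1r ler_expR.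
  by lra.
move: c; rewrite Int0 (_ : (fun n => Int _) = (fun n => expR (4*tn n)*BL (tn n))) //.
apply/funext => n; rewrite Int_scale; last exact: itg_L.
by rewrite Int_indic//; exact: measurable_L.
Qed.

Lemma MM_cvg (tn : nat -> R) (a e : R) : aL (tn n) @[n --> \oo] --> a -> EL (tn n) @[n --> \oo] --> e -> 0<=a ->
 expR (4*tn n)*BL (tn n) @[n --> \oo] --> (0 : R) ->
 MM aL EL BL K kap (tn n) @[n --> \oo] --> Mlim a e.
Proof.
move=> ca ce a0 cC.
have cy : yr aL kap (tn n) @[n --> \oo] --> ylim a.
 apply: cube_root_cvg => //; [by move=> n; rewrite divr_ge0 ?aL_ge0// ltW|by rewrite divr_ge0// ltW|].
 by apply: cvgM; [exact: ca|exact: cvg_cst].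
rewrite /MM /Mlim -[X in _ --> X]subr0.
apply: cvgB.
 apply: cvgD.
  apply: cvgM; last exact: cvg_cst.
  by apply: cvgM; [exact: cvg_cst|exact: cvg_exp4].
 apply: cvgM; last exact: ce.
 by apply: cvgB; [exact: cvg_cst|apply: cvgM; [exact: cvg_cst|exact: cy]].
rewrite (_ : (fun n => _) = (fun n => 3*K*(expR (4*tn n)*BL (tn n)))); last by apply/funext => n; rewrite mulrA.
rewrite -[X in _ --> X](mulr0 (3*K)); apply: cvgM; [exact: cvg_cst|exact: cC].
Qed.

(** At minus infinity the superlevel sets exhaust [Om], so all masses are counted. At plus infinity,
    in [MM_high], only the masses [A0] and [E0] of the singular points are left. *)
Lemma MM_low : MM aL EL BL K kap (- n%:R) @[n --> \oo] --> Mlim (A0+Int fO) (E0+K*Int vO).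
Proof.
have Jc G : itg G -> (forall x, 0<=G x) -> (forall x, ~ Om x -> G x = 0) -> J G (- n%:R) @[n --> \oo] --> Int G.
 move=> iG G0 Gz; have iA : itg (fun x => \1_Om x*G x).
  apply: itg_eq iG => x; have [Ox|nO]:=pselect (Om x); first by rewrite indicT ?mul1r.
  by rewrite Gz ?mulr0.
 have -> : Int G = Int (fun x => \1_Om x*G x).
  apply: Int_eq => x; have [Ox|nO]:=pselect (Om x); first by rewrite indicT ?mul1r.
  by rewrite Gz ?mulr0.
 apply: J_cvg => // x; have [Ox|nO]:=pselect (Om x); last first.
  by rewrite (indicF nO); apply: (@cvg_near _ _ 0%N) => n _; rewrite indicF// => -[].
 rewrite (indicT Ox); apply: (@cvg_near _ _ (Num.trunc (- u x)).+1) => n nn; rewrite indicT//; split => //.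
 by rewrite ltrNl; apply: lt_le_trans (truncnS_gt _) _; rewrite ler_nat.
apply: MM_cvg.
- by apply: cvgD; [exact: cvg_cst|apply: Jc; [exact: ifO|exact: fO_ge0|by move=> x nO; rewrite /fO indicF ?mul0r]].
- apply: cvgD; first exact: cvg_cst.
 by apply: cvgM; [exact: cvg_cst|apply: Jc; [exact: ivO|exact: vO_ge0|by move=> x nO; rewrite /vO indicF ?mul0r]].
- by rewrite addr_ge0//; apply: Int_ge0; exact: fO_ge0.
- apply: EC_cvg => x Ox.
 rewrite -[X in _ --> X](mulr0 1); apply: cvgM.
  apply: (@cvg_near _ _ (Num.trunc (- u x)).+1) => n nn; rewrite indicT//; split => //.
  by rewrite ltrNl; apply: lt_le_trans (truncnS_gt _) _; rewrite ler_nat.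
 exact: expR_cvg0.
Qed.

Lemma MM_high : MM aL EL BL K kap n%:R @[n --> \oo] --> Mlim A0 E0.
Proof.
have far_t x n : (Num.trunc (u x)<n)%N -> \1_(L n%:R) x = 0 :> R.
 move=> nn; rewrite indicF// => -[_]; apply/negP; rewrite -leNgt ltW//.
 by apply: lt_le_trans (truncnS_gt _) _; rewrite ler_nat.
have Jc G : itg G -> (forall x, 0<=G x) -> J G n%:R @[n --> \oo] --> (0 : R).
 move=> iG G0; have i0 : itg (fun x => \1_set0 x*G x).
  by apply: itg_eq (@itg0 R) => x; rewrite indicF ?mul0r.
 have e0 : Int (fun x => \1_set0 x*G x) = 0.
  by rewrite -[RHS](@Int0 R); apply: Int_eq => x; rewrite indicF ?mul0r.
 rewrite -e0; apply: J_cvg => // x; rewrite (@indicF R _ set0)//.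
 by apply: (@cvg_near _ _ (Num.trunc (u x)).+1) => n nn; exact: far_t.
apply: MM_cvg => //.
- by rewrite -[X in _ --> X]addr0; apply: cvgD; [exact: cvg_cst|apply: Jc; [exact: ifO|exact: fO_ge0]].
- rewrite -[X in _ --> X]addr0; apply: cvgD; first exact: cvg_cst.
 by rewrite -[X in _ --> X](mulr0 K); apply: cvgM; [exact: cvg_cst|apply: Jc; [exact: ivO|exact: vO_ge0]].
- apply: EC_cvg => x Ox; apply: (@cvg_near _ _ (Num.trunc (u x)).+1) => n nn.
 by rewrite far_t ?mul0r.
Qed.

Lemma level_low t : Mlim (A0+Int fO) (E0+K*Int vO)<=MM aL EL BL K kap t.
Proof.
apply: (ler_cvg_to MM_low (cvg_cst (MM aL EL BL K kap t))).
exists (Num.trunc (- t)).+1 => // n /= nn; apply: level_mono0.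
by rewrite lerNl ltW//; apply: lt_le_trans (truncnS_gt _) _; rewrite ler_nat.
Qed.

Lemma level_high t : MM aL EL BL K kap t<=Mlim A0 E0.
Proof.
apply: (ler_cvg_to (cvg_cst (MM aL EL BL K kap t)) MM_high).
exists (Num.trunc t).+1 => // n /= nn; apply: level_mono0.
by rewrite ltW//; apply: lt_le_trans (truncnS_gt _) _; rewrite ler_nat.
Qed.

Theorem level_limits : Mlim (A0+Int fO) (E0+K*Int vO)<=Mlim A0 E0.
Proof. exact: le_trans (level_low 0) (level_high 0). Qed.

Lemma open_gt (h : E -> R) c : (forall x, Om x -> cts h x) -> open [set x | Om x /\ c<h x].
Proof.
move=> ch; rewrite openE => x [Ox tx]; rewrite /interior.
have n1 : \forall y \near x, Om y by exact: open_nbhs_nbhs.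
have nb:=@lt_nbhsr _ _ _ tx; have cx:=ch x Ox.
have n2 : \forall y \near x, c<h y by exact: (cx _ nb).
by apply: filterS2 n1 n2.
Qed.

(** A point of nonzero gradient is not a local minimum. The lower point makes room for a level
    strictly between [u y] and [u x], whose superlevel set is nonempty. *)
Lemma lower_point (P : E -> Prop) x : Om x -> enorm (grad u x) != 0 -> (\forall y \near x, P y) ->
 exists2 y, P y & u y<u x.
Proof.
move=> Ox gn nP.
have [i di] : exists i, partial i u x != 0.
 apply: contrapT => n; move/eqP: gn; apply; rewrite /enorm /dot big1 ?sqrtr0// => i _.
 rewrite !mxE; have -> : partial i u x = 0 by apply: contrapT => /eqP h; apply: n; exists i.
 by lra.
have [ex dx] : is_derive x (e_ i) u (partial i u x) by exact: is_Ck_derivable cu Ox.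
pose d:=partial i u x; pose sg:=if 0<d then -1 else 1 : R.
have sd : sg*d<0.
 have dn : d != 0 by [].
 rewrite /sg; case: ifP => h; first by lra.
 by lra.
have sn : sg != 0 by rewrite /sg; case: ifP => _; rewrite ?oppr_eq0 oner_eq0.
have cq : (fun h : R => h^-1 *: (u (h *: e_ i+x)-u x)) @ 0^' --> d.
 by [].
have nq : \forall h \near (0 : R)^', h^-1 *: (u (h *: e_ i+x)-u x)*sg<0.
 have c2 : (fun h : R => h^-1 *: (u (h *: e_ i+x)-u x)*sg) @ 0^' --> d*sg by apply: cvgM => //; exact: cvg_cst.
 by rewrite mulrC in sd; have:=@lt_nbhsl _ _ _ sd => nb; exact: (c2 _ nb).
have nP2 : \forall h \near (0 : R)^', P (h *: e_ i+x).
 have c3 : (fun h : R => h *: (e_ i : E)+x) @ (0 : R) --> x.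
  have c4 : (fun h : R => h *: (e_ i : E)+x) @ (0 : R) --> 0 *: (e_ i : E)+x.
   by apply: cvgD; [exact: scalel_continuous|exact: cvg_cst].
  by rewrite scale0r add0r in c4.
 exact: nbhs_dnbhs (c3 _ nP).
have [r r0 hr] : exists2 r : R, 0<r & forall h : R, `|h| < r -> h != 0 ->
  h^-1 *: (u (h *: e_ i+x)-u x)*sg<0 /\ P (h *: e_ i+x).
 have nn : \forall h \near (0 : R), h != 0 -> h^-1 *: (u (h *: e_ i+x)-u x)*sg<0 /\ P (h *: e_ i+x).
  have n1 : \forall h \near (0 : R), h != 0 -> h^-1 *: (u (h *: e_ i+x)-u x)*sg<0 by [].
  have n2 : \forall h \near (0 : R), h != 0 -> P (h *: e_ i+x) by [].
  by apply: filterS2 n1 n2 => h h1 h2 hn; split; [exact: h1|exact: h2].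
 have /nbhs_ballP[r /= r0 hr]:=nn; exists r => // h hh hn; apply: hr => //.
 by rewrite /ball /= sub0r normrN.
pose h:=sg*(r/2).
have s1 : `|sg| = 1 by rewrite /sg; case: ifP => _; rewrite ?normrN normr1.
have r2 : 0<r/2 by lra.
have hn : h != 0 by rewrite mulf_neq0// gt_eqF.
have hh : `|h| < r by rewrite normrM s1 gtr0_norm//; lra.
have [q1 q2]:=hr h hh hn; exists (h *: e_ i+x) => //.
rewrite -subr_lt0; move: q1; move: (u _-u x) => D; rewrite /GRing.scale /= => q1.
have ss : sg*sg = 1 by rewrite /sg; case: ifP => _; rewrite ?mulrNN mulr1.
have -> : D = (h^-1*D*sg)*(r/2).
 have -> : h^-1*D*sg*(r/2) = h^-1*h*D by rewrite /h; ring.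
 by rewrite mulVf// mul1r.
by rewrite pmulr_llt0.
Qed.

Lemma pow4_slack (x s X : R) : 0<=x -> x<=X -> 0<=s -> s<=1 -> (x+s)^+4<=x^+4+s*(15*(X+1)^+3).
Proof.
move=> x0 xX s0 s1.
have -> : (x+s)^+4 = x^+4+s*(4*x^+3+6*x^+2*s+4*x*s^+2+s^+3) by ring.
rewrite lerD2l; apply: ler_wpM2l => //.
have X1 : 0<=X+1 by lra.
have h1 : x^+3<=(X+1)^+3 by rewrite lerXn2r ?nnegrE//; lra.
have xs : x<=X+1 by lra.
have s1' : s<=X+1 by lra.
have h2 : x^+2*s<=(X+1)^+3.
 rewrite [leRHS]exprSr; apply: ler_pM; [exact: sqr_ge0|exact: s0| |exact: s1'].
 by rewrite lerXn2r.
have h3 : x*s^+2<=(X+1)^+3.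
 rewrite [leRHS]exprS; apply: ler_pM; [exact: x0|exact: sqr_ge0|exact: xs|].
 by rewrite lerXn2r.
have h4 : s^+3<=(X+1)^+3 by rewrite lerXn2r.
by lra.
Qed.

Hypothesis Hp0 : forall x, Om x -> enorm (grad u x) = 0 -> f x*Th x = 0.

(** Equality of the two limits makes the quantity constant. If the pointwise inequality were strict
    at a point, it would be so on an open set [N] with a uniform gap; the gap pays for a slack [s]
    in AM-GM, and the quantity would grow by at least [s Vol N] between two levels enclosing [N]. *)
Theorem level_rigid : Mlim (A0+Int fO) (E0+K*Int vO) = Mlim A0 E0 ->
 forall x, Om x -> f x*Th x = 3*K*expR (4*u x)*enorm (grad u x)^+4.
Proof.
move=> eqM x0 Ox0; apply/eqP; rewrite eq_le HAM// andbT leNgt; apply/negP => gap.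
have MMc t : MM aL EL BL K kap t = Mlim A0 E0.
 by apply/eqP; rewrite eq_le level_high -eqM level_low.
have cp x : Om x -> cts (fun x => enorm (grad u x)) x.
 by move=> Ox; apply: C1at_grad_cont; exact: is_Ck_C1at oOm cu Ox.
pose g x:=f x*Th x-3*K*expR (4*u x)*enorm (grad u x)^+4.
have cg x : Om x -> cts g x.
 move=> Ox; apply: cont_sub; first by apply: cont_mul; [exact: cf|exact: cTh].
 apply: cont_mul; last by apply: cont_exp; exact: cp.
 apply: cont_mul; first exact: cont_cst.
 apply: cont_comp; first exact: continuous_expR.
 by apply: cont_mul; [exact: cont_cst|exact: u_cont].
pose c0:=g x0/2; have g0 : 0<g x0 by rewrite subr_gt0.
have c00 : 0<c0 by pos.
have pn : enorm (grad u x0) != 0.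
 by apply/eqP => e; move: gap; rewrite e Hp0// expr0n mulr0 ltxx.
pose P0:=enorm (grad u x0)+1; have P00 : 0<=P0 by rewrite addr_ge0 ?enorm_ge0.
pose W : set E:=[set y | Om y /\ c0<g y] `&` [set y | Om y /\ - P0 < - enorm (grad u y)].
have oW : open W.
 by apply: openI; apply: open_gt => // x Ox; apply: cont_opp; exact: cp.
have Wx0 : W x0.
 by split; split => //; [rewrite /c0; lra|rewrite ltrN2 /P0 ltrDl].
have [x1 Wx1 u10]:=lower_point Ox0 pn (open_nbhs_nbhs (conj oW Wx0)).
have Ox1 : Om x1 by case: Wx1 => -[].
(* Between these levels [lamL N] falls from the volume of [N] to 0, while [x0] stays in [L T1],
   which keeps [y] and [B] positive up to [T1]. *)
pose T0:=u x1-1; pose T1:=(u x1+u x0)/2.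
have T01 : T0<=T1 by rewrite /T0 /T1; lra.
pose N : set E:=W `&` ([set y | Om y /\ T0<u y] `&` [set y | Om y /\ - T1 < - u y]).
have oN : open N.
 by apply: openI => //; apply: openI; apply: open_gt => x Ox; [exact: u_cont|apply: cont_opp; exact: u_cont].
have Nx1 : N x1.
 by split => //; split; split => //; rewrite /T0 /T1 ?ltrN2; lra.
have mN : measurable (N : set (@E4 R)).
 have cc x : N x -> cts (fun _ : E => 1 : R) x by move=> _; exact: cst_continuous.
 have m1:=measurable_indicM oN cc.
 have -> : N = [set x : @E4 R | (0 : R)<(\1_N x : R)*1].
  apply/seteqP; split => x /=; first by move=> h; rewrite indicT// mulr1.
  by move=> h; apply: contrapT => n; move: h; rewrite indicF// mul0r ltxx.
 exact: measurable_superlevelE.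
have NL : N `<=` L T0 by move=> y [_ [[? ?] _]].
have [r hr]:=L_bounded T0.
have VN : 0<Vol N:=Vol_gt0 mN (subset_trans NL hr) (open_nbhs_nbhs (conj oN Nx1)).
have l0 : lamL N T0 = Vol N.
 rewrite -Int_indic//; apply: Int_eq => x.
 have [h|h]:=pselect (N x); last by rewrite (indicF h) mulr0.
 by rewrite (indicT h) (indicT (NL x h)) mulr1.
have l1 : lamL N T1 = 0.
 rewrite -[RHS](@Int0 R); apply: Int_eq => x.
 have [h|h]:=pselect (N x); last by rewrite (indicF h) mulr0.
 rewrite (indicF (_ : ~ L T1 x)) ?mul0r// => -[_ tx].
 by case: h => _ [_ [_]]; rewrite ltrN2 => /(lt_trans tx); rewrite ltxx.
have B1 : 0<BL T1 by apply: (@Vol_L_gt0 T1 x0); split => //; rewrite /T1; lra.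
have y1 : 0<yr aL kap T1 by exact: (yr_gt0 kap0 aL_gt0 B1).
pose X:=4*(K*expR (4*T1))*(BL T0/omega) `^ 4^-1*P0.
have X0 : 0<=X.
 by apply: mulr_ge0 => //; apply: mulr_ge0; [apply: mulr_ge0; [exact: ler0n|apply: mulr_ge0; [exact: ltW|exact: expR_ge0]]|exact: powR_ge0].
pose cm:=1024/(3*kap)*(K*expR (4*T0))^+3*BL T1.
have cm0 : 0<cm by exact: coef_gt0 K0 (expR_gt0 _) B1 kap0.
have D0 : 0<15*(X+1)^+3 by apply: mulr_gt0; [exact: ltr0n|apply: exprn_gt0; exact: ltr_wpDl].
(* The three bounds serve [pow4_slack], the smallness condition of [level_mono], and the gap [c0],
   which must cover the extra terms of the fourth power. *)
pose s:=Num.min 1 (Num.min (2*yr aL kap T1*(K*expR (4*T0))) (cm*c0/(15*(X+1)^+3))).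
have s0 : 0<s.
 rewrite !lt_min ltr01 /=; apply/andP; split; last by apply: divr_gt0 => //; exact: mulr_gt0.
 by apply: mulr_gt0; [exact: mulr_gt0|apply: mulr_gt0 => //; exact: expR_gt0].
have s1 : s<=1 by rewrite ge_min lexx.
have s2 : s<=2*yr aL kap T1*(K*expR (4*T0)) by rewrite !ge_min lexx orbT.
have s3 : s*(15*(X+1)^+3)<=cm*c0 by rewrite -ler_pdivlMr// !ge_min lexx !orbT.
have:=level_mono T01 mN (ltW s0) s2; rewrite !MMc l0 l1 mulr0 addr0.
move=> H; have : Mlim A0 E0+s*Vol N<=Mlim A0 E0; last by rewrite gerDl leNgt mulr_gt0.
apply: H => t x Tt tT Lx; have Ox:=proj1 Lx.
have sl:=level_slack0 Lx.
have ct : cm<=1024/(3*kap)*(K*expR (4*t))^+3*BL t.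
 apply: (coef_mono K0 (expR_gt0 _) _ (BL_mono (ltW tT)) (ltW B1) kap0).
 by rewrite ler_expR ler_pM2l.
have [h|h]:=pselect (N x); last first.
 rewrite (indicF h) mulr0 addr0; apply: le_trans sl _; apply: ler_wpM2l; last exact: HAM.
 exact: le_trans (ltW cm0) ct.
have [[[_ gx] [_ px]] _]:=h; rewrite (indicT h) mulr1.
have kX : kw t*enorm (grad u x)<=X.
 apply: ler_pM.
 - by apply: mulr_ge0; [apply: mulr_ge0; [exact: ler0n|apply: mulr_ge0; [exact: ltW|exact: expR_ge0]]|exact: powR_ge0].
 - exact: enorm_ge0.
 - apply: ler_pM; [|exact: powR_ge0| |].
  + by apply: mulr_ge0; [exact: ler0n|apply: mulr_ge0; [exact: ltW|exact: expR_ge0]].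
  + apply: ler_wpM2l; first exact: ler0n.
   by rewrite ler_pM2l// ler_expR ler_pM2l// ltW.
  + apply: ge0_ler_powR; rewrite ?nnegrE//; try (apply: divr_ge0; [exact: BL_ge0|exact: omega_ge0]).
   by rewrite ler_pM2r ?invr_gt0 ?omega_gt0//; exact: BL_mono.
 - by rewrite ltrN2 in px; exact: ltW.
have k0 : 0<=kw t*enorm (grad u x).
 apply: mulr_ge0; last exact: enorm_ge0.
 by apply: mulr_ge0; [apply: mulr_ge0; [exact: ler0n|apply: mulr_ge0; [exact: ltW|exact: expR_ge0]]|exact: powR_ge0].
apply: le_trans (pow4_slack k0 kX (ltW s0) s1) _.
have s4:=le_trans s3 (le_trans (ler_wpM2r (ltW c00) ct) (ler_wpM2l (le_trans (ltW cm0) ct) (ltW gx))).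
apply: le_trans (lerD sl s4) _.
by rewrite -mulrDr addrC subrK.
Qed.

End Superlevel.

(** * Cut-offs at the ends and total fluxes *)

Section Chi.
Context {R : realType}.
Local Notation E:='rV[R]_4.
Variables (c : E) (sg : R).
Hypothesis sgE : sg = 1 \/ sg = -1.

(** Equal to 1 close to the end and to 0 away from it, with gradient [gS]; it decreases to 0
    pointwise off the centre as [k] grows. *)
Definition chi (k : nat) (x : E) : R :=
 let S:=k.+1%:R^+15 in
 cutf c (fun s => th ((sg*s-S)/S)) (if sg == 1 then 0 else 1) x.

Let N1 : (-1 == 1 :> R) = false.
Proof. by rewrite eq_sym gt_eqF//. Qed.

Lemma profile_sg k : exists s1 s2, let S:=k.+1%:R^+15 in
 profile (fun s => th ((sg*s-S)/S)) (fun s => sg*hK k (sg*s)) (if sg == 1 then 0 else 1) (if sg == 1 then 1 else 0) s1 s2.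
Proof.
have P:=@profile_chi R k; case: sgE => sE.
 exists (k.+1%:R^+15*0+k.+1%:R^+15), (k.+1%:R^+15*1+k.+1%:R^+15) => /=; rewrite sE eqxx.
 have -> : (fun s => th ((1*s-k.+1%:R^+15)/k.+1%:R^+15)) = (fun s => th ((s-k.+1%:R^+15)/k.+1%:R^+15) : R) by apply/funext => s; rewrite mul1r.
 by have -> : (fun s => 1*hK k (1*s)) = (hK k : R -> R) by apply/funext => s; rewrite !mul1r.
exists (- (k.+1%:R^+15*1+k.+1%:R^+15)), (- (k.+1%:R^+15*0+k.+1%:R^+15)) => /=; rewrite sE N1.
have:=profile_neg P.
have -> : (fun s => th ((-1*s-k.+1%:R^+15)/k.+1%:R^+15)) = (fun s => th ((- s-k.+1%:R^+15)/k.+1%:R^+15) : R) by apply/funext => s; rewrite mulN1r.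
by have -> : (fun s => -1*hK k (-1*s)) = (fun s => - hK k (- s) : R) by apply/funext => s; rewrite !mulN1r.
Qed.

Lemma C1at_chi k x : C1at (chi k) x.
Proof. by have [s1 [s2 P]]:=profile_sg k; exact: (C1at_cutf c P x). Qed.

Lemma partial_chi k i x : partial i (chi k) x = gS c sg k i x.
Proof. by have [s1 [s2 P]]:=profile_sg k; rewrite (partial_cutf c P i x). Qed.

Lemma chi_near k : \forall x \near c, chi k x = if sg == 1 then 0 else 1.
Proof. by have [s1 [s2 P]]:=profile_sg k; exact: (cutf_near c P). Qed.

Lemma chi_far k : exists r : R, forall x, r < `|x| -> chi k x = if sg == 1 then 1 else 0.
Proof. by have [s1 [s2 P]]:=profile_sg k; exists (`|c| + expR s2) => x h; exact: (cutf_far P). Qed.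

Lemma chiE k x : x != c -> chi k x = th ((ell c sg x-k.+1%:R^+15)/k.+1%:R^+15).
Proof. by move=> xc; rewrite /chi cutf_E. Qed.

Lemma chi_01 k x : 0<=chi k x<=1.
Proof.
have [->|xc]:=eqVneq x c; last by rewrite chiE// th_01.
by rewrite /chi /cutf eqxx; case: ifP => _; rewrite ?lexx ?ler01.
Qed.

Lemma chi_0 k x : x != c -> ell c sg x<=k.+1%:R^+15 -> chi k x = 0.
Proof.
move=> xc h; rewrite chiE//; have [//|->]:=@th_le0 R ((ell c sg x-k.+1%:R^+15)/k.+1%:R^+15); last by [].
by rewrite ler_pdivrMr ?ltr0n// mul0r subr_le0.
Qed.

Lemma chi_near0 k x : x != c -> ell c sg x<k.+1%:R^+15 -> \forall y \near x, chi k y = 0.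
Proof.
move=> xc h; have n1:=near_ell_lt xc h.
have n2 : nbhs x (punct c):=open_nbhs_nbhs (conj (@open_punct R c) xc).
by apply: filterS2 n1 n2 => y h1 h2; apply: chi_0 => //; exact: ltW.
Qed.

Lemma chi_mono k m x : (k<=m)%N -> chi m x<=chi k x.
Proof.
move=> km; have [->|xc]:=eqVneq x c; first by rewrite /chi /cutf eqxx.
have S0 n : 0<n.+1%:R^+15 :> R by [].
have Skm : k.+1%:R^+15<=m.+1%:R^+15 :> R by rewrite lerXn2r ?nnegrE// ler_nat.
have [h|h]:=leP (ell c sg x) (m.+1%:R^+15).
 by rewrite (chi_0 xc h); have /andP[]:=chi_01 k x.
rewrite !chiE//; apply: th_mono; rewrite !mulrBl !divff ?gt_eqF// lerD2r.
apply: ler_wpM2l; first by apply: le_trans (ltW h); exact: ltW.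
by rewrite lef_pV2 ?posrE.
Qed.

Lemma chi_cvg0 x : x != c -> chi k x @[k --> \oo] --> (0 : R).
Proof.
move=> xc; apply: (@cvg_harmonic _ _ 0 0 (Num.trunc (ell c sg x)).+1) => // k hk.
rewrite mul0r subr0 chi_0 ?normr0//.
apply: le_trans (ltW (truncnS_gt (ell c sg x))) _.
apply: (@le_trans _ _ k.+1%:R); first by rewrite ler_nat; exact: leq_trans hk _.
by rewrite -{1}[k.+1%:R]expr1 ler_weXn2l// ler1n.
Qed.

End Chi.

Section Flux.
Context {R : realType}.
Local Notation E:='rV[R]_4.
Variables (m : nat) (yv : 'I_m -> E) (s0 : R).
Hypothesis yinj : injective yv.
Definition reg : set E:=[set x | forall i, x != yv i].
Hypothesis Hf : forall i x, x != yv i -> s0<ell (yv i) (-1) x -> reg x.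
Hypothesis Hi : forall x, x != 0 -> s0<ell 0 1 x -> reg x.
Variables (X : 'I_4 -> E -> R) (g : E -> R).
Hypothesis cX : forall j, is_Ck 1 reg (X j).
Hypothesis cg : forall x, reg x -> cts g x.
Hypothesis g0 : forall x, reg x -> 0<=g x.
Hypothesis dX : forall x, reg x -> \sum_j partial j (X j) x = - g x.
Variables (a : 'I_m -> R) (aoo C : R).
Hypothesis C0 : 0<=C.
Hypothesis mass_f : forall i k, s0<k.+1%:R^+15-1 ->
 mass_bound (gS (yv i) (-1) k) X (C/k.+1%:R) (a i).
Hypothesis mass_i : forall k, s0<k.+1%:R^+15-1 ->
 mass_bound (gS 0 1 k) X (C/k.+1%:R) aoo.

Local Notation chf i:=(chi (yv i) (-1)).
Local Notation chi8:=(chi 0 1).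

Lemma open_reg : open reg.
Proof.
rewrite openE => x h.
have H i : nbhs x (punct (yv i)):=open_nbhs_nbhs (conj (@open_punct R (yv i)) (h i)).
exact: (@filter_forall E 'I_m (fun i => punct (yv i)) (nbhs x) (nbhs_filter x) H).
Qed.

Definition gO x:=\1_reg x*g x.

Lemma gO_ge0 x : 0<=gO x.
Proof.
rewrite /gO indicE; case: (boolP (x \in reg)) => [/set_mem h|_]; last by rewrite mul0r.
by rewrite mul1r g0.
Qed.

Lemma gO_mble : mble gO.
Proof. by apply: measurable_indicM => //; exact: open_reg. Qed.

Let sN : (-1 : R) = 1 \/ (-1 : R) = -1. Proof. by lra. Qed.
Let sP : (1 : R) = 1 \/ (1 : R) = -1. Proof. by left. Qed.

Lemma nreg x : ~ reg x -> exists i, x = yv i.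
Proof. by move=> /existsNP[i /negP]; rewrite negbK => /eqP ->; exists i. Qed.

Lemma flux_step (z : E -> R) (r : R) : (forall x, r < `|x| -> z x = 0) -> (forall x, C1at z x) ->
 (forall i, \forall x \near yv i, z x = 0) ->
 [/\ Cc (dpairing z X), Cc (fun x => z x*gO x) &
 Int (dpairing z X) = Int (fun x => z x*gO x)].
Proof.
move=> zr z1 z0.
have [||c1 c2 e1]:=@divergence_thm R z X r; first exact: zr.
 move=> x; have [Rx|/nreg[i ->]]:=pselect (reg x); [left|by right].
 by split => // j; exact: is_Ck_C1at open_reg (cX j) Rx.
have e x : - (z x * \sum_j partial j (X j) x) = z x*gO x.
 have [Rx|nR]:=pselect (reg x).
  by rewrite dX// /gO indicE mem_set// mul1r mulrN opprK.
 by have [i ->]:=nreg nR; rewrite (nbhs_singleton (z0 i)) !mul0r oppr0.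
split => //.
 have [k1 [r1 h1]]:=c2; split.
  rewrite (_ : (fun x => z x*gO x) = (fun x => - (z x * \sum_j partial j (X j) x))); last by apply/funext => x; rewrite e.
  by move=> x; apply: cont_opp; exact: k1.
 by exists r1 => x /h1; rewrite -e => ->; rewrite oppr0.
rewrite e1 (Int_eq (fun x => esym (e x))) -mulN1r -Int_scale; last exact: itg_Cc.
by apply: Int_eq => x; rewrite mulN1r.
Qed.

Lemma chi_f_near (i j : 'I_m) k : s0<k.+1%:R^+15-1 -> \forall x \near yv j, chf i k x = (i == j)%:R.
Proof.
move=> hk; have [->|ij]:=eqVneq i j.
 by have:=chi_near (yv j) sN k; rewrite eq_sym gt_eqF// (@lt_trans _ _ 0) ?ltrN10.
have yij : yv j != yv i by apply: contra ij => /eqP/yinj ->.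
apply: chi_near0 => //; rewrite ltNge; apply/negP => h.
have /(Hf yij) : s0<ell (yv i) (-1) (yv j) by lra.
by move=> /(_ j); rewrite eqxx.
Qed.

Lemma chi_i_near (j : 'I_m) k : s0<k.+1%:R^+15-1 -> \forall x \near yv j, chi8 k x = 0.
Proof.
move=> hk; have [->|yj]:=eqVneq (yv j) 0.
 by have:=chi_near 0 sP k; rewrite eqxx.
apply: chi_near0 => //; rewrite ltNge; apply/negP => h.
have /(Hi yj) : s0<ell 0 1 (yv j) by lra.
by move=> /(_ j); rewrite eqxx.
Qed.

Lemma chi_f_far k : exists r : R, forall i x, r < `|x| -> chf i k x = 0.
Proof.
have /choice[r Hr] i : exists r : R, forall x, r < `|x| -> chf i k x = 0.
 by have:=chi_far (yv i) sN k; rewrite eq_sym gt_eqF// (@lt_trans _ _ 0) ?ltrN10.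
exists (\sum_i `|r i|) => i x h; apply: Hr; apply: le_lt_trans h.
by apply: le_trans (ler_norm _) _; rewrite (bigD1 i)//= lerDl sumr_ge0.
Qed.

(** Subtracting, at each end, the limit of the test function times the cut-off yields a compactly
    supported function that vanishes near every singular point, where the divergence theorem
    applies. *)
Lemma flux_cutoffs (eta : E -> R) (hoo : R) (h : 'I_m -> R) k : s0<k.+1%:R^+15-1 ->
 (exists r : R, forall x, r < `|x| -> eta x = hoo) -> (forall x, C1at eta x) ->
 (forall i, \forall x \near yv i, eta x = h i) ->
 let z:=fun x => eta x-hoo*chi8 k x - \sum_i h i*chf i k x in
 [/\ itg (fun x => z x*gO x), Cc (dpairing eta X) &
  Int (fun x => z x*gO x) = Int (dpairing eta X)
   - hoo*Int (pairing (gS 0 1 k) X) - \sum_i h i*Int (pairing (gS (yv i) (-1) k) X)].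
Proof.
move=> hk [r1 e1] eC eN z.
have [r2 e2]:=chi_f_far k; have [r3 e3]:=chi_far 0 sP k; rewrite eqxx in e3.
have Csum (F : 'I_m -> E -> R) x : (forall i, C1at (F i) x) -> forall (v : E), is_derive x v (fun x => \sum_i F i x) (\sum_i \sum_j v 0 j * partial j (F i) x).
 by move=> cF v; apply: isd_sum => i; exact: C1at_is_derive.
have dz x j : partial j z x = partial j eta x-hoo*gS 0 1 k j x - \sum_i h i*gS (yv i) (-1) k j x.
 have d1 : is_derive x (delta_mx 0 j) eta (partial j eta x):=C1at_derivable j (eC x).
 have d2 : is_derive x (delta_mx 0 j) (chi8 k) (gS 0 1 k j x).
  by rewrite -(partial_chi _ sP); exact: C1at_derivable (C1at_chi 0 sP k x).
 have d3 i : is_derive x (delta_mx 0 j) (fun x => h i*chf i k x) (h i*gS (yv i) (-1) k j x).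
  by apply: isd_cmul; rewrite -(partial_chi _ sN); exact: C1at_derivable (C1at_chi (yv i) sN k x).
 by have [_]:=isd_sub (isd_sub d1 (isd_cmul hoo d2)) (isd_sum d3).
have zC x : C1at z x.
 have n1:=eC x; have n2:=C1at_chi 0 sP k x.
 have n3 : \forall y \near x, forall i, forall j, derivable (chf i k) y (delta_mx 0 j) /\ cts (partial j (chf i k)) y.
  have H i:=C1at_chi (yv i) sN k x.
  exact: (@filter_forall E 'I_m (fun i y => forall j, derivable (chf i k) y (delta_mx 0 j) /\ cts (partial j (chf i k)) y) (nbhs x) (nbhs_filter x) H).
 apply: filterS3 n1 n2 n3 => y a1 a2 a3 j.
 have b1 : is_derive y (delta_mx 0 j) eta (partial j eta y) by have [d _]:=a1 j; split.
 have b2 : is_derive y (delta_mx 0 j) (chi8 k) (partial j (chi8 k) y) by have [d _]:=a2 j; split.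
 have b3 i : is_derive y (delta_mx 0 j) (fun x => h i*chf i k x) (h i * partial j (chf i k) y).
  by apply: isd_cmul; have [d _]:=a3 i j; split.
 have [d _]:=isd_sub (isd_sub b1 (isd_cmul hoo b2)) (isd_sum b3); split; first exact: d.
 have -> : partial j z = (fun x => partial j eta x-hoo * partial j (chi8 k) x - \sum_i h i * partial j (chf i k) x).
  apply/funext => w; rewrite dz -(partial_chi _ sP); congr (_-_).
  by apply: eq_bigr => i _; rewrite -(partial_chi _ sN).
 apply: cont_sub; last first.
  by apply: cont_sum => i; apply: cont_mul; [exact: cont_cst|have [_ q]:=a3 i j; exact: q].
 apply: cont_sub; first by have [_ q]:=a1 j; exact: q.
 by apply: cont_mul; [exact: cont_cst|have [_ q]:=a2 j; exact: q].
have z0 i : \forall x \near yv i, z x = 0.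
 have n1:=eN i; have n2:=chi_i_near i hk.
 have n3 : \forall x \near yv i, forall l, chf l k x = (l == i)%:R.
  have H l:=chi_f_near l i hk.
  exact: (@filter_forall E 'I_m (fun l y => chf l k y = (l == i)%:R) (nbhs (yv i)) (nbhs_filter (yv i)) H).
 apply: filterS3 n1 n2 n3 => x q1 q2 q3; rewrite /z q1 q2 mulr0 subr0.
 rewrite (bigD1 i)//= q3 eqxx mulr1 big1 ?addr0 ?subrr// => l li.
 by rewrite q3 (negbTE li) mulr0.
have zr x : Num.max r1 (Num.max r2 r3) < `|x| -> z x = 0.
 rewrite !gt_max => /and3P[q1 q2 q3]; rewrite /z e1// e3// mulr1 subrr big1 ?subrr// => i _.
 by rewrite e2 ?mulr0.
have [k1 k2 k3]:=flux_step zr zC z0.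
have ceta : Cc (dpairing eta X).
 apply: (@Cc_intro _ _ r1) => [x xr|x].
  rewrite big1// => j _.
  have n1 : \forall y \near x, eta y = hoo by apply: filterS (near_far xr) => y; exact: e1.
  by rewrite (near_partial j n1) /partial derive_cst mul0r.
 left; apply: cont_sum => j; have [Rx|nR]:=pselect (reg x).
  by apply: cont_mul; [exact: C1at_partial_cont|exact: is_Ck_cont (cX j) Rx].
 have [i ->]:=nreg nR; apply: (@cont_near_eq _ _ (fun=> 0)); last exact: cont_cst.
 have:=nbhs_interior (eN i); apply: filterS => y n1.
 by rewrite (near_partial j n1) /partial derive_cst mul0r.
split => //; first exact: itg_Cc.
have [ci _]:=mass_i hk; have cf i:=proj1 (mass_f i hk).
have i1:=itg_Cc ceta; have i2:=itg_Cc ci; have i3 i:=itg_Cc (cf i).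
have i3s:=itg_sum (index_enum 'I_m) xpredT (fun i => itg_scale (h i) (i3 i)).
rewrite -k3.
rewrite (@Int_eq _ _ (fun x => \sum_j partial j eta x*X j x-hoo*(\sum_j gS 0 1 k j x*X j x) - \sum_i h i*(\sum_j gS (yv i) (-1) k j x*X j x))); last first.
 move=> x; rewrite mulr_sumr -sumrB (eq_bigr (fun i => \sum_j h i*gS (yv i) (-1) k j x*X j x)); last first.
  by move=> i _; rewrite mulr_sumr; apply: eq_bigr => j _; rewrite mulrA.
 rewrite exchange_big -sumrB /=; apply: eq_bigr => j _; rewrite dz -mulr_suml.
 by ring.
rewrite Int_sub//; last by apply: itg_sub => //; exact: itg_scale.
rewrite Int_sub//; last exact: itg_scale.
rewrite (Int_scale _ i2) (Int_sum _ _ (fun i => itg_scale (h i) (i3 i))).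
by congr (_-_); apply: eq_bigr => i _; rewrite Int_scale.
Qed.

Lemma big_k : exists k0 : nat, forall k, (k0<=k)%N -> s0<k.+1%:R^+15-1.
Proof.
exists (Num.trunc (s0+1)).+1 => k hk; rewrite ltrBrDr.
apply: lt_le_trans (truncnS_gt (s0+1)) _.
apply: (@le_trans _ _ k.+1%:R); first by rewrite ler_nat; exact: leq_trans hk _.
by rewrite -{1}[k.+1%:R]expr1 ler_weXn2l// ler1n.
Qed.

Lemma cvg_masses (c0 hoo : R) (h : 'I_m -> R) (k0 : nat) : (forall k, (k0<=k)%N -> s0<k.+1%:R^+15-1) ->
 (c0-hoo*Int (pairing (gS 0 1 (k0+k)) X) - \sum_i h i*Int (pairing (gS (yv i) (-1) (k0+k)) X)) @[k --> \oo]
  --> c0-hoo*aoo - \sum_i h i*a i.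
Proof.
move=> hk; pose D:=`|hoo| * C + \sum_i `|h i| * C.
have D0 : 0<=D by apply: addr_ge0; [exact: mulr_ge0|apply: sumr_ge0 => i _; exact: mulr_ge0].
apply: (@cvg_harmonic _ _ _ D 0%N) => // k _.
have kk:=hk (k0+k)%N (leq_addr _ _).
have [_ m1]:=mass_i kk; have m2 i:=proj2 (mass_f i kk).
move: m1; set I1:=Int _ => m1; pose I2 i:=Int (pairing (gS (yv i) (-1) (k0+k)) X).
have -> : c0-hoo*I1 - \sum_i h i*I2 i-(c0-hoo*aoo - \sum_i h i*a i) =
 - (hoo*(I1-aoo)) - \sum_i h i*(I2 i-a i).
 have -> : \sum_i h i*(I2 i-a i) = \sum_i h i*I2 i - \sum_i h i*a i.
  by rewrite -sumrB; apply: eq_bigr => i _; ring.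
 ring.
apply: (@le_trans _ _ (D/(k0+k).+1%:R)); last first.
 by apply: ler_wpM2l => //; rewrite lef_pV2 ?posrE ?ltr0n// ler_nat ltnS leq_addl.
apply: le_trans (ler_normB _ _) _; rewrite normrN normrM /D mulrDl.
apply: lerD; first by rewrite -mulrA; apply: ler_wpM2l.
apply: le_trans (ler_norm_sum _ _ _) _; rewrite mulr_suml; apply: ler_sum => i _.
by rewrite normrM -mulrA; apply: ler_wpM2l => //; exact: m2.
Qed.

(** The case [eta = 1]. The cut-offs decrease with [k] and [g >= 0], so monotone convergence gives
    integrability along with the value. *)
Theorem total_flux : itg gO /\ Int gO = - aoo - \sum_i a i.
Proof.
have [k0 hk]:=big_k.
have one_far : exists r : R, forall x : E, r < `|x| -> (fun _ : E => 1 : R) x = 1 by exists 0.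
have one_C1 x : C1at (fun _ : E => 1 : R) x by apply: (@C1at_near_cst _ _ 1); exact: near_all.
have one_near i : \forall x \near yv i, (fun _ : E => 1 : R) x = 1 by exact: near_all.
pose z k x:=1-1*chi8 (k0+k) x - \sum_i 1*chf i (k0+k) x.
have S k:=flux_cutoffs (hk (k0+k)%N (leq_addr _ _)) one_far one_C1 (h:=fun=> 1) one_near.
have z1 k x : z k x<=1.
 have /andP[c1 _]:=chi_01 0 1 (k0+k) x.
 have c2 : 0 <= \sum_i 1*chf i (k0+k) x.
  by apply: sumr_ge0 => i _; rewrite mul1r; have /andP[]:=chi_01 (yv i) (-1) (k0+k) x.
 by rewrite /z; move: c1 c2; move: (chi _ _ _ _) (\sum_i _) => p q *; lra.
have I0 : Int (dpairing (fun _ : E => 1 : R) X) = 0.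
 rewrite -[RHS]Int0; apply: Int_eq => x; apply: big1 => j _.
 by rewrite /partial derive_cst mul0r.
have c2:=@cvg_masses 0 1 (fun=> 1) k0 hk.
apply: (@Int_monotone _ (fun k x => z k x*gO x)).
- by move=> k; have []:=S k.
- exact: gO_mble.
- move=> x k n kn; apply: ler_wpM2r; first exact: gO_ge0.
 rewrite /z; apply: lerB; first by rewrite lerD2l lerN2 !mul1r; apply: chi_mono; rewrite leq_add2l.
 by apply: ler_sum => i _; rewrite !mul1r; apply: chi_mono; rewrite leq_add2l.
- by move=> k x; rewrite -[leRHS]mul1r; apply: ler_wpM2r; [exact: gO_ge0|exact: z1].
- move=> x; have [Rx|nR]:=pselect (reg x); last first.
  have -> : gO x = 0 by rewrite /gO indicE memNset// mul0r.
  by rewrite (_ : (fun n => z n x*0) = (fun=> 0)); [exact: cvg_cst|apply/funext => n; rewrite mulr0].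
 rewrite -[X in _ --> X]mul1r; apply: cvgM; last exact: cvg_cst.
 have l1 : chi8 (k0+k) x @[k --> \oo] --> (0 : R).
  have [->|x0]:=eqVneq x 0.
   rewrite (_ : (fun k => _) = (fun=> 0)); first exact: cvg_cst.
   by apply/funext => k; rewrite /chi /cutf !eqxx.
  exact: (cvg_addl k0 (chi_cvg0 1 x0)).
 have l2 i : chf i (k0+k) x @[k --> \oo] --> (0 : R).
  exact: (cvg_addl k0 (chi_cvg0 (-1) (Rx i))).
 have l3 : (\sum_i 1*chf i (k0+k) x) @[k --> \oo] --> (\sum_(i<m) (0 : R)).
  apply: cvg_bigsum => i; rewrite (_ : (fun k => _) = (fun k => chf i (k0+k) x)); first exact: l2.
  by apply/funext => k; rewrite mul1r.
 rewrite big1 // in l3.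
 suff : z k x @[k --> \oo] --> (1-0-0 : R) by rewrite !subr0.
 rewrite /z.
 apply: cvgB; last exact: l3.
 apply: cvgB; first exact: cvg_cst.
 rewrite (_ : (fun k => _) = (fun k => chi8 (k0+k) x)); first exact: l1.
 by apply/funext => k; rewrite mul1r.
- rewrite (_ : (fun n => _) = (fun k => 0-1*Int (pairing (gS 0 1 (k0+k)) X) - \sum_i 1*Int (pairing (gS (yv i) (-1) (k0+k)) X))); last first.
  by apply/funext => k; have [_ _ ->]:=S k; rewrite I0.
 have -> : - aoo - \sum_i a i = 0-1*aoo - \sum_i 1*a i.
  by rewrite sub0r mul1r; congr (_-_); apply: eq_bigr => i _; rewrite mul1r.
 exact: c2.
Qed.

(** Once [gO] is known to be integrable, dominated convergence removes the cut-offs; only the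
    masses, weighted by the limits [h i], remain. *)
Theorem flux_identity (eta : E -> R) (H : R) (h : 'I_m -> R) :
 (exists r : R, forall x, r < `|x| -> eta x = 0) -> (forall x, C1at eta x) ->
 (forall i, \forall x \near yv i, eta x = h i) -> (forall x, `|eta x| <= H) ->
 [/\ Cc (dpairing eta X), itg (fun x => eta x*gO x) &
 Int (dpairing eta X) = Int (fun x => eta x*gO x) + \sum_i h i*a i].
Proof.
move=> er eC eN eH; have [k0 hk]:=big_k; have [iO _]:=total_flux.
have S k:=flux_cutoffs (hk (k0+k)%N (leq_addr _ _)) er eC eN.
have H0 : 0<=H by apply: le_trans (eH 0).
have me : mble eta by apply: continuous_mble => x; exact: C1at_cont.
have ie : itg (fun x => eta x*gO x).
 apply: (itg_dom _ _ (itg_scale H iO)).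
  by apply: measurable_funM => //; exact: gO_mble.
 by move=> x; rewrite normrM (ger0_norm (gO_ge0 x)); apply: ler_wpM2r => //; exact: gO_ge0.
have [_ cE _]:=S 0%N; split => //.
pose G:=H + \sum_i `|h i|.
have c1:=@cvg_masses (Int (dpairing eta X)) 0 h k0 hk.
have c2 : Int (fun x => (eta x-0*chi8 (k0+k) x - \sum_i h i*chf i (k0+k) x)*gO x) @[k --> \oo] --> Int (fun x => eta x*gO x).
 apply: (@Int_dominated _ _ _ (fun x => G*gO x)) => //.
 - by move=> k; have [i1 _ _]:=S k; exact: itg_mble i1.
 - exact: itg_scale.
 - move=> x; have [Rx|nR]:=pselect (reg x); last first.
   have -> : gO x = 0 by rewrite /gO indicE memNset// mul0r.
   by rewrite mulr0 (_ : (fun n => _) = (fun=> 0)); [exact: cvg_cst|apply/funext => n; rewrite mulr0].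
  apply: cvgM; last exact: cvg_cst.
  have l2 i : chf i (k0+k) x @[k --> \oo] --> (0 : R).
   exact: (cvg_addl k0 (chi_cvg0 (-1) (Rx i))).
  have l3 : (\sum_i h i*chf i (k0+k) x) @[k --> \oo] --> (\sum_i h i*0).
   by apply: cvg_bigsum => i; apply: cvgM; [exact: cvg_cst|exact: l2].
  have -> : eta x = eta x-0 - \sum_i h i*0 by rewrite big1 ?subr0// => i; rewrite mulr0.
  apply: cvgB; last exact: l3.
  rewrite (_ : (fun k => _) = (fun=> eta x-0 - \sum_i h i*0-0)); first by rewrite big1 ?subr0; [exact: cvg_cst|move=> i _; rewrite mulr0].
  by apply/funext => k; rewrite mul0r big1 ?subr0// => i _; rewrite mulr0.
 - move=> k x; rewrite normrM (ger0_norm (gO_ge0 x)); apply: ler_wpM2r; first exact: gO_ge0.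
  rewrite mul0r subr0; apply: le_trans (ler_normB _ _) _; apply: lerD => //.
  apply: le_trans (ler_norm_sum _ _ _) _; apply: ler_sum => i _.
  by rewrite normrM ler_piMr// ger0_norm; have /andP[]:=chi_01 (yv i) (-1) (k0+k) x.
have e : (fun k => Int (fun x => (eta x-0*chi8 (k0+k) x - \sum_i h i*chf i (k0+k) x)*gO x)) =
  (fun k => Int (dpairing eta X)-0*Int (pairing (gS 0 1 (k0+k)) X) - \sum_i h i*Int (pairing (gS (yv i) (-1) (k0+k)) X)).
 by apply/funext => k; have [_ _ ->]:=S k.
rewrite e in c2.
have:=cvg_unique _ c2 c1; rewrite mul0r subr0 => ->; last exact: norm_hausdorff.
by lra.
Qed.

End Flux.

(** * The inequality and its equality case for a conic factor on R^4 *)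

Lemma tden_flux {R : realType} (h : 'I_4 -> 'I_4 -> R) (p : 'I_4 -> R) :
 tden h p = 2*(\sum_j p j*(- (2^-1*(trc h * p j-hvec h p j)+2^-1*(nrm2 p * p j))))-2^-1*(\sum_j p j*(nrm2 p * p j)).
Proof. by rewrite /tden; sum4; field. Qed.

Lemma fden0 {R : realType} (h : 'I_4 -> 'I_4 -> R) (p : 'I_4 -> R) : nrm2 p = 0 -> fden h p = 0.
Proof.
move=> n0; have p0:=nrm2_eq0 n0; rewrite /fden n0 mul0r add0r /hpp big1 ?mulr0 ?oppr0// => i _.
by rewrite p0 mul0r.
Qed.

Lemma enorm_grad4 {R : realType} (u : 'rV[R]_4 -> R) x : enorm (grad u x)^+4 = nrm2 (gr u x)^+2.
Proof.
rewrite (exprM _ 2 2) enorm_sqr /dot; congr (_^+2); apply: eq_bigr => i _.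
by rewrite !mxE.
Qed.

Section Conic.
Context {R : realType}.
Local Notation E:='rV[R]_4.
Variables (m : nat) (yv : 'I_m -> E) (be : 'I_m -> R) (gam K M s0 : R) (u : E -> R).
Hypothesis yinj : injective yv.
Hypothesis cu : is_Ck 3 (reg yv) u.
Hypothesis K0 : 0<K.
Hypothesis s0_ge0 : 0<=s0.
Hypothesis be0 : forall i, be i<0.
Hypothesis gam0 : 0<gam.
Hypothesis S1 : forall x, reg yv x -> 0<sig1 (hs u x) (gr u x).
Hypothesis S2 : forall x, reg yv x -> sig2 (hs u x) (gr u x) = K*expR (4*u x).
Hypothesis HEf : forall i x, x != yv i -> s0 < -1*Lr (yv i) x -> reg yv x /\ `|u x-be i*Lr (yv i) x| <= M.
Hypothesis HEi : forall x, x != 0 -> s0<1*Lr 0 x -> reg yv x /\ `|u x - - gam*Lr 0 x| <= M.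

Let Om:=reg yv.
Let f x:=fden (hs u x) (gr u x).
Let Th x:=tden (hs u x) (gr u x).

Let oOm : open Om. Proof. exact: open_reg. Qed.

Lemma sig2_gt0 x : Om x -> 0<sig2 (hs u x) (gr u x).
Proof. by move=> Ox; rewrite S2// mulr_gt0// expR_gt0. Qed.

Lemma fT_ge0 x : Om x -> 0<=f x /\ 0<=Th x.
Proof. by move=> Ox; apply: fden_tden_ge0; [exact: (hs_sym oOm cu Ox)|exact: S1|exact: sig2_gt0]. Qed.

Lemma end_far T : exists r : R, forall x, r < `|x| -> Om x /\ u x<T.
Proof.
pose s:=Num.max s0 ((M-T)/gam+1); exists (`|0 : E| + expR s) => x /(@Lr_far _ 0 s)[x0].
rewrite gt_max => /andP[h1 h2]; have [Ox hu]:=HEi x0 ltac:(by rewrite mul1r); split => //.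
have:=ler_norml (u x - - gam*Lr 0 x) M; rewrite hu => /esym/andP[_ h3].
have h4 : (M-T)/gam<Lr 0 x by lra.
by move: h4; rewrite ltr_pdivrMr//; move: h3; rewrite mulNr opprK; move: (gam*_) (_*gam) (mulrC gam (Lr 0 x)) => A B ->; lra.
Qed.

Lemma end_near x T : ~ Om x -> \forall y \near x, Om y -> T<u y.
Proof.
move=> /nreg[i ->].
apply: filterS (@Lr_near _ (yv i) (Num.min (- s0) ((T+M)/be i-1))) => y hy Oy.
have yn:=Oy i; have:=hy yn; rewrite lt_min => /andP[h1 h2].
have [_ hu]:=HEf yn ltac:(by rewrite mulN1r ltrNr).
have:=ler_norml (u y-be i*Lr (yv i) y) M; rewrite hu => /esym/andP[h3 _].
have h4 : Lr (yv i) y<(T+M)/be i by lra.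
have h5 : T+M<be i*Lr (yv i) y by rewrite mulrC -ltr_ndivlMr.
by lra.
Qed.

Let S3:=\sum_i be i^+3.
Let Sq:=\sum_i be i^+2.
Let A0:=- S3*(@kappa R).
Let E0:=(3*Sq+S3)/2*(@kappa R).

Lemma uniform_masses : exists2 C : R, 0<=C &
 (forall i, end_masses u (yv i) (be i) (-1) s0 C) /\ end_masses u 0 (- gam) 1 s0 C.
Proof.
have fd x : Om x -> 0<=fden (hs u x) (gr u x) by move=> /fT_ge0[].
have [Ci Ci0 hi]:=end_mass oOm cu (or_introl erefl) s0_ge0 fd HEi.
have /choice[Cf hf] i : exists C, 0<=C /\ end_masses u (yv i) (be i) (-1) s0 C.
 by have [C C0 h]:=end_mass oOm cu (or_intror erefl) s0_ge0 fd (@HEf i); exists C.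
have Cf0 i : 0<=Cf i by have []:=hf i.
exists (Ci + \sum_i Cf i); first by rewrite addr_ge0// sumr_ge0.
split=> [i|]; last by apply: end_masses_le hi; rewrite lerDl sumr_ge0.
by have [_]:=hf i; apply: end_masses_le; rewrite (bigD1 i)//= addrCA lerDl addr_ge0// sumr_ge0.
Qed.

Let rf i x : x != yv i -> s0<ell (yv i) (-1) x -> reg yv x.
Proof. by move=> h1 h2; have []:=HEf h1 h2. Qed.

Let ri x : x != 0 -> s0<ell 0 1 x -> reg yv x.
Proof. by move=> h1 h2; have []:=HEi h1 h2. Qed.

Definition flux_package (X : 'I_4 -> E -> R) (g : E -> R) (a : 'I_m -> R) (aoo : R) : Prop :=
 (itg (gO yv g) /\ Int (gO yv g) = - aoo - \sum_i a i) /\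
 forall (eta : E -> R) (H : R) (h : 'I_m -> R),
 (exists r : R, forall x, r < `|x| -> eta x = 0) -> (forall x, C1at eta x) ->
 (forall i, \forall x \near yv i, eta x = h i) -> (forall x, `|eta x| <= H) ->
 [/\ Cc (dpairing eta X), itg (fun x => eta x*gO yv g x) &
 Int (dpairing eta X) = Int (fun x => eta x*gO yv g x) + \sum_i h i*a i].

Lemma flux_Xa : flux_package (Xa u) f (fun i => -1*be i^+3*kappa) (1*(- gam)^+3*kappa).
Proof.
have [C C0 [mf mi]]:=uniform_masses.
have c1 j : is_Ck 1 (reg yv) (Xa u j) by exact: is_CkW (is_Ck_Xa oOm cu j).
have c2 x : reg yv x -> cts f x by move=> Rx; exact: (proj1 (is_Ck_fden oOm cu)).
have g0 x : reg yv x -> 0<=f x by move=> /fT_ge0[].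
have dX x : reg yv x -> \sum_j partial j (Xa u j) x = - f x by move=> Rx; exact: (div_Xa oOm cu Rx).
have m1 i k hk:=proj1 (mf i k hk); have m2 k hk:=proj1 (mi k hk).
split; first exact: (total_flux yinj rf ri c1 c2 g0 dX C0 m1 m2).
by move=> eta H h; exact: (flux_identity yinj rf ri c1 c2 g0 dX C0 m1 m2).
Qed.

Lemma neg_mass (G Y : 'I_4 -> E -> R) (b e : R) : mass_bound G Y e b -> mass_bound G (fun j x => - Y j x) e (- b).
Proof.
move=> [c h]; rewrite /mass_bound; have -> : pairing G (fun j x => - Y j x) = (fun x => -1 * \sum_j G j x*Y j x).
 by apply/funext => x; rewrite mulN1r -sumrN; apply: eq_bigr => j _; rewrite mulrN.
split; last by rewrite (Int_scale _ (itg_Cc c)) mulN1r -opprD normrN.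
have [c1 [r hr]]:=c; split; last by exists r => x /hr ->; rewrite mulr0.
by move=> x; apply: cont_mul; [exact: cont_cst|exact: c1].
Qed.

(** The sign is changed so that the divergence is nonpositive, as for [Xa]. *)
Lemma flux_Vf : flux_package (fun j x => - Vf u j x) (fun x => K*expR (4*u x))
 (fun i => - (-1*(3*be i^+2+be i^+3)/2*kappa)) (- (1*(3*(- gam)^+2+(- gam)^+3)/2*kappa)).
Proof.
have [C C0 [mf mi]]:=uniform_masses.
have c1 j : is_Ck 1 (reg yv) (fun x => - Vf u j x) by apply: is_Ck_opp oOm _; exact: (is_Ck_Vf oOm cu j).
have c2 x : reg yv x -> cts (fun x => K*expR (4*u x)) x.
 move=> Rx; apply: cont_mul; first exact: cont_cst.
 apply: cont_comp; first exact: continuous_expR.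
 by apply: cont_mul; [exact: cont_cst|exact: (proj1 cu)].
have g0 x : reg yv x -> 0<=K*expR (4*u x) by move=> _; rewrite mulr_ge0 ?expR_ge0// ltW.
have dX x : reg yv x -> \sum_j partial j (fun x => - Vf u j x) x = - (K*expR (4*u x)).
 move=> Rx; rewrite -S2// -(div_Vf oOm cu Rx) -sumrN; apply: eq_bigr => j _.
 have [ex _] : is_derive x (delta_mx 0 j) (Vf u j) (partial j (Vf u j) x) by exact: is_Ck_derivable (is_Ck_Vf oOm cu j) Rx.
 by rewrite /partial deriveN.
have m1 i k hk:=neg_mass (proj2 (mf i k hk)); have m2 k hk:=neg_mass (proj2 (mi k hk)).
split; first exact: (total_flux yinj rf ri c1 c2 g0 dX C0 m1 m2).
by move=> eta H h; exact: (flux_identity yinj rf ri c1 c2 g0 dX C0 m1 m2).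
Qed.

Lemma sum_massA : \sum_i -1*be i^+3*kappa = A0.
Proof. by rewrite /A0 -sumrN mulr_suml; apply: eq_bigr => i _; rewrite mulN1r. Qed.

Lemma sum_massE : \sum_i-(-1*(3*be i^+2+be i^+3)/2*kappa) = E0.
Proof.
rewrite /E0 /Sq /S3 mulr_sumr -big_split /= !mulr_suml; apply: eq_bigr => i _.
by ring.
Qed.

Lemma gO_vO x : gO yv (fun x => K*expR (4*u x)) x = K*vO Om u x.
Proof. by rewrite /gO /vO; ring. Qed.

Lemma total_fluxes : [/\ itg (fO Om f), Int (fO Om f) = gam^+3*kappa-A0,
  itg (vO Om u) & K*Int (vO Om u) = (3*gam^+2-gam^+3)/2*kappa-E0].
Proof.
have [[i1 e1] _]:=flux_Xa; have [[i2 e2] _]:=flux_Vf.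
have i3 : itg (vO Om u).
 apply: itg_eq (itg_scale K^-1 i2) => x; rewrite gO_vO mulrA mulVf ?mul1r//.
 by pos.
split => //; first by rewrite e1 sum_massA; ring.
rewrite -Int_scale// -(Int_eq gO_vO) e2 sum_massE; ring.
Qed.

(** By [tden_flux], [tden] is the gradient of [u] paired with the field [-2V - X/2]. The test
    function has gradient [trap(u) grad u] on [Om] and takes the value [b-a] at each conic point,
    which collects the masses [A0] and [E0]. *)
Lemma flux_test sg a b : 0<sg -> a<=b ->
 itg (fun x => \1_Om x*(trap sg a b (u x)*Th x)) /\
 Int (fun x => \1_Om x*(trap sg a b (u x)*Th x)) =
 2*(K*Int (fun x => eta Om u sg a b x*vO Om u x)+(b-a)*E0) -
 2^-1*(Int (fun x => eta Om u sg a b x*fO Om f x)+(b-a)*A0).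
Proof.
move=> sg0 ab; have cu1 : is_Ck 1 Om u by exact: is_CkW (is_CkW cu).
have hC:=C1at_eta oOm cu1 end_near sg0 ab.
have [r hr]:=eta_far end_far sg0 ab.
have hN i : \forall x \near yv i, eta Om u sg a b x = b-a.
 by apply: (eta_near end_near sg0 ab) => /(_ i); rewrite eqxx.
have hB x : `|eta Om u sg a b x| <= b-a.
 by have /andP[h1 h2]:=@eta_bounds R Om u sg a b sg0 ab x; rewrite ger0_norm.
have [_ F1]:=flux_Xa; have [_ F2]:=flux_Vf.
have [c1 i1 e1]:=F1 _ _ (fun=> b-a) (ex_intro _ r hr) hC hN hB.
have [c2 i2 e2]:=F2 _ _ (fun=> b-a) (ex_intro _ r hr) hC hN hB.
rewrite -mulr_sumr sum_massA in e1; rewrite -mulr_sumr sum_massE in e2.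
have pw x : \1_Om x*(trap sg a b (u x)*Th x) =
 2*(\sum_j partial j (eta Om u sg a b) x * - Vf u j x)-2^-1*(\sum_j partial j (eta Om u sg a b) x*Xa u j x).
 have [Ox|nO]:=pselect (Om x); last first.
  by rewrite indicF// mul0r !big1 ?mulr0 ?subrr// => j; rewrite (partial_eta_out end_near sg0 ab)// mul0r.
 have p1 j : partial j (eta Om u sg a b) x = trap sg a b (u x)*gr u x j by exact: (partial_eta_in oOm cu1).
 rewrite indicT// mul1r /Th tden_flux mulrBr; congr (_-_); rewrite mulrCA; congr (_*_); rewrite mulr_sumr; apply: eq_bigr => j _.
  by rewrite p1 -mulrA.
 by rewrite p1 -mulrA.
have iv : Int (fun x => eta Om u sg a b x*gO yv (fun x => K*expR (4*u x)) x) = K*Int (fun x => eta Om u sg a b x*vO Om u x).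
 rewrite -Int_scale; first by apply: Int_eq => x; rewrite gO_vO mulrCA.
 apply: itg_eq (itg_scale K^-1 i2) => x; rewrite gO_vO.
 transitivity (K^-1*K*(eta Om u sg a b x*vO Om u x)); first by ring.
 by rewrite mulVf ?mul1r// gt_eqF.
have j1:=itg_scale 2 (itg_Cc c2); have j2:=itg_scale 2^-1 (itg_Cc c1).
split; first by apply: itg_eq (itg_sub j1 j2) => x; rewrite pw.
rewrite (Int_eq pw) (Int_sub j1 j2) (Int_scale _ (itg_Cc c2)) (Int_scale _ (itg_Cc c1)) e1 e2 iv.
by [].
Qed.

(** If [fden] vanished on the open set [L t], so would the gradient, hence the Hessian,
    contradicting [sig2 > 0]. *)
Lemma Hnd t x : L Om u t x -> exists y, L Om u t y /\ 0<f y.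
Proof.
move=> Lx; apply: contrapT => n.
have cu1 : is_Ck 1 Om u by exact: is_CkW (is_CkW cu).
have g0 y : L Om u t y -> forall i, gr u y i = 0.
 move=> Ly; have Oy:=proj1 Ly; apply: nrm2_eq0; apply/eqP; rewrite eq_le nrm2_ge0 andbT leNgt.
 apply/negP => N0; apply: n; exists y; split => //.
 by have []:=fden_tden_gt0 (hs_sym oOm cu Oy) (S1 Oy) (sig2_gt0 Oy) N0.
have h0 i j : hs u x i j = 0.
 rewrite /hs {1}/partial (near_eq_derive (g:=fun=> 0)) ?derive_cst//.
 have nL : \forall y \near x, L Om u t y by exact: open_nbhs_nbhs (conj (@open_L R Om u oOm cu1 t) Lx).
 by apply: filterS nL => y Ly; exact: g0 Ly i.
have:=sig2_gt0 (proj1 Lx); rewrite /sig2.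
have -> : trc (hs u x) = 0 by apply: big1 => i _; exact: h0.
have -> : hs2 (hs u x) = 0 by apply: big1 => i _; apply: big1 => j _; rewrite h0 expr0n.
have -> : hpp (hs u x) (gr u x) = 0 by apply: big1 => i _; rewrite g0// mul0r.
by lra.
Qed.

Lemma HAM x : Om x -> 3*K*expR (4*u x)*enorm (grad u x)^+4<=f x*Th x.
Proof.
move=> Ox; rewrite enorm_grad4; apply: le_trans (fden_tden_ge _ (hs_sym oOm cu Ox)).
by rewrite S2// le_eqVlt; apply/orP; left; apply/eqP; ring.
Qed.

Let A00 : 0<=A0.
Proof.
rewrite -sum_massA; apply: sumr_ge0 => i _; apply: mulr_ge0; last exact: ltW (@kappa_gt0 R).
by rewrite mulN1r oppr_ge0 mulr_le0_ge0 ?sqr_ge0// ltW.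
Qed.

Hypothesis be1 : forall i, -1<be i.

Let E00 : 0<=E0.
Proof.
rewrite -sum_massE; apply: sumr_ge0 => i _; rewrite !mulN1r !mulNr opprK.
apply: mulr_ge0; last exact: ltW (@kappa_gt0 R).
apply: divr_ge0 => //; have -> : 3*be i^+2+be i^+3 = be i^+2*(3+be i) by ring.
by apply: mulr_ge0; [exact: sqr_ge0|have:=be1 i; lra].
Qed.

Let cu1 : is_Ck 1 Om u. Proof. exact: is_CkW (is_CkW cu). Qed.
Let cf x : Om x -> cts f x.
Proof. by move=> Rx; exact: (proj1 (is_Ck_fden oOm cu)). Qed.
Let cT x : Om x -> cts Th x.
Proof. by move=> Rx; exact: (proj1 (is_Ck_tden oOm cu)). Qed.
Let f0 x : Om x -> 0<=f x. Proof. by move=> /fT_ge0[]. Qed.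
Let T0 x : Om x -> 0<=Th x. Proof. by move=> /fT_ge0[]. Qed.

Theorem conic_ineq : Mlim kappa (gam^+3*kappa) ((3*gam^+2-gam^+3)/2*kappa)<=Mlim kappa A0 E0.
Proof.
have [i1 e1 i2 e2]:=total_fluxes.
have:=level_limits oOm cu1 cf f0 T0 end_far end_near K0 A00 E00 i1 i2 flux_test HAM Hnd (@kappa_gt0 R) (@kappa_le R).
by rewrite e1 e2 ![_+(_-_)]addrC !subrK.
Qed.

Theorem conic_rigid : Mlim kappa (gam^+3*kappa) ((3*gam^+2-gam^+3)/2*kappa) = Mlim kappa A0 E0 ->
 forall x, Om x -> fden (hs u x) (gr u x)*tden (hs u x) (gr u x) = 3*nrm2 (gr u x)^+2*sig2 (hs u x) (gr u x).
Proof.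
move=> eqM x Ox; have [i1 e1 i2 e2]:=total_fluxes.
have p0 y : Om y -> enorm (grad u y) = 0 -> f y*Th y = 0.
 move=> Oy g0; have n0 : nrm2 (gr u y) = 0.
  by have:=enorm_grad4 u y; rewrite g0 expr0n => /esym/eqP; rewrite sqrf_eq0 => /eqP.
 by rewrite /f fden0// mul0r.
have:=level_rigid oOm cu1 cf cT f0 T0 end_far end_near K0 A00 E00 i1 i2 flux_test HAM Hnd (@kappa_gt0 R) (@kappa_le R) p0.
rewrite e1 e2 ![_+(_-_)]addrC !subrK => /(_ eqM x Ox); rewrite /f /Th => ->.
by rewrite enorm_grad4 S2//; ring.
Qed.

End Conic.

(** * Rigidity: the local form of the Hessian *)

Lemma rearr4 {R : realType} (a b c d : R) : a*b+(c+d) = b*a+c+d.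
Proof. by ring. Qed.

Lemma cen_arith {R : realType} (A b q g1 g2 : R) (d : bool) : A != 0 ->
 A*d%:R+b*(g1*g2) = q*A+g1/A*(b*A*g2) -> d%:R-q = 0.
Proof.
move=> A0; have -> : g1/A*(b*A*g2) = b*(g1*g2) by field.
by nra.
Qed.

Section CodazziAlgebra.
Context {R : realType}.
Implicit Types (p w b h : 'I_4 -> R).

(** The hypothesis is the symmetry in [j] and [k] of the derivative of [A delta + b p p], with the
    derivative of [p] replaced by that same tensor. For [w = dA - b A p], contraction with [delta]
    and with [p p] gives two linear relations between [w] and the part of [db] orthogonal to [p];
    they force [w] to be orthogonal to [p] and then to vanish. *)
Lemma codazzi_alg (A b : R) p (dA db : 'I_4 -> R) : nrm2 p != 0 ->
 (forall i j k, dA k*(i == j)%:R+db k*(p i * p j)+b*((A*(i == k)%:R+b*(p i * p k)) * p j+p i*(A*(j == k)%:R+b*(p j * p k))) =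
   dA j*(i == k)%:R+db j*(p i * p k)+b*((A*(i == j)%:R+b*(p i * p j)) * p k+p i*(A*(k == j)%:R+b*(p k * p j)))) ->
 forall k, dA k = b*A * p k.
Proof.
move=> N0 H; pose w k:=dA k-b*A * p k.
have R1 i j k : w k*(i == j)%:R-w j*(i == k)%:R+(db k * p j-db j * p k) * p i = 0.
 have:=H i j k; rewrite (eq_sym k j) => /eqP; rewrite -subr_eq0 => /eqP <-; rewrite /w; ring.
suff w0 k : w k = 0 by move=> k; apply/eqP; rewrite -subr_eq0; apply/eqP; exact: w0.
move: (w) R1 => {w H}w R1.
pose s:=\sum_i db i * p i; pose t:=\sum_i w i * p i; pose N:=nrm2 p.
have T1 l : 3*w l+(db l*N-s * p l) = 0.
 by rewrite -[RHS](@big1 _ 0 +%R _ (index_enum 'I_4) xpredT _ (fun i _ => R1 i i l)) /N /s; case4 l; sum4; ring.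
have T2 : N*w k-t * p k+(db k*N-s * p k)*N = 0.
 have Z i j : (w k*(i == j)%:R-w j*(i == k)%:R+(db k * p j-db j * p k) * p i)*(p i * p j) = 0 by rewrite R1 mul0r.
 rewrite -[RHS](@big1 _ 0 +%R _ (index_enum 'I_4) xpredT _ (fun i _ => @big1 _ 0 +%R _ (index_enum 'I_4) xpredT _ (fun j _ => Z i j))) /N /s /t.
 by clear; case4 k; sum4; ring.
have /eqP : 3*t = 0.
 have Z l : (3*w l+(db l*N-s * p l)) * p l = 0 by rewrite T1 mul0r.
 by rewrite -[RHS](@big1 _ 0 +%R _ (index_enum 'I_4) xpredT _ (fun i _ => Z i)) /N /s /t; clear; sum4; ring.
rewrite mulf_eq0 pnatr_eq0 /= => /eqP t0.
have /eqP : N*w k*2 = 0 by move: T2; rewrite t0; have:=T1 k; move: (db k*N-s * p k) => q h1 h2; nra.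
by rewrite !mulf_eq0 pnatr_eq0 orbF (negPf N0) => /eqP.
Qed.

Lemma hpp_form (A b : R) p (h : 'I_4 -> 'I_4 -> R) : (forall i j, h i j = A*(i == j)%:R+b*(p i * p j)) ->
 hpp h p = A*nrm2 p+b*nrm2 p^+2.
Proof. by move=> e; sum4; rewrite !e /=; ring. Qed.

(** The formula does not contain [b], which has no limit a priori at critical points of [u], and
    thus can be extended there. *)
Lemma sig2_form (A b : R) p (h : 'I_4 -> 'I_4 -> R) : (forall i j, h i j = A*(i == j)%:R+b*(p i * p j)) ->
 sig2 h p = - 6*A^+2+3*A*trc h-3*A*nrm2 p+3/2*nrm2 p*trc h.
Proof. by move=> e; rewrite /sig2; sum4; rewrite !e /=; field. Qed.

End CodazziAlgebra.

Section LocallyConstant.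
Context {R : realType} {n : nat}.
Local Notation E:='rV[R]_n.

Lemma locally_constant (U : set E) (g : E -> R) x : open U -> is_Ck 1 U g -> (forall y i, U y -> partial i g y = 0) ->
 U x -> \forall y \near x, g y = g x.
Proof.
move=> oU cg g0 Ux.
have /nbhs_ballP[r /= r0 hr] : nbhs x U by exact: open_nbhs_nbhs.
apply/nbhs_ballP; exists r => //= y xy.
have ln t : 0<=t<=1 -> U (x+t *: (y-x)).
 move=> /andP[t0 t1]; apply: hr; have [_ hb]:=xy; split => // i j.
 have:=hb i j; rewrite ord1 /ball /= !mxE opprD addrA subrr sub0r normrN normrM (ger0_norm t0) => h.
 by apply: le_lt_trans h; rewrite distrC ler_piMl.
have d (t : R) : 0<=t<=1 -> is_derive t 1 (fun s : R => g (x+s *: (y-x))) 0.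
 move=> /ln Ut; apply: is_derive_line.
 apply: (is_derive_eq (C1at_is_derive (y-x) (is_Ck_C1at oU cg Ut))).
 by apply: big1 => i _; rewrite g0// mulr0.
have [c _]:=mean_value ler01 (dg:=fun=> 0) d.
have e : x+1 *: (y-x) = y by rewrite scale1r addrC subrK.
by rewrite e scale0r addr0 mul0r => /eqP; rewrite subr_eq0 => /eqP.
Qed.

End LocallyConstant.

Section Rigid.
Context {R : realType}.
Local Notation E:='rV[R]_4.
Local Notation e_ i:=(delta_mx 0 i : E).
Variables (Om : set E) (u : E -> R).
Hypothesis oOm : open Om.
Hypothesis cu : is_Ck 3 Om u.
Hypothesis S1 : forall x, Om x -> 0<sig1 (hs u x) (gr u x).
Hypothesis S2 : forall x, Om x -> 0<sig2 (hs u x) (gr u x).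
Hypothesis eqh : forall x, Om x -> fden (hs u x) (gr u x)*tden (hs u x) (gr u x) = 3*nrm2 (gr u x)^+2*sig2 (hs u x) (gr u x).

Definition Pn : set E:=[set x | Om x /\ Nf u x != 0].
Definition Am x : R:=- tden (hs u x) (gr u x)/(3*Nf u x)-Nf u x/2.
Definition bm x : R:=(hpp (hs u x) (gr u x)-Am x*Nf u x)/Nf u x^+2.

Lemma Nf_gt0 x : Pn x -> 0<Nf u x.
Proof. by move=> [_ n]; rewrite lt_neqAle eq_sym n nrm2_ge0. Qed.

Lemma open_Pn : open Pn.
Proof.
rewrite openE => x [Ox Nx]; rewrite /interior.
have n1 : \forall y \near x, Om y by exact: open_nbhs_nbhs.
have c : cts (Nf u) x by exact: (proj1 (is_Ck_Nf oOm cu)).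
have N0 : 0<Nf u x by apply: Nf_gt0.
have nb:=@lt_nbhsr _ _ _ N0.
have n2 : \forall y \near x, 0<Nf u y by exact: (c _ nb).
by apply: filterS2 n1 n2 => y Oy Ny; split => //; rewrite gt_eqF.
Qed.

Lemma hs_form x : Pn x -> forall i j, hs u x i j = Am x*(i == j)%:R+bm x*(gr u x i*gr u x j).
Proof.
move=> Px; have [Ox _]:=Px; have N0:=Nf_gt0 Px.
have [b hb]:=fden_tden_eq (hs_sym oOm cu Ox) N0 (eqh Ox).
have e : b = bm x.
 have:=hpp_form hb; rewrite -/(Nf u x) /bm => ->.
 by rewrite -/(Am x); field; rewrite gt_eqF.
by move=> i j; rewrite hb e.
Qed.

Lemma Am_lt0 x : Pn x -> Am x<0.
Proof.
move=> Px; have [Ox _]:=Px; have N0:=Nf_gt0 Px.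
have [_ T0]:=fden_tden_gt0 (hs_sym oOm cu Ox) (S1 Ox) (S2 Ox) N0.
have : 0<tden (hs u x) (gr u x)/(3*Nf u x) by rewrite divr_gt0// mulr_gt0.
by rewrite /Am mulNr; move: (_/(3*_)) N0 => A; lra.
Qed.

Let Psub : Pn `<=` Om. Proof. by move=> x []. Qed.

Lemma is_Ck_Am : is_Ck 1 Pn Am.
Proof.
have oP:=open_Pn; have cN : is_Ck 1 Pn (Nf u) by exact: is_Ck_sub Psub (is_CkW (is_Ck_Nf oOm cu)).
apply: is_Ck_sub_fun; [exact: oP| |].
 apply: is_Ck_mul; [exact: oP| |].
  by apply: is_Ck_opp; [exact: oP|exact: is_Ck_sub Psub (is_Ck_tden oOm cu)].
 apply: is_Ck_inv; [exact: oP| |exact: is_Ck_scale].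
 by move=> x Px; rewrite gt_eqF// mulr_gt0// Nf_gt0.
by apply: is_Ck_mul; [exact: oP|exact: cN|exact: is_Ck_cst].
Qed.

Lemma is_Ck_bm : is_Ck 1 Pn bm.
Proof.
have oP:=open_Pn; have cN : is_Ck 1 Pn (Nf u) by exact: is_Ck_sub Psub (is_CkW (is_Ck_Nf oOm cu)).
apply: is_Ck_mul; [exact: oP| |].
 apply: is_Ck_sub_fun; [exact: oP|exact: is_Ck_sub Psub (is_Ck_hpp oOm cu)|].
 by apply: is_Ck_mul; [exact: oP|exact: is_Ck_Am|exact: cN].
apply: is_Ck_inv; [exact: oP| |exact: is_Ck_exp].
by move=> x Px; rewrite expf_neq0// gt_eqF// Nf_gt0.
Qed.

Lemma partial_Am x k : Pn x -> partial k Am x = bm x*Am x*gr u x k.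
Proof.
move=> Px; have [Ox Nx]:=Px; have oP:=open_Pn; move: k.
apply: (codazzi_alg Nx (db:=fun k => partial k bm x)) => i j k.
have F i' j' k' : partial k' (fun y => hs u y i' j') x = partial k' Am x*(i' == j')%:R+partial k' bm x*(gr u x i'*gr u x j')
  + bm x*(hs u x i' k'*gr u x j'+gr u x i'*hs u x j' k').
 rewrite (near_partial (g:=fun y => (i' == j')%:R*Am y+bm y*(gr u y i'*gr u y j'))); last first.
  by apply: filterS (open_nbhs_nbhs (conj oP Px)) => y Py; rewrite hs_form// mulrC.
 have dA : is_derive x (e_ k') Am (partial k' Am x) by exact: is_Ck_derivable is_Ck_Am Px.
 have db : is_derive x (e_ k') bm (partial k' bm x) by exact: is_Ck_derivable is_Ck_bm Px.
 have dp:=isd_mul (d_gr cu i' k' Ox) (d_gr cu j' k' Ox).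
 have [_ e]:=isd_add (isd_cmul (i' == j')%:R dA) (isd_mul db dp).
 exact: (etrans e (rearr4 _ _ _ _)).
by have:=third_sym oOm cu i j k Ox; rewrite !F !(hs_form Px).
Qed.

(** The candidate centre: [grad u] would be [Am] times the position relative to it. By [partial_Am]
    the derivative of [grad u / Am] is the identity, so [cen] is locally constant. *)
Definition cen i (x : E) : R:=x 0 i-gr u x i/Am x.

Lemma is_Ck_cen i : is_Ck 1 Pn (cen i).
Proof.
have oP:=open_Pn; apply: is_Ck_sub_fun; [exact: oP|exact: is_Ck_coord|].
apply: is_Ck_mul; [exact: oP|exact: is_Ck_sub Psub (is_CkW (is_Ck_gr cu i))|].
by apply: is_Ck_inv; [exact: oP|move=> x /Am_lt0 h; rewrite lt_eqF|exact: is_Ck_Am].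
Qed.

Lemma partial_cen x i j : Pn x -> partial j (cen i) x = 0.
Proof.
move=> Px; have [Ox Nx]:=Px; have A0:=lt0r_neq0; have An : Am x != 0 by rewrite lt_eqF// Am_lt0.
have dA : is_derive x (e_ j) Am (partial j Am x) by exact: is_Ck_derivable is_Ck_Am Px.
have dq : is_derive x (e_ j) (fun y => gr u y i/Am y) (partial j (fun y => gr u y i/Am y) x).
 apply: is_Ck_derivable Px; apply: is_Ck_mul; [exact: open_Pn|exact: is_Ck_sub Psub (is_CkW (is_Ck_gr cu i))|].
 by apply: is_Ck_inv; [exact: open_Pn|move=> y /Am_lt0 h; rewrite lt_eqF|exact: is_Ck_Am].
have e1 : hs u x i j = partial j (fun y => gr u y i/Am y) x*Am x+gr u x i/Am x * partial j Am x.
 have [_ e1]:=d_gr cu i j Ox; have [_ e2]:=isd_mul dq dA; rewrite -e1 -e2.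
 apply: near_eq_derive; apply: filterS (open_nbhs_nbhs (conj open_Pn Px)) => y Py.
 by rewrite divfK// lt_eqF// Am_lt0.
have [_ e]:=isd_sub (is_derive_coord x (e_ j) i) dq; apply: (etrans e).
move: e1; rewrite partial_Am// (hs_form Px) mxE eqxx andTb.
by move: An; move: (Am x) (bm x) (partial j _ x) (gr u x i) (gr u x j) => A b q g1 g2 An; exact: cen_arith.
Qed.

Lemma cen_locally_constant x : Pn x -> \forall y \near x, forall i, cen i y = cen i x.
Proof.
move=> Px; have H i:=locally_constant open_Pn (is_Ck_cen i) (fun y j => @partial_cen y i j) Px.
exact: (@filter_forall E 'I_4 (fun i y => cen i y = cen i x) (nbhs x) (nbhs_filter x) H).
Qed.

Definition Sc (c : E) : set E:=[set x | Pn x /\ forall i, gr u x i = Am x*(x 0 i-c 0 i)].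

Lemma Sc_cen (c x : E) : Pn x -> (forall i, cen i x = c 0 i) <-> (forall i, gr u x i = Am x*(x 0 i-c 0 i)).
Proof.
move=> Px; have An : Am x != 0 by rewrite lt_eqF// Am_lt0.
split=> h i; first by rewrite -h opprB addrC subrK mulrC divfK.
by rewrite /cen h mulrC mulKf// opprB addrC subrK.
Qed.

Lemma open_Sc c : open (Sc c).
Proof.
rewrite openE => x [Px hx]; rewrite /interior.
have n1 : \forall y \near x, Pn y by exact: open_nbhs_nbhs (conj open_Pn Px).
apply: filterS2 n1 (cen_locally_constant Px) => y Py hy; split => //.
by apply/(Sc_cen c Py) => i; rewrite hy; move: i; apply/(Sc_cen c Px).
Qed.

(** At a critical point [Am] has no meaning. There it is replaced in the formula of [sig2_form] by
    [grad u . (x-c)/|x-c|^2], which is continuous off [c] and agrees with [Am] on [Sc c]. The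
    difference [G] between [sig2] and the formula vanishes on [Sc c] but equals [sig2 > 0] at the
    critical point, so [Sc c] stays away from it. *)
Lemma coclosed_Sc c : open [set x | Om x /\ x != c /\ ~ Sc c x].
Proof.
rewrite openE => x [Ox [xc nS]]; rewrite /interior.
have n1 : \forall y \near x, Om y by exact: open_nbhs_nbhs.
have n2 : \forall y \near x, y != c by exact: open_nbhs_nbhs (conj (@open_punct R c) xc).
have n12 : \forall y \near x, Om y /\ y != c by apply: filterS2 n1 n2.
have [Nx|/eqP Nx]:=pselect (Nf u x = 0); last first.
 have Px : Pn x by [].
 have n3 : \forall y \near x, Pn y by exact: open_nbhs_nbhs (conj open_Pn Px).
 have n4:=cen_locally_constant Px.
 have n34 : \forall y \near x, Pn y /\ forall i, cen i y = cen i x by apply: filterS2 n3 n4.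
 apply: filterS2 n12 n34 => y [Oy yc] [Py hy]; split => //; split => // -[_ h].
 apply: nS; split => //; apply/(Sc_cen c Px) => i; rewrite -hy; move: i.
 exact/(Sc_cen c Py).
pose a y : R:=(\sum_i gr u y i*zc c i y)/rho c y.
pose G y : R:=sig2 (hs u y) (gr u y)-(- 6*a y^+2+3*a y*trc (hs u y)-3*a y*Nf u y+3/2*Nf u y*trc (hs u y)).
have r0 y : y != c -> 0<rho c y by exact: rho_gt0.
have cg i : cts (fun y => gr u y i) x by exact: (proj1 (is_Ck_gr cu i)).
have cz i : cts (zc c i) x by apply: cont_sub; [exact: coord_continuous|exact: cont_cst].
have ca : cts a x.
 apply: cont_mul; first by apply: cont_sum => i; exact: cont_mul.
 apply: cont_inv; first by rewrite gt_eqF// r0.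
 by apply: cont_sum => i; exact: cont_exp.
have ct : cts (fun y => trc (hs u y)) x by exact: (proj1 (is_Ck_trc oOm cu)).
have cN : cts (Nf u) x by exact: (proj1 (is_Ck_Nf oOm cu)).
have cS : cts (fun y => sig2 (hs u y) (gr u y)) x.
 apply: cont_near_eq (_ : cts (fun y => \sum_i partial i (Vf u i) y) x).
  by apply: filterS n1 => y Oy; exact: (div_Vf oOm cu Oy).
 by apply: cont_sum => i; exact: (proj1 (is_Ck_partial i (is_Ck_Vf oOm cu i))).
have cG : cts G x.
 apply: cont_sub => //; apply: cont_add; [apply: cont_sub; [apply: cont_add|]|].
 - by apply: cont_mul; [exact: cont_cst|exact: cont_exp].
 - by apply: cont_mul => //; apply: cont_mul => //; exact: cont_cst.
 - by apply: cont_mul => //; apply: cont_mul => //; exact: cont_cst.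
 - by apply: cont_mul => //; apply: cont_mul => //; exact: cont_cst.
have p0:=nrm2_eq0 Nx.
have G0 : 0<G x.
 rewrite /G Nx /a big1; last by move=> i _; rewrite p0 mul0r.
 by rewrite mul0r expr0n !mulr0 !mul0r !addr0 subr0 subr0 S2.
have nb:=@lt_nbhsr _ _ _ G0.
have n3 : \forall y \near x, 0<G y by exact: (cG _ nb).
apply: filterS2 n12 n3 => y [Oy yc] Gy; split => //; split => // -[Py h].
move: Gy; rewrite /G (sig2_form (hs_form Py)) -/(Nf u y).
have -> : a y = Am y.
 rewrite /a (eq_bigr (fun i => Am y*zc c i y^+2)); last by move=> i _; rewrite h expr2 mulrA.
 by rewrite -mulr_sumr mulfK// gt_eqF// r0.
by lra.
Qed.

End Rigid.

(** * Broken paths that avoid finitely many points *)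

Section Avoid.
Context {R : realType} {n : nat}.
Local Notation E:='rV[R]_n.

Lemma continuous_segment (x y : E) : continuous (fun s : R => x+s *: y).
Proof. by move=> s; apply: cvgD; [exact: cvg_cst|exact: scalel_continuous]. Qed.

Lemma clopen_segment (S V : set E) (x y : E) : open S -> open V -> (forall z, S z -> V z -> False) ->
 (forall s : R, 0<=s<=1 -> S (x+s *: (y-x)) \/ V (x+s *: (y-x))) -> S x -> S y.
Proof.
move=> oS oV dis cov Sx; pose g (s : R):=x+s *: (y-x).
have cg : continuous g by exact: continuous_segment.
have e : (`[0%R, 1%R] `&` (g @^-1` S)) = (`[0%R, 1%R] `&` ~` (g @^-1` V)).
 apply/seteqP; split => s /= [h1 h2]; split => //; first by move=> h3; exact: dis h2 h3.
 by have []:=cov s ltac:(by move: h1; rewrite in_itv).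
have e1 : `[0%R, 1%R] `&` (g @^-1` S) = `[0%R, 1%R]%classic.
 apply: (@segment_connected R 0 1).
 - exists 0; split => /=; first by rewrite in_itv /= lexx ler01.
  by rewrite /g scale0r addr0.
 - by exists (g @^-1` S) => //; apply: open_comp => // s _; exact: cg.
 - exists (~` (g @^-1` V)); last by [].
  by apply: open_closedC; apply: open_comp => // s _; exact: cg.
have : `[0%R, 1%R]%classic (1 : R) by rewrite /= in_itv /= lexx ler01.
by rewrite -e1 => -[_]; rewrite /= /g scale1r addrC subrK.
Qed.

Lemma independent_unique (d v : E) (i j : 'I_n) : d 0 i != 0 -> v 0 i = 0 -> v 0 j != 0 ->
 forall s s' t t' : R, s != 0 -> s *: (d+t *: v) = s' *: (d+t' *: v) -> t = t'.
Proof.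
move=> di vi vj s s' t t' s0 /rowP e.
have:=e i; rewrite !mxE vi !mulr0 !addr0 => /(mulIf di) ss.
have:=e j; rewrite !mxE -ss => /(mulfI s0)/addrI/(mulIf vj) //.
Qed.

(** The vertex [w t] is the midpoint of [x] and [y] displaced by [t] in direction [j]. Its
    directions seen from [x], and likewise from [y], are pairwise independent, so a forbidden point
    lies on each of the two lines for at most one natural number [t]; by the pigeonhole principle
    some [t] is good. *)
Lemma avoid_finite (T : finType) (F : T -> E) (x y : E) (i j : 'I_n) : j != i -> (x-y) 0 i != 0 ->
 (forall a, x <> F a /\ y <> F a) ->
 exists w : E, forall s : R, 0<=s<=1 -> forall a, x+s *: (w-x) <> F a /\ w+s *: (y-w) <> F a.
Proof.
move=> ji di xy; pose d : E:=2^-1 *: (y-x); pose v : E:=delta_mx 0 j.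
pose w (t : nat):=x+(d+t%:R *: v).
have e1 t : w t-x = d+t%:R *: v by rewrite addrC addKr.
have e2 t : w t-y = - d+t%:R *: v.
 have -> : w t-y = (x-y)+(d+t%:R *: v) by rewrite addrAC.
 by rewrite addrA; congr (_+_); apply/rowP => k; rewrite !mxE; field.
have d0 : d 0 i != 0.
 rewrite !mxE mulf_neq0 ?invr_neq0 ?pnatr_eq0//; move: di; rewrite !mxE -oppr_eq0 opprB//.
have nd0 : (- d) 0 i != 0 by rewrite mxE oppr_eq0.
have vi : v 0 i = 0 by rewrite mxE eq_sym (negPf ji).
have vj : v 0 j != 0 by rewrite mxE !eqxx oner_eq0.
pose bad (t : nat) (p : T*bool):=exists s : R, if p.2 then x+s *: (w t-x) = F p.1 else y+s *: (w t-y) = F p.1.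
have inj t t' p : bad t p -> bad t' p -> t = t'.
 case: p => a [] [s /= hs1] [s' /= hs2]; apply/eqP; rewrite -(eqr_nat R); apply/eqP.
  have s0 : s != 0 by apply/eqP => s0; case: (xy a) => + _; apply; rewrite -hs1 s0 scale0r addr0.
  by apply: (independent_unique d0 vi vj s0 (s':=s')); move: hs1; rewrite -hs2 => /addrI; rewrite !e1.
 have s0 : s != 0 by apply/eqP => s0; case: (xy a) => _; apply; rewrite -hs1 s0 scale0r addr0.
 by apply: (independent_unique nd0 vi vj s0 (s':=s')); move: hs1; rewrite -hs2 => /addrI; rewrite !e2.
have [t ht] : exists t, forall p, ~ bad t p.
 apply: contrapT => nt; have H t : exists p, bad t p.
  by apply: contrapT => h; apply: nt; exists t => p hp; apply: h; exists p.
 have [f hf]:=choice H.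
 pose g (k : 'I_#|{: T*bool}|.+1):=f k.
 have gi : injective g.
  by move=> k k' e; apply: val_inj; apply: (inj _ _ (f k)); [exact: hf|rewrite [f k]e; exact: hf].
 by have:=leq_card _ gi; rewrite card_ord ltnn.
exists (w t) => s /andP[s0 s1] a; split => h.
 by apply: (ht (a, true)); exists s.
apply: (ht (a, false)); exists (1-s) => /=; rewrite -h.
by apply/rowP => k; rewrite !mxE; ring.
Qed.

End Avoid.

(** * Rigidity: a single centre and radial symmetry *)

Section Conclusion.
Context {R : realType}.
Local Notation E:='rV[R]_4.
Local Notation e_ i:=(delta_mx 0 i : E).
Variables (m : nat) (yv : 'I_m -> E) (u : E -> R) (i0 : 'I_m).
Let Om:=reg yv.
Hypothesis Om0 : exists x, Om x.
Hypothesis cu : is_Ck 3 Om u.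
Hypothesis S1 : forall x, Om x -> 0<sig1 (hs u x) (gr u x).
Hypothesis S2 : forall x, Om x -> 0<sig2 (hs u x) (gr u x).
Hypothesis eqh : forall x, Om x -> fden (hs u x) (gr u x)*tden (hs u x) (gr u x) = 3*nrm2 (gr u x)^+2*sig2 (hs u x) (gr u x).
Hypothesis nearS : forall (x : E) (T : R), ~ Om x -> \forall y \near x, Om y -> T<u y.

Let oOm : open Om. Proof. exact: open_reg. Qed.

Lemma Pn_nonempty : exists x, Pn Om u x.
Proof.
apply: contrapT => n; have [x Ox]:=Om0.
have g0 y : Om y -> forall i, gr u y i = 0.
 move=> Oy; apply: nrm2_eq0; apply: contrapT => /eqP h; apply: n; exists y; split => //.
have h0 i j : hs u x i j = 0.
 rewrite /hs {1}/partial (near_eq_derive (g:=fun=> 0)) ?derive_cst//.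
 have nL : \forall y \near x, Om y by exact: open_nbhs_nbhs.
 by apply: filterS nL => y Ly; exact: g0 Ly i.
have:=S2 Ox; rewrite /sig2.
have -> : trc (hs u x) = 0 by apply: big1 => i _; exact: h0.
have -> : hs2 (hs u x) = 0 by apply: big1 => i _; apply: big1 => j _; rewrite h0 expr0n.
have -> : hpp (hs u x) (gr u x) = 0 by apply: big1 => i _; rewrite g0// mul0r.
by lra.
Qed.

(** [Sc c] is open, and its complement off [c] in the regular set is open too; a two-segment path
    that avoids [c] and the singular points carries membership from one point to all others. *)
Lemma central : exists c : E, forall x, Om x -> x != c -> Sc Om u c x.
Proof.
have [x0 Px0]:=Pn_nonempty; pose c : E:=\row_i cen u i x0; exists c => x Ox xc.
have Sx0 : Sc Om u c x0.
 split => //; apply/(Sc_cen oOm cu S1 S2 c Px0) => i; by rewrite mxE.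
have x0c : x0 != c.
 apply/eqP => e; have [[_ Nx] h]:=Sx0; move/eqP: Nx; apply.
 by apply: big1 => i _; rewrite h -e subrr mulr0 expr0n.
have [-> //|xx0]:=pselect (x = x0).
pose F (a : option 'I_m):=if a is Some i then yv i else c.
have av z : (forall a, z <> F a) -> Om z /\ z != c.
 by move=> h; split; [move=> i; apply/eqP; exact: (h (Some i))|apply/eqP; exact: (h None)].
have avr z : Om z -> z != c -> forall a, z <> F a.
 by move=> Oz zc [i|] /=; [apply/eqP; exact: Oz|apply/eqP].
have [i di] : exists i, (x0-x) 0 i != 0.
 apply: contrapT => n; apply: xx0; apply/rowP => i; apply/esym/eqP; rewrite -subr_eq0.
 by apply/eqP; apply: contrapT => /eqP h; apply: n; exists i; rewrite !mxE.
have [j ji] : exists j : 'I_4, j != i.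
 by case: (eqVneq i ord0) => [->|h]; [exists ord_max|exists ord0; rewrite eq_sym].
have [w hw]:=avoid_finite ji di (fun a => conj (avr x0 (proj1 (proj1 Sx0)) x0c a) (avr x Ox xc a)).
pose V : set E:=[set x | Om x /\ x != c /\ ~ Sc Om u c x].
have oS : open (Sc Om u c):=@open_Sc R Om u oOm cu S1 S2 eqh c.
have oV : open V:=@coclosed_Sc R Om u oOm cu S1 S2 eqh c.
have dis z : Sc Om u c z -> V z -> False by move=> h [_ [_]].
have cov z : (forall a, z <> F a) -> Sc Om u c z \/ V z.
 by move=> /av[Oz zc]; have [h|h]:=pselect (Sc Om u c z); [left|right].
have Sw : Sc Om u c w.
 by apply: (clopen_segment oS oV dis _ Sx0) => s s01; apply: cov => a; exact: (proj1 (hw s s01 a)).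
by apply: (clopen_segment oS oV dis _ Sw) => s s01; apply: cov => a; exact: (proj2 (hw s s01 a)).
Qed.

Lemma near_reg i : \forall y \near yv i, y != yv i -> Om y.
Proof.
have H j : \forall y \near yv i, yv j != yv i -> y != yv j.
 have [->|ne]:=eqVneq (yv j) (yv i); first by apply: near_all => y /eqP.
 have h : punct (yv j) (yv i) by rewrite /punct /= eq_sym.
 by apply: filterS (open_nbhs_nbhs (conj (@open_punct R (yv j)) h)).
have:=@filter_forall E 'I_m (fun j y => yv j != yv i -> y != yv j) (nbhs (yv i)) (nbhs_filter (yv i)) H.
apply: filterS => y h yi j; have [e|/h//]:=eqVneq (yv j) (yv i).
by rewrite e.
Qed.

(** Since [Am < 0], [u] increases towards [c]. If [yv i] were not [c], then [u] would increase along
    the segment leaving [yv i] towards [c], whereas it tends to plus infinity at [yv i]. *)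
Lemma singular_central c : (forall x, Om x -> x != c -> Sc Om u c x) -> forall i, yv i = c.
Proof.
move=> hc i; apply: contrapT => /eqP yc.
pose d:=yv i-c; have d0 : d != 0 by rewrite subr_eq0.
have dn : 0 < `|d| by rewrite normr_gt0.
have /nbhs_ballP[r /= r0 hr]:=near_reg i.
pose z (s : R):=yv i+s *: (- d).
have zr (rr : R) s : 0<s -> s * `|d| < rr -> ball (yv i) rr (z s).
 move=> s0 h; split; first by apply: le_lt_trans h; rewrite mulr_ge0// ltW.
 move=> i' j'; rewrite ord1 /ball /= (_ : yv i 0 j'-z s 0 j' = s*d 0 j'); last by rewrite !mxE; ring.
 rewrite normrM (ger0_norm (ltW s0)); apply: le_lt_trans h; apply: ler_wpM2l; first exact: ltW.
 exact: norm_row_le.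
have zy s : 0<s -> z s != yv i.
 move=> s0; rewrite /z -subr_eq0 addrAC subrr add0r scaler_eq0 oppr_eq0 negb_or d0 andbT gt_eqF//.
have zc s i' : z s 0 i'-c 0 i' = (1-s)*d 0 i'.
 by rewrite !mxE; ring.
(* Small enough for the segment to end at most half-way to [c] and inside a ball without other
   singular points. *)
pose ep:=Num.min (1/2) (r/(2 * `|d|)).
have ep0 : 0<ep by rewrite lt_min divr_gt0// divr_gt0// mulr_gt0.
have epd : ep * `|d| < r.
 apply: le_lt_trans (_ : r/2<r); last lra.
 have : ep<=r/(2 * `|d|) by rewrite ge_min lexx orbT.
 rewrite ler_pdivlMr ?mulr_gt0// => h; lra.
have ep2 : ep<=1/2 by rewrite ge_min lexx.
have zOm s : 0<s<=ep -> Om (z s) /\ z s != c.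
 move=> /andP[s0 s1]; split.
  apply: hr (zy s s0); apply: zr => //; apply: le_lt_trans epd; exact: ler_wpM2r.
 apply/eqP => e; have:=fun k => zc s k; rewrite e => h; move/eqP: d0; apply; apply/rowP => k.
 rewrite [RHS]mxE; have:=h k; rewrite subrr => /esym/eqP; rewrite mulf_eq0 => /orP[|/eqP//].
 by lra.
have nO : ~ Om (yv i) by move=> /(_ i); rewrite eqxx.
have /nbhs_ballP[r' /= r'0 hr']:=nearS (u (z ep)) nO.
pose s1:=Num.min ep (r'/(2 * `|d|)).
have s10 : 0<s1 by rewrite lt_min ep0 divr_gt0// mulr_gt0.
have s1e : s1<=ep by rewrite ge_min lexx.
have s1d : s1 * `|d| < r'.
 apply: le_lt_trans (_ : r'/2<r'); last lra.
 have : s1<=r'/(2 * `|d|) by rewrite ge_min lexx orbT.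
 rewrite ler_pdivlMr ?mulr_gt0// => h; lra.
have [Oz1 _]:=zOm s1 ltac:(by rewrite s10).
have ub:=hr' _ (zr _ _ s10 s1d) Oz1.
have dz (s : R) : s1<=s<=ep -> is_derive s 1 (fun s => u (z s)) (- Am u (z s)*(1-s) * \sum_k d 0 k^+2).
 move=> /andP[h1 h2]; have [Oz zcs]:=zOm s ltac:(by rewrite h2 (lt_le_trans s10)).
 have [Pz hz]:=hc _ Oz zcs; apply: is_derive_line.
 apply: (is_derive_eq (C1at_is_derive (- d) (is_Ck_C1at oOm (is_CkW (is_CkW cu)) Oz))).
 rewrite mulr_sumr; apply: eq_bigr => k _; rewrite -/(gr u _ k) hz zc !mxE; ring.
have [s2 /andP[h1 h2] e2]:=mean_value s1e dz.
have [Oz zcs]:=zOm s2 ltac:(by rewrite h2 (lt_le_trans s10)).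
have [Pz _]:=hc _ Oz zcs; have A0:=Am_lt0 oOm cu S1 S2 Pz.
have : 0<=u (z ep)-u (z s1).
 rewrite e2; apply: mulr_ge0; last by lra.
 apply: mulr_ge0; last by apply: sumr_ge0 => k _; exact: sqr_ge0.
 by apply: mulr_ge0; [rewrite oppr_ge0 ltW|lra].
by lra.
Qed.

Lemma dot_split0 (X : E) : dot X X = X 0 0^+2+dot (X-X 0 0 *: e_ 0) (X-X 0 0 *: e_ 0).
Proof.
have -> : dot (X-X 0 0 *: e_ 0) (X-X 0 0 *: e_ 0) = dot X X-X 0 0^+2; last by lra.
transitivity (\sum_i (X 0 i*X 0 i-X 0 0^+2*(0 == i)%:R)).
 apply: eq_bigr => i _; rewrite !mxE eqxx andTb.
 by have [->|ne]:=eqVneq i 0; [rewrite ?eqxx /=; ring|rewrite !mulr0 !subr0].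
by rewrite sumrB (sum_deltar (fun _ => X 0 0^+2)).
Qed.

Lemma row4E (x : E) : x = x 0 0 *: e_ 0+(x-x 0 0 *: e_ 0).
Proof. by rewrite addrC subrK. Qed.

(** The gradient is parallel to [x-c], so [u] is constant along the circle about [c] that joins [x]
    to the half-line in direction [e_ 0]. *)
Lemma radial_about c : (forall x, x != c -> Sc Om u c x) -> forall x, x != c -> u x = u (c+enorm (x-c) *: e_ 0).
Proof.
move=> hc x xc; pose X:=x-c; pose r:=enorm X.
have X0 : X != 0 by rewrite subr_eq0.
have r0 : 0<r.
 rewrite lt_neqAle enorm_ge0 andbT eq_sym; apply/eqP => e.
 by move/eqP: X0; apply; apply: dot_eq0; rewrite -enorm_sqr -/r e expr0n.
pose Y:=X-X 0 0 *: e_ 0.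
have Y0 : Y 0 0 = 0 by rewrite !mxE mulr1 subrr.
have rY : r^+2 = X 0 0^+2+dot Y Y.
 by rewrite enorm_sqr; exact: dot_split0.
pose a:=X 0 0/r; pose th:=acos a.
have a2 : a^+2<=1.
 rewrite /a expr_div_n ler_pdivrMr ?exprn_gt0// mul1r rY lerDl; exact: dot_ge0.
have a1 : -1<=a<=1 by rewrite -ler_norml -(@ler_pXn2r _ 2) ?nnegrE// expr1n real_normK ?num_real.
have ca : cos th = a by rewrite acosK//.
have sa : sin th = Num.sqrt (1-a^+2) by rewrite sin_acos.
have sr : (r*sin th)^+2 = dot Y Y.
 have sq : Num.sqrt (1-a^+2)^+2 = 1-a^+2 by rewrite sqr_sqrtr// subr_ge0.
 have ar : a*r = X 0 0 by rewrite divfK// gt_eqF.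
 rewrite exprMn sa sq; transitivity (r^+2-(a*r)^+2); first by ring.
 by nra.
(* [V] is the second axis of the circle. If [x-c] already lies on the first axis, any orthogonal
   vector of length [r] will do. *)
have [V [V0 VV VY]] : exists V : E, [/\ V 0 0 = 0, dot V V = r^+2 & sin th *: V = Y].
 have [s0|/eqP s0]:=pselect (sin th = 0).
  exists (r *: e_ 1); split; first by rewrite !mxE mulr0.
   rewrite /dot (bigD1 1)//= !mxE eqxx mulr1 big1 ?addr0// => i i1.
   by rewrite !mxE (negPf i1) mulr0 mul0r.
  rewrite s0 scale0r; apply/esym; apply: dot_eq0; by rewrite -sr s0 mulr0 expr0n.
 exists ((sin th)^-1 *: Y); split; first by rewrite mxE Y0 mulr0.
  by rewrite dotZ -sr exprMn mulrCA -exprMn mulVf// expr1n mulr1.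
 by rewrite scalerA mulfV// scale1r.
pose g (p : R) : E:=c+(r*cos p) *: e_ 0+sin p *: V.
have gc p i : g p 0 i-c 0 i = r*cos p*(i == 0)%:R+sin p*V 0 i.
 by rewrite !mxE; ring.
have gth : g th = x.
 rewrite /g VY ca /a mulrC divfK ?gt_eqF// -addrA -row4E.
 by rewrite addrC subrK.
have g0 : g 0 = c+r *: e_ 0 by rewrite /g cos0 sin0 mulr1 scale0r addr0.
transitivity (u (g th)); first by rewrite gth.
transitivity (u (g 0)); last by rewrite g0.
apply: (is_derive_0_is_cst (f:=fun p => u (g p))) => p.
have sV (F : 'I_4 -> R) : \sum_i F i*(i == 0)%:R = F 0 by exact: sum_deltal.
have gnc : g p != c.
 apply/eqP => e; have : \sum_i (g p 0 i-c 0 i)^+2 = 0 by apply: big1 => i _; rewrite e subrr expr0n.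
 rewrite (eq_bigr (fun i => ((r*cos p)^+2+2*r*cos p*sin p*V 0 i)*(i == 0)%:R+sin p^+2*(V 0 i*V 0 i))); last first.
  by move=> i _; rewrite gc; case: (i == 0) => /=; ring.
 rewrite big_split /= sV -mulr_sumr -/(dot V V) V0 VV mulr0 addr0 exprMn.
 have:=cos2Dsin2 p; move=> cs h; move: (exprn_gt0 2 r0); rewrite -[r^+2]mulr1 -cs mulrDr [_*sin p^+2]mulrC h ltxx//.
have [[Og _] hg]:=hc _ gnc.
have d i : is_derive p 1 (fun q => g q 0 i) ((\row_i (- r*sin p*(i == 0)%:R+cos p*V 0 i) : E) 0 i).
 rewrite (_ : (fun q => g q 0 i) = (fun q => c 0 i+r*(i == 0)%:R*cos q+V 0 i*sin q)); last first.
  by apply/funext => q; have:=gc q i; move/eqP; rewrite subr_eq => /eqP ->; ring.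
 have dc : is_derive p 1 (fun _ : R => c 0 i) 0 by exact: is_derive_cst.
 have d1 : is_derive p 1 (fun q => r*(i == 0)%:R*cos q) (r*(i == 0)%:R * - sin p).
  by have:=is_deriveZ (r*(i == 0)%:R) (is_derive_cos p).
 have d2 : is_derive p 1 (fun q => V 0 i*sin q) (V 0 i*cos p).
  by have:=is_deriveZ (V 0 i) (is_derive_sin p).
 apply: (is_derive_eq (is_deriveD (is_deriveD dc d1) d2)).
 by rewrite !mxE; ring.
have:=is_derive_chain (is_Ck_C1at oOm (is_CkW (is_CkW cu)) Og) d.
move=> h; apply: (is_derive_eq h).
rewrite (eq_bigr (fun i => Am u (g p)*((- r^+2*sin p*cos p+r*(cos p^+2-sin p^+2)*V 0 i)*(i == 0)%:R+cos p*sin p*(V 0 i*V 0 i)))); last first.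
 move=> i _; rewrite -/(gr u _ i) hg gc mxE; case: (i == 0) => /=; ring.
rewrite -mulr_sumr big_split /= sV -mulr_sumr -/(dot V V) V0 VV; ring.
Qed.

Theorem rigid_radial : (forall i, yv i = yv i0) /\
 exists U : R -> R, forall x, x != yv i0 -> u x = U (enorm (x-yv i0)).
Proof.
have [c hc]:=central; have ec:=singular_central hc.
have ei i : yv i = yv i0 by rewrite !ec.
split => //; exists (fun r => u (yv i0+r *: e_ 0)) => x xi.
apply: radial_about xi => y yi; rewrite ec; apply: hc; last by rewrite -(ec i0).
by move=> i; rewrite ei.
Qed.

End Conclusion.

(** * Symmetric functions of the eigenvalues as traces *)

Section CharPoly.
Context {R : realType}.
Implicit Types (M : 'M[R]_4) (s : seq R) (p : {poly R}).

Lemma coef_comp_opp p i : (p \Po (- 'X))`_i = (-1)^+i * p`_i.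
Proof.
rewrite comp_polyE coef_sum.
rewrite (eq_bigr (fun j : 'I_(size p) => if j == i :> nat then (-1)^+i * p`_i else 0)); last first.
 move=> j _; have -> : (- 'X)^+j = ((-1)^+j) *: 'X^j :> {poly R}.
  elim: (nat_of_ord j) => [|k IH]; first by rewrite !expr0 scale1r.
  by rewrite [in LHS]exprS IH mulNr -scalerAr -exprS -scaleNr [(-1)^+k.+1]exprS mulN1r.
 rewrite !coefZ coefXn; have [->|ne]:=eqVneq (j : nat) i; first by rewrite ?eqxx mulr1 mulrC.
 by rewrite ?[i == _]eq_sym ?(negPf ne) !mulr0.
have [ip|pi]:=ltnP i (size p).
 rewrite (bigD1 (Ordinal ip))//= eqxx big1 ?addr0// => j ji.
 by case: eqP => // e; case/eqP: ji; apply: val_inj.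
by rewrite big1 ?(nth_default _ pi) ?mulr0// => j _; case: eqP.
Qed.

(** The determinant of [X^2 - M^2 = (X - M)(X + M)]; the sign of [X + M = -((-X) - M)] disappears
    because the dimension is even. *)
Lemma char_poly_square M : char_poly (M *m M) \Po 'X^2 = char_poly M*(char_poly M \Po (- 'X)).
Proof.
rewrite /char_poly -!det_map_mx /= -det_mulmx.
have dN (A : 'M[{poly R}]_4) : \det A = \det (- A) by rewrite -scaleN1r detZ -signr_odd expr0 mul1r.
rewrite dN; congr (\det _).
rewrite /char_poly_mx !map_mxB /= !map_scalar_mx /= !comp_polyX.
have mc q : map_mx (comp_poly q) (map_mx polyC M) = map_mx polyC M.
 by apply/matrixP => i j; rewrite !mxE comp_polyC.
have mc2 : map_mx (comp_poly 'X^2) (map_mx polyC (M *m M)) = map_mx polyC M *m map_mx polyC M.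
 by rewrite map_mxM map_mxM /= !mc.
rewrite mc2 !mc mulmxBl !mulmxBr -!scalar_mxM mulrN -expr2 raddfN /= !mul_scalar_mx !mul_mx_scalar.
rewrite scaleNr; move: ('X *: _) (_ *m _) (_%:M) => B C A.
by rewrite !opprB opprK [C+B]addrC addrA subrK addrC.
Qed.

(** Comparison of the coefficients of degree 6 in [char_poly_square]: on the left stands
    [- \tr (M *m M)]. *)
Lemma char_poly_coef2 M : (char_poly M)`_2 = 2^-1*(\tr M^+2 - \tr (M *m M)).
Proof.
have:=congr1 (fun p : {poly R} => p`_6) (char_poly_square M).
rewrite coef_comp_poly_Xn// /= coefM !big_ord_recl big_ord0 /= !coef_comp_opp /bump /=.
have z k M' : (4<k)%N -> (char_poly M')`_k = 0 by move=> h; rewrite nth_default// size_char_poly.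
have l M' : (char_poly M')`_4 = 1.
 by have:=char_poly_monic M'; rewrite monicE lead_coefE size_char_poly => /eqP.
have t M' : (char_poly M')`_3 = - \tr M' by rewrite (@char_poly_trace _ 4).
rewrite !addn0 !add1n !subn0 (z 6%N)// (z 5%N)// !l.
rewrite (_ : (6-2 = 4)%N)// (_ : (6-3 = 3)%N)// (_ : (6-4 = 2)%N)// !t.
move=> h; have h2 : 2*(char_poly M)`_2 = \tr M^+2 - \tr (M *m M).
 by apply/eqP; rewrite -subr_eq0; move/eqP: h; rewrite -subr_eq0 => /eqP h; rewrite -oppr_eq0 -[X in _ == X]h; apply/eqP; ring.
by rewrite -h2 mulKf.
Qed.

(** The default [[::]] has vanishing elementary symmetric functions in positive degree, so a nonzero
    value shows that the characteristic polynomial splits. *)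
Lemma eigenvalues_split M k : elem_sym k.+1 (eigenvalues M) != 0 ->
 char_poly M = \prod_(a <- eigenvalues M) ('X-a%:P).
Proof.
rewrite /eigenvalues; case: xgetP => [s _ //|_ /eqP[]].
rewrite /elem_sym big1// => I /eqP h.
have:=max_card (mem I); rewrite card_ord h //.
Qed.

Lemma elem_sym12 M : elem_sym 1 (eigenvalues M) != 0 ->
 elem_sym 1 (eigenvalues M) = \tr M /\ elem_sym 2 (eigenvalues M) = 2^-1*(\tr M^+2 - \tr (M *m M)).
Proof.
move=> h; have e:=eigenvalues_split h.
have sz : size (eigenvalues M) = 4%N.
 by have:=size_char_poly M; rewrite e size_prod_XsubC => -[].
have c k : (k<=size (eigenvalues M))%N ->
  elem_sym (size (eigenvalues M)-k) (eigenvalues M) = (-1)^+(size (eigenvalues M)-k)*(char_poly M)`_k.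
 move=> k4; rewrite e coef_prod_XsubC// mulrA -exprD addnn -signr_odd odd_double mul1r.
 by rewrite /elem_sym; apply: eq_bigl => I; rewrite inE.
have c3:=c 3%N; have c2:=c 2%N; rewrite sz in c3 c2; split.
 by rewrite c3// (@char_poly_trace _ 4)// expr1 mulN1r opprK.
by rewrite c2// char_poly_coef2 sqrrN expr1n mul1r.
Qed.

End CharPoly.

(** * Curvature of a conformally flat metric *)

Section DeltaSums.
Context {R : realType}.
Implicit Types (p : 'I_4 -> R).

Lemma dsum (F : 'I_4 -> R) j : \sum_i (i == j)%:R*F i = F j.
Proof. by rewrite -[RHS](sum_deltal F); apply: eq_bigr => i _; rewrite mulrC. Qed.

Lemma dsum' (F : 'I_4 -> R) j : \sum_i (j == i)%:R*F i = F j.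
Proof. by rewrite -[RHS](sum_deltar F); apply: eq_bigr => i _; rewrite mulrC. Qed.

(** The Christoffel symbols of [e^(2u)|dx|^2] when [p] is the gradient of [u]. *)
Definition Gam p (k i j : 'I_4) : R:=(k == i)%:R * p j+(k == j)%:R * p i-(i == j)%:R * p k.

Lemma Gam_trace p l : \sum_k Gam p k k l = 4 * p l.
Proof. by rewrite /Gam; case4 l; sum4; ring. Qed.

Lemma Gam_contract p i j : \sum_l Gam p l i j*(4 * p l) = 8*(p i * p j)-4*nrm2 p*(i == j)%:R.
Proof. by rewrite /Gam; case4 i; case4 j; sum4; ring. Qed.

Lemma Gam_quad p i j : \sum_k \sum_l Gam p k j l*Gam p l i k = 6*(p i * p j)-2*nrm2 p*(i == j)%:R.
Proof. by rewrite /Gam; case4 i; case4 j; sum4; ring. Qed.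

Lemma ricci_sum (h : 'I_4 -> 'I_4 -> R) i j : (forall i j, h i j = h j i) ->
 \sum_k ((k == i)%:R*h j k+(k == j)%:R*h i k-(i == j)%:R*h k k-h i j) = - 2*h i j-trc h*(i == j)%:R.
Proof.
move=> hs; rewrite !sumrB !big_split /= sumr_const card_ord (dsum (fun k => h j k)) (dsum (fun k => h i k)) -mulr_sumr -/(trc h).
by rewrite (hs j i); ring.
Qed.

End DeltaSums.

Section ConformallyFlat.
Context {R : realType}.
Local Notation E:='rV[R]_4.
Local Notation e_ i:=(delta_mx 0 i : E).
Variables (V : set E) (U : E -> R) (G : E -> 'M[R]_4).
Hypothesis oV : open V.
Hypothesis cU : is_Ck 3 V U.
Hypothesis GE : forall y, V y -> G y = (expR (2*U y))%:M.

Lemma christoffel_flat y k i j : V y -> christoffel G k i j y = Gam (gr U y) k i j.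
Proof.
move=> Vy.
have dG a b c : partial a (fun z => G z b c) y = 2*gr U y a*expR (2*U y)*(b == c)%:R.
 rewrite (near_partial (g:=fun z => (b == c)%:R*expR (2*U z))); last first.
  by apply: filterS (open_nbhs_nbhs (conj oV Vy)) => z Vz; rewrite GE// mxE; case: (b == c); rewrite ?mul1r ?mul0r ?mulr1n ?mulr0n.
 have dU : is_derive y (e_ a) U (gr U y a) by exact: is_Ck_derivable cU Vy.
 have d2:=@is_derive_comp1 R _ expR (fun z => 2*U z) y (e_ a) _ _ (is_derive_expR _) (isd_cmul 2 dU).
 have [_ e]:=isd_cmul (b == c)%:R d2; rewrite /partial e; ring.
rewrite /christoffel GE// invmx_scalar.
rewrite (eq_bigr (fun l => (k == l)%:R*((expR (2*U y))^-1*(2*expR (2*U y))*(gr U y i*(j == l)%:R+gr U y j*(i == l)%:R-gr U y l*(i == j)%:R)))); last first.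
 by move=> l _; rewrite !dG mxE; case: (k == l); rewrite ?mulr1n ?mulr0n /=; ring.
rewrite dsum' mulrA; have e0 : expR (2*U y) != 0 by pos.
rewrite (_ : 2^-1*_ = 1); last by field.
by rewrite /Gam (eq_sym k i) (eq_sym k j); ring.
Qed.

Lemma partial_christoffel y k i j a : V y -> partial a (christoffel G k i j) y =
 (k == i)%:R*hs U y j a+(k == j)%:R*hs U y i a-(i == j)%:R*hs U y k a.
Proof.
move=> Vy; rewrite (near_partial (g:=fun z => Gam (gr U z) k i j)); last first.
 by apply: filterS (open_nbhs_nbhs (conj oV Vy)) => z Vz; exact: christoffel_flat.
have [_ e]:=isd_sub (isd_add (isd_cmul (k == i)%:R (d_gr cU j a Vy)) (isd_cmul (k == j)%:R (d_gr cU i a Vy))) (isd_cmul (i == j)%:R (d_gr cU k a Vy)).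
exact: e.
Qed.

Lemma ricci_flat y i j : V y -> ricci G y i j =
 - 2*hs U y i j-trc (hs U y)*(i == j)%:R+2*(gr U y i*gr U y j)-2*nrm2 (gr U y)*(i == j)%:R.
Proof.
move=> Vy; rewrite mxE.
have -> : \sum_k (partial k (christoffel G k i j) y-partial j (christoffel G k i k) y) =
 - 2*hs U y i j-trc (hs U y)*(i == j)%:R.
 rewrite -(ricci_sum i j (hs_sym oV cU Vy)); apply: eq_bigr => k _.
 rewrite !partial_christoffel// eqxx (eq_sym i k) /=.
 by move: (hs U y j k) (hs U y i k) (hs U y k k) (hs U y i j) (hs U y k j) => *; ring.
rewrite (eq_bigr (fun k => \sum_l Gam (gr U y) k k l*Gam (gr U y) l i j - \sum_l Gam (gr U y) k j l*Gam (gr U y) l i k)); last first.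
 by move=> k _; rewrite -sumrB; apply: eq_bigr => l _; rewrite !christoffel_flat.
rewrite sumrB exchange_big /= Gam_quad.
rewrite (eq_bigr (fun l => Gam (gr U y) l i j*(4*gr U y l))); last first.
 by move=> l _; rewrite -mulr_suml Gam_trace mulrC.
by rewrite Gam_contract; move: (hs U y i j) (trc _) (nrm2 _) (gr U y i*_) => *; ring.
Qed.

Definition AMx (f : E -> R) y : 'M[R]_4:=\matrix_(i, j) schoutenA (hs f y) (gr f y) i j.

Lemma schouten_flat y : V y -> schouten G y = AMx U y.
Proof.
move=> Vy; have e0 : expR (2*U y) != 0 by pos.
have sc : scalar_curv G y = (expR (2*U y))^-1*(- 6*trc (hs U y)-6*nrm2 (gr U y)).
 rewrite /scalar_curv GE// invmx_scalar.
 rewrite (eq_bigr (fun i => (expR (2*U y))^-1*ricci G y i i)); last first.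
  move=> i _; rewrite -[RHS](dsum' (fun j => (expR (2*U y))^-1*ricci G y i j) i).
  by apply: eq_bigr => j _; rewrite mxE; case: (i == j); rewrite ?mulr1n ?mulr0n ?mul1r ?mul0r.
 rewrite -mulr_sumr; congr (_*_).
 rewrite (eq_bigr (fun i => - 2*hs U y i i+2*gr U y i^+2 + - (trc (hs U y)+2*nrm2 (gr U y)))); last first.
  move=> i _; rewrite ricci_flat// eqxx /=.
  by lra.
 by rewrite !big_split /= sumr_const card_ord -!mulr_sumr -/(trc (hs U y)) -/(nrm2 (gr U y)); move: (trc _) (nrm2 _) => *; ring.
have entry (A B : 'M[R]_4) c i j : (2^-1 *: (A-c *: B)) i j = 2^-1*(A i j-c*B i j) by rewrite !mxE.
apply/matrixP => i j; rewrite /schouten entry sc GE// ricci_flat// !mxE /schoutenA.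
move: e0; move: (expR _) (hs U y i j) (trc _) (nrm2 _) (gr U y i*_) => e h t n q e0.
by field.
Qed.

(** The condition on [sigma 1] excludes the default value of [eigenvalues], after which both
    functions are traces; for the metrics considered it follows from membership in the positive
    cone. *)
Lemma sigma_flat y : V y -> sigma 1 G y != 0 ->
 sigma 1 G y = expR (- (2*U y)) * \tr (AMx U y) /\
 sigma 2 G y = expR (- (4*U y))*(2^-1*(\tr (AMx U y)^+2 - \tr (AMx U y *m AMx U y))).
Proof.
move=> Vy; rewrite /sigma schouten_flat// GE// invmx_scalar mul_scalar_mx => h.
have [-> ->]:=elem_sym12 h.
rewrite -scalemxAl -scalemxAr scalerA !mxtraceZ -!expRN; split => //.
have -> : expR (- (4*U y)) = expR (- (2*U y))*expR (- (2*U y)) by rewrite -expRD; congr expR; ring.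
by ring.
Qed.

Lemma tr_AMx y : \tr (AMx U y) = sig1 (hs U y) (gr U y).
Proof. by rewrite /sig1 -(trc_schoutenA (hs U y) (gr U y)); apply: eq_bigr => i _; rewrite mxE. Qed.

Lemma tr_AMx2 y : V y -> 2^-1*(\tr (AMx U y)^+2 - \tr (AMx U y *m AMx U y)) = sig2 (hs U y) (gr U y).
Proof.
move=> Vy; have -> : \tr (AMx U y *m AMx U y) = hs2 (schoutenA (hs U y) (gr U y)).
 apply: eq_bigr => i _; rewrite mxE; apply: eq_bigr => j _; rewrite !mxE expr2.
 by rewrite (schoutenA_sym _ (hs_sym oV cU Vy) j i).
by rewrite tr_AMx hs2_schoutenA /sig1 /sig2; move: (trc _) (nrm2 _) (hs2 _) (hpp _ _) => *; field.
Qed.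

End ConformallyFlat.

(** * Stereographic charts of the 4-sphere *)

Section Stereo.
Context {R : realType}.
Local Notation E:='rV[R]_4.
Local Notation F:='rV[R]_5.
Local Notation e_ i:=(delta_mx 0 i : E).
Implicit Types (x y z : E) (X Y : F).

Definition hor (X : F) : E:=lsubmx (X : 'rV[R]_(4+1)).
Definition ver (X : F) : R:=rsubmx (X : 'rV[R]_(4+1)) 0 0.
Definition mk5 (x : E) (t : R) : F:=row_mx x (t%:M : 'M[R]_1) : 'rV[R]_(4+1).

Lemma hor_mk x t : hor (mk5 x t) = x.
Proof. exact: row_mxKl. Qed.

Lemma ver_mk x t : ver (mk5 x t) = t.
Proof. by rewrite /ver row_mxKr !mxE. Qed.

Lemma mk5E X : mk5 (hor X) (ver X) = X.
Proof.
have e : ((ver X)%:M : 'M[R]_1) = rsubmx (X : 'rV[R]_(4+1)).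
 by apply/matrixP => i j; rewrite !ord1 /ver [LHS]mxE eqxx mulr1n.
by rewrite /mk5 e; exact: (@hsubmxK _ 1 4 1).
Qed.

Lemma mk5_inj x t y s : mk5 x t = mk5 y s -> x = y /\ t = s.
Proof. by move=> e; rewrite -(hor_mk x t) -(hor_mk y s) -{2}(ver_mk x t) -{2}(ver_mk y s) e. Qed.

Lemma mk5_l x t i : mk5 x t 0 (@lshift 4 1 i) = x 0 i.
Proof. exact: row_mxEl. Qed.

Lemma mk5_r x t i : mk5 x t 0 (@rshift 4 1 i) = t.
Proof. by rewrite /mk5; apply: (etrans (row_mxEr _ _ _ _)); rewrite ord1 mxE. Qed.

Lemma dot5 X Y : dot X Y = dot (hor X) (hor Y)+ver X*ver Y.
Proof.
rewrite -{1}(mk5E X) -{1}(mk5E Y) /dot (@big_split_ord _ _ _ 4 1) /= big_ord1; congr (_+_).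
 by apply: eq_bigr => i _; rewrite !mk5_l.
by rewrite !mk5_r.
Qed.

Lemma hor_lin a X Y : hor (a *: X+Y) = a *: hor X+hor Y.
Proof. by apply/matrixP => i j; rewrite !mxE. Qed.

Lemma ver_lin a X Y : ver (a *: X+Y) = a*ver X+ver Y.
Proof. by rewrite /ver !mxE. Qed.

Lemma dotD (n : nat) (u v w : 'rV[R]_n) : dot (u+v) w = dot u w+dot v w.
Proof. by rewrite -big_split; apply: eq_bigr => i _; rewrite mxE mulrDl. Qed.

Lemma dotZl (n : nat) (a : R) (u w : 'rV[R]_n) : dot (a *: u) w = a*dot u w.
Proof. by rewrite mulr_sumr; apply: eq_bigr => i _; rewrite mxE mulrA. Qed.

Lemma dotDr (n : nat) (u v w : 'rV[R]_n) : dot w (u+v) = dot w u+dot w v.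
Proof. by rewrite dotC dotD !(dotC w). Qed.

Lemma dotZr (n : nat) (a : R) (u w : 'rV[R]_n) : dot w (a *: u) = a*dot w u.
Proof. by rewrite dotC dotZl dotC. Qed.

Lemma dotNl (n : nat) (u w : 'rV[R]_n) : dot (- u) w = - dot u w.
Proof. by rewrite -scaleN1r dotZl mulN1r. Qed.

Lemma dotNr (n : nat) (u w : 'rV[R]_n) : dot w (- u) = - dot w u.
Proof. by rewrite dotC dotNl dotC. Qed.

(** [2/qd y] is the conformal factor of the stereographic chart. *)
Definition qd y : R:=dot y y+1.

Lemma qd_gt0 y : 0<qd y.
Proof. by rewrite ltr_wpDl// dot_ge0. Qed.

Definition sgn (b : bool) : R:=(-1)^+b.

Lemma sgn_sqr b : sgn b*sgn b = 1.
Proof. by rewrite -expr2 sqrr_sign. Qed.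

Lemma stereoE b y : stereo b y = mk5 ((qd y)^-1 *: (2 *: y)) ((qd y)^-1*(sgn b*(dot y y-1))).
Proof.
by rewrite /stereo scale_row_mx scale_scalar_mx.
Qed.

Lemma hor_stereo b y : hor (stereo b y) = (qd y)^-1 *: (2 *: y).
Proof. by rewrite stereoE hor_mk. Qed.

Lemma ver_stereo b y : ver (stereo b y) = sgn b*((dot y y-1)/qd y).
Proof. by rewrite stereoE ver_mk mulrC mulrA. Qed.

Lemma poleE b : pole b = mk5 0 (sgn b) :> F.
Proof. by []. Qed.

(** For unit vectors [1 - dot X Y] is half the squared chordal distance, so this is the formula for
    chordal distance in the chart. *)
Lemma dot_stereo b x y : dot (stereo b x) (stereo b y) = 1-2*dot (x-y) (x-y)/(qd x*qd y).
Proof.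
rewrite dot5 !hor_stereo !ver_stereo !dotZl !dotZr mulrACA sgn_sqr mul1r.
rewrite !(dotD, dotDr, dotNl, dotNr) (dotC y x) /qd.
have hx:=qd_gt0 x; have hy:=qd_gt0 y; rewrite /qd in hx hy.
by move: hx hy; move: (dot x x) (dot y y) (dot x y) => a b' c hx hy; field; rewrite !gt_eqF.
Qed.

Lemma sphere_stereo b y : sphere4 (stereo b y).
Proof. by rewrite /sphere4 /= dot_stereo subrr /dot big1 ?mulr0 ?mul0r ?subr0// => i; rewrite mxE mul0r. Qed.

Lemma dot_stereo_pole b y : dot (stereo b y) (pole b) = 1-2/qd y.
Proof.
rewrite dot5 poleE hor_mk ver_mk ver_stereo mulrAC sgn_sqr mul1r.
have -> : dot (hor (stereo b y)) (0 : E) = 0 by rewrite /dot big1// => i; rewrite [(0 : E) _ _]mxE mulr0.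
have hy:=qd_gt0 y; rewrite /qd in hy *; move: hy; move: (dot y y) => a hy; field; by lra.
Qed.

Lemma sphere_pole b : sphere4 (pole b : F).
Proof. by rewrite /sphere4 /= dot5 hor_mk ver_mk sgn_sqr /dot big1 ?add0r// => i; rewrite mxE mul0r. Qed.

Lemma sphere_eq X Y : sphere4 X -> sphere4 Y -> dot X Y = 1 -> X = Y.
Proof.
rewrite /sphere4 /= => hX hY hXY; apply/eqP; rewrite -subr_eq0; apply/eqP; apply: dot_eq0.
by rewrite !(dotD, dotDr, dotNl, dotNr) (dotC Y X) hX hY hXY; ring.
Qed.

Lemma stereo_inj b : injective (stereo b : E -> F).
Proof.
move=> x y e; have:=sphere_stereo b y; rewrite /sphere4 /= -{1}e dot_stereo => /eqP.
have q0 : 0<qd x*qd y by rewrite mulr_gt0// qd_gt0.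
rewrite -subr_eq0 addrAC subrr add0r oppr_eq0 !mulf_eq0 invr_eq0 (gt_eqF q0) pnatr_eq0 /= orbF => /eqP h.
by apply/eqP; rewrite -subr_eq0; apply/eqP; exact: dot_eq0.
Qed.

Lemma stereo_neq_pole b y : stereo b y <> pole b.
Proof.
move=> e; have:=dot_stereo_pole b y; rewrite e; have:=sphere_pole b; rewrite /sphere4 /= => -> /eqP.
rewrite -subr_eq0 opprB addrC subrK mulf_eq0 pnatr_eq0 invr_eq0 (gt_eqF (qd_gt0 y)) //.
Qed.

Definition proj (b : bool) X : E:=(1-sgn b*ver X)^-1 *: hor X.

Lemma sphere_hv X : sphere4 X -> dot (hor X) (hor X) = 1-ver X^+2.
Proof. by rewrite /sphere4 /= dot5 => /eqP; rewrite eq_sym -subr_eq => /eqP ->. Qed.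

Lemma not_pole b X : sphere4 X -> X <> pole b -> 0<1-sgn b*ver X.
Proof.
move=> hX np; have h:=sphere_hv hX; have d0:=dot_ge0 (hor X).
have v1 : ver X^+2<=1 by lra.
have s1 : (sgn b*ver X)^+2 = ver X^+2 by rewrite exprMn expr2 sgn_sqr mul1r.
have le1 : sgn b*ver X<=1.
 by nra.
rewrite lt_neqAle subr_ge0 le1 andbT eq_sym; apply/eqP => /eqP; rewrite subr_eq0 => /eqP e.
have ev : ver X = sgn b by rewrite -[LHS]mul1r -(sgn_sqr b) -mulrA -e mulr1.
apply: np; rewrite -(mk5E X) poleE ev; congr mk5; apply: dot_eq0; rewrite h ev expr2 sgn_sqr subrr//.
Qed.

Lemma proj_stereo b X : sphere4 X -> X <> pole b -> stereo b (proj b X) = X.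
Proof.
move=> hX np; have t0:=not_pole hX np; have h:=sphere_hv hX.
set t:=1-sgn b*ver X in t0.
have ev : ver X = sgn b*(1-t) by rewrite opprB addrC subrK mulrA sgn_sqr mul1r.
have dd : dot (proj b X) (proj b X) = (2-t)/t.
 rewrite /proj -/t dotZl dotZr h ev exprMn expr2 sgn_sqr mul1r; field; by rewrite gt_eqF.
have qq : qd (proj b X) = 2/t by rewrite /qd dd; field; rewrite gt_eqF.
rewrite stereoE qq dd -[RHS]mk5E; congr mk5.
 by rewrite /proj -/t !scalerA -[RHS]scale1r; congr (_ *: _); field; rewrite gt_eqF.
by rewrite ev; field; rewrite gt_eqF.
Qed.

Lemma is_derive_dot y i : is_derive y (e_ i) (fun z => dot z z) (2*y 0 i).
Proof.
have h j : is_derive y (e_ i) (fun z : E => z 0 j*z 0 j) (2*y 0 j*(i == j)%:R).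
 apply: (is_derive_eq (isd_mul (is_derive_coord y (e_ i) j) (is_derive_coord y (e_ i) j))).
 by rewrite !mxE (eq_sym j i); ring.
apply: (is_derive_eq (isd_sum h)).
rewrite (bigD1 i)//= eqxx mulr1 big1 ?addr0// => j /negPf; rewrite eq_sym => ->; by rewrite mulr0.
Qed.

Lemma is_derive_qdV y i : is_derive y (e_ i) (fun z => (qd z)^-1) (- (qd y)^-1^+2*(2*y 0 i)).
Proof.
have q0:=qd_gt0 y.
have h1 : is_derive y (e_ i) qd (2*y 0 i).
 have h0 : is_derive y (e_ i) (fun _ : E => 1 : R) 0 by exact: is_derive_cst.
 by apply: (is_derive_eq (isd_add (is_derive_dot y i) h0)); rewrite addr0.
have qn : qd y != 0 by lra.
have hV : is_derive (qd y) 1 (fun s : R => s^-1) (- (qd y) ^- 2 *: (1 : R)) by exact: is_deriveV.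
apply: (is_derive_eq (is_derive_comp1 hV h1)).
by rewrite /GRing.scale /= mulr1 exprVn.
Qed.

Local Notation dsc i j y:=(2*(qd y)^-1*(i == j)%:R-4*(qd y)^-1^+2*y 0 i*y 0 j).

Lemma is_derive_stereo_hor b y i j : is_derive y (e_ i) (fun z => hor (stereo b z) 0 j)
 (dsc i j y).
Proof.
rewrite (_ : (fun z => _) = (fun z => (qd z)^-1*(2*z 0 j))); last by apply/funext => z; rewrite hor_stereo !mxE.
apply: (is_derive_eq (isd_mul (is_derive_qdV y i) (isd_cmul 2 (is_derive_coord y (e_ i) j)))).
by rewrite mxE (eq_sym j i); ring.
Qed.

Lemma is_derive_stereo_ver b y i : is_derive y (e_ i) (fun z => ver (stereo b z)) (sgn b*(4*(qd y)^-1^+2*y 0 i)).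
Proof.
rewrite (_ : (fun z => _) = (fun z => sgn b*(1-2*(qd z)^-1))); last first.
 apply/funext => z; rewrite ver_stereo; congr (_*_).
 by have:=qd_gt0 z; rewrite /qd => q0; field; rewrite gt_eqF.
have h0 : is_derive y (e_ i) (fun _ : E => 1 : R) 0 by exact: is_derive_cst.
apply: (is_derive_eq (isd_cmul (sgn b) (isd_sub h0 (isd_cmul 2 (is_derive_qdV y i))))).
by ring.
Qed.

Definition dst b y i : F:=mk5 (\row_j (dsc i j y)) (sgn b*(4*(qd y)^-1^+2*y 0 i)).

Lemma coord5 X (k : 'I_5) : X 0 k = match @fintype.split 4 1 k with inl i => hor X 0 i | inr _ => ver X end.
Proof.
rewrite -{1}(mk5E X) -[k in LHS](@splitK 4 1 k); case: fintype.split => i; first exact: mk5_l.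
exact: mk5_r.
Qed.

Lemma is_derive_row (V : normedModType R) (tau : V -> F) (a v : V) (d : F) :
 (forall i, is_derive a v (fun p : V => hor (tau p) 0 i) (hor d 0 i)) ->
 is_derive a v (fun p : V => ver (tau p)) (ver d) -> is_derive a v tau d.
Proof.
move=> h1 h2.
have h k : is_derive a v (fun p : V => tau p 0 k) (d 0 k).
 rewrite coord5 (_ : (fun p : V => tau p 0 k) = (fun p : V => match @fintype.split 4 1 k with inl i => hor (tau p) 0 i | inr _ => ver (tau p) end)).
  by case: fintype.split.
 by apply/funext => p; rewrite coord5.
have dv : derivable tau a v.
 by apply/derivable_mxP => i k; rewrite ord1; have []:=h k.
apply: DeriveDef => //; rewrite derive_mx//; apply/rowP => k; rewrite mxE.
by have [_]:=h k.
Qed.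

Lemma is_derive_stereo b y i : is_derive y (e_ i) (stereo b) (dst b y i).
Proof.
apply: is_derive_row => [j|]; first by rewrite hor_mk mxE; exact: is_derive_stereo_hor.
by rewrite ver_mk; exact: is_derive_stereo_ver.
Qed.

Lemma partial_stereo b y i : partial i (stereo b) y = dst b y i.
Proof. by have [_]:=is_derive_stereo b y i. Qed.

Lemma dot_dst b y i j : dot (dst b y i) (dst b y j) = (2/qd y)^+2*(i == j)%:R.
Proof.
rewrite dot5 /dst !hor_mk !ver_mk mulrACA sgn_sqr mul1r.
pose q:=(qd y)^-1.
rewrite /dot (eq_bigr (fun k => 4*q^+2*(i == k)%:R*(j == k)%:R-8*q^+3*y 0 j*y 0 k*(i == k)%:R-8*q^+3*y 0 i*y 0 k*(j == k)%:R+16*q^+4*y 0 i*y 0 j*(y 0 k*y 0 k))); last first.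
 by move=> k _; rewrite !mxE -/q; ring.
rewrite big_split /= !sumrB.
have sd (G : 'I_4 -> R) l : \sum_k G k*(l == k)%:R = G l.
 by rewrite (bigD1 l)//= eqxx mulr1 big1 ?addr0// => k /negPf; rewrite eq_sym => ->; rewrite mulr0.
rewrite (sd (fun k => 4*q^+2*(i == k)%:R)) (sd (fun k => 8*q^+3*y 0 j*y 0 k)) (sd (fun k => 8*q^+3*y 0 i*y 0 k)) -mulr_sumr -/(dot y y) -/q.
have qe : dot y y*q = 1-q.
 by have:=qd_gt0 y; rewrite /q /qd => q0; field; rewrite gt_eqF.
have -> : 16*q^+4*y 0 i*y 0 j*dot y y = 16*q^+3*y 0 i*y 0 j*(dot y y*q) by ring.
by rewrite qe; ring.
Qed.

Lemma tangent_dst b y i : tangent (stereo b y) (dst b y i).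
Proof.
rewrite /tangent dot5 hor_stereo ver_stereo /dst hor_mk ver_mk dotZl dotZl.
pose q:=(qd y)^-1; have qe : dot y y*q = 1-q.
 by have:=qd_gt0 y; rewrite /q /qd => q0; field; rewrite gt_eqF.
have -> : dot y (\row_j (dsc i j y)) = 2*q*y 0 i-4*q*y 0 i*(dot y y*q).
 rewrite /dot (eq_bigr (fun k => 2*q*y 0 k*(i == k)%:R-4*q^+2*y 0 i*(y 0 k*y 0 k))); last by move=> k _; rewrite !mxE -/q; ring.
 rewrite sumrB -mulr_sumr -/(dot y y).
 have -> : \sum_k 2*q*y 0 k*(i == k)%:R = 2*q*y 0 i.
  by rewrite (bigD1 i)//= eqxx mulr1 big1 ?addr0// => k /negPf; rewrite eq_sym => ->; rewrite mulr0.
 ring.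
rewrite -/q qe.
have -> : sgn b*((dot y y-1)*q)*(sgn b*(4*q^+2*y 0 i)) = (sgn b*sgn b)*((dot y y*q-q)*(4*q^+2*y 0 i)) by ring.
by rewrite sgn_sqr qe; ring.
Qed.

End Stereo.

(** * The conformal factor of a conic metric in the charts *)

Ltac cks:=repeat first [assumption | exact: is_Ck_cst | exact: is_Ck_coord | apply: is_Ck_sub_fun | apply: is_Ck_mul | apply: is_Ck_scale].

Section LocalSmoothness.
Context {R : realType} {n : nat}.
Local Notation E:='rV[R]_n.

Lemma is_Ck_local k (U : set E) (f : E -> R) :
 (forall x, U x -> exists V : set E, V x /\ is_Ck k V f) -> is_Ck k U f.
Proof.
elim: k f => [|k IH] f H; split => //.
- by move=> x /H[V [Vx [c _]]]; exact: c.
- by move=> x /H[V [Vx [c _]]]; exact: c.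
move=> i; split; first by move=> x /H[V [Vx [_ /(_ i)[d _]]]]; exact: d.
by apply: IH => x /H[V [Vx [_ /(_ i)[_ d]]]]; exists V.
Qed.

End LocalSmoothness.

Section SmallAngles.
Context {R : realType}.

Lemma sin_small : exists2 e : R, 0<e & forall t : R, 0<t<e -> t/2<=sin t<=t.
Proof.
have c0 : {for (0 : R), continuous cos} by exact: continuous_cos.
have h : (1/2 : R)<cos 0 by rewrite cos0; lra.
have nb:=@lt_nbhsr _ _ _ h.
have /nbhs_ballP[e /= e0 he] : \forall t \near (0 : R), 1/2<cos t by exact: (c0 _ nb).
exists e => // t /andP[t0 te].
have d (s : R) : 0<=s<=t -> is_derive s 1 sin (cos s) by move=> _; exact: is_derive_sin.
have [c /andP[c1 c2]]:=mean_value (ltW t0) d; rewrite sin0 !subr0 => ->.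
have cc : 1/2<cos c by apply: he; rewrite /ball /= sub0r normrN ger0_norm// (le_lt_trans c2).
by apply/andP; split; have:=cos_le1 c; nra.
Qed.

Lemma cos_half (d : R) : 1-cos d = 2*sin (d/2)^+2.
Proof.
have e : d = d/2+d/2 by lra.
rewrite {1}e cosD -!expr2; by rewrite -[X in X-_](cos2Dsin2 (d/2)); ring.
Qed.

(** From [1 - cos d = 2 sin(d/2)^2] and [t/2 <= sin t <= t] for small [t]. It replaces the
    great-circle distance by [1 - dot], which is rational in the charts. *)
Lemma acos_small (dl : R) : 0<dl -> exists2 e : R, 0<e & forall s : R, -1<=s -> s<1 -> 1-s<e ->
 [/\ 0<acos s, acos s<dl & acos s^+2/8<=1-s<=acos s^+2].
Proof.
move=> dl0; have [e e0 he]:=@sin_small.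
pose d0:=Num.min (Num.min (dl/2) e) (1 : R).
have d00 : 0<d0 by rewrite !lt_min divr_gt0// e0 ltr01.
have d0d : d0<=dl/2 by rewrite !ge_min lexx.
have d0e : d0<=e by rewrite !ge_min lexx orbT.
have d01 : d0<=1 by rewrite !ge_min lexx orbT.
have pi1 : 1<=pi :> R by apply: le_trans (pi_ge2 R); rewrite ler1n.
have sq (d : R) : 0<d -> d<=d0 -> d^+2/8<=1-cos d<=d^+2.
 move=> dp dd; have /andP[h1 h2]:=he (d/2) ltac:(lra).
 rewrite cos_half; nra.
exists (1-cos d0); first by have /andP[+ _]:=sq _ d00 (lexx _); apply: lt_le_trans; rewrite divr_gt0// exprn_gt0.
move=> s s1 s2 hs; have s_in : s \in `[(-1), 1] by rewrite in_itv /= s1 ltW.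
have ca:=acosK s_in.
have a0 : 0<=acos s by apply: acos_ge0; rewrite s1 ltW.
have ap : acos s<=pi by apply: acos_lepi; rewrite s1 ltW.
have a0' : 0<acos s.
 rewrite lt_neqAle a0 andbT; apply/eqP => e1; move: ca; rewrite -e1 cos0 => e2; move: s2; rewrite -e2 ltxx //.
have ad : acos s<d0.
 rewrite ltNge; apply/negP => h.
 have : cos (acos s)<=cos d0.
  by rewrite leNgt ltr_cos ?in_itv /= ?a0 ?(ltW d00) ?(le_trans d01)// -leNgt.
 by lra.
split => //; first by lra.
by have:=sq _ a0' (ltW ad); rewrite ca.
Qed.

End SmallAngles.

Section Charts.
Context {R : realType}.
Local Notation E:='rV[R]_4.
Local Notation F:='rV[R]_5.
Local Notation e_ i:=(delta_mx 0 i : E).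
Implicit Types (x y : E) (X Y : F).

Lemma is_Ck_qd k (U : set E) : open U -> is_Ck k U qd.
Proof.
move=> oU; apply: is_Ck_add => //; last exact: is_Ck_cst.
by apply: is_Ck_sum => // i; apply: is_Ck_mul => //; exact: is_Ck_coord.
Qed.

Lemma is_Ck_stereo k (U : set E) b (l : 'I_5) : open U -> is_Ck k U (fun x => stereo b x 0 l).
Proof.
move=> oU; have cV : is_Ck k U (fun x => (qd x)^-1).
 by apply: is_Ck_inv => //; [move=> x _; rewrite gt_eqF// qd_gt0|exact: is_Ck_qd].
have [[i e]|[i e]] : (exists i, @fintype.split 4 1 l = inl i) \/ (exists i, @fintype.split 4 1 l = inr i).
  by case: (@fintype.split 4 1 l) => i; [left|right]; exists i.
 rewrite (_ : (fun x => _) = (fun x => (qd x)^-1*(2*x 0 i))); last by apply/funext => x; rewrite coord5 e hor_stereo !mxE.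
 by cks.
rewrite (_ : (fun x => _) = (fun x => sgn b*(1-2*(qd x)^-1))); last first.
 apply/funext => z; rewrite coord5 e ver_stereo; congr (_*_).
 by have:=qd_gt0 z; rewrite /qd => q0; field; rewrite gt_eqF.
by cks.
Qed.

Lemma tangent_exists X : sphere4 X -> exists2 a, tangent X a & 0<dot a a.
Proof.
move=> hX; have [b np] : exists b, X <> pole b.
 have [e|np]:=pselect (X = pole false); last by exists false.
 exists true; rewrite e !poleE => /mk5_inj[_]; rewrite /sgn expr0 expr1 => h.
 by have:=ltrN10 R; rewrite -h ltNge ler01.
rewrite -(proj_stereo hX np); exists (dst b (proj b X) 0); first exact: tangent_dst.
by rewrite dot_dst mulr1 exprn_gt0// divr_gt0// qd_gt0.
Qed.

Lemma dot_sphere X Y : sphere4 X -> sphere4 Y -> -1<=dot X Y<=1.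
Proof.
rewrite /sphere4 /= => hX hY; have:=cauchy_schwarz_sqr X Y; rewrite hX hY mulr1 => h.
by nra.
Qed.

Variables (D : conformal_divisor R) (g : metric R) (w : F -> R).
Hypothesis sw : smooth_on_sphere (regular_set D) w.
Hypothesis gw : forall X a c, regular_set D X -> tangent X a -> tangent X c -> g X a c = expR (2*w X)*round_metric X a c.

(** The two expressions of [g] on one nonzero tangent vector give [w = v + beta log d]; and [log d]
    is half of [ln (1 - dot X p)] up to a bounded error, as [d^2] and [1 - dot X p] are comparable
    within a factor 8. *)
Lemma conic_w (beta : R) p : sphere4 p -> (forall X, regular_set D X -> X <> p) -> conic_singularity g beta p ->
 exists e M : R, 0<e /\ forall X, regular_set D X -> 1-dot X p<e -> `|w X-beta/2 * ln (1-dot X p)| <= M.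
Proof.
move=> hp np [dl [M [v [dl0 H]]]]; have [e e0 he]:=acos_small dl0.
exists e, (M + `|beta/2| * ln 8); split => // X rX Xe.
have hX : sphere4 X by case: rX.
have /andP[s1 s2]:=dot_sphere hX hp.
have s3 : dot X p<1.
 by rewrite lt_neqAle s2 andbT; apply/eqP => h; apply: (np X rX); exact: sphere_eq.
have [a0 ad /andP[sq1 sq2]]:=he _ s1 s3 Xe.
have [vM gv]:=H X hX (np X rX) ad.
have [a ta da]:=tangent_exists hX.
have:=gw rX ta ta; rewrite (gv a a ta ta) /round_metric => /(mulIf (lt0r_neq0 da)).
rewrite /round_dist; set d:=acos (dot X p) in a0 ad sq1 sq2 *.
rewrite /powR (gt_eqF a0) -expRD => /expR_inj h.
have wv : w X = v X+beta * ln d by lra.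
have c0 : 0<1-dot X p by lra.
have l1 : ln (1-dot X p)<=2 * ln d.
 by rewrite mulr_natl -lnXn// ler_ln ?posrE ?exprn_gt0.
have l2 : 2 * ln d-ln 8<=ln (1-dot X p).
 by rewrite mulr_natl -lnXn// -ln_div ?posrE ?exprn_gt0// ler_ln ?posrE ?divr_gt0 ?exprn_gt0.
have l8 : 0<=ln 8 :> R by lra.
rewrite wv (_ : v X+beta * ln d-beta/2 * ln (1-dot X p) = v X+beta/2*(2 * ln d-ln (1-dot X p))); last by lra.
apply: le_trans (ler_normD _ _) _; apply: lerD => //; rewrite normrM; apply: ler_wpM2l => //.
by rewrite ger0_norm; lra.
Qed.

Definition Vc b : set E:=[set y | regular_set D (stereo b y)].

Lemma cont_dot_stereo b X y : cts (fun z => dot (stereo b z) X) y.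
Proof.
apply: cont_sum => l; apply: cont_mul; last exact: cont_cst.
have h:=@is_Ck_stereo 0 setT b l openT.
exact: (proj1 h y I).
Qed.

Lemma open_Vc b : open (Vc b).
Proof.
rewrite openE => y [_ hy]; rewrite /interior.
have H (i : 'I_(npoints D)) : \forall z \near y, dot (stereo b z) (point i)<1.
 have s1 : dot (stereo b y) (point i)<1.
  have /andP[_ h]:=dot_sphere (sphere_stereo b y) (point_sphere i).
  by rewrite lt_neqAle h andbT; apply/eqP => e; apply: (hy i); apply: sphere_eq => //; [exact: sphere_stereo|exact: point_sphere].
 have nb:=@lt_nbhsl _ _ _ s1; have c:=@cont_dot_stereo b (point i) y.
 exact: (c _ nb).
have:=@filter_forall E 'I_(npoints D) (fun i z => dot (stereo b z) (point i)<1) (nbhs y) (nbhs_filter y) H.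
apply: filterS => z hz; split; first exact: sphere_stereo.
by move=> i e; have:=hz i; rewrite e; have:=point_sphere i; rewrite /sphere4 /= => ->; rewrite ltxx.
Qed.

Definition Uc b y : R:=w (stereo b y)+ln (2/qd y).

Lemma is_Ck_lnq k (U : set E) : open U -> is_Ck k U (fun y => ln (2/qd y)).
Proof.
move=> oU; apply: is_Ck_ln => //; first by move=> y _; rewrite divr_gt0// qd_gt0.
apply: is_Ck_scale => //; apply: is_Ck_inv => //; last exact: is_Ck_qd.
by move=> y _; rewrite gt_eqF// qd_gt0.
Qed.

Lemma is_Ck_Uc k b : is_Ck k (Vc b) (Uc b).
Proof.
have oV:=@open_Vc b; apply: is_Ck_add => //; last exact: is_Ck_lnq.
exact: sw.
Qed.

Lemma expR_conf (w0 : R) y : expR (2*(w0+ln (2/qd y))) = expR (2*w0)*(2/qd y)^+2.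
Proof.
have q0 : 0<2/qd y by rewrite divr_gt0// qd_gt0.
by rewrite mulrDr expRD; congr (_*_); rewrite (_ : 2*_ = ln (2/qd y)+ln (2/qd y)) ?expRD ?lnK ?posrE// mulr_natl.
Qed.

Lemma pullback_flat b y : Vc b y -> pullback (stereo b) g y = (expR (2*Uc b y))%:M.
Proof.
move=> Vy; apply/matrixP => i j; rewrite !mxE !partial_stereo gw//; try exact: tangent_dst.
rewrite /round_metric dot_dst expR_conf mulrA.
by lra.
Qed.

Hypothesis C2 : C2_plus D g.
Variable K : R.
Hypothesis HK : forall b y, regular_set D (stereo b y) -> sigma 2 (pullback (stereo b) g) y = K.

Lemma chart_sigma b y : Vc b y -> 0<sig1 (hs (Uc b) y) (gr (Uc b) y) /\ sig2 (hs (Uc b) y) (gr (Uc b) y) = K*expR (4*Uc b y).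
Proof.
move=> Vy; have [s1 s2]:=C2 Vy.
have [e1 e2]:=sigma_flat (@open_Vc b) (@is_Ck_Uc 3 b) (@pullback_flat b) Vy (lt0r_neq0 s1).
rewrite tr_AMx in e1; rewrite (tr_AMx2 (@open_Vc b) (@is_Ck_Uc 3 b) Vy) (HK Vy) in e2.
split; first by move: s1; rewrite e1 pmulr_rgt0// expR_gt0.
by rewrite e2 expRN mulrAC mulVf ?mul1r// gt_eqF// expR_gt0.
Qed.

Lemma K_gt0 b y : Vc b y -> 0<K.
Proof. by move=> Vy; rewrite -(HK Vy); have [_]:=C2 Vy. Qed.

End Charts.

(** * Behaviour of the curvature under inversion *)

Section Kelvin.
Context {R : realType}.
Local Notation E:='rV[R]_4.
Local Notation e_ i:=(delta_mx 0 i : E).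
Variables (c : E) (a : R).

(** For [a > 0], inversion in the sphere of centre [c] and radius [sqrt a]. *)
Definition kelvin (x : E) : E:=c+(a/rho c x) *: (x-c).

Let z i x : R:=zc c i x.
Let q x : R:=(rho c x)^-1.
(** The Jacobian of [kelvin]: [a/rho] times the reflection in the hyperplane orthogonal to [x-c]. *)
Let T k i x : R:=a*((i == k)%:R*q x-2*q x^+2*z i x*z k x).

Let sumzz x : rho c x = \sum_k z k x*z k x.
Proof. by []. Qed.

Let is_derive_z k i x : is_derive x (e_ i) (z k) (i == k)%:R.
Proof. by rewrite eq_sym; exact: is_derive_zc. Qed.

Lemma is_derive_q i x : x != c -> is_derive x (e_ i) q (- (2*q x^+2*z i x)).
Proof.
move=> xc; have rn : rho c x != 0 by rewrite gt_eqF// rho_gt0.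
have hV : is_derive (rho c x) 1 (fun s : R => s^-1) (- (rho c x) ^- 2 *: (1 : R)) by exact: is_deriveV.
apply: (is_derive_eq (is_derive_comp1 hV (partial_rho c i x))).
by rewrite /GRing.scale /= exprVn /z; ring.
Qed.

Lemma is_derive_kelvin k i x : x != c -> is_derive x (e_ i) (fun y => kelvin y 0 k) (T k i x).
Proof.
move=> xc; rewrite (_ : (fun y => _) = fun y => c 0 k+a*(q y*z k y)); last first.
 by apply/funext => y; rewrite /kelvin !mxE /z -mulrA.
have h0 : is_derive x (e_ i) (fun _ : E => c 0 k) 0 by exact: is_derive_cst.
apply: (is_derive_eq (isd_add h0 (isd_cmul a (isd_mul (is_derive_q i xc) (is_derive_z k i x))))).
rewrite /T; ring.
Qed.

Let dT k i j x : R:=a*(- 2*q x^+2*(z j x*(i == k)%:R+(j == i)%:R*z k x+z i x*(j == k)%:R)+8*q x^+3*z i x*z j x*z k x).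

Lemma is_derive_T k i j x : x != c -> is_derive x (e_ j) (T k i) (dT k i j x).
Proof.
move=> xc; have dq:=is_derive_q j xc.
have h:=isd_cmul a (isd_sub (isd_cmul (i == k)%:R dq)
 (isd_mul (isd_mul (isd_cmul 2 (isd_mul dq dq)) (is_derive_z i j x)) (is_derive_z k j x))).
rewrite (_ : T k i = fun y => a*((i == k)%:R*q y-2*(q y*q y)*z i y*z k y)); last by [].
by apply: (is_derive_eq h); rewrite /dT; ring.
Qed.

Variables (V W : set E) (U f : E -> R).
Hypothesis oV : open V.
Hypothesis cU : is_Ck 3 V U.
Hypothesis oW : open W.
Hypothesis cf : is_Ck 3 W f.
Hypothesis fE : forall x, W x -> [/\ x != c, V (kelvin x) & f x = U (kelvin x)+(ln a-ln (rho c x))].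

Lemma gr_kelvin x i : W x -> gr f x i = \sum_k T k i x*gr U (kelvin x) k-2*(q x*z i x).
Proof.
move=> Wx; have [xc Vx _]:=fE Wx.
have cc : C1at U (kelvin x) by apply: (is_Ck_C1at oV _ Vx); exact: is_Ck_le cU.
have h1:=@is_derive_chain R 4 E U kelvin x (e_ i) (\row_k T k i x) cc.
have h2 : is_derive x (e_ i) (fun y => U (kelvin y)) (\sum_k T k i x*gr U (kelvin x) k).
 rewrite (eq_bigr (fun k => (\row_k T k i x) 0 k * partial k U (kelvin x))); last by move=> k _; rewrite mxE.
 by apply: h1 => k; rewrite mxE; exact: is_derive_kelvin.
have rp : 0<rho c x:=rho_gt0 xc.
have h3 : is_derive x (e_ i) (fun y => ln (rho c y)) ((rho c x)^-1*(2*z i x)).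
 by apply: is_derive_comp1 (partial_rho c i x); exact: is_derive1_ln.
have h0 : is_derive x (e_ i) (fun _ : E => ln a) 0 by exact: is_derive_cst.
have h4:=isd_add h2 (isd_sub h0 h3).
have [_ h5] : is_derive x (e_ i) f (\sum_k T k i x*gr U (kelvin x) k+(0-(rho c x)^-1*(2*z i x))).
 apply: near_is_derive h4; apply: (open_near_eq oW _ Wx) => y Wy.
 by have [_ _]:=fE Wy.
by rewrite [LHS]h5 /q; ring.
Qed.

Lemma hs_kelvin x i j : W x -> hs f x i j =
 \sum_k (T k i x*(\sum_l T l j x*hs U (kelvin x) k l)+dT k i j x*gr U (kelvin x) k)
 - 2*(q x*(j == i)%:R-2*q x^+2*z j x*z i x).
Proof.
move=> Wx; have [xc Vx _]:=fE Wx.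
have h2 k : is_derive x (e_ j) (fun y => gr U (kelvin y) k) (\sum_l T l j x*hs U (kelvin x) k l).
 have cc : C1at (partial k U) (kelvin x).
  by apply: (is_Ck_C1at oV _ Vx); apply: is_Ck_partial; exact: is_Ck_le cU.
 rewrite (eq_bigr (fun l => (\row_l T l j x) 0 l * partial l (partial k U) (kelvin x))); last by move=> l _; rewrite mxE.
 by apply: (is_derive_chain cc) => l; rewrite mxE; exact: is_derive_kelvin.
have h4:=isd_sub (isd_sum (fun k => isd_mul (is_derive_T k i j xc) (h2 k))) (isd_cmul 2 (isd_mul (is_derive_q j xc) (is_derive_z i j x))).
have [_ h5]:=near_is_derive (open_near_eq oW (fun y Wy => esym (gr_kelvin i Wy)) Wx) h4.
rewrite /hs [LHS]h5; congr (_-_); last by lra.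
by apply: eq_bigr => k _; rewrite addrC; congr (_+_); rewrite mulrC.
Qed.

Lemma rhoV_rho x : x != c -> q x*rho c x = 1.
Proof. by move=> /rho_gt0 r0; rewrite mulVf// gt_eqF. Qed.

Lemma sum_T (p : 'I_4 -> R) i x : \sum_k T k i x * p k = a*(q x * p i-2*q x^+2*z i x*(\sum_k p k*z k x)).
Proof.
rewrite (eq_bigr (fun k => a*q x * p k*(i == k)%:R-2*a*q x^+2*z i x*(p k*z k x))); last by move=> k _; rewrite /T; ring.
by rewrite sumrB (sum_deltar (fun k => a*q x * p k)) -mulr_sumr; ring.
Qed.

Lemma sum_dT (p : 'I_4 -> R) i j x : \sum_k dT k i j x * p k =
 a*(- 2*q x^+2*(z j x * p i+(j == i)%:R*(\sum_k p k*z k x)+z i x * p j)+8*q x^+3*z i x*z j x*(\sum_k p k*z k x)).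
Proof.
rewrite (eq_bigr (fun k => (- 2*a*q x^+2*z j x) * p k*(i == k)%:R+(- 2*a*q x^+2*z i x) * p k*(j == k)%:R
  + (- 2*a*q x^+2*(j == i)%:R+8*a*q x^+3*z i x*z j x)*(p k*z k x))); last by move=> k _; rewrite /dT; ring.
rewrite !big_split /= (sum_deltar (fun k => (- 2*a*q x^+2*z j x) * p k)) (sum_deltar (fun k => (- 2*a*q x^+2*z i x) * p k)) -mulr_sumr; ring.
Qed.

Lemma sum_TT i j x : x != c -> \sum_k T k i x*T k j x = (a*q x)^+2*(j == i)%:R.
Proof.
move=> xc; rewrite sum_T {1}/T.
have -> : \sum_k T k j x*z k x = a*(q x*z j x-2*q x*z j x*(q x*rho c x)).
 by rewrite (sum_T (fun k => z k x)) sumzz; ring.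
rewrite rhoV_rho//; ring.
Qed.

Lemma nrm2_kelvin (p : 'I_4 -> R) x : x != c ->
 nrm2 (fun i => \sum_k T k i x * p k-2*(q x*z i x)) =
 (a*q x)^+2*nrm2 p+4*a*q x^+2*(\sum_k p k*z k x)+4*q x.
Proof.
move=> xc; set Q:=\sum_k p k*z k x.
pose b:=2*a*q x^+2*Q+2*q x.
rewrite /nrm2 (eq_bigr (fun i => (a*q x)^+2 * p i^+2-2*(a*q x)*b*(p i*z i x)+b^+2*(z i x*z i x))); last first.
 by move=> i _; rewrite sum_T -/Q /b; ring.
rewrite big_split /= sumrB -!mulr_sumr -/Q -sumzz.
have -> : b^+2*rho c x = 4*q x*(a*q x*Q+1)^+2*(q x*rho c x) by rewrite /b; ring.
by rewrite rhoV_rho// /b; ring.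
Qed.

Lemma kelvin_entry (p b cc S H P1 P2 Q N r qq zi zj d : R) :
 P1 = r*(qq * p-2*qq^+2*zi*Q) -> P2 = r*(qq*b-2*qq^+2*zj*Q) ->
 S = r*(- 2*qq^+2*(zj * p+d*Q+zi*b)+8*qq^+3*zi*zj*Q) ->
 - (H+S-2*(qq*d-2*qq^+2*zj*zi))+(P1-2*(qq*zi))*(P2-2*(qq*zj))
  - 2^-1*((r*qq)^+2*N+4*r*qq^+2*Q+4*qq)*d =
 - H+P1*P2-2^-1*N*((r*qq)^+2*d).
Proof. by move=> -> -> ->; field. Qed.

Let Tm x : 'M[R]_4:=\matrix_(i, k) T k i x.

(** By the relation [fE], [kelvin] maps [e^(2f)|dx|^2] isometrically to [e^(2U)|dx|^2], so the
    Schouten tensor is transported as a tensor: the second derivatives of the inversion cancel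
    against those of [- ln rho]. *)
Lemma AMx_kelvin x : W x -> AMx f x = Tm x *m AMx U (kelvin x) *m (Tm x)^T.
Proof.
move=> Wx; have [xc _ _]:=fE Wx; apply/matrixP => i j; rewrite !mxE /schoutenA.
have -> : nrm2 (gr f x) = (a*q x)^+2*nrm2 (gr U (kelvin x))+4*a*q x^+2*(\sum_k gr U (kelvin x) k*z k x)+4*q x.
 by rewrite -nrm2_kelvin//; apply: eq_bigr => k _; rewrite gr_kelvin.
rewrite !gr_kelvin// hs_kelvin// big_split /= (eq_sym i j).
rewrite (kelvin_entry 0 _ _ (sum_T _ i x) (sum_T _ j x) (sum_dT _ i j x)).
rewrite -(sum_TT _ _ xc).
set p:=gr U _; set H:=hs U _.
have e1 : - (\sum_k T k i x*(\sum_l T l j x*H k l)) = \sum_l \sum_k T k i x * - H k l*T l j x.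
 rewrite -sumrN exchange_big; apply: eq_bigr => k _; rewrite mulr_sumr -sumrN; apply: eq_bigr => l _; ring.
have e2 : (\sum_k T k i x * p k)*(\sum_k T k j x * p k) = \sum_l \sum_k T k i x*(p k * p l)*T l j x.
 rewrite mulr_sumr; apply: eq_bigr => l _; rewrite mulr_suml; apply: eq_bigr => k _; ring.
have e3 : 2^-1*nrm2 p*(\sum_k T k i x*T k j x) = \sum_l \sum_k T k i x*(2^-1*nrm2 p*(k == l)%:R)*T l j x.
 rewrite mulr_sumr; apply: eq_bigr => l _.
 rewrite (eq_bigr (fun k => (2^-1*nrm2 p*T l j x*T k i x)*(l == k)%:R)); last by move=> k _; rewrite (eq_sym k l); ring.
 by rewrite (sum_deltar (fun k => 2^-1*nrm2 p*T l j x*T k i x)); ring.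
rewrite e1 e2 e3 -big_split -sumrB; apply: eq_bigr => l _; rewrite !mxE mulr_suml -big_split -sumrB.
by apply: eq_bigr => k _; rewrite !mxE /schoutenA -/p -/H /=; ring.
Qed.

Lemma Tm_sqr x : x != c -> (Tm x)^T *m Tm x = ((a*q x)^+2)%:M.
Proof.
move=> xc; apply/matrixP => i j; rewrite !mxE.
rewrite (eq_bigr (fun k => T k i x*T k j x)); last by move=> k _; rewrite !mxE /T (eq_sym k) (eq_sym k j); ring.
by rewrite sum_TT// (eq_sym j); case: (i == j); rewrite ?mulr1 ?mulr0.
Qed.

Lemma sig_kelvin x : W x ->
 sig1 (hs f x) (gr f x) = (a*q x)^+2*sig1 (hs U (kelvin x)) (gr U (kelvin x)) /\
 sig2 (hs f x) (gr f x) = (a*q x)^+4*sig2 (hs U (kelvin x)) (gr U (kelvin x)).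
Proof.
move=> Wx; have [xc Vx _]:=fE Wx; have e:=AMx_kelvin Wx; have eT:=Tm_sqr xc.
set M:=Tm x in e eT; set A:=AMx U _ in e.
have t1 : \tr (M *m A *m M^T) = (a*q x)^+2 * \tr A.
 by rewrite mxtrace_mulC mulmxA eT mul_scalar_mx mxtraceZ.
have t2 : \tr (M *m A *m M^T *m (M *m A *m M^T)) = (a*q x)^+4 * \tr (A *m A).
 rewrite !mulmxA -(mulmxA (M *m A)) eT mul_mx_scalar -!scalemxAl mxtraceZ mxtrace_mulC !mulmxA eT.
 by rewrite mul_scalar_mx -scalemxAl mxtraceZ; ring.
have a1:=tr_AMx f x; have a2:=tr_AMx U (kelvin x).
have b1:=tr_AMx2 oW cf Wx; have b2:=tr_AMx2 oV cU Vx.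
rewrite e t1 -/A in a1 b1; rewrite -/A in a2 b2; rewrite t2 in b1.
split; first by apply: (etrans (esym a1)); rewrite a2.
apply: (etrans (esym b1)); rewrite -b2.
by ring.
Qed.

End Kelvin.

(** * Moving a conic point to infinity *)

Section Householder.
Context {R : realType} {n : nat}.
Local Notation F:='rV[R]_n.
Variables (a b : F).

(** The reflection in the hyperplane orthogonal to [a-b]. For [a = b] the division by 0 makes it the
    identity, so that case needs no separate definition. *)
Definition hh (X : F) : F:=X-(2*dot X (a-b)/dot (a-b) (a-b)) *: (a-b).

Lemma hh_dotE X Y : dot (hh X) Y = dot X Y-2*dot X (a-b)/dot (a-b) (a-b)*dot Y (a-b).
Proof. by rewrite /hh dotD dotNl dotZl (dotC Y). Qed.

Lemma dot_hh X Y : dot (hh X) (hh Y) = dot X Y.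
Proof.
rewrite hh_dotE dotC hh_dotE (dotC Y X) (hh_dotE Y (a-b)).
have [e|n0]:=eqVneq (dot (a-b) (a-b)) 0; first by rewrite e invr0 !mulr0 !mul0r !subr0.
by field.
Qed.

Lemma hhK X : hh (hh X) = X.
Proof.
have [e|n0]:=eqVneq (dot (a-b) (a-b)) 0; first by rewrite /hh e invr0 !mulr0 !scale0r !subr0.
rewrite {1}/hh hh_dotE /hh -addrA -opprD -scalerDl.
set s:=(X in _-X *: _); have -> : s = 0 by rewrite /s; field.
by rewrite scale0r subr0.
Qed.

Lemma hh_swap : dot a a = dot b b -> hh b = a.
Proof.
move=> e; have [e0|n0]:=eqVneq (dot (a-b) (a-b)) 0.
 by rewrite /hh e0 invr0 mulr0 scale0r subr0; apply/esym/eqP; rewrite -subr_eq0; apply/eqP; exact: dot_eq0.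
rewrite /hh (_ : 2*dot b (a-b)/dot (a-b) (a-b) = -1); first by rewrite scaleN1r opprK addrC subrK.
apply: (mulIf n0); rewrite divfK// mulN1r !(dotD, dotDr, dotNl, dotNr) (dotC b a) e; ring.
Qed.

Lemma hh_id X : a = b -> hh X = X.
Proof. by move=> e; rewrite /hh e subrr scaler0 subr0. Qed.

End Householder.

Section Normalization.
Context {R : realType}.
Local Notation E:='rV[R]_4.
Local Notation F:='rV[R]_5.
Local Notation e_ i:=(delta_mx 0 i : E).
Implicit Types (x y : E) (X Y : F).
Variables (D : conformal_divisor R) (g : metric R) (w : F -> R).
Hypothesis sw : smooth_on_sphere (regular_set D) w.
Hypothesis gw : forall X a c, regular_set D X -> tangent X a -> tangent X c -> g X a c = expR (2*w X)*round_metric X a c.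
Hypothesis C2 : C2_plus D g.
Variable K : R.
Hypothesis HK : forall b y, regular_set D (stereo b y) -> sigma 2 (pullback (stereo b) g) y = K.
Hypothesis HC : forall i : 'I_(npoints D), conic_singularity g (order i) (point i).
Variable j : 'I_(npoints D).

(* Exchanges [point j] with the point at infinity of the chart [stereo false]. *)
Definition swp : F -> F:=hh (point j) (pole false).

Lemma swp_pole : swp (pole false) = point j.
Proof. by apply: hh_swap; rewrite (point_sphere j) (sphere_pole false). Qed.

Lemma swp_point : swp (point j) = pole false.
Proof. by rewrite -swp_pole /swp hhK. Qed.

Lemma sphere_swp X : sphere4 X -> sphere4 (swp X).
Proof. by rewrite /sphere4 /= dot_hh. Qed.

Lemma dot_swp X Y : dot (swp X) Y = dot X (swp Y).
Proof. by rewrite -(dot_hh (point j) (pole false)) hhK. Qed.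

(** The conic points other than [point j], seen in the chart after the reflection. *)
Definition yv (k : 'I_(npoints D).-1) : E:=proj false (swp (point (lift j k))).
(** The logarithm of the conformal factor of [g] in the same chart: the reflection is an isometry of
    the round metric, so only the factor of the stereographic chart is added. *)
Definition un x : R:=w (swp (stereo false x))+ln (2/qd x).

Lemma stereo_yv k : stereo false (yv k) = swp (point (lift j k)).
Proof.
apply: proj_stereo; first by apply: sphere_swp; exact: point_sphere.
move=> e; have : point (lift j k) = point j by rewrite -swp_pole -e /swp hhK.
by move=> /point_inj/eqP; rewrite eq_sym (negbTE (neq_lift _ _)).
Qed.

Lemma yv_inj : injective yv.
Proof.
move=> k l /(congr1 (stereo false)); rewrite !stereo_yv => /(congr1 swp); rewrite /swp !hhK.
by move=> /point_inj/lift_inj.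
Qed.

Lemma regE x : reg yv x <-> regular_set D (swp (stereo false x)).
Proof.
split=> [h|[_ h] k].
 split; first by apply: sphere_swp; exact: sphere_stereo.
 move=> i; have [k ->|->]:=unliftP j i => e.
  have /eqP:=h k; apply; apply: (@stereo_inj R false); rewrite stereo_yv -e /swp hhK //.
 by apply: (@stereo_neq_pole R false x); rewrite -swp_point -e /swp hhK.
by apply/eqP => e; apply: (h (lift j k)); rewrite e stereo_yv /swp hhK.
Qed.

Lemma is_Ck_swp k (U : set E) (l : 'I_5) : open U -> is_Ck k U (fun x => swp (stereo false x) 0 l).
Proof.
move=> oU; set n0:=point j-pole false.
rewrite (_ : (fun x => _) = fun x => stereo false x 0 l-(2/dot n0 n0*n0 0 l) * \sum_i stereo false x 0 i*n0 0 i).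
 apply: is_Ck_sub_fun => //; first exact: is_Ck_stereo.
 apply: is_Ck_scale => //; apply: is_Ck_sum => // i; apply: is_Ck_mul => //; first exact: is_Ck_stereo.
 by cks.
by apply/funext => x; rewrite /swp /hh -/n0 !mxE -/(dot _ n0); congr (_-_); ring.
Qed.

(** Smoothness of [w] is given in the two charts only. Near any point the reflected image avoids one
    of the two poles, and there [w] is read in the corresponding chart after a smooth change of
    coordinates. *)
Lemma is_Ck_un k : is_Ck k (reg yv) un.
Proof.
apply: is_Ck_local => x Ox; have [b nb] : exists b, swp (stereo false x) <> pole b.
 have [e|np]:=pselect (swp (stereo false x) = pole false); last by exists false.
 exists true; rewrite e !poleE => /mk5_inj[_]; rewrite /sgn expr0 expr1 => h.
 by have:=ltrN10 R; rewrite -h ltNge ler01.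
pose W:=reg yv `&` [set y | dot (stereo false y) (swp (pole b))<1].
have oW : open W.
 apply: openI; first exact: open_reg.
 by apply: open_preimage_lt => y; exact: cont_dot_stereo.
have sS y : sphere4 (swp (stereo false y)) by apply: sphere_swp; exact: sphere_stereo.
have Wn y : W y -> swp (stereo false y) <> pole b.
 move=> [_ /=]; rewrite -dot_swp => h e; move: h; rewrite e.
 by have:=sphere_pole b; rewrite /sphere4 /= => ->; rewrite ltxx.
exists W; split.
 split => //=; rewrite -dot_swp; have /andP[_ h]:=dot_sphere (sS x) (sphere_pole b).
 by rewrite lt_neqAle h andbT; apply/eqP => e; apply: nb; apply: sphere_eq => //; exact: sphere_pole.
apply: is_Ck_add; [exact: oW| |exact: is_Ck_lnq].
apply: (@is_Ck_eq _ _ k W (fun y => (w \o stereo b) (proj b (swp (stereo false y))))); first exact: oW.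
 by move=> y Wy /=; rewrite proj_stereo//; exact: Wn.
apply: (@is_Ck_comp _ _ k W (Vc D b) (w \o stereo b) (fun y => proj b (swp (stereo false y)))); [exact: oW|exact: open_Vc| | |exact: sw].
 by move=> y Wy; rewrite /Vc /= proj_stereo//; [apply/regE; case: Wy|exact: Wn].
move=> i; rewrite (_ : (fun y => _) = fun y => (1-sgn b*swp (stereo false y) 0 (@rshift 4 1 0))^-1*swp (stereo false y) 0 (@lshift 4 1 i)).
 apply: is_Ck_mul; [exact: oW| |exact: is_Ck_swp].
 apply: is_Ck_inv; [exact: oW| |].
  move=> y Wy; have:=not_pole (sS y) (Wn y Wy); rewrite /ver !mxE => h; by rewrite gt_eqF.
 apply: is_Ck_sub_fun; [exact: oW|exact: is_Ck_cst|].
 by apply: is_Ck_scale; [exact: oW|exact: is_Ck_swp].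
by apply/funext => y; rewrite /proj /ver /hor !mxE.
Qed.

Lemma un_id x : point j = pole false -> un x = Uc w false x.
Proof. by move=> e; rewrite /un /swp hh_id. Qed.

Section Kel.
Variable c : E.
Hypothesis pj : point j = stereo false c.

Lemma swp_off x : x != c -> swp (stereo false x) <> pole false.
Proof.
move=> /eqP xc e; apply: xc; apply: (@stereo_inj R false).
by rewrite -pj -swp_pole -e /swp hhK.
Qed.

(** Read in the chart, the reflection is the inversion centred at the image [c] of [point j] with
    squared radius [qd c]; this reduces the curvature equation for [un] to the one in the given
    chart. *)
Lemma proj_swp x : x != c -> proj false (swp (stereo false x)) = kelvin c (qd c) x.
Proof.
move=> xc; have r0:=rho_gt0 xc; have qx:=qd_gt0 x; have qc:=qd_gt0 c.
have s1 : sgn false = 1 :> R by [].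
set n0:=stereo false c-pole false.
have nn : dot n0 n0 = 4/qd c.
 rewrite /n0 !(dotD, dotDr, dotNl, dotNr) (dotC (pole false)) dot_stereo_pole.
 rewrite (sphere_stereo false c) (sphere_pole false); field; by lra.
have xn : dot (stereo false x) n0 = 2/qd x*(1-rho c x/qd c).
 by rewrite dotDr dotNr dot_stereo dot_stereo_pole -rhoE; field; rewrite !gt_eqF.
pose k:=(qd c-rho c x)/qd x.
have SE : swp (stereo false x) = (- k) *: n0+stereo false x.
 rewrite /swp /hh pj -/n0 xn nn scaleNr addrC; congr (- _+_); congr (_ *: _).
 by rewrite /k; field; rewrite !gt_eqF.
have hn : hor n0 = (2/qd c) *: c.
 rewrite /n0 addrC -scaleN1r hor_lin poleE hor_mk scaler0 add0r hor_stereo scalerA.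
 by rewrite mulrC.
have vn : ver n0 = - 2/qd c.
 rewrite /n0 addrC -scaleN1r ver_lin poleE ver_mk ver_stereo s1; rewrite /qd in qc *.
 by field; rewrite gt_eqF.
rewrite /proj SE hor_lin ver_lin hn vn hor_stereo ver_stereo s1.
have -> : 1-1*(- k*(- 2/qd c)+1*((dot x x-1)/qd x)) = 2*rho c x/(qd x*qd c).
 have -> : dot x x-1 = qd x-2 by rewrite /qd; ring.
 by rewrite /k; field; rewrite !gt_eqF.
apply/rowP => i; rewrite /kelvin !mxE /k; field; by lra.
Qed.

Lemma un_kelvin x : x != c -> un x = Uc w false (kelvin c (qd c) x)+(ln (qd c)-ln (rho c x)).
Proof.
move=> xc; have r0:=rho_gt0 xc; have qx:=qd_gt0 x; have qc:=qd_gt0 c.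
have sS : sphere4 (swp (stereo false x)) by apply: sphere_swp; exact: sphere_stereo.
have nS:=swp_off xc; have:=@dot_stereo_pole R false (kelvin c (qd c) x).
rewrite /Uc -proj_swp// proj_stereo// => e.
rewrite /un -addrA; congr (_+_).
have:=dot_swp (stereo false x) (pole false); rewrite swp_pole pj dot_stereo -rhoE -/(swp _) e.
rewrite proj_swp// => e2.
have -> : 2/qd (kelvin c (qd c) x) = 2/qd x*rho c x/qd c.
 by lra.
have t0 : 0<2/qd x by rewrite divr_gt0.
rewrite (@ln_div _ (2/qd x*rho c x)) ?posrE//; last exact: mulr_gt0.
by rewrite (@lnM _ (2/qd x)) ?posrE//; ring.
Qed.

Lemma punctured_near (P : E -> Prop) : (\forall x \near c, P x) -> exists2 x, x != c & P x.
Proof.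
move=> /nbhs_ballP[d /= d0 h]; exists (c+(d/2) *: e_ 0).
 rewrite -subr_eq0 addrC addKr scaler_eq0 negb_or gt_eqF ?divr_gt0//=.
 by apply/eqP => /rowP/(_ 0); rewrite !mxE !eqxx => /eqP; rewrite oner_eq0.
apply: h; rewrite -ball_normE /ball_ /= opprD addrA subrr sub0r normrN normrZ gtr0_norm ?divr_gt0//.
apply: (@le_lt_trans _ _ (d/2*1)); last by lra.
apply: ler_wpM2l; first by lra.
by apply: norm_row_bound => // i; rewrite mxE eqxx /=; case: eqP => _; rewrite ?normr1 ?normr0.
Qed.

Lemma open_punctured : open (reg yv `&` punct c).
Proof. by apply: openI; [exact: open_reg|exact: open_punct]. Qed.

Lemma sig_un_off x : reg yv x -> x != c ->
 0<sig1 (hs un x) (gr un x) /\ sig2 (hs un x) (gr un x) = K*expR (4*un x).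
Proof.
move=> Ox xc; have qc:=qd_gt0 c.
have sE y : (reg yv `&` punct c) y -> [/\ y != c, Vc D false (kelvin c (qd c) y) &
  un y = Uc w false (kelvin c (qd c) y)+(ln (qd c)-ln (rho c y))].
 move=> [Oy yc]; split => //; last exact: un_kelvin.
 have sS : sphere4 (swp (stereo false y)) by apply: sphere_swp; exact: sphere_stereo.
 by rewrite /Vc /= -proj_swp// proj_stereo//; [exact/regE|exact: swp_off].
have cW : is_Ck 3 (reg yv `&` punct c) un by apply: is_Ck_sub (@is_Ck_un 3) => ? [].
have [-> ->]:=sig_kelvin (@open_Vc R D false) (is_Ck_Uc sw 3 false) open_punctured cW sE (conj Ox xc).
have [_ Vx ux]:=sE _ (conj Ox xc).
have [s1 ->]:=chart_sigma sw gw C2 HK Vx; have r0:=rho_gt0 xc.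
split; first by rewrite mulr_gt0// exprn_gt0// divr_gt0.
rewrite ux; set U:=Uc w false _; set l:=ln (qd c)-ln (rho c x).
have -> : qd c*(rho c x)^-1 = expR l by rewrite /l -ln_div ?posrE// lnK// posrE divr_gt0.
have -> : 4*(U+l) = 4*U+(l+l+(l+l)) by ring.
by rewrite !expRD; ring.
Qed.

(** The inversion sends [c] to infinity, so the equation at [c] follows by continuity from punctured
    neighbourhoods. Continuity alone gives [sig1 >= 0]; if [sig1] were 0, then [2 sig2] would be
    minus the squared norm of the Schouten tensor, contradicting [sig2 > 0]. *)
Lemma sig_un_at : reg yv c ->
 0<sig1 (hs un c) (gr un c) /\ sig2 (hs un c) (gr un c) = K*expR (4*un c).
Proof.
move=> Oc; have oO:=@open_reg R _ yv; have cu:=@is_Ck_un 3.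
have nO : \forall x \near c, reg yv x by exact: open_nbhs_nbhs.
have e2 : sig2 (hs un c) (gr un c) = K*expR (4*un c).
 pose h x:=sig2 (hs un x) (gr un x)-K*expR (4*un x).
 have ch : cts h c.
  apply: (@is_Ck_cont _ _ 1 (reg yv)) => //; apply: is_Ck_sub_fun => //.
   apply: is_Ck_add => //; last exact: is_Ck_hpp.
   apply: is_Ck_add => //; first apply: is_Ck_scale => //.
    apply: is_Ck_sub_fun => //; first by apply: is_Ck_exp => //; exact: is_Ck_trc.
    by apply: is_Ck_sum => // i; apply: is_Ck_sum => // k; apply: is_Ck_exp => //; exact: is_Ck_hs.
   apply: is_Ck_mul => //; last exact: is_Ck_trc.
   by apply: is_Ck_scale => //; exact: is_CkW (is_Ck_Nf _ _).
  by apply: is_Ck_scale => //; apply: is_Ck_expR => //; apply: is_Ck_scale => //; exact: is_Ck_un.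
 apply/eqP; rewrite -subr_eq0; apply/negPn/negP => hn.
 have nh : \forall x \near c, h x != 0.
  have nb : nbhs (h c) [set t : R | t != 0] by apply: open_nbhs_nbhs; split => //; exact: open_neq.
  exact: (ch _ nb).
 have [x xc [Ox /eqP]]:=punctured_near (filterI nO nh); apply.
 by rewrite /h; have [_ ->]:=sig_un_off Ox xc; rewrite subrr.
split => //; have K0:=K_gt0 C2 HK.
have s0 : 0<=sig1 (hs un c) (gr un c).
 pose h x:=sig1 (hs un x) (gr un x).
 have ch : cts h c.
  apply: (@is_Ck_cont _ _ 1 (reg yv)) => //; apply: is_Ck_sub_fun => //.
   by apply: is_Ck_opp => //; exact: is_Ck_trc.
  exact: is_CkW (is_Ck_Nf _ _).
 rewrite leNgt; apply/negP => hn.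
 have nb:=@lt_nbhsl _ _ _ hn; have nh : \forall x \near c, h x<0:=ch _ nb.
 have [x xc [Ox hx]]:=punctured_near (filterI nO nh).
 by have [h1 _]:=sig_un_off Ox xc; move: hx; rewrite ltNge (ltW h1).
rewrite lt_neqAle s0 andbT eq_sym; apply/eqP => e1.
have [x xc Ox]:=punctured_near nO.
have Vx : Vc D false (kelvin c (qd c) x).
 rewrite /Vc /= -proj_swp// proj_stereo//; [exact/regE|apply: sphere_swp; exact: sphere_stereo|exact: swp_off].
have s2 : 0<sig2 (hs un c) (gr un c) by rewrite e2 mulr_gt0// ?expR_gt0//; exact: K0 Vx.
have:=hs2_schoutenA (hs un c) (gr un c).
have : 0<=hs2 (schoutenA (hs un c) (gr un c)) by apply: sumr_ge0 => i _; apply: sumr_ge0 => k _; rewrite sqr_ge0.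
move=> h0 h1; rewrite h1 in h0; move: s2 e1 h0; rewrite /sig1 /sig2.
by nra.
Qed.

End Kel.

Lemma sig_un x : reg yv x ->
 0<sig1 (hs un x) (gr un x) /\ sig2 (hs un x) (gr un x) = K*expR (4*un x).
Proof.
move=> Ox; have [e|np]:=pselect (point j = pole false).
 have eu : un = Uc w false by apply/funext => y; exact: un_id.
 rewrite eu; apply: (chart_sigma sw gw C2 HK); rewrite /Vc /=.
 by have /regE:=Ox; rewrite /swp hh_id.
have pj : point j = stereo false (proj false (point j)) by rewrite proj_stereo//; exact: point_sphere.
have [e|xc]:=eqVneq x (proj false (point j)); last exact: sig_un_off pj x Ox xc.
by rewrite e in Ox *; exact: sig_un_at pj Ox.
Qed.

Lemma ln_qd_le c x (b : R) : dot (x-c) (x-c)<=1 -> 3+2*dot c c<=b -> 0<=ln (qd x)<=ln b.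
Proof.
move=> h hb; have b0 : 0<b by have:=dot_ge0 c; lra.
have q1 : 1<=qd x by rewrite lerDr dot_ge0.
rewrite ln_ge0//= ler_ln ?posrE ?qd_gt0//; apply: le_trans hb; rewrite /qd.
have:=dot_ge0 (x-c-c); have -> : dot x x = dot (x-c+c) (x-c+c) by rewrite subrK.
move: h; move: (x-c) => d; rewrite !(dotD, dotDr, dotNl, dotNr) (dotC c d); lra.
Qed.

(** In the chart [1 - dot] is [2 rho/(qd x qd y)]. Near [yv k] the factors [qd] are bounded above
    and below, so half its logarithm is [Lr] up to a bounded error. *)
Lemma near_end k : exists s M : R, forall x, x != yv k -> s < - Lr (yv k) x -> reg yv x ->
 `|un x-order (lift j k)*Lr (yv k) x| <= M.
Proof.
set p:=lift j k; set y:=yv k; set be:=order p.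
have [e [M [e0 H]]]:=conic_w gw (point_sphere p) (fun X (rX : regular_set D X) => proj2 rX p) (HC p).
exists (`|ln 2-ln e|), (M+(`|be/2| * (ln 2+ln (3+2*dot y y)+ln (qd y))+(ln 2+ln (3+2*dot y y)))) => x xy hs0 Ox.
have r0:=rho_gt0 xy; have qx:=qd_gt0 x; have qy:=qd_gt0 y.
have rX:=(proj1 (regE x)) Ox.
have L2 : ln (rho y x) = 2*Lr y x by rewrite /Lr; field.
have l20 : 0<ln 2 :> R by rewrite ln_gt0// ltr1n.
have Lneg : Lr y x<0 by have:=normr_ge0 (ln 2-ln e); move: hs0; rewrite -/y; lra.
have r1 : dot (x-y) (x-y)<=1.
 by rewrite -rhoE -ler_ln ?posrE// ln1; lra.
have /andP[q1 q2]:=ln_qd_le r1 (lexx _).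
have y1 : 0<=ln (qd y) by rewrite ln_ge0// lerDr dot_ge0.
have ed : 1-dot (swp (stereo false x)) (point p) = 2*rho y x/(qd x*qd y).
 by rewrite dot_swp -stereo_yv dot_stereo -rhoE opprB addrC subrK.
have el : ln (1-dot (swp (stereo false x)) (point p)) = ln 2+2*Lr y x-(ln (qd x)+ln (qd y)).
 rewrite ed (@ln_div _ (2*rho y x)) ?posrE; [|exact: mulr_gt0|exact: mulr_gt0].
 by rewrite !lnM ?posrE// L2.
have d0 : 0<1-dot (swp (stereo false x)) (point p).
 by rewrite ed; apply: divr_gt0; apply: mulr_gt0.
have He : 1-dot (swp (stereo false x)) (point p)<e.
 rewrite -ltr_ln ?posrE// el; have:=ler_norm (ln 2-ln e); move: hs0; rewrite -/y; lra.
have:=H _ rX He; rewrite el /un ln_div ?posrE// => hM.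
set W:=w _ in hM *; set b2:=be/2 in hM *.
have -> : W+(ln 2-ln (qd x))-be*Lr y x = (W-b2*(ln 2+2*Lr y x-(ln (qd x)+ln (qd y)))) +
  (b2*(ln 2-ln (qd x)-ln (qd y))+(ln 2-ln (qd x))) by rewrite /b2; field.
apply: le_trans (ler_normD _ _) _; apply: lerD => //.
apply: le_trans (ler_normD _ _) _; rewrite normrM; apply: lerD.
 by apply: ler_wpM2l => //; rewrite ler_norml; apply/andP; split; lra.
by rewrite ler_norml; apply/andP; split; lra.
Qed.

(** At infinity [1 - dot] is [2/qd x], of order [|x|^-2]. The conic order thus contributes
    [- order j] to the slope in [log|x|], and the factor of the chart contributes [-2]. *)
Lemma far_end : exists s M : R, forall x, x != 0 -> s<Lr 0 x -> reg yv x ->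
 `|un x - - (2+order j)*Lr 0 x| <= M.
Proof.
set be:=order j.
have [e [M [e0 H]]]:=conic_w gw (point_sphere j) (fun X (rX : regular_set D X) => proj2 rX j) (HC j).
exists (`|ln 2-ln e|), (M+(`|be/2| * ln 2+(`|be/2+1| * ln 2+ln 2))) => x x0 hs0 Ox.
have r0:=rho_gt0 x0; have qx:=qd_gt0 x.
have rX:=(proj1 (regE x)) Ox.
have L2 : ln (rho 0 x) = 2*Lr 0 x by rewrite /Lr; field.
have l20 : 0<ln 2 :> R by rewrite ln_gt0// ltr1n.
have Lpos : 0<Lr 0 x by have:=normr_ge0 (ln 2-ln e); lra.
have rx : rho 0 x = dot x x by rewrite rhoE subr0.
have r1 : 1<dot x x by rewrite -rx -ltr_ln ?posrE// ln1; lra.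
have q1 : 2*Lr 0 x<=ln (qd x) by rewrite -L2 ler_ln ?posrE// rx lerDl.
have q2 : ln (qd x)<=ln 2+2*Lr 0 x.
 by rewrite -L2 -lnM ?posrE// ler_ln ?posrE /qd; lra.
have ed : 1-dot (swp (stereo false x)) (point j) = 2/qd x.
 by rewrite dot_swp swp_point dot_stereo_pole opprB addrC subrK.
have el : ln (1-dot (swp (stereo false x)) (point j)) = ln 2-ln (qd x) by rewrite ed ln_div ?posrE.
have d0 : 0<1-dot (swp (stereo false x)) (point j) by rewrite ed divr_gt0.
have He : 1-dot (swp (stereo false x)) (point j)<e.
 rewrite -ltr_ln ?posrE// el; have:=ler_norm (ln 2-ln e); lra.
have:=H _ rX He; rewrite el /un ln_div ?posrE// => hM.
set W:=w _ in hM *; set b2:=be/2 in hM *.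
have -> : W+(ln 2-ln (qd x)) - - (2+be)*Lr 0 x = (W-b2*(ln 2-ln (qd x))) +
  (b2 * ln 2+((b2+1)*(2*Lr 0 x-ln (qd x))+ln 2)) by rewrite /b2; field.
apply: le_trans (ler_normD _ _) _; apply: lerD => //.
apply: le_trans (ler_normD _ _) _; rewrite normrM (gtr0_norm l20); apply: lerD => //.
apply: le_trans (ler_normD _ _) _; rewrite normrM (gtr0_norm l20); apply: lerD => //.
by apply: ler_wpM2l => //; rewrite ler_norml; apply/andP; split; lra.
Qed.

Lemma le_sum_norm (I : finType) (F : I -> R) i : F i <= \sum_i `|F i|.
Proof.
apply: le_trans (ler_norm _) _; rewrite (bigD1 i)//= lerDl; exact: sumr_ge0.
Qed.

Lemma ends : exists s M : R, [/\ 0<=s,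
 forall k x, x != yv k -> s < - Lr (yv k) x -> reg yv x /\ `|un x-order (lift j k)*Lr (yv k) x| <= M &
 forall x, x != 0 -> s<Lr 0 x -> reg yv x /\ `|un x - - (2+order j)*Lr 0 x| <= M].
Proof.
have [sf hf]:=choice near_end; have [Mf {}hf]:=choice hf; have [si [Mi hi]]:=far_end.
(* [s2] and [s3] dominate the logarithmic distances between singular points and from the origin, so
   beyond the threshold no singular point is met. *)
pose s1:=\sum_k `|sf k|; pose s2:=\sum_k \sum_l `|Lr (yv k) (yv l)|; pose s3:=\sum_l `|Lr 0 (yv l)|.
have p1 : 0<=s1 by apply: sumr_ge0.
have p2 : 0<=s2 by apply: sumr_ge0 => k _; apply: sumr_ge0.
have p3 : 0<=s3 by apply: sumr_ge0.
have pi:=ler_norm si; have p4:=normr_ge0 si.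
exists (s1+s2+s3 + `|si|), ((\sum_k `|Mf k|) + `|Mi|); split; first by lra.
- move=> k x xk hs0; have Ox : reg yv x.
  move=> l; apply/eqP => e; move: hs0; rewrite e.
  have h1 : - Lr (yv k) (yv l)<=s2.
   apply: le_trans (_ : \sum_l `|Lr (yv k) (yv l)| <= _).
    by apply: le_trans (le_sum_norm (fun l => - Lr (yv k) (yv l)) l) _; apply: ler_sum => i _; rewrite normrN.
   by rewrite [leRHS](bigD1 k)//= lerDl; apply: sumr_ge0 => i _; apply: sumr_ge0.
  by lra.
 split => //; have h2 : sf k<=s1:=le_sum_norm sf k.
 have h3:=le_sum_norm Mf k; have h4:=normr_ge0 Mi.
 apply: le_trans (hf k x xk _ Ox) _; by lra.
move=> x x0 hs0; have Ox : reg yv x.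
 move=> l; apply/eqP => e; move: hs0; rewrite e.
 by have h1 : Lr 0 (yv l)<=s3:=le_sum_norm (fun l => Lr 0 (yv l)) l; lra.
split => //; apply: le_trans (hi x x0 _ Ox) _; first by lra.
have:=ler_norm Mi; have : 0 <= \sum_k `|Mf k| by apply: sumr_ge0.
by lra.
Qed.

End Normalization.

(** * Conformal transformations of the sphere and footballs *)

Section Entries.
Context {R : realType} {n : nat}.
Local Notation F:='rV[R]_n.

Lemma is_derive_entry (V : normedModType R) (X : V -> F) (p v : V) (d : F) :
 (forall l, is_derive p v (fun q => X q 0 l) (d 0 l)) <-> is_derive p v X d.
Proof.
split=> h.
 have dv : derivable X p v by apply/derivable_mxP => i k; rewrite ord1; have []:=h k.
 by apply: DeriveDef => //; rewrite derive_mx//; apply/rowP => k; rewrite mxE; have [_]:=h k.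
move=> l; have [dv e]:=h; have /derivable_mxP H:=dv; split; first exact: H.
by rewrite -e derive_mx// mxE.
Qed.

End Entries.

Section Translation.
Context {R : realType} {n m : nat}.
Local Notation F:='rV[R]_n.
Local Notation E:='rV[R]_m.
Variables (C Z : F).
Hypothesis ZZ : dot Z Z = 1.
Hypothesis CZ : dot C Z = 0.

(* In the stereographic chart of pole [Z], [trl] is the translation by [C]. *)
Definition tD (X : F) : R:=1+dot X C+dot C C/2*(1-dot X Z).
Definition tP (X : F) : F:=X+(1-dot X Z) *: C+(tD X-1) *: Z.
Definition trl (X : F) : F:=(tD X)^-1 *: tP X.
Definition dtD (a : F) : R:=dot a C-dot C C/2*dot a Z.
Definition dtP (a : F) : F:=a-dot a Z *: C+dtD a *: Z.
Definition dtrl (X a : F) : F:=(tD X)^-1 *: dtP a-(dtD a/tD X^+2) *: tP X.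

Let ex:=(@dotD R n, @dotDr R n, @dotZl R n, @dotZr R n, @dotNl R n, @dotNr R n).

Lemma tP_sqr X : dot X X = 1 -> dot (tP X) (tP X) = tD X^+2.
Proof.
move=> XX; rewrite /tP !ex ZZ CZ XX (dotC Z C) CZ (dotC C X) (dotC Z X) /tD.
by move: (dot X C) (dot X Z) (dot C C) => *; field.
Qed.

Lemma tP_dtP X a : dot X X = 1 -> dot X a = 0 -> dot (tP X) (dtP a) = tD X*dtD a.
Proof.
move=> XX Xa; rewrite /tP /dtP !ex ZZ CZ Xa (dotC Z C) CZ (dotC C a) (dotC Z a) /tD /dtD.
by move: (dot X C) (dot X Z) (dot C C) (dot a C) (dot a Z) => *; field.
Qed.

Lemma dtP_dtP a b : dot (dtP a) (dtP b) = dot a b+dtD a*dtD b.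
Proof.
rewrite /dtP !ex ZZ CZ (dotC Z C) CZ (dotC C b) (dotC Z b) /dtD.
by move: (dot a C) (dot a Z) (dot C C) (dot b C) (dot b Z) (dot a b) => *; field.
Qed.

Lemma trl_sphere X : dot X X = 1 -> 0<tD X -> dot (trl X) (trl X) = 1.
Proof. by move=> XX D0; rewrite /trl dotZl dotZr tP_sqr//; field; rewrite gt_eqF. Qed.

Lemma dot_dtrl X a b : dot X X = 1 -> dot X a = 0 -> dot X b = 0 -> 0<tD X ->
 dot (dtrl X a) (dtrl X b) = (tD X) ^- 2*dot a b.
Proof.
move=> XX Xa Xb D0; rewrite /dtrl.
have -> (A B P : F) r s t : dot (r *: A-s *: P) (r *: B-t *: P) =
  r^+2*dot A B-r*t*dot P A-r*s*dot P B+s*t*dot P P.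
 by rewrite !ex (dotC A P); ring.
rewrite !tP_dtP// dtP_dtP tP_sqr//; move: (dot a b) (dtD a) (dtD b) => *; field; by rewrite gt_eqF.
Qed.

Lemma is_derive_dotl (X : E -> F) p v d (Y : F) : is_derive p v X d -> is_derive p v (fun q => dot (X q) Y) (dot d Y).
Proof.
move=> /is_derive_entry h; apply: isd_sum => i.
rewrite (_ : (fun q => _) = fun q => Y 0 i*X q 0 i); last by apply/funext => q; rewrite mulrC.
by rewrite mulrC; exact: isd_cmul.
Qed.

Lemma is_derive_trl (X : E -> F) p v d : tD (X p) != 0 -> is_derive p v X d ->
 is_derive p v (fun q => trl (X q)) (dtrl (X p) d).
Proof.
move=> D0 hX; have c0 (k : R) : is_derive p v (fun _ : E => k) 0 by exact: is_derive_cst.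
have hC:=is_derive_dotl C hX; have hZ:=is_derive_dotl Z hX.
have hD : is_derive p v (fun q => tD (X q)) (dtD d).
 apply: (is_derive_eq (isd_add (isd_add (c0 1) hC) (isd_cmul (dot C C/2) (isd_sub (c0 1) hZ)))).
 by rewrite /dtD; ring.
have hV : is_derive (tD (X p)) 1 (fun s : R => s^-1) (- (tD (X p)) ^- 2 *: (1 : R)) by exact: is_deriveV.
have hI:=is_derive_comp1 (u:=fun q => tD (X q)) hV hD.
have /is_derive_entry hXl:=hX; apply/is_derive_entry => l.
have h:=isd_mul hI (isd_add (isd_add (hXl l) (isd_cmul (C 0 l) (isd_sub (c0 1) hZ))) (isd_cmul (Z 0 l) (isd_sub hD (c0 1)))).
rewrite (_ : (fun q => _) = fun q => (tD (X q))^-1*(X q 0 l+C 0 l*(1-dot (X q) Z)+Z 0 l*(tD (X q)-1))).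
 by apply: (is_derive_eq h); rewrite /dtrl /dtP /tP !mxE /GRing.scale /= mulr1; field.
by apply/funext => q; rewrite /trl /tP !mxE; congr (_*_); ring.
Qed.

Lemma is_Ck_dotl k (U : set E) (X : E -> F) (Y : F) : open U -> (forall l, is_Ck k U (fun x => X x 0 l)) ->
 is_Ck k U (fun x => dot (X x) Y).
Proof. by move=> oU h; apply: is_Ck_sum => // i; apply: is_Ck_mul => //; exact: is_Ck_cst. Qed.

Lemma is_Ck_trl k (U : set E) (X : E -> F) l : open U -> (forall x, U x -> tD (X x) != 0) ->
 (forall l, is_Ck k U (fun x => X x 0 l)) -> is_Ck k U (fun x => trl (X x) 0 l).
Proof.
move=> oU D0 h; have cD : is_Ck k U (fun x => tD (X x)).
 apply: is_Ck_add => //; first by apply: is_Ck_add => //; [exact: is_Ck_cst|exact: is_Ck_dotl].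
 by apply: is_Ck_scale => //; apply: is_Ck_sub_fun => //; [exact: is_Ck_cst|exact: is_Ck_dotl].
rewrite (_ : (fun q => _) = fun q => (tD (X q))^-1*(X q 0 l+C 0 l*(1-dot (X q) Z)+Z 0 l*(tD (X q)-1))).
 apply: is_Ck_mul => //; first exact: is_Ck_inv.
 apply: is_Ck_add => //; first apply: is_Ck_add => //.
  by apply: is_Ck_scale => //; apply: is_Ck_sub_fun => //; [exact: is_Ck_cst|exact: is_Ck_dotl].
 by apply: is_Ck_scale => //; apply: is_Ck_sub_fun => //; exact: is_Ck_cst.
by apply/funext => q; rewrite /trl /tP !mxE; congr (_*_); ring.
Qed.

Lemma is_derive_hh (a b : F) (X : E -> F) p v d : is_derive p v X d -> is_derive p v (fun q => hh a b (X q)) (hh a b d).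
Proof.
move=> hX; have hn:=is_derive_dotl (a-b) hX; have /is_derive_entry h:=hX; apply/is_derive_entry => l.
rewrite (_ : (fun q => _) = fun q => X q 0 l-2/dot (a-b) (a-b)*(a-b) 0 l*dot (X q) (a-b)).
 by apply: (is_derive_eq (isd_sub (h l) (isd_cmul _ hn))); rewrite /hh !mxE; ring.
by apply/funext => q; rewrite /hh !mxE; ring.
Qed.

Lemma is_Ck_hh k (a b : F) (U : set E) (X : E -> F) l : open U ->
 (forall l, is_Ck k U (fun x => X x 0 l)) -> is_Ck k U (fun x => hh a b (X x) 0 l).
Proof.
move=> oU h; rewrite (_ : (fun q => _) = fun q => X q 0 l-2/dot (a-b) (a-b)*(a-b) 0 l*dot (X q) (a-b)).
 by apply: is_Ck_sub_fun => //; apply: is_Ck_scale => //; exact: is_Ck_dotl.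
by apply/funext => q; rewrite /hh !mxE; ring.
Qed.

End Translation.

Section SphereTranslation.
Context {R : realType}.
Local Notation E:='rV[R]_4.
Local Notation F:='rV[R]_5.
Local Notation e_ i:=(delta_mx 0 i : E).
Variable c : E.

Let C : F:=mk5 c 0.
Let Z : F:=pole false.

Lemma mk5D (x y : E) (s t : R) : mk5 x s+mk5 y t = mk5 (x+y) (s+t).
Proof. by rewrite /mk5 [LHS](@add_row_mx _ 1 4 1) -raddfD. Qed.

Lemma mk5Z (a : R) (x : E) (s : R) : a *: mk5 x s = mk5 (a *: x) (a*s).
Proof. by rewrite /mk5 [LHS](@scale_row_mx _ 1 4 1) scale_scalar_mx. Qed.

Lemma CZ0 : dot C Z = 0.
Proof.
rewrite dot5 /C /Z poleE !hor_mk !ver_mk mul0r addr0; by rewrite /dot big1// => i _; rewrite [(0 : E) _ _]mxE mulr0.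
Qed.

Lemma tD_pole : tD C Z (pole false) = 1.
Proof. by rewrite /tD (sphere_pole false) (dotC _ C) CZ0 subrr mulr0 !addr0. Qed.

(** So [tD] is the quotient of the conformal factors of the chart before and after the translation;
    in particular it is positive on the sphere. *)
Lemma tD_stereo y : tD C Z (stereo false y) = qd (y+c)/qd y.
Proof.
have qy:=qd_gt0 y; rewrite /tD dot_stereo_pole.
have -> : dot C C = dot c c by rewrite dot5 /C hor_mk ver_mk mulr0 addr0.
have -> : dot (stereo false y) C = 2/qd y*dot y c.
 by rewrite dot5 /C hor_mk ver_mk mulr0 addr0 hor_stereo !dotZl; ring.
have -> : qd (y+c) = qd y+2*dot y c+dot c c by rewrite /qd !(dotD, dotDr) (dotC c y); ring.
by field; rewrite gt_eqF.
Qed.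

Lemma trl_pole : trl C Z (pole false) = pole false.
Proof. by rewrite /trl /tP tD_pole (sphere_pole false) !subrr !scale0r !addr0 invr1 scale1r. Qed.

Lemma trl_stereo y : trl C Z (stereo false y) = stereo false (y+c).
Proof.
have qy:=qd_gt0 y; have qc:=qd_gt0 (y+c).
have s1 : sgn false = 1 :> R by rewrite /sgn expr0.
have DE : dot (y+c) (y+c) = qd (y+c)-1 by rewrite /qd addrK.
rewrite /trl /tP tD_stereo dot_stereo_pole [RHS]stereoE [X in X+_+_]stereoE /C /Z poleE s1 !mk5Z !mk5D mk5Z.
congr mk5.
 by apply/rowP => i; rewrite !mxE; field; rewrite !gt_eqF.
have -> : dot y y = qd y-1 by rewrite /qd addrK.
by rewrite DE; field; rewrite !gt_eqF.
Qed.

Lemma sphere_cases (X : F) : sphere4 X -> X = pole false \/ exists y, X = stereo false y.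
Proof.
move=> hX; have [e|np]:=pselect (X = pole false); [by left|right].
by exists (proj false X); rewrite proj_stereo.
Qed.

Lemma tD_gt0 X : sphere4 X -> 0<tD C Z X.
Proof.
by move=> /sphere_cases[->|[y ->]]; rewrite ?tD_pole ?ltr01// tD_stereo divr_gt0// qd_gt0.
Qed.

Lemma sphere_trl X : sphere4 X -> sphere4 (trl C Z X).
Proof. by move=> hX; apply: trl_sphere => //; [exact: (sphere_pole false)|exact: CZ0|exact: tD_gt0]. Qed.

Lemma stereo_0 b : stereo b (0 : E) = pole (~~ b).
Proof.
have d0 : dot (0 : E) 0 = 0 by rewrite /dot big1// => i _; rewrite mxE mul0r.
rewrite stereoE /qd d0 sub0r add0r invr1 !scaler0 mul1r poleE; congr mk5.
by rewrite /sgn; case: b; rewrite /= ?expr0 ?expr1; ring.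
Qed.

End SphereTranslation.

Definition shift5 {R : realType} (c : 'rV[R]_4) : 'rV[R]_5 -> 'rV[R]_5:=trl (mk5 c 0) (pole false).

Section Football.
Context {R : realType}.
Local Notation E:='rV[R]_4.
Local Notation F:='rV[R]_5.
Local Notation e_ i:=(delta_mx 0 i : E).
Implicit Types (x y : E) (X Y : F).

Lemma shift5K (c : E) X : sphere4 X -> shift5 c (shift5 (- c) X) = X.
Proof.
rewrite /shift5 => /sphere_cases[->|[y ->]]; first by rewrite !trl_pole.
by rewrite !trl_stereo subrK.
Qed.

Variables (D : conformal_divisor R) (j : 'I_(npoints D)) (c : E).
Let S : F -> F:=swp j.

Lemma conformal_T : conformal_transformation (shift5 (- c) \o S) (S \o shift5 c).
Proof.
have oT : open [set: E] by exact: openT.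
have sS X : sphere4 X -> sphere4 (S X):=@sphere_swp R D j X.
have ss b (y : E) : sphere4 (stereo b y):=sphere_stereo b y.
have spre b : stereo b @^-1` (sphere4 : set F) = setT by apply/seteqP; split => // y _; exact: ss.
have ck b k l : is_Ck k setT (fun x : E => stereo b x 0 l):=is_Ck_stereo k b l oT.
split.
- split=> [X hX|l b k]; first exact/sphere_trl/sS.
 rewrite spre; apply: (@is_Ck_trl R 5 4) => // [x _|i]; first by rewrite gt_eqF// tD_gt0//; exact: sS.
 exact: is_Ck_hh.
- split=> [X hX|l b k]; first exact/sS/sphere_trl.
 rewrite spre; apply: (@is_Ck_hh R 5 4) => // i.
 by apply: (@is_Ck_trl R 5 4) => // x _; rewrite gt_eqF// tD_gt0.
- by move=> X hX /=; rewrite shift5K; [exact: hhK|exact: sS].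
- by move=> X hX; have:=shift5K (- c) hX; rewrite opprK /= /S /swp hhK.
exists (fun X => (tD (mk5 (- c) 0) (pole false) (S X)) ^- 2); split=> [X hX|b y].
 by rewrite invr_gt0 exprn_gt0// tD_gt0//; exact: sS.
have dd i : is_derive y (e_ i) (shift5 (- c) \o S \o stereo b) (dtrl (mk5 (- c) 0) (pole false) (S (stereo b y)) (S (dst b y i))).
 apply: is_derive_trl; first by rewrite gt_eqF// tD_gt0//; exact: sS.
 exact: is_derive_hh (is_derive_stereo b y i).
apply/matrixP => i k; rewrite !mxE /partial.
have [_ ->]:=dd i; have [_ ->]:=dd k; rewrite -!/(partial _ _ _) !partial_stereo /round_metric.
rewrite dot_dtrl ?(sphere_pole false) ?CZ0//; [by rewrite dot_hh|exact: sS (ss _ _)| | |exact: tD_gt0 (sS _ (ss _ _))].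
- by rewrite dot_hh; exact: tangent_dst.
by rewrite dot_hh; exact: tangent_dst.
Qed.

Lemma pullback_shift (g : metric R) (w : F -> R) y :
 (forall X a c, regular_set D X -> tangent X a -> tangent X c -> g X a c = expR (2*w X)*round_metric X a c) ->
 regular_set D (S (stereo false (y+c))) ->
 pullback (S \o shift5 c \o stereo false) g y = (expR (2*un w j (y+c)))%:M.
Proof.
move=> gw ry.
have dd i : is_derive y (e_ i) (S \o shift5 c \o stereo false) (S (dst false (y+c) i)).
 rewrite (_ : S \o shift5 c \o stereo false = fun z => S (stereo false (z+c))); last first.
  by apply/funext => z /=; rewrite /shift5 trl_stereo.
 apply: is_derive_hh; apply/is_derive_entry => l.
 have /is_derive_entry/(_ l)[h1 h2]:=is_derive_stereo false (y+c) i.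
 have e0 : (fun h : R => h^-1 *: (((fun z : E => stereo false (z+c) 0 l) \o shift y) (h *: e_ i)-stereo false (y+c) 0 l)) =
   (fun h : R => h^-1 *: (((fun z : E => stereo false z 0 l) \o shift (y+c)) (h *: e_ i)-stereo false (y+c) 0 l)).
  by apply/funext => h /=; rewrite addrA.
 by split; [rewrite /derivable e0|rewrite /derive e0].
apply/matrixP => i k; rewrite !mxE /partial.
have [_ ->]:=dd i; have [_ ->]:=dd k; rewrite /= {1}/shift5 trl_stereo.
rewrite gw//; [|by rewrite /tangent /S dot_hh; exact: tangent_dst..].
rewrite /round_metric /S dot_hh dot_dst /un expR_conf mulrA.
by case: (i == k); rewrite ?mulr1 ?mulr1n ?mulr0 ?mulr0n.
Qed.

End Football.

(** * From the limits of the monotone quantity to the criticality conditions *)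

Section Criticality.
Context {R : realType}.

Lemma powR_cubeK (y : R) : 0<=y -> (y^+3) `^ 3^-1 = y.
Proof. by move=> y0; rewrite -powR_mulrn// -powRrM mulfV ?powRr1. Qed.

Lemma ylim_cube (kap y : R) : 0<kap -> 0<=y -> ylim kap (y^+3*kap) = y.
Proof. by move=> k0 y0; rewrite /ylim mulfK ?gt_eqF// powR_cubeK. Qed.

Lemma cbrt_cube (y : R) : 0<=y -> cbrt (- y^+3) = - y.
Proof.
rewrite le_eqVlt => /orP[/eqP <-|y0]; first by rewrite (_ : - 0^+3 = 0 :> R) ?/cbrt ?sgr0 ?mul0r ?oppr0// expr0n oppr0.
have y3 : 0<y^+3 by exact: exprn_gt0.
by rewrite /cbrt sgrN gtr0_sg// normrN gtr0_norm// powR_cubeK ?ltW// mulN1r.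
Qed.

Lemma cube_root (a : R) : 0<=a -> exists2 y, 0<=y & y^+3 = a.
Proof.
move=> a0; exists (a `^ 3^-1); first exact: powR_ge0.
by rewrite -powR_mulrn ?powR_ge0// -powRrM mulVf ?powRr1.
Qed.

Lemma order_lt0 (D : conformal_divisor R) (i : 'I_(npoints D)) : order i<0.
Proof. by have /andP[]:=order_itv i. Qed.

Lemma order_gtN1 (D : conformal_divisor R) (i : 'I_(npoints D)) : -1<order i.
Proof. by have /andP[]:=order_itv i. Qed.

Lemma sum_lift n (j : 'I_n) (F : 'I_n -> R) : \sum_(i<n | i != j) F i = \sum_k F (lift j k).
Proof.
have e1 : \sum_i F i = F j + \sum_(i<n | i != j) F i by rewrite (bigD1 j).
have e2 : \sum_i F i = F j + \sum_k F (lift j k) by rewrite (bigD1_ord j).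
by apply: (@addrI _ (F j)); rewrite -e1.
Qed.

Variables (D : conformal_divisor R) (j : 'I_(npoints D)).
Let be k:=order (lift j k).
Let gam:=2+order j.

(** With slope [-gam] at infinity the cube root is [y = gam], and the limit is
    [(9/8) kappa gam^2 (gam-2)^2]. *)
Lemma calL_Mlim : Mlim kappa (gam^+3*kappa) ((3*gam^+2-gam^+3)/2*kappa) = 3 * @kappa R*calL j.
Proof.
have g0 : 0<=gam by rewrite /gam; have:=order_gtN1 j; lra.
by rewrite /Mlim ylim_cube ?kappa_gt0// /calL /gam; field.
Qed.

(** Here the cube root is [y = - order_tilde j]: the orders are negative, so the real cube root of
    their sum of cubes is minus that of a nonnegative number. *)
Lemma calR_Mlim : Mlim kappa (- (\sum_k be k^+3)*kappa) ((3*(\sum_k be k^+2) + \sum_k be k^+3)/2*kappa) = 3 * @kappa R*calR j.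
Proof.
have s0 : 0 <= - (\sum_k be k^+3).
 rewrite -sumrN; apply: sumr_ge0 => k _; rewrite oppr_ge0; have:=order_lt0 (lift j k); rewrite -/(be k) => h; nra.
have [y y0 ey]:=cube_root s0.
rewrite /calR /order_tilde !(sum_lift j) -/be.
rewrite (_ : \sum_k order (lift j k)^+3 = \sum_k be k^+3)// (_ : \sum_k order (lift j k)^+2 = \sum_k be k^+2)//.
have -> : \sum_k be k^+3 = - y^+3 by rewrite ey opprK.
by rewrite opprK /Mlim ylim_cube ?kappa_gt0// cbrt_cube//; field.
Qed.

(** Excludes a single conic point from the equality case, as [calL j] is positive. *)
Lemma calR_single : (npoints D = 1)%N -> calR j = 0.
Proof.
move=> n1; rewrite /calR /order_tilde.
have z (F : 'I_(npoints D) -> R) : \sum_(i<npoints D | i != j) F i = 0.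
 rewrite sum_lift; apply: big1 => k _; exfalso; have:=ltn_ord k; by move: (nat_of_ord k); rewrite n1.
rewrite !z; have -> : cbrt (0 : R) = 0 by rewrite /cbrt sgr0 mul0r.
ring.
Qed.

Lemma calL_gt0 : 0<calL j.
Proof.
have h1:=order_lt0 j; have h2:=order_gtN1 j; rewrite /calL.
have : 0<order j^+2 by rewrite exprn_even_gt0//= lt_eqF.
have : 0<(order j+2)^+2 by apply: exprn_gt0; lra.
by move=> A B; apply: mulr_gt0 => //; apply: mulr_gt0 => //; lra.
Qed.

(** For two points of orders [a] and [b], equality amounts to [(a-b)(a+b+2)(a(a+2) + b(b+2)) = 0];
    on [(-1, 0)] the second factor is positive and the third negative. *)
Lemma order_pair (p : 'I_(npoints D)) : (forall i, i = j \/ i = p) -> p <> j -> calL j = calR j -> order p = order j.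
Proof.
move=> hp pj; have z (F : 'I_(npoints D) -> R) : \sum_(i<npoints D | i != j) F i = F p.
 rewrite (bigD1 p)/=; last by apply/eqP.
 by rewrite big1 ?addr0// => i /andP[/eqP ij /eqP ip]; case: (hp i).
have a0:=order_lt0 p; have a1:=order_gtN1 p; have b0:=order_lt0 j; have b1:=order_gtN1 j.
rewrite /calL /calR /order_tilde !z.
have -> : cbrt (order p^+3) = order p.
 have e : order p^+3 = - (- order p)^+3 by ring.
 by rewrite e cbrt_cube ?opprK// oppr_ge0 ltW.
move: (order p) (order j) a0 a1 b0 b1 => a b a0 a1 b0 b1 h.
have : (a-b)*(a+b+2)*(a*(a+2)+b*(b+2)) = 0 by lra.
move=> /eqP; rewrite !mulf_eq0 subr_eq0 => /orP[/orP[/eqP //|/eqP h1]|/eqP h1]; exfalso; clear -a0 a1 b0 b1 h1; [lra|nra].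
Qed.

Section Metric.
Variable g : metric R.
Hypothesis cg : conformal_class D g.
Hypothesis C2 : C2_plus D g.
Hypothesis cs : constant_sigma2 D g.

Lemma calL_le_calR : calL j<=calR j /\ (calL j = calR j -> football D g).
Proof.
have [[w [sw gw]] HC]:=cg; have [K HK]:=cs.
have cu:=is_Ck_un sw j 3; have yi:=@yv_inj R D j.
have [s [M [s0 HEf HEi]]]:=ends gw HC j.
have g0 : 0<gam by rewrite /gam; have:=order_gtN1 j; lra.
have b0 k : be k<0:=order_lt0 (lift j k).
have b1 k : -1<be k:=order_gtN1 (lift j k).
have HF k x : x != yv j k -> s < -1*Lr (yv j k) x -> reg (yv j) x /\ `|un w j x-be k*Lr (yv j k) x| <= M.
 by move=> xk; rewrite mulN1r; exact: HEf.
have HI (x : 'rV[R]_4) : x != 0 -> s<1*Lr 0 x -> reg (yv j) x /\ `|un w j x - - gam*Lr 0 x| <= M.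
 by move=> xk; rewrite mul1r; exact: HEi.
(* A regular point, found far out in the chart; there the sign of [K] is read off and the rigidity
   argument starts. *)
have [x0 Ox0] : exists x, reg (yv j) x.
 have [r hr]:=end_far g0 HI 0; pose x : 'rV[R]_4:=(`|r| + 1) *: delta_mx 0 0.
 have hx : r < `|x|.
  apply: lt_le_trans (norm_row_le _ 0); rewrite !mxE !eqxx mulr1.
  by have:=ler_norm r; have:=ler_norm (`|r| + 1); lra.
 by exists x; have []:=hr x hx.
have K0 : 0<K.
 have [h _]:=(proj1 (regE _ _)) Ox0.
 have [e|[y e]]:=sphere_cases h.
  apply: (@K_gt0 R D g C2 K HK true 0); rewrite /Vc /=.
  by have:=(proj1 (regE _ _)) Ox0; rewrite e stereo_0 //.
 by apply: (@K_gt0 R D g C2 K HK false y); rewrite /Vc /= -e; exact/regE.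
have S1 x : reg (yv j) x -> 0<sig1 (hs (un w j) x) (gr (un w j) x) by move=> /(sig_un sw gw C2 HK)[].
have S2 x : reg (yv j) x -> sig2 (hs (un w j) x) (gr (un w j) x) = K*expR (4*un w j x) by move=> /(sig_un sw gw C2 HK)[].
have k3 : 0<3 * @kappa R by apply: mulr_gt0 => //; exact: kappa_gt0.
split.
 have:=conic_ineq yi cu K0 s0 b0 g0 S1 S2 HF HI b1.
 by rewrite calL_Mlim calR_Mlim ler_pM2l.
move=> eqLR; have eqM : Mlim kappa (gam^+3*kappa) ((3*gam^+2-gam^+3)/2*kappa) =
  Mlim (@kappa R) (- (\sum_k be k^+3)*kappa) ((3*(\sum_k be k^+2) + \sum_k be k^+3)/2*kappa).
 by rewrite calL_Mlim calR_Mlim eqLR.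
have eqh:=conic_rigid yi cu K0 s0 b0 g0 S1 S2 HF HI b1 eqM.
have S2' x : reg (yv j) x -> 0<sig2 (hs (un w j) x) (gr (un w j) x).
 by move=> Ox; rewrite S2//; apply: mulr_gt0 => //; exact: expR_gt0.
have nn : npoints D = (npoints D).-1.+1 by rewrite prednK// (leq_ltn_trans _ (ltn_ord j)).
have n1 : (0<(npoints D).-1)%N.
 rewrite lt0n; apply/eqP => n0; have:=calL_gt0; rewrite eqLR calR_single ?ltxx//.
 by rewrite nn n0.
pose k0:=Ordinal n1.
have [yE [U hU]]:=rigid_radial k0 (ex_intro _ x0 Ox0) cu S1 S2' eqh (fun x T => end_near b0 HF T (x:=x)).
(* The rigidity theorem makes all the [yv] coincide, and [yv] is injective, so exactly one conic
   point remains besides [point j]. *)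
have kE k : k = k0 by apply: yi; exact: yE.
have iE i : i = j \/ i = lift j k0.
 by have [k ->|->]:=unliftP j i; [right; rewrite (kE k)|left].
have lj : lift j k0 <> j by apply/eqP; rewrite eq_sym neq_lift.
have oe:=order_pair iE lj eqLR.
split => //.
- rewrite nn; congr S; apply/eqP; rewrite eqn_leq n1 andbT leqNgt; apply/negP => h.
 by have:=congr1 val (kE (Ordinal h)).
- by move=> i i'; case: (iE i) => ->; case: (iE i') => ->.
exists (lift j k0), j; split => //.
set c:=yv j k0 in hU.
exists (shift5 (- c) \o swp j), (swp j \o shift5 c); split.
- exact: conformal_T.
- by rewrite /= -stereo_yv /shift5 trl_stereo -/c subrr stereo_0.
- by rewrite /= swp_point /shift5 trl_pole.
exists U => y y0.
have yc : y+c != c by rewrite -subr_eq0 addrK; apply/eqP.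
rewrite (pullback_shift gw); first by rewrite hU// addrK.
by apply/regE => k; rewrite (kE k).
Qed.

End Metric.

End Criticality.

Theorem theorem5 (R : realType) (D : conformal_divisor R) :
  (supercritical D ->
     ~ exists g : metric R,
         [/\ conformal_class D g, C2_plus D g & constant_sigma2 D g]) /\
  (critical D ->
     forall g : metric R,
       conformal_class D g -> C2_plus D g -> constant_sigma2 D g ->
       football D g).
Proof.
split=> [[j hj] [g [cg C2 cs]]|[j hj] g cg C2 cs].
 by have [+ _]:=calL_le_calR j cg C2 cs; rewrite leNgt hj.
by have [_]:=calL_le_calR j cg C2 cs; apply.
Qed.
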